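(* Let $K$ and $K'$ be number fields of the same degree, and let $\mathcal S$ be a subset of the primes of inertia degree $1$ of $K$. Suppose that for some finite extension $L/K$, $\mathcal S$ contains $\text{Spl}(L/K)$ except for a density zero set. Furthermore, suppose there exists an isomorphism $\psi: \check{G}_{K}[l] \xrightarrow{\sim} \check{G}_{K'}[l]$ with an injective norm-preserving map $\phi: \mathcal S \to \mathcal P_{K'}$ such that \[ \chi(\mathfrak p) = \psi(\chi)(\phi(\mathfrak p)) \] for all $\chi \in \check{G}_{K}[l]$ and $\mathfrak p \in \mathcal S$. Then $K \simeq K'$ and there is a unique $\sigma_\psi: K \xrightarrow{\sim} K'$ such that the bijection of primes induced by $\sigma_\psi$ equals $\phi$ on $\mathcal S$ except for finitely many exceptions.
   Context: $l$ is a prime number. $\check{G}_{K}[l]$ is the subgroup of the group of Dirichlet characters (continuous homomorphisms $G_K\to\mathbb{C}^\times$) generated by characters of order $l$; $\chi(\mathfrak p)$ is the value of $\chi$ at Frobenius of $\mathfrak p$ if unramified, $0$ if ramified. $\mathcal P_{K'}$ is the set of primes of $K'$, $\text{Spl}(L/K)$ the set of primes of $K$ splitting completely in $L$, and density means Dirichlet density. *)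

(* Defs.v *)
From HB Require Import structures.
From mathcomp Require Import all_boot all_order all_algebra all_field.
From mathcomp Require Import complex finmap.
From mathcomp Require Import all_classical all_reals all_analysis.

Set Implicit Arguments.
Unset Strict Implicit.
Unset Printing Implicit Defensive.

Import Order.TTheory GRing.Theory Num.Theory.
Import numFieldNormedType.Exports.

Local Open Scope classical_set_scope.
Local Open Scope ring_scope.

Definition integers (F : fieldType) : set F :=
  [set x | integralOver (intr : int -> F) x].
Arguments integers F : clear implicits.

(* Nonzero prime ideals of [integers F], as subsets of F.  F is either a number
   field or an algebraic closure of one. *)
Definition prime_ideal (F : fieldType) : set (set F) :=
  [set P | [/\ P `<=` integers F,
               P 0,
               forall x y, P x -> P y -> P (x + y) &
               forall a x, integers F a -> P x -> P (a * x)] /\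
           [/\ exists2 x, P x & x != 0,
               ~ P 1 &
               forall x y, integers F x -> integers F y ->
                 P (x * y) -> P x \/ P y]].
Arguments prime_ideal F : clear implicits.

(* The number of cosets of P in [integers F] ([fset_set] is empty on infinite
   sets, so the value is 0 when the quotient is infinite). *)
Definition ideal_norm (F : fieldType) (P : set F) : nat :=
  #|` fset_set [set [set y | integers F y /\ P (y - x)] | x in integers F] |%fset.

Definition lies_over (F E : fieldType) (i : {rmorphism F -> E})
    (p : set F) (P : set E) : Prop := i @^-1` P = p.

(* The residue field of P has a basis of d elements over the residue field of
   the prime of F below P. *)
Definition has_inertia_degree (F E : fieldType) (i : {rmorphism F -> E})
    (P : set E) (d : nat) : Prop :=
  exists b : 'I_d -> E,
    [/\ forall k, integers E (b k),
        forall x, integers E x -> exists a : 'I_d -> F,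
          (forall k, integers F (a k)) /\ P (x - \sum_k i (a k) * b k) &
        forall a : 'I_d -> F, (forall k, integers F (a k)) ->
          P (\sum_k i (a k) * b k) -> forall k, P (i (a k))].

Definition degree1_primes (K : fieldExtType rat) : set (set K) :=
  [set p | prime_ideal K p /\ has_inertia_degree (in_alg K) p 1].
Arguments degree1_primes K : clear implicits.

(* p splits completely in L when there are [L : K] distinct primes above it. *)
Definition Spl (K : fieldType) (L : fieldExtType K) : set (set K) :=
  [set p | prime_ideal K p /\
    ([set P | prime_ideal L P /\ lies_over (in_alg L) p P]
       #= `I_(\dim {:L}))%card].
Arguments Spl {K} L.

Definition prime_zeta (R : realType) (K : fieldType) (A : set (set K))
    (s : R) : \bar R :=
  \esum_(p in A) ((ideal_norm p)%:R `^ (- s))%:E.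

Definition has_dirichlet_density (R : realType) (K : fieldType)
    (A : set (set K)) (d : R) : Prop :=
  (fine (prime_zeta A s) / fine (prime_zeta (prime_ideal K) s))
    @[s --> (1 : R)^'+] --> d.

Record algClosure (K : fieldType) := AlgClosure {
  algClosure_sort :> closedFieldType;
  algClosure_emb : {rmorphism K -> algClosure_sort};
  algClosureP : forall x, algebraicOver algClosure_emb x }.

Section AbsoluteGalois.
Variables (K : fieldType) (Kbar : algClosure K).
Local Notation iota := (algClosure_emb Kbar).

Record absGal := AbsGal {
  absGal_fun :> {rmorphism Kbar -> Kbar};
  absGal_bij : bijective absGal_fun;
  absGal_fix : forall x, absGal_fun (iota x) = iota x }.

Fact absGal_mul_bij (s t : absGal) : bijective (s \o t : {rmorphism _ -> _}).
Proof. exact: bij_comp (absGal_bij s) (absGal_bij t). Qed.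

Fact absGal_mul_fix (s t : absGal) x :
  (s \o t : {rmorphism _ -> _}) (iota x) = iota x.
Proof. by rewrite /= !absGal_fix. Qed.

Definition absGal_mul (s t : absGal) : absGal :=
  AbsGal (absGal_mul_bij s t) (absGal_mul_fix s t).

(* Krull topology: the cosets s Gal(Kbar / K(r)), r a finite sequence of
   elements of Kbar, form a base of neighbourhoods of s. *)
Definition krull_nbhs (s : absGal) : set_system absGal :=
  filter_from [set: seq Kbar]
    (fun r => [set t : absGal | forall x, x \in r -> t x = s x]).

Definition decomposition (Q : set Kbar) : set absGal :=
  [set s : absGal | s @` Q = Q].

Definition inertia (Q : set Kbar) : set absGal :=
  [set s : absGal | decomposition Q s /\
     forall x, integers Kbar x -> Q (s x - x)].

(* The Frobenius elements at all primes of Kbar above p. *)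
Definition frobenius (p : set K) : set absGal :=
  [set s : absGal | exists Q : set Kbar,
     [/\ prime_ideal Kbar Q, lies_over iota p Q, decomposition Q s &
         forall x, integers Kbar x -> Q (s x - x ^+ ideal_norm p)]].

Variable R : realType.

(* [^o] selects the normed topology of the complex field. *)
Definition dirichlet_character : set (absGal -> R[i]) :=
  [set chi : absGal -> R[i] |
             [/\ forall s, chi s != 0,
                 forall s t, chi (absGal_mul s t) = chi s * chi t &
                 forall s, chi @ krull_nbhs s --> (chi s : R[i]^o)]].

Definition character_subgroup (M : set (absGal -> R[i])) : Prop :=
  [/\ M `<=` dirichlet_character,
      M (fun=> 1),
      forall chi eta, M chi -> M eta -> M (fun s => chi s * eta s) &
      forall chi, M chi -> M (fun s => (chi s)^-1)].

Definition characters_of_order (l : nat) : set (absGal -> R[i]) :=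
  [set chi : absGal -> R[i] |
             [/\ dirichlet_character chi,
                 (0 < l)%N,
                 forall s, chi s ^+ l = 1 &
                 forall m, (0 < m < l)%N -> exists s, chi s ^+ m != 1]].

Definition characters_gen (l : nat) : set (absGal -> R[i]) :=
  smallest character_subgroup (characters_of_order l).

Definition unramified (chi : absGal -> R[i]) (p : set K) : Prop :=
  forall Q : set Kbar, prime_ideal Kbar Q -> lies_over iota p Q ->
    forall s, inertia Q s -> chi s = 1.

(* If chi is unramified at p, it takes a single value on [frobenius p], so the
   choice made by [xget] is irrelevant. *)
Definition char_at (chi : absGal -> R[i]) (p : set K) : R[i] :=
  if `[< unramified chi p >] then xget 0 (chi @` frobenius p) else 0.

End AbsoluteGalois.

Arguments characters_gen {K} Kbar R l.

Definition is_character_iso (R : realType) (K K' : fieldType)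
    (Kbar : algClosure K) (Kbar' : algClosure K')
    (A : set (absGal Kbar -> R[i])) (A' : set (absGal Kbar' -> R[i]))
    (psi : (absGal Kbar -> R[i]) -> (absGal Kbar' -> R[i])) : Prop :=
  set_bij A A' psi /\
  forall chi eta, A chi -> A eta ->
    psi (fun s => chi s * eta s) = (fun s => psi chi s * psi eta s).

(* The primes of S at which [phi] differs from the map induced by [sigma]. *)
Definition exceptions (K K' : fieldType) (S : set (set K))
    (phi : set K -> set K') (sigma : {rmorphism K -> K'}) : set (set K) :=
  [set p | S p /\ sigma @` p <> phi p].

(* Main.v *)
(** Embed K and K' in an algebraic closure W of Q. Conjugating by an embedding
    x of K turns a character chi into a function chi_x on the open normal
    subgroup G_M of Gal(W/Q) fixing the images of all embeddings of K, K' and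
    L, and chi_x(Frob_Q) = chi(x^-1 Q) when Q is a prime of W.

    No Chebotarev theorem is needed. For a monic irreducible f over Z, counting
    the elements of Z[X]/(f) by norm shows that the sum of rho_f(p) p^-s, where
    rho_f(p) is the number of roots of f mod p, is ln(1/(s-1)) + O(1). Comparing
    the fixed field of a normal subgroup N with that of <s>N yields a Frobenius
    element in the class of a generator of <s>N/N, at a prime outside any
    given set of density zero.

    At such a Frobenius element phi induces a bijection x |-> y of embeddings
    with chi_x(s) = psi(chi)_y(s). A Kummer character that is nontrivial at
    exactly one of the primes above a split p forces y to be independent of s
    and chi, so that chi_x = psi(chi)_y on all of G_M. Then the stabilizer of y
    is contained in that of x, and Galois theory gives sigma with y sigma = x.
    Infinitely many exceptions would yield two of them with Frobenius elements
    agreeing modulo G_M, which a Kummer character separates. Uniqueness is read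
    off a totally split prime. *)

From HB Require Import structures.
Require Import Defs.
From mathcomp Require Import all_boot all_order all_algebra all_field.
From mathcomp Require Import complex finmap.
From mathcomp Require Import all_classical all_reals all_analysis.
From mathcomp Require Import perm ring lra zify.

Set Implicit Arguments.
Unset Strict Implicit.
Unset Printing Implicit Defensive.

Import Order.TTheory GRing.Theory Num.Theory.
Import numFieldNormedType.Exports.

Local Open Scope classical_set_scope.
Local Open Scope ring_scope.

(** * Embeddings into an algebraic closure *)

(** The comparison of two fields only uses the common main term ln(1/(s-1)), so bounds of order x
    from both sides for the number of pairs (m, r), m <= x, f(r) = 0 mod m, suffice, and no residue
    of a zeta function has to be known. The price is that Frobenius elements are located only up to
    the choice of a generator of <s>N/N. This loss is harmless because all values are l-th roots of
    unity: u^c = v^c with c prime to l gives u = v.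

    Such an N must be open, so only finitely many characters are seen at a time, and the bijection x
    |-> y obtained depends on s and on the family. The auxiliary Kummer character repairs this. An
    element on which it is nontrivial at a single embedding of K marks one embedding of K'.
    Multiplying s by elements on which the family is trivial makes the auxiliary character trivial
    at s; a further factor that carries the mark then shows which y belongs to x at s. Since K' has
    finitely many embeddings, one counterexample for each of them would form a finite family, which
    settles all characters at once. *)

Lemma compactness (A B : eqType) (C : A -> seq B)
    (Good : seq A -> (A -> B) -> Prop) :
  (forall r f, Good r f -> forall a, a \in r -> f a \in C a) ->
  (forall r f g, {in r, f =1 g} -> Good r f -> Good r g) ->
  (forall r r' f, {subset r <= r'} -> Good r' f -> Good r f) ->
  (forall r, exists f, Good r f) ->
  exists f, forall r, Good r f.
Proof.
move=> HC Hloc Hmono Hex.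
have [F HF] := choice Hex.
pose G : set_system (seq A) :=
  filter_from [set: seq A] (fun r : seq A => [set r' : seq A | {subset r <= r'}]).
have PG : ProperFilter G.
  apply: filter_from_proper; last by move=> r _; exists r.
  apply: filter_from_filter; first by exists [::].
  move=> r1 r2 _ _; exists (r1 ++ r2) => // r H; split=> a ar; apply: H;
  by rewrite mem_cat ar ?orbT.
(* The limit takes at a the value that [F r a] has for [U]-almost all lists r; finiteness of [C a]
   makes such a value exist. *)
have [U [UU GU]] := ultraFilterLemma PG.
have UF : ProperFilter U by exact: ultra_proper.
have key (s : seq B) a : U [set r | F r a \in s] ->
    exists b, U [set r | F r a = b].
  elim: s => [|b s IH] H.
    have [r] : [set r : seq A | F r a \in [::]] !=set0 by apply: filter_ex H.
    by [].
  have [Hb|Hb] := in_ultra_setVsetC [set r | F r a = b] UU; first by exists b.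
  apply: IH; apply: filterS (filterI H Hb) => r /= [].
  by rewrite inE => /orP[/eqP|].
have /choice[f Hf] a : exists b, U [set r | F r a = b].
  apply: (key (C a)).
  have Ha : U [set r : seq A | a \in r].
    by apply: GU; exists [:: a] => // r H; apply: H; rewrite inE.
  by apply: filterS Ha => r /= ar; apply: HC ar.
exists f => r.
have H1 : U [set r' : seq A | {subset r <= r'}] by apply: GU; exists r.
have H2 : U [set r' : seq A | {in r, F r' =1 f}].
  elim: r {H1} => [|a r IH]; first by apply: filterS filterT => r' _ a.
  apply: filterS (filterI (Hf a) IH) => r' /= [E H] c.
  by rewrite inE => /orP[/eqP->|/H].
have [r' /= [S E]] := filter_ex (filterI H1 H2).
by apply: (Hloc _ _ _ E); apply: Hmono S (HF r').
Qed.

Lemma rmorphism_of (A B : nzRingType) (f : A -> B) :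
  (forall x y, f (x - y) = f x - f y) -> f 1 = 1 ->
  (forall x y, f (x * y) = f x * f y) ->
  exists g : {rmorphism A -> B}, forall x, g x = f x.
Proof.
move=> fB f1 fM.
pose a := GRing.isZmodMorphism.Build A B f fB.
pose m := GRing.isMonoidMorphism.Build A B f (conj f1 fM).
pose g : {rmorphism A -> B} := HB.pack f a m.
by exists g.
Qed.

Lemma rmorphism_eqP (A B : nzRingType) (f g : {rmorphism A -> B}) :
  f =1 g -> f = g.
Proof.
case: f => f [[f1] [f2]]; case: g => g [[g1] [g2]] /= /funext E.
subst g; do 2 f_equal; f_equal; exact: Prop_irrelevance.
Qed.

Lemma absGal_eqP (K : fieldType) (Kb : algClosure K) (s t : absGal Kb) :
  (forall z, s z = t z) -> s = t.
Proof.
case: s => s s1 s2; case: t => t t1 t2 /= /rmorphism_eqP E; subst t.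
by f_equal; exact: Prop_irrelevance.
Qed.

(** * Minimal polynomials and primitive elements *)

Section MinPoly.
Variables (k F : fieldType) (i : {rmorphism k -> F}).

Lemma min_poly_exists w : algebraicOver i w ->
  exists m : {poly k}, [/\ m \is monic, root (map_poly i m) w &
    forall P, root (map_poly i P) w -> m %| P].
Proof.
move=> [q q0 qw].
have ex : exists n, `[< exists p, [/\ p != 0, root (map_poly i p) w & size p = n] >].
  by exists (size q); apply/asboolP; exists q.
case: (ex_minnP ex) => n /asboolP[p [p0 pw sp]] Hmin.
have lc0 : (lead_coef p)^-1 != 0 by rewrite invr_eq0 lead_coef_eq0.
exists ((lead_coef p)^-1 *: p); split.
- by rewrite monicE lead_coefZ mulVf // lead_coef_eq0.
- by rewrite map_polyZ rootZ // fmorph_eq0.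
- move=> P Pw; rewrite dvdpZl //; apply/modp_eq0P/eqP/negPn/negP => r0.
  have rw : root (map_poly i (P %% p)) w.
    move: Pw; rewrite {1}(divp_eq P p) rmorphD rmorphM /= rootE hornerD hornerM.
    by rewrite (rootP pw) mulr0 add0r.
  have : (n <= size (P %% p)%R)%N.
    by apply: Hmin; apply/asboolP; exists (P %% p).
  by rewrite leqNgt -sp ltn_modp p0.
Qed.

Hypothesis char0 : [pchar k] =i pred0.
Hypothesis alg : forall x, algebraicOver i x.

Lemma primitive_list (r : seq F) :
  exists w, forall a, a \in r -> exists P : {poly k}, (map_poly i P).[w] = a.
Proof.
elim: r => [|y r [x Hx]]; first by exists 0.
have [p p0 px] := alg x; have [q q0 qy] := alg y.
have [n [[P HP] [Q HQ]]] := pchar0_PET p0 px q0 qy char0.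
exists (y *+ n - x) => a; rewrite inE => /orP[/eqP->|/Hx[R <-]]; first by exists Q.
by exists (R \Po P); rewrite map_comp_poly horner_comp HP.
Qed.

End MinPoly.

(** Writes c |-> c(P) mod m as a matrix over k, whose rank does not change when k is replaced by a
    larger field. *)
Lemma comp_modp_mx (k : fieldType) (m P c : {poly k}) e n :
  (size c <= e)%N ->
  poly_rV c *m (\matrix_(a < e) poly_rV (P ^+ a %% m)) =
  poly_rV ((c \Po P) %% m) :> 'rV[k]_n.
Proof.
move=> sc.
have Ec : c = \sum_(a < e) c`_a *: 'X^a.
  rewrite -poly_def; apply/polyP => t; rewrite coef_poly; case: ltnP => // le.
  by rewrite nth_default // (leq_trans sc).
have modS (G : 'I_e -> {poly k}) : (\sum_a G a) %% m = \sum_a (G a %% m).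
  apply: (big_morph (fun q => q %% m)) => [x y|]; [exact: modpD | exact: mod0p].
rewrite {2}Ec linear_sum /= modS linear_sum.
rewrite mulmx_sum_row; apply: eq_bigr => a _; rewrite rowK !mxE comp_polyZ.
by rewrite comp_Xn_poly modpZl linearZ.
Qed.

(** * Extension of homomorphisms into an algebraically closed field *)

Section Extension.
Variables (k F : fieldType) (i : {rmorphism k -> F}).
Hypothesis char0 : [pchar k] =i pred0.
Hypothesis alg : forall x, algebraicOver i x.
Variables (Om : closedFieldType) (j : {rmorphism k -> Om}).

Lemma closed_root_list (p : {poly Om}) : p != 0 ->
  exists r : seq Om, forall z, root p z -> z \in r.
Proof.
move=> p0; have [r E] := closed_field_poly_normal p.
exists r => z; rewrite E rootZ ?lead_coef_eq0 // root_prod_XsubC.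
by [].
Qed.

(* The linear system over k expressing c(P0) = 0 mod m for deg c < deg mu only
   has the zero solution, hence so does the system over Om; this is applied to
   c = mu / (X - y). *)
Lemma min_root_over (w x : F) (y : Om) (m P0 : {poly k}) :
  root (map_poly i m) w -> (forall P, root (map_poly i P) w -> m %| P) ->
  (map_poly i P0).[w] = x ->
  (forall P, root (map_poly i P) x -> root (map_poly j P) y) ->
  exists2 w', root (map_poly j m) w' & (map_poly j P0).[w'] = y.
Proof.
move=> mw Hm Px xy; apply: contrapT => Hno.
(* A common root of [m] and [P0 - y] would be the required [w']. *)
have cop : coprimep (map_poly j m) (map_poly j P0 - y%:P).
  apply/coprimepP => D Dm DP; rewrite -size_poly_eq1; apply/negPn/negP.
  move=> /closed_rootP[w' Dw']; apply: Hno; exists w'; first by apply: root_dvdp Dw'.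
  have : root (map_poly j P0 - y%:P) w' by apply: root_dvdp Dw'.
  by rewrite rootE !hornerE subr_eq0 => /eqP.
have [mu [mumon mux Hmu]] := min_poly_exists (alg x).
have /factor_theorem[nu Enu] := xy _ mux.
have mu0 : mu != 0 by rewrite monic_neq0.
have nu0 : nu != 0.
  apply: contraNneq mu0 => nu0; move: Enu; rewrite nu0 mul0r => /eqP.
  by rewrite map_poly_eq0.
have snu : (size nu = (size mu).-1)%N.
  move: (congr1 (size : {poly Om} -> nat) Enu).
  by rewrite size_map_poly size_Mmonic ?monicXsubC // size_XsubC addn2 => ->.
have m0 : m != 0.
  have [q q0 qw] := alg w; apply: contraNneq q0 => m0.
  by move/Hm: qw; rewrite m0 dvd0p.
pose e := (size mu).-1; pose n := (size m).-1.
have sn : size m = n.+1 by rewrite prednK // size_poly_gt0.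
pose A : 'M[k]_(e, n) := \matrix_(a < e) poly_rV (P0 ^+ a %% m).
have free : row_free A.
  apply: inj_row_free => v; rewrite -{1}(rVpolyK v) comp_modp_mx ?size_poly //.
  set c := rVpoly v => c0.
  have : (c \Po P0) %% m = 0.
    have sz : (size ((c \Po P0) %% m)%R <= n)%N by rewrite -ltnS -sn ltn_modp.
    by rewrite -(poly_rV_K sz) c0 linear0.
  move/modp_eq0P/dvdpP => [q /(congr1 (map_poly i))].
  rewrite map_comp_poly rmorphM => /(congr1 (horner^~ w)).
  rewrite horner_comp Px hornerM (rootP mw) mulr0 => /rootP/Hmu.
  have [E|cn0] := eqVneq c 0; first by rewrite -(rVpolyK v) -/c E linear0.
  move/(dvdp_leq cn0); rewrite leqNgt (leq_ltn_trans (size_poly _ _)) //.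
  by rewrite prednK // size_poly_gt0.
suff : poly_rV nu = 0 :> 'rV_e.
  move=> E; have := poly_rV_K (leqnn (size nu)).
  by move/eqP: nu0; rewrite -[LHS](@poly_rV_K _ e) ?snu // E linear0.
apply: (row_free_inj (_ : row_free (map_mx j A))); first by rewrite row_free_map.
have -> : map_mx j A = \matrix_(a < e) poly_rV (map_poly j P0 ^+ a %% map_poly j m).
  apply/row_matrixP => a; rewrite -map_row !rowK map_poly_rV map_modp.
  by rewrite rmorphXn.
rewrite mul0mx comp_modp_mx ?snu //.
suff /modp_eq0P -> : map_poly j m %| nu \Po map_poly j P0 by rewrite linear0.
rewrite -(Gauss_dvdpl _ cop).
have -> : (nu \Po map_poly j P0) * (map_poly j P0 - y%:P) = map_poly j (mu \Po P0).
  by rewrite map_comp_poly Enu comp_polyM comp_polyB comp_polyX comp_polyC.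
by rewrite dvdp_map Hm // map_comp_poly rootE horner_comp Px.
Qed.

Let conj_list : exists C : F -> seq Om, forall a, exists q : {poly k},
  [/\ q != 0, root (map_poly i q) a &
      forall z, root (map_poly j q) z -> z \in C a].
Proof.
have H a : exists l : seq Om, exists q : {poly k},
  [/\ q != 0, root (map_poly i q) a &
      forall z, root (map_poly j q) z -> z \in l]; last by have [C HC] := choice H; exists C.
have [q q0 qa] := alg a.
have q0' : map_poly j q != 0 by rewrite map_poly_eq0.
by have [r Hr] := closed_root_list q0'; exists r, q.
Qed.

(** Glues solutions found on finite lists into one homomorphism; the conditions [Phi] will be
    congruences modulo a prime, for conjugacy of primes and for Frobenius elements. *)
Lemma hom_compactness (Phi : F -> Om -> Prop) :
  (forall r : seq F, exists w : {rmorphism F -> Om},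
     (forall x, w (i x) = j x) /\ forall a, a \in r -> Phi a (w a)) ->
  exists w : {rmorphism F -> Om},
     (forall x, w (i x) = j x) /\ forall a, Phi a (w a).
Proof.
move=> H; have [C HC] := conj_list.
have [||||f Hf] := @compactness F Om C (fun r f => exists w : {rmorphism F -> Om},
   (forall x, w (i x) = j x) /\ forall a, a \in r -> f a = w a /\ Phi a (w a)).
- move=> r f [w [wi wr]] a /wr[-> _]; have [q [q0 qa ->]] // := HC a.
  move: qa; rewrite !rootE => /eqP E.
  have -> : map_poly j q = map_poly w (map_poly i q).
    by rewrite -map_poly_comp; apply: eq_map_poly => x /=; rewrite wi.
  by rewrite horner_map E rmorph0.
- move=> r f g fg [w [wi wr]]; exists w; split=> // a ar.
  by rewrite -fg //; apply: wr.
- by move=> r r' f S [w [wi wr]]; exists w; split=> // a /S; apply: wr.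
- move=> r; have [w [wi wr]] := H r; exists w, w; split=> // a /wr; by split.
have [||| g Eg] := @rmorphism_of F Om f.
- move=> x y; have [w [_ wr]] := Hf [:: x; y; x - y].
  have [|-> _] := wr x; rewrite ?inE ?eqxx ?orbT //.
  have [|-> _] := wr y; rewrite ?inE ?eqxx ?orbT //.
  have [|-> _] := wr (x - y); rewrite ?inE ?eqxx ?orbT //.
  exact: rmorphB.
- have [w [_ wr]] := Hf [:: 1]; have [|-> _] := wr 1; rewrite ?inE ?eqxx //.
  exact: rmorph1.
- move=> x y; have [w [_ wr]] := Hf [:: x; y; x * y].
  have [|-> _] := wr x; rewrite ?inE ?eqxx ?orbT //.
  have [|-> _] := wr y; rewrite ?inE ?eqxx ?orbT //.
  have [|-> _] := wr (x * y); rewrite ?inE ?eqxx ?orbT //.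
  exact: rmorphM.
exists g; split=> [x|a]; rewrite Eg.
  have [w [wi wr]] := Hf [:: i x].
  by have [|-> _] := wr (i x); rewrite ?inE ?eqxx ?orbT.
have [w [wi wr]] := Hf [:: a].
by have [|-> ?] := wr a; rewrite ?inE ?eqxx ?orbT.
Qed.

Lemma hom_extension_root (x : F) (y : Om) :
  (forall P, root (map_poly i P) x -> root (map_poly j P) y) ->
  exists w : {rmorphism F -> Om}, (forall a, w (i a) = j a) /\ w x = y.
Proof.
move=> xy; have [C HC] := conj_list.
(* A partial homomorphism on r is recorded by one generator [w] and its image [w'], so that every
   polynomial relation carries over from F to Om. *)
pose Good (r : seq F) (f : F -> Om) := exists w w',
  [/\ forall P, root (map_poly i P) w -> root (map_poly j P) w',
      exists2 P, (map_poly i P).[w] = x & (map_poly j P).[w'] = y &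
      forall a, a \in r -> exists2 P, (map_poly i P).[w] = a &
                                     (map_poly j P).[w'] = f a].
have [||||f Hf] := @compactness F Om C Good.
- move=> r f [w [w' [ww _ wr]]] a /wr[P Pa <-]; have [q [q0 qa ->]] // := HC a.
  have : root (map_poly i (q \Po P)) w.
    by rewrite map_comp_poly rootE horner_comp Pa.
  by move/ww; rewrite map_comp_poly rootE horner_comp.
- move=> r f g fg [w [w' [ww wx wr]]]; exists w, w'; split=> // a ar.
  by have [P ? ?] := wr _ ar; exists P => //; rewrite -fg.
- move=> r r' f S [w [w' [ww wx wr]]]; exists w, w'; split=> // a /S; exact: wr.
- move=> r; have [w Hw] := primitive_list char0 alg (x :: r).
  have [P0 Px] : exists P, (map_poly i P).[w] = x by apply: Hw; rewrite inE eqxx.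
  have [m [mm mw Hm]] := min_poly_exists (alg w).
  have [w' rw yw] : exists2 w', root (map_poly j m) w' & (map_poly j P0).[w'] = y.
    exact: (min_root_over mw Hm Px xy).
  have /choice[Pf HPf] a : exists P : {poly k}, a \in r -> (map_poly i P).[w] = a.
    have [ar|_] := boolP (a \in r); last by exists 0.
    by have [|P HP] := Hw a; [rewrite inE ar orbT | exists P].
  exists (fun a => (map_poly j (Pf a)).[w']).
  exists w, w'; split; first by move=> P /Hm/dvdpP[Q ->]; rewrite rmorphM rootM rw orbT.
    by exists P0.
  by move=> a ar; exists (Pf a) => //; apply: HPf.
have [||| g Eg] := @rmorphism_of F Om f.
- move=> u v; have [w [w' [ww _ wr]]] := Hf [:: u; v; u - v].
  have [|P1 E1 <-] := wr u; rewrite ?inE ?eqxx ?orbT //.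
  have [|P2 E2 <-] := wr v; rewrite ?inE ?eqxx ?orbT //.
  have [|P3 E3 <-] := wr (u - v); rewrite ?inE ?eqxx ?orbT //.
  have := ww (P3 - (P1 - P2)); rewrite !rmorphB !rootE !hornerE E1 E2 E3 subrr eqxx.
  by move=> /(_ isT); rewrite subr_eq0 => /eqP.
- have [w [w' [ww _ wr]]] := Hf [:: 1].
  have [|P1 E1 <-] := wr 1; rewrite ?inE ?eqxx ?orbT //.
  have := ww (P1 - 1); rewrite !rmorphB !rmorph1 !rootE !hornerE E1 subrr eqxx.
  by move=> /(_ isT); rewrite subr_eq0 => /eqP.
- move=> u v; have [w [w' [ww _ wr]]] := Hf [:: u; v; u * v].
  have [|P1 E1 <-] := wr u; rewrite ?inE ?eqxx ?orbT //.
  have [|P2 E2 <-] := wr v; rewrite ?inE ?eqxx ?orbT //.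
  have [|P3 E3 <-] := wr (u * v); rewrite ?inE ?eqxx ?orbT //.
  have := ww (P3 - (P1 * P2)); rewrite !rmorphB !rmorphM !rootE !hornerE E1 E2 E3 subrr eqxx.
  by move=> /(_ isT); rewrite subr_eq0 => /eqP.
exists g; split=> [a|]; rewrite Eg.
  have [w [w' [ww _ wr]]] := Hf [:: i a].
  have [|P1 E1 <-] := wr (i a); rewrite ?inE ?eqxx ?orbT //.
  have := ww (P1 - a%:P); rewrite !rmorphB /= !map_polyC !rootE !hornerE E1 subrr eqxx.
  by move=> /(_ isT); rewrite subr_eq0 => /eqP.
have [w [w' [ww [P0 E0 <-] wr]]] := Hf [:: x].
have [|P1 E1 <-] := wr x; rewrite ?inE ?eqxx ?orbT //.
have := ww (P1 - P0); rewrite !rmorphB !rootE !hornerE E1 E0 subrr eqxx.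
by move=> /(_ isT); rewrite subr_eq0 => /eqP.
Qed.

Lemma hom_extension : exists w : {rmorphism F -> Om}, forall a, w (i a) = j a.
Proof.
have [|w [wi _]] := @hom_extension_root 0 0; last by exists w.
by move=> P; rewrite !rootE !horner_coef0 !coef_map !fmorph_eq0.
Qed.

End Extension.

Lemma min_poly_deriv (k F : fieldType) (i : {rmorphism k -> F}) w
    (m : {poly k}) : [pchar k] =i pred0 ->
  m \is monic -> root (map_poly i m) w ->
  (forall P, root (map_poly i P) w -> m %| P) ->
  ~~ root (map_poly i m^`()) w.
Proof.
move=> /pcharf0P ch mm mw Hm; apply/negP => /Hm.
have m0 := monic_neq0 mm.
have sm : (1 < size m)%N.
  rewrite ltnNge; apply/negP => /size1_polyC E; move: mw mm.
  rewrite E map_polyC rootE hornerC fmorph_eq0 => /eqP ->.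
  by rewrite monicE lead_coef0 eq_sym oner_eq0.
have d0 : m^`() != 0.
  apply/eqP => /(congr1 (fun q : {poly k} => q`_(size m).-2)).
  rewrite coef_deriv coef0 (_ : (size m).-2.+1 = (size m).-1); last by case: (size m) sm => [|[]].
  move/eqP; rewrite -[_`_ _]/(lead_coef m) (monicP mm) ch.
  by case: (size m) sm => [|[]].
by move/(dvdp_leq d0); rewrite leqNgt lt_size_deriv.
Qed.

Lemma min_poly_separable (k F : fieldType) (i : {rmorphism k -> F}) w
    (m : {poly k}) : [pchar k] =i pred0 ->
  m \is monic -> root (map_poly i m) w ->
  (forall P, root (map_poly i P) w -> m %| P) -> separable_poly m.
Proof.
move=> ch mm mw Hm; have dw := min_poly_deriv ch mm mw Hm.
have m0 := monic_neq0 mm.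
rewrite separable_poly.unlock; apply/coprimepP => D /dvdpP[q Eq] Dd; rewrite -size_poly_eq1.
have /norP[q0 D0] : ~~ ((q == 0) || (D == 0)) by rewrite -mulf_eq0 -Eq.
move: (mw); rewrite Eq rmorphM rootM => /orP[/Hm/(dvdp_leq q0)|Dw].
  rewrite Eq size_mul // => le.
  have := size_poly_gt0 D; have := size_poly_gt0 q; rewrite q0 D0.
  by move: le; lia.
case/negP: dw; case/dvdpP: Dd => e ->.
by rewrite rmorphM rootM Dw orbT.
Qed.

(** A polynomial over k has all its roots in C already. Hence homomorphisms between algebraic
    closures are onto. *)
Lemma alg_in_closed_image (k : fieldType) (C : closedFieldType) (D : fieldType)
    (i : {rmorphism k -> C}) (h : {rmorphism C -> D}) v :
  algebraicOver (h \o i) v -> exists u, h u = v.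
Proof.
move=> [q q0 qv].
have [r E] := closed_field_poly_normal (map_poly i q).
move: qv; rewrite (map_poly_comp h i) E map_polyZ rootZ; last first.
  by rewrite fmorph_eq0 lead_coef_eq0 map_poly_eq0.
rewrite rmorph_prod.
under eq_bigr do rewrite rmorphB /= map_polyX map_polyC /=.
rewrite -(big_map h predT (fun z => 'X - z%:P)) root_prod_XsubC.
by case/mapP => u _ ->; exists u.
Qed.

Lemma fmorph_bijective (A B : fieldType) (h : {rmorphism A -> B}) :
  (forall v, exists u, h u = v) -> bijective h.
Proof.
move=> /choice[g Hg]; exists g => // x.
by apply: (fmorph_inj h); rewrite Hg.
Qed.

Lemma fmorph_inverse (A B : fieldType) (h : {rmorphism A -> B}) :
  bijective h -> exists g : {rmorphism B -> A}, cancel h g /\ cancel g h.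
Proof.
move=> [f hf fh].
have [|||g Hg] := @rmorphism_of B A f.
- by move=> x y; apply: (fmorph_inj h); rewrite rmorphB !fh.
- by apply: (fmorph_inj h); rewrite fh rmorph1.
- by move=> x y; apply: (fmorph_inj h); rewrite rmorphM !fh.
by exists g; split=> x; rewrite Hg.
Qed.

(** * Inverses, fixed elements and finite orbits in the absolute Galois group *)

Section AbsGalGroup.
Variables (k : fieldType) (Kb : algClosure k).
Implicit Types s t : absGal Kb.
Local Notation em := (algClosure_emb Kb).

Lemma absGal_of (g : {rmorphism Kb -> Kb}) :
  (forall a, g (em a) = em a) -> exists s : absGal Kb, forall z, s z = g z.
Proof.
move=> ga; have gb : bijective g.
  apply: fmorph_bijective => v; apply: (@alg_in_closed_image k _ _ em).
  have [q q0 qv] := algClosureP v; exists q => //.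
  by rewrite (_ : map_poly (g \o em) q = map_poly em q) //; apply: eq_map_poly => a /=.
by exists (AbsGal gb ga).
Qed.

Lemma absGal1_ex : exists s : absGal Kb, forall z, s z = z.
Proof. by have [|s Hs] := @absGal_of idfun; [|exists s]. Qed.
Definition absGal1 := projT1 (cid absGal1_ex).
Lemma absGal1E z : absGal1 z = z.
Proof. by rewrite /absGal1; case: cid. Qed.

Lemma absGalV_ex s : exists t : absGal Kb, cancel s t /\ cancel t s.
Proof.
have [g [sg gs]] := fmorph_inverse (absGal_bij s).
have [|t Ht] := @absGal_of g; first by move=> a; rewrite -{1}(absGal_fix s) sg.
by exists t; split=> z; rewrite Ht.
Qed.
Definition absGalV s := projT1 (cid (absGalV_ex s)).
Lemma absGalVK s : cancel s (absGalV s).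
Proof. by rewrite /absGalV; case: cid => ? []. Qed.
Lemma absGalKV s : cancel (absGalV s) s.
Proof. by rewrite /absGalV; case: cid => ? []. Qed.

Fixpoint absGalX s n := if n is n'.+1 then absGal_mul s (absGalX s n') else absGal1.

Lemma absGalXE s n z : absGalX s n z = iter n s z.
Proof. by elim: n => [|n IH] /=; [exact: absGal1E | rewrite IH]. Qed.

Hypothesis char0 : [pchar k] =i pred0.

Lemma absGal_conj (x y : Kb) :
  (forall P, root (map_poly em P) x -> root (map_poly em P) y) ->
  exists s : absGal Kb, s x = y.
Proof.
move=> H; have [w [wi wx]] := hom_extension_root char0 (@algClosureP _ Kb) H.
by have [s Hs] := absGal_of wi; exists s; rewrite Hs.
Qed.

Lemma absGal_fixed (z : Kb) : (forall s : absGal Kb, s z = z) -> exists a, z = em a.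
Proof.
move=> Hz; have [m [mm mz Hm]] := min_poly_exists (algClosureP z).
have dz := min_poly_deriv char0 mm mz Hm.
have /factor_theorem[q Eq] := mz.
have [sq|sq] := eqVneq (size q) 1%N.
  have sm : size m = 2.
    rewrite -(size_map_poly em) Eq size_Mmonic ?monicXsubC ?size_XsubC ?sq //.
    by rewrite -size_poly_gt0 sq.
  exists (- m`_0); move: (rootP mz); rewrite horner_coef size_map_poly sm.
  rewrite !big_ord_recl big_ord0 !coef_map /= expr0 expr1 mulr1 addr0.
  rewrite (_ : m`_1 = 1) ?rmorph1 ?mul1r; last by move: (monicP mm); rewrite lead_coefE sm.
  by move/eqP; rewrite addrC addr_eq0 => /eqP ->; rewrite rmorphN.
have [z' qz'] := closed_rootP q sq.
have mz' : root (map_poly em m) z' by rewrite Eq rootM qz'.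
have zz' : z' != z.
  apply: contraNneq dz => E; rewrite -deriv_map Eq derivM derivXsubC mulr1.
  by rewrite rootE hornerD hornerM !hornerE subrr mulr0 add0r -[X in q.[X]]E.
have [|s Hs] := @absGal_conj z z'.
  by move=> P /Hm/dvdpP[Q ->]; rewrite rmorphM rootM mz' orbT.
by move: zz'; rewrite -Hs Hz eqxx.
Qed.

(** Such an f factors through the finitely many conjugates of a primitive element for r. The target
    is arbitrary because orbits of polynomials are needed besides those of elements. *)
Lemma absGal_orbit (T : eqType) (f : absGal Kb -> T) (r : seq Kb) :
  (forall s t, {in r, s =1 t} -> f s = f t) ->
  exists O : seq T, uniq O /\ forall y, y \in O <-> exists s, y = f s.
Proof.
move=> Hf; have [w Hw] := primitive_list char0 (@algClosureP _ Kb) r.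
have [q q0 qw] := algClosureP w.
have q0' : map_poly em q != 0 by rewrite map_poly_eq0.
have [C HC] := closed_root_list q0'.
have /choice[F HF] (z : Kb) : exists y : T, forall s, s w = z -> f s = y.
  have [[s sz]|no] := pselect (exists s : absGal Kb, s w = z).
    exists (f s) => t tz; apply: Hf => a /Hw[P <-].
    have E (g : absGal Kb) : g (map_poly em P).[w] = (map_poly em P).[g w].
      rewrite -horner_map /= -map_poly_comp.
      by congr (_.[_]); apply: eq_map_poly => x /=; rewrite absGal_fix.
    by rewrite !E tz sz.
  by exists (f absGal1) => s sz; case: no; exists s.
pose C' := [seq z <- C | `[< exists s : absGal Kb, s w = z >]].
exists (undup (map F C')); split=> [|y]; first exact: undup_uniq.
rewrite mem_undup; split.
  by case/mapP => z; rewrite mem_filter => /andP[/asboolP[s sw] _] ->; exists s; rewrite (HF z s sw).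
case=> s ->; rewrite (HF _ s erefl); apply: map_f; rewrite mem_filter.
apply/andP; split; first by apply/asboolP; exists s.
apply: HC; move: qw; rewrite !rootE => /eqP E.
have -> : map_poly em q = map_poly s (map_poly em q).
  by rewrite -map_poly_comp; apply: eq_map_poly => x /=; rewrite absGal_fix.
by rewrite horner_map E rmorph0.
Qed.

Lemma orbit_perm (T : eqType) (act : absGal Kb -> T -> T) (y : T) (O : seq T) s :
  (forall g h z, act (absGal_mul g h) z = act g (act h z)) ->
  injective (act s) ->
  uniq O -> (forall z, z \in O <-> exists g, z = act g y) ->
  perm_eq (map (act s) O) O.
Proof.
move=> actM inj uO HO.
have S : {subset map (act s) O <= O}.
  by move=> z /mapP[z' /HO[g ->] ->]; apply/HO; exists (absGal_mul s g); rewrite actM.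
apply: uniq_perm => //; first by rewrite map_inj_uniq.
have := uniq_min_size (_ : uniq (map (act s) O)) S.
rewrite map_inj_uniq // size_map => /(_ uO (leqnn _)) [_ H].
exact: H.
Qed.

Lemma fixed_poly (Z : {poly Kb}) : (forall s : absGal Kb, map_poly s Z = Z) ->
  exists c : {poly k}, Z = map_poly em c.
Proof.
move=> HZ; have /choice[c Hc] n : exists a, Z`_n = em a.
  by apply: absGal_fixed => s; rewrite -{2}(HZ s) coef_map.
exists (\poly_(n < size Z) c n); apply/polyP => n; rewrite coef_map coef_poly.
case: ltnP => [_|le]; first exact: Hc.
by rewrite raddf0 nth_default.
Qed.

(** Finitely many elements are packed as the coefficients of one polynomial Y, so that a single
    conjugate of Y acts on all of them at once. The product over the orbit is a polynomial in a
    second variable with coefficients in k[X]. *)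
Lemma poly_orbit (Y : {poly Kb}) :
  exists O : seq {poly Kb}, [/\ uniq O, Y \in O,
    forall Z, Z \in O -> exists s : absGal Kb, Z = map_poly s Y &
    exists c : nat -> {poly k}, forall n,
      (\prod_(Z <- O) ('X - Z%:P) : {poly {poly Kb}})`_n = map_poly em (c n)].
Proof.
have [|O [uO HO]] := @absGal_orbit _ (fun s => map_poly s Y) Y.
  move=> s t st; apply/polyP => n; rewrite !coef_map.
  have [le|lt] := leqP (size Y) n; first by rewrite nth_default // !raddf0.
  by apply: st; apply: mem_nth.
exists O; split=> //.
- apply/HO; exists absGal1; apply/polyP => n; by rewrite coef_map /= absGal1E.
- by move=> Z /HO.
suff H n : exists c, (\prod_(Z <- O) ('X - Z%:P) : {poly {poly Kb}})`_n = map_poly em c.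
  by have [c Hc] := choice H; exists c.
apply: fixed_poly => s; rewrite -coef_map /=.
have pe : perm_eq (map (map_poly s) O) O.
  apply: (@orbit_perm _ (fun g => map_poly g) Y) => //.
  - by move=> g h Z; apply/polyP => a; rewrite !coef_map.
  - exact: map_inj_poly (fmorph_inj s) (rmorph0 s).
suff -> : map_poly (map_poly s) (\prod_(Z <- O) ('X - Z%:P) : {poly {poly Kb}}) =
   \prod_(Z <- O) ('X - Z%:P) by [].
rewrite -[RHS](perm_big _ pe) /= big_map rmorph_prod /=.
by apply: eq_bigr => Z _; rewrite rmorphB /= map_polyX map_polyC /=.
Qed.

End AbsGalGroup.

(** * Embeddings of a finite extension *)

Section Embeddings.
Variables (F : fieldType) (E : fieldExtType F) (Om : closedFieldType).
Variable j : {rmorphism F -> Om}.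
Hypothesis char0 : [pchar F] =i pred0.

Lemma fieldExt_algebraic (x : E) : algebraicOver (in_alg E) x.
Proof.
have /polyOver1P[p Ep] := minPolyOver 1%AS x.
exists p; last by rewrite -Ep root_minPoly.
by apply: contraNneq (monic_neq0 (monic_minPoly 1%AS x)) => p0; rewrite Ep p0 rmorph0.
Qed.

(** E is generated by one element, so embeddings correspond to the roots of its separable minimal
    polynomial. *)
Lemma embeddings : exists w : 'I_(\dim {:E}) -> {rmorphism E -> Om},
  [/\ forall t a, w t (in_alg E a) = j a,
      forall t u, w t =1 w u -> t = u &
      forall v : {rmorphism E -> Om}, (forall a, v (in_alg E a) = j a) ->
        exists t, v =1 w t].
Proof.
have [g Hg] := primitive_list char0 fieldExt_algebraic (vbasis {:E}).
have gen x : exists P : {poly F}, (map_poly (in_alg E) P).[g] = x.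
  have /choice[P HP] (t : 'I_(\dim {:E})) :
      exists P, (map_poly (in_alg E) P).[g] = (vbasis {:E})`_t.
    by apply: Hg; apply: mem_nth; rewrite size_tuple.
  exists (\sum_t coord (vbasis {:E}) t x *: P t).
  rewrite rmorph_sum horner_sum /= {2}(coord_vbasis (memvf x)).
  apply: eq_bigr => t _; rewrite map_polyZ hornerZ HP.
  by rewrite -[RHS]mulr_algl.
have [m [mm mg Hm]] := min_poly_exists (fieldExt_algebraic g).
have Edim : \dim {:E} = (size m).-1.
  have -> : fullv = <<1; g>>%VS :> {vspace E}.
    apply/vspaceP => x; rewrite memvf; have [P <-] := gen x.
    by rewrite mempx_Fadjoin //; apply/polyOver1P; exists P.
  rewrite dim_Fadjoin dimv1 muln1.
  have := size_minPoly 1%AS g.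
  have /polyOver1P[p Ep] := minPolyOver 1%AS g.
  suff -> : size (minPoly 1 g) = size m by move=> ->.
  rewrite Ep size_map_poly; apply/eqP; rewrite eqn_leq; apply/andP; split.
    rewrite -(size_map_poly (in_alg E)) -(size_map_poly (in_alg E) m) -Ep.
    apply: dvdp_leq; first by rewrite map_poly_eq0 monic_neq0.
    by apply: minPoly_dvdp => //; apply/polyOver1P; exists m.
  apply: dvdp_leq; last by apply: Hm; rewrite -Ep root_minPoly.
  by rewrite -(map_poly_eq0 (in_alg E)) -Ep monic_neq0 ?monic_minPoly.
have [r Er] := closed_field_poly_normal (map_poly j m).
rewrite (lead_coef_map j) (monicP mm) rmorph1 scale1r in Er.
have ur : uniq r.
  by rewrite -separable_prod_XsubC -Er separable_map (min_poly_separable char0 mm mg Hm).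
have sr : size r = \dim {:E}.
  by rewrite Edim -(size_map_poly j) Er size_prod_XsubC.
have /choice[w Hw] (t : 'I_(\dim {:E})) : exists w : {rmorphism E -> Om},
    (forall a, w (in_alg E a) = j a) /\ w g = r`_t.
  apply: hom_extension_root => //; first exact: fieldExt_algebraic.
  move=> P /Hm/dvdpP[Q ->]; rewrite rmorphM /= rootM Er.
  by rewrite root_prod_XsubC orbC mem_nth // sr.
have evalP (v : {rmorphism E -> Om}) P : (forall a, v (in_alg E a) = j a) ->
    v (map_poly (in_alg E) P).[g] = (map_poly j P).[v g].
  move=> va; rewrite -horner_map /= -map_poly_comp.
  by congr (_.[_]); apply: eq_map_poly => a /=; rewrite va.
exists w; split.
- by move=> t a; case: (Hw t).
- move=> t u /(_ g); case: (Hw t) => _ ->; case: (Hw u) => _ -> /eqP.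
  by rewrite nth_uniq ?sr // => /eqP/val_inj.
- move=> v va; have : v g \in r.
    rewrite -root_prod_XsubC -Er rootE -evalP // (rootP mg).
    by rewrite rmorph0.
  move=> /(nthP 0)[t]; rewrite sr => lt Et; exists (Ordinal lt) => x.
  have [wa wg] := Hw (Ordinal lt); have [P <-] := gen x.
  by rewrite !evalP // wg -Et.
Qed.

End Embeddings.

(** * Prime ideals and Frobenius elements *)

Lemma intr_surj_rat (q : rat) : integers rat q -> exists n : int, q = n%:~R.
Proof.
move=> [p mp pq].
have Aq : ratr q \in Aint.
  apply: (@root_monic_Aint (map_poly (intr : int -> algC) p)).
  - rewrite (_ : map_poly _ p = map_poly ratr (map_poly (intr : int -> rat) p)).
      by rewrite rootE horner_map (rootP pq) rmorph0.
    by rewrite -map_poly_comp; apply: eq_map_poly => x /=; rewrite ratr_int.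
  - exact: monic_map.
  - by apply/polyOverP => n; rewrite coef_map /= intr_int.
have /intrP[n En] := Cint_rat_Aint (Crat_rat q) Aq.
by exists n; apply: (fmorph_inj (@ratr algC)); rewrite [LHS]En [RHS]ratr_int.
Qed.

(** * Rings of algebraic integers *)

Section Integers.
Variable F : fieldType.
Implicit Types x y : F.

Lemma integersD x y : integers F x -> integers F y -> integers F (x + y).
Proof. exact: integral_add. Qed.
Lemma integersB x y : integers F x -> integers F y -> integers F (x - y).
Proof. exact: integral_sub. Qed.
Lemma integersN x : integers F x -> integers F (- x).
Proof. exact: integral_opp. Qed.
Lemma integersM x y : integers F x -> integers F y -> integers F (x * y).
Proof. exact: integral_mul. Qed.
Lemma integers_int (n : int) : integers F n%:~R.
Proof. exact: integral_id. Qed.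
Lemma integers_nat n : integers F n%:R.
Proof. exact: integral_nat. Qed.
Lemma integers0 : integers F 0. Proof. exact: (integers_nat 0). Qed.
Lemma integers1 : integers F 1. Proof. exact: (integers_nat 1). Qed.
Lemma integersX x n : integers F x -> integers F (x ^+ n).
Proof. by move=> Fx; elim: n => [|n IH]; rewrite ?expr0 ?exprS; [exact: integers1|exact: integersM]. Qed.
Lemma integers_sum (I : Type) (r : seq I) (f : I -> F) :
  (forall n, integers F (f n)) -> integers F (\sum_(n <- r) f n).
Proof. by move=> H; apply: big_ind => //; [exact: integers0|exact: integersD]. Qed.
Lemma integers_prod (I : Type) (r : seq I) (p : pred I) (f : I -> F) :
  (forall n, integers F (f n)) -> integers F (\prod_(n <- r | p n) f n).
Proof. by move=> H; apply: big_ind => //; [exact: integers1|exact: integersM]. Qed.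

Lemma integers_root x (p : {poly F}) : p \is monic -> root p x ->
  (forall n, integers F p`_n) -> integers F x.
Proof.
move=> mp px H; apply: (integral_root_monic mp px).
by move=> _ /(nthP 0)[n _ <-]; apply: H.
Qed.

Lemma integers_horner x (p : {poly F}) :
  (forall n, integers F p`_n) -> integers F x -> integers F p.[x].
Proof.
by move=> H Fx; rewrite horner_coef; apply: integers_sum => n; apply: integersM (H _) (integersX _ Fx).
Qed.

(** The multiple is the constant term of an annihilating polynomial, once powers of X are divided
    out. *)
Lemma integers_dvd_nat x : integers F x -> x != 0 ->
  exists2 n : nat, (0 < n)%N & exists2 y, integers F y & n%:R = x * y.
Proof.
move=> Fx x0; have [p mp px] := Fx.
have p0 := monic_neq0 mp; move: p0 px {mp}.
elim: {p}(size p) {-2}p (leqnn (size p)) => [|n IH] p sp p0 px.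
  by move: p0; rewrite -size_poly_leq0 sp.
have [c0|c0] := eqVneq p`_0 0.
  have /factor_theorem[q Eq] : root p 0 by rewrite rootE horner_coef0 c0.
  rewrite subr0 in Eq; have q0 : q != 0 by apply: contraNneq p0 => E; rewrite Eq E mul0r.
  apply: (IH q) => //; first by move: sp; rewrite Eq size_mulX.
  by move: px; rewrite Eq rmorphM /= map_polyX rootM rootX (negPf x0) orbF.
exists (absz p`_0); first by rewrite absz_gt0.
suff [y Fy E] : exists2 y, integers F y & (p`_0)%:~R = x * y.
  case: (p`_0) E => m E; first by exists y.
  exists (- y); first exact: integersN.
  by rewrite mulrN -E NegzE mulrNz opprK.
have [q Eq] : exists q : {poly int}, p = q * 'X + (p`_0)%:P.
  exists (Poly (behead p)); rewrite -cons_poly_def.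
  by apply/polyP => -[|m]; rewrite coef_cons //= coef_Poly nth_behead.
exists (- (map_poly intr q).[x]).
  apply: integersN; apply: integers_horner => // m.
  by rewrite coef_map; apply: integers_int.
move: px; rewrite {1}Eq rmorphD rmorphM /= map_polyX map_polyC rootE !hornerE.
by rewrite addrC addr_eq0 => /eqP ->; rewrite mulrN mulrC.
Qed.

End Integers.

Lemma integers_fmorph (F E : fieldType) (h : {rmorphism F -> E}) x :
  integers E (h x) <-> integers F x.
Proof.
have eqp (p : {poly int}) : map_poly (intr : int -> E) p = map_poly h (map_poly intr p).
  by rewrite -map_poly_comp; apply: eq_map_poly => n /=; rewrite rmorph_int.
split=> -[p mp px]; exists p => //; move: px; rewrite eqp.
  by rewrite fmorph_root.
by rewrite fmorph_root.
Qed.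

(** * Prime ideals and their residue fields *)

Section PrimeIdeals.
Variables (F : fieldType) (P : set F).
Hypothesis PP : prime_ideal F P.
Implicit Types x y : F.

Lemma prime_sub x : P x -> integers F x. Proof. by case: PP => -[S _ _ _] _; apply: S. Qed.
Lemma prime0 : P 0. Proof. by case: PP => -[]. Qed.
Lemma primeD x y : P x -> P y -> P (x + y). Proof. by case: PP => -[_ _ D _] _; apply: D. Qed.
Lemma primeMl x y : integers F x -> P y -> P (x * y).
Proof. by case: PP => -[_ _ _ M] _; apply: M. Qed.
Lemma primeMr x y : integers F y -> P x -> P (x * y).
Proof. by rewrite mulrC; apply: primeMl. Qed.
Lemma primeN x : P x -> P (- x).
Proof. by move=> Px; rewrite -mulN1r; apply: primeMl => //; apply/integersN/integers1. Qed.
Lemma primeB x y : P x -> P y -> P (x - y).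
Proof. by move=> Px Py; apply: primeD => //; apply: primeN. Qed.
Lemma primeBC x y : P (x - y) -> P (y - x).
Proof. by move=> H; rewrite -opprB; apply: primeN. Qed.
Lemma prime_trans x y z : P (x - y) -> P (y - z) -> P (x - z).
Proof. by move=> H1 H2; have := primeD H1 H2; rewrite addrA subrK. Qed.
Lemma prime_ne1 : ~ P 1. Proof. by case: PP => _ []. Qed.
Lemma primeM x y : integers F x -> integers F y -> P (x * y) -> P x \/ P y.
Proof. by case: PP => _ [_ _]; apply. Qed.
Lemma prime_nz : exists2 x, P x & x != 0. Proof. by case: PP => _ []. Qed.
Lemma prime_sum (I : Type) (r : seq I) (f : I -> F) :
  (forall n, P (f n)) -> P (\sum_(n <- r) f n).
Proof. by move=> H; apply: big_ind => //; [exact: prime0|exact: primeD]. Qed.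
Lemma prime_cong x y : P (x - y) -> P y -> P x.
Proof. by move=> H1 H2; rewrite -(subrK y x); apply: primeD. Qed.
Lemma primeX x n : integers F x -> P (x ^+ n) -> P x.
Proof.
move=> Fx; elim: n => [|n IH]; first by move/prime_ne1.
by rewrite exprS => /(primeM Fx (integersX _ Fx))[|/IH].
Qed.
Lemma prime_congM x y z t : integers F x -> integers F t ->
  P (x - y) -> P (z - t) -> P (x * z - y * t).
Proof.
move=> Fx Ft H1 H2.
have -> : x * z - y * t = x * (z - t) + (x - y) * t by ring.
by apply: primeD; [exact: primeMl | exact: primeMr].
Qed.
Lemma prime_congX x y n : integers F x -> integers F y ->
  P (x - y) -> P (x ^+ n - y ^+ n).
Proof.
move=> Fx Fy H; elim: n => [|n IH]; first by rewrite subrr; exact: prime0.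
by rewrite !exprS; apply: prime_congM => //; apply: integersX.
Qed.
Lemma prime_prod (I : eqType) (r : seq I) (f : I -> F) :
  (forall n, n \in r -> integers F (f n)) -> P (\prod_(n <- r) f n) ->
  exists2 n, n \in r & P (f n).
Proof.
elim: r => [|a r IH] H; first by rewrite big_nil => /prime_ne1.
rewrite big_cons => /primeM[||Pa|].
- by apply: H; rewrite inE eqxx.
- rewrite big_seq; apply: big_ind => [||n nr]; [exact: integers1|exact: integersM|].
  by apply: H; rewrite inE nr orbT.
- by exists a; rewrite ?inE ?eqxx.
- move=> /IH[|n nr Pn]; first by move=> n nr; apply: H; rewrite inE nr orbT.
  by exists n; rewrite ?inE ?nr ?orbT.
Qed.

Lemma prime_int_coef x : P x -> x != 0 -> exists2 n : nat, (0 < n)%N & P n%:R.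
Proof.
move=> Px x0; have [n n0 [y Fy E]] := integers_dvd_nat (prime_sub Px) x0.
by exists n => //; rewrite E; apply: primeMr.
Qed.

Lemma prime_above : exists2 p : nat, prime p & P p%:R.
Proof.
have [x Px x0] := prime_nz; have [n n0 Pn] := prime_int_coef Px x0.
elim: {n}(n) {-2}n (leqnn n) n0 Pn => [|m IH] n; first by case: n.
move=> le n0 Pn; have [n1|n1] := leqP n 1.
  by case: prime_ne1; rewrite (_ : 1 = n%:R) //; case: n {le} n0 n1 Pn => [|[]].
have Ediv : n = (pdiv n * (n %/ pdiv n))%N by rewrite mulnC divnK // pdiv_dvd.
move: Pn; rewrite {1}Ediv natrM => /primeM[||Pp|]; try exact: integers_nat.
  by exists (pdiv n) => //; apply: pdiv_prime.
apply: IH; first by rewrite -ltnS (leq_trans _ le) // ltn_Pdiv // prime_gt1 // pdiv_prime.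
by rewrite divn_gt0 ?pdiv_gt0 // pdiv_leq.
Qed.

Variable p : nat.
Hypotheses (pp : prime p) (Pp : P p%:R).

Lemma prime_natP n : P n%:R <-> (p %| n)%N.
Proof.
split=> [Pn|/dvdnP[m ->]]; last by rewrite natrM; apply: primeMl => //; apply: integers_nat.
apply: contrapT => /negP; rewrite -prime_coprime // => cop.
have [a b E _] := egcdnP n (prime_gt0 pp).
move: E; rewrite (eqP cop) => E.
case: prime_ne1; rewrite (_ : 1 = (a * p)%:R - (b * n)%:R); last by rewrite E natrD addrC addKr.
by apply: primeB; rewrite natrM; apply: primeMl => //; apply: integers_nat.
Qed.

Lemma prime_intP (n : int) : P n%:~R <-> (p %| `|n|)%N.
Proof.
rewrite -prime_natP; case: n => n //; rewrite NegzE mulrNz abszN /=.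
by split=> /primeN; rewrite ?opprK.
Qed.

(** The residue ring is a domain integral over F_p. A monic relation for x modulo P is divided by X
    as long as its constant term is divisible by p; after that it exhibits the inverse of x. *)
Lemma prime_maximal x : integers F x -> ~ P x ->
  exists2 y, integers F y & P (x * y - 1).
Proof.
move=> Fx nPx; have [q mq qx] := Fx.
have : P (map_poly intr q).[x] by rewrite (rootP qx); exact: prime0.
elim: {q}(size q) {-2}q (leqnn (size q)) mq {qx} => [|n IH] q sq mq Pq.
  by move: (monic_neq0 mq); rewrite -size_poly_leq0 sq.
have [r Er] : exists r : {poly int}, q = r * 'X + (q`_0)%:P.
  exists (Poly (behead q)); rewrite -cons_poly_def.
  apply/polyP => -[|m]; rewrite coef_cons //= coef_Poly nth_behead //.
have Fr : integers F (map_poly intr r).[x].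
  by apply: integers_horner => // m; rewrite coef_map; apply: integers_int.
have Eq : (map_poly intr q).[x] = (map_poly intr r).[x] * x + (q`_0)%:~R.
  by rewrite {1}Er rmorphD rmorphM /= map_polyX map_polyC !hornerE.
have [r0|r0] := eqVneq r 0.
  case: prime_ne1; move: Pq; rewrite Eq r0 map_poly0 horner0 mul0r add0r.
  by move: (monicP mq); rewrite {1}Er r0 mul0r add0r lead_coefC => ->.
have mr : r \is monic.
  move: mq; rewrite Er !monicE lead_coefDl ?lead_coefMX //.
  by rewrite size_mulX // (leq_ltn_trans (size_polyC_leq1 _)) // ltnS size_poly_gt0.
have [pc|pc] := boolP (p %| absz (q`_0)%R)%N.
  have : P ((map_poly intr r).[x] * x).
    rewrite -(addrK (q`_0)%:~R (_ * _)) -Eq; apply: primeB => //.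
    exact/prime_intP.
  case/primeM => // Pr; apply: (IH r) => //.
  by rewrite -ltnS (leq_trans _ sq) // Er size_MXaddC (negPf r0).
have cop : coprimez (p%:Z) q`_0 by rewrite coprimezE /= prime_coprime.
have [[u v] /= E] := coprimezP _ _ cop.
exists (- (v%:~R * (map_poly intr r).[x])).
  by apply/integersN/integersM => //; apply: integers_int.
have -> : x * - (v%:~R * (map_poly intr r).[x]) - 1 =
    - (v%:~R * (map_poly intr q).[x]) - u%:~R * p%:R.
  have E' : u%:~R * p%:R + v%:~R * (q`_0)%:~R = 1 :> F.
    by have := congr1 (fun z : int => z%:~R : F) E; rewrite intrD !intrM.
  by rewrite Eq -[X in _ - X = _]E'; ring.
apply: primeB; first by apply/primeN/primeMl => //; apply: integers_int.
by apply: primeMl => //; apply: integers_int.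
Qed.

End PrimeIdeals.

Lemma prime_max_sub (F : fieldType) (P Q : set F) :
  prime_ideal F P -> prime_ideal F Q -> P `<=` Q -> P = Q.
Proof.
move=> PP PQ S; apply/seteqP; split=> // x Qx; apply: contrapT => nPx.
have [p pp Pp] := prime_above PP.
have [y Fy] := prime_maximal PP pp Pp (prime_sub PQ Qx) nPx.
move=> /S H; apply: (prime_ne1 PQ); rewrite -(subKr (x * y) 1).
by apply: (primeB PQ) H; apply: primeMr.
Qed.

(** * Gauss' lemma modulo a prime ideal *)

Section GaussLemma.
Variables (F : fieldType) (P : set F).
Hypothesis PP : prime_ideal F P.
Definition polyI (A : {poly F}) := forall n, integers F A`_n.
Definition polyP_ (A : {poly F}) := forall n, P A`_n.

Lemma polyIM A B : polyI A -> polyI B -> polyI (A * B).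
Proof. by move=> HA HB n; rewrite coefM; apply: integers_sum => m; apply: integersM. Qed.
Lemma polyI1 : polyI 1.
Proof. by move=> n; rewrite coef1; apply: integers_nat. Qed.
Lemma polyID A B : polyI A -> polyI B -> polyI (A + B).
Proof. by move=> HA HB n; rewrite coefD; apply: integersD. Qed.
Lemma polyIX A n : polyI A -> polyI (A ^+ n).
Proof. by move=> HA; elim: n => [|n IH]; rewrite ?exprS; [exact: polyI1|exact: polyIM]. Qed.
Lemma polyPD A B : polyP_ A -> polyP_ B -> polyP_ (A + B).
Proof. by move=> HA HB n; rewrite coefD; apply: primeD. Qed.
Lemma polyPN A : polyP_ A -> polyP_ (- A).
Proof. by move=> HA n; rewrite coefN; apply: primeN. Qed.
Lemma polyP0 : polyP_ 0.
Proof. by move=> n; rewrite coef0; exact: prime0 PP. Qed.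
Lemma polyPMl A B : polyI A -> polyP_ B -> polyP_ (A * B).
Proof. by move=> HA HB n; rewrite coefM; apply: prime_sum => // m; apply: primeMl. Qed.
Lemma polyPMr A B : polyI B -> polyP_ A -> polyP_ (A * B).
Proof. by move=> HB HA; rewrite mulrC; apply: polyPMl. Qed.

Lemma polyP_Gauss A B : polyI A -> polyI B -> polyP_ (A * B) -> polyP_ A \/ polyP_ B.
Proof.
move=> HA HB HAB.
have [?|/existsNP nA] := pselect (polyP_ A); first by left.
have [?|/existsNP nB] := pselect (polyP_ B); first by right.
have exA : exists n, `[< ~ P A`_n >] by case: nA => n ?; exists n; apply/asboolP.
have exB : exists n, `[< ~ P B`_n >] by case: nB => n ?; exists n; apply/asboolP.
case: (ex_minnP exA) => a /asboolP Ha mina; case: (ex_minnP exB) => b /asboolP Hb minb.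
have ltA n : (n < a)%N -> P A`_n.
  by move=> lt; apply: contrapT => H; have := mina n (asboolT H); rewrite leqNgt lt.
have ltB n : (n < b)%N -> P B`_n.
  by move=> lt; apply: contrapT => H; have := minb n (asboolT H); rewrite leqNgt lt.
suff : P (A`_a * B`_b) by case/(primeM PP (HA _) (HB _)).
have := HAB (a + b)%N; rewrite coefM.
have la : (a < (a + b).+1)%N by rewrite ltnS leq_addr.
rewrite (bigD1 (Ordinal la)) //= addKn => H.
rewrite -[X in P X](addrK (\sum_(i < (a + b).+1 | i != Ordinal la) A`_i * B`_(a + b - i))).
apply: primeB => //; apply: big_ind => [||n na]; [exact: prime0 PP|exact: primeD|].
have [lt|gt|E] := ltngtP n a.
- by apply: primeMr => //; apply: ltA.
- by apply: primeMl => //; apply: ltB; have := ltn_ord n; move: gt; lia.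
- by case/eqP: na; apply: val_inj.
Qed.

Lemma polyP_prod (O : seq {poly F}) (f : {poly F} -> {poly F}) :
  (forall Z, Z \in O -> polyI (f Z)) -> polyP_ (\prod_(Z <- O) f Z) ->
  exists2 Z, Z \in O & polyP_ (f Z).
Proof.
elim: O => [|a r IH] H.
  by rewrite big_nil => /(_ 0%N); rewrite coef1 => /(prime_ne1 PP).
rewrite big_cons => /polyP_Gauss[||Pa|].
- by apply: H; rewrite inE eqxx.
- rewrite big_seq; apply: big_ind => [||Z Zr]; [exact: polyI1|exact: polyIM|].
  by apply: H; rewrite inE Zr orbT.
- by exists a; rewrite ?inE ?eqxx.
- move=> /IH[|n nr Pn]; first by move=> n nr; apply: H; rewrite inE nr orbT.
  by exists n; rewrite ?inE ?nr ?orbT.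
Qed.

End GaussLemma.

Lemma char0_rat : [pchar rat] =i pred0.
Proof. exact: pchar_num. Qed.

Lemma char0_emb (k F : fieldType) (i : {rmorphism k -> F}) :
  [pchar k] =i pred0 -> [pchar F] =i pred0.
Proof. by move=> H n; rewrite (fmorph_pchar i). Qed.

Lemma rat_rmorphism_eq (F : fieldType) (i j : {rmorphism rat -> F}) : i =1 j.
Proof.
move=> q; rewrite -(divq_num_den q) !fmorph_div !rmorph_int //.
Qed.

Lemma fmorph_prime_ideal (F E : fieldType) (h : {rmorphism F -> E}) (Q : set E) :
  (exists2 x, Q (h x) & x != 0) -> prime_ideal E Q -> prime_ideal F (h @^-1` Q).
Proof.
move=> nz PQ; split; split => /=.
- by move=> x /= /(prime_sub PQ)/integers_fmorph.
- by rewrite /= rmorph0; exact: prime0.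
- by move=> x y /= Px Py; rewrite rmorphD; apply: primeD.
- by move=> a x Fa Px; rewrite /= rmorphM; apply: primeMl => //; apply/integers_fmorph.
- by case: nz => x; exists x.
- by rewrite /= rmorph1; exact: prime_ne1.
- move=> x y Fx Fy; rewrite /= rmorphM => /(primeM PQ); apply; exact/integers_fmorph.
Qed.

Lemma natr_neq0_char0 (F : fieldType) n : [pchar F] =i pred0 -> prime n ->
  n%:R != 0 :> F.
Proof. by move=> /pcharf0P -> pn; rewrite -lt0n prime_gt0. Qed.

Lemma preimage_prime_ideal (F E : fieldType) (h : {rmorphism F -> E}) (Q : set E) :
  [pchar F] =i pred0 -> prime_ideal E Q -> prime_ideal F (h @^-1` Q).
Proof.
move=> ch PQ; apply: fmorph_prime_ideal => //.
have [p pp Qp] := prime_above PQ; exists p%:R; first by rewrite rmorph_nat.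
exact: natr_neq0_char0.
Qed.

(** * Conjugacy of primes *)

Section OverBase.
Variables (k F : fieldType) (i : {rmorphism k -> F}) (Kb : algClosure k).
Hypothesis char0 : [pchar k] =i pred0.
Hypothesis alg : forall x, algebraicOver i x.
Local Notation em := (algClosure_emb Kb).
Variables (P : set F) (Q : set Kb).
Hypotheses (PP : prime_ideal F P) (PQ : prime_ideal Kb Q).
Hypothesis same : forall a, P (i a) -> Q (em a).

(* The product of the conjugates of [sum_n r_n X^n], r_n in P, has its
   coefficients in the contraction of P to k, hence in Q; Gauss' lemma modulo Q
   then singles out a conjugate with all its coefficients in Q. *)
Lemma cover_finite (r : seq F) : exists w : {rmorphism F -> Kb},
  (forall x, w (i x) = em x) /\ forall a, a \in r -> P a -> Q (w a).
Proof.
have [w0 w0i] := hom_extension char0 alg em.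
pose Y0 := \poly_(n < size r) (if `[< P r`_n >] then r`_n else 0).
have Y0P : polyP_ P Y0.
  move=> n; rewrite coef_poly; case: ifP => _; last exact: prime0.
  by case: asboolP => // _; exact: prime0.
have [Y00|Y00] := eqVneq Y0 0.
  exists w0; split=> // a /(nthP 0)[n ns <-] Pa.
  have : Y0`_n = 0 by rewrite Y00 coef0.
  by rewrite coef_poly ns asboolT // => ->; rewrite rmorph0; exact: prime0.
pose Y := map_poly w0 Y0.
have [Ob [uO YO HO [c Hc]]] := poly_orbit char0 Y.
have YI : polyI Y by move=> n; rewrite coef_map; apply/integers_fmorph/(prime_sub PP).
have OI Z : Z \in Ob -> polyI Z.
  by move=> /HO[s ->] n; rewrite coef_map; apply/integers_fmorph.
pose n0 := (-1) ^+ size Ob * c 0%N.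
have EN : \prod_(Z <- Ob) Z = map_poly em n0.
  rewrite rmorphM rmorph_sign /= -Hc -horner_coef0 horner_prod.
  under [in RHS]eq_bigr do rewrite hornerXsubC sub0r -mulN1r.
  have EP (u : seq {poly Kb}) : \prod_(Z <- u) (-1 * Z) = (-1) ^+ size u * \prod_(Z <- u) Z.
    elim: u => [|Z u IH]; first by rewrite !big_nil mulr1.
    by rewrite !big_cons IH /= exprS; ring.
  by rewrite EP mulrA -exprMn mulN1r opprK expr1n mul1r.
pose R := \prod_(Z <- rem Y Ob) Z.
have EYR : map_poly w0 (map_poly i n0) = Y * R.
  rewrite -map_poly_comp (_ : map_poly _ n0 = map_poly em n0); last first.
    by apply: eq_map_poly => a /=; rewrite w0i.
  by rewrite -EN (perm_big _ (perm_to_rem YO)) big_cons.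
have RI : polyI R.
  rewrite /R big_seq; apply: big_ind => [||Z Zr]; [exact: polyI1|exact: polyIM|].
  by apply: OI; apply: mem_rem Zr.
(* The cofactor R is a quotient of polynomials over the image of F, so it descends to F; as it is
   integral, the coefficients of [n0] lie in P. *)
pose R0 := map_poly i n0 %/ Y0.
have ER : R = map_poly w0 R0.
  by rewrite map_divp EYR mulKp // map_poly_eq0.
have R0I : polyI R0.
  by move=> n; apply/(integers_fmorph w0); rewrite -coef_map -ER.
have En0 : map_poly i n0 = Y0 * R0.
  apply: (map_poly_inj w0); rewrite EYR ER; exact: (esym (rmorphM _ _ _)).
have QN : polyP_ Q (\prod_(Z <- Ob) Z).
  move=> n; rewrite EN coef_map; apply: same; rewrite -coef_map /= En0.
  by apply: polyPMr.
have [Z ZO QZ] := polyP_prod PQ OI QN.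
have [s Es] := HO _ ZO.
have [w Hw] : exists w : {rmorphism F -> Kb}, forall x, w x = s (w0 x).
  by exists ((s : {rmorphism Kb -> Kb}) \o w0).
exists w; split=> [x|a /(nthP 0)[n ns <-] Pa]; first by rewrite Hw w0i absGal_fix.
by have := QZ n; rewrite Es !coef_map coef_poly ns asboolT // Hw.
Qed.

(** Compactness gives one embedding carrying all of P into Q, and maximality of primes gives
    equality. With F the closure itself this is the conjugacy of primes above a given one; with F a
    number field it realizes P as the trace of Q along some embedding. *)
Lemma cover : exists w : {rmorphism F -> Kb},
  (forall x, w (i x) = em x) /\ w @^-1` Q = P.
Proof.
have [|w [wi wP]] := @hom_compactness _ _ i alg Kb em (fun a z => P a -> Q z).
  by move=> r; have [w ?] := cover_finite r; exists w.
exists w; split=> //; apply/esym/prime_max_sub => //.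
exact: preimage_prime_ideal (char0_emb i char0) PQ.
Qed.

End OverBase.

(** * Existence of primes above p *)

Section PrimeExists.
Variable F : fieldType.
Hypothesis char0 : [pchar F] =i pred0.

Definition proper_ideal (I : set F) : Prop :=
  [/\ I `<=` integers F, forall x y, I x -> I y -> I (x + y),
      forall a x, integers F a -> I x -> I (a * x) & ~ I 1].

(** The multiples of p form a proper ideal because 1/p is not an algebraic integer; Zorn's lemma
    enlarges it to a maximal one. *)
Lemma prime_ideal_exists (p : nat) (i : {rmorphism rat -> F}) : prime p ->
  exists2 Q, prime_ideal F Q & Q p%:R.
Proof.
move=> pp; pose I0 := [set x | exists2 a, integers F a & x = p%:R * a].
have I0p : proper_ideal I0.
  split.
  - by move=> _ [a Fa ->]; apply: integersM Fa; apply: integers_nat.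
  - by move=> _ _ [a Fa ->] [b Fb ->]; exists (a + b); [exact: integersD|rewrite mulrDr].
  - by move=> a _ Fa [b Fb ->]; exists (a * b); [exact: integersM|rewrite mulrCA].
  - case=> a Fa E.
    have Ea : a = i (p%:R^-1).
      have p0 := natr_neq0_char0 char0 pp; apply: (mulfI p0); rewrite -E.
      by rewrite fmorphV rmorph_nat mulfV.
    move: Fa; rewrite Ea => /integers_fmorph/intr_surj_rat[n En].
    have : (n * p)%:~R = 1 :> rat by rewrite intrM -En mulVf // natr_neq0_char0 //; exact: char0_rat.
    move/eqP; rewrite -[1]/(1%:~R) eqr_int => /eqP E1.
    have := congr1 absz E1; rewrite abszM /= => /eqP; rewrite muln_eq1 => /andP[_ /eqP E2].
    by move: (prime_gt1 pp); rewrite E2.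
pose T := {I : set F | proper_ideal I /\ I p%:R}.
have t0 : T by exists I0; split => //; exists 1; [exact: integers1|rewrite mulr1].
pose Rl (A B : T) := `[< sval A `<=` sval B >].
have [||||[Q [PQ Qp]] Hmax] := @Zorn T Rl.
- by move=> t; apply/asboolP.
- by move=> r s t /asboolP rs /asboolP st; apply/asboolP => x /rs/st.
- move=> [A HA] [B HB] /asboolP /= AB /asboolP /= BA; apply: eq_exist => /=.
  exact/seteqP.
- move=> A tot; have [[t1 At1]|no] := pselect (exists t, A t); last first.
    by exists t0 => s As; case: no; exists s.
  pose U := [set x | exists2 t : T, A t & sval t x].
  have PU : proper_ideal U /\ U p%:R.
    split; last by exists t1 => //; case: (svalP t1).
    split.
    - by move=> x [t At tx]; case: (svalP t) => -[S _ _ _] _; apply: S.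
    - move=> x y [t At tx] [u Au uy].
      have [/asboolP tu|/asboolP ut] := tot _ _ At Au.
        by exists u => //; case: (svalP u) => -[_ D _ _] _; apply: D => //; apply: tu.
      by exists t => //; case: (svalP t) => -[_ D _ _] _; apply: D => //; apply: ut.
    - by move=> a x Fa [t At tx]; exists t => //; case: (svalP t) => -[_ _ M _] _; apply: M.
    - by case=> t At t1'; case: (svalP t) => -[_ _ _ []].
  by exists (exist _ U PU) => s As; apply/asboolP => x sx; exists s.
exists Q => //; case: (PQ) => S D M n1.
have Q0 : Q 0 by rewrite -(mul0r p%:R); apply: (M _ _ _ Qp); exact: integers0.
split; split => //.
- by exists p%:R => //; apply: natr_neq0_char0.
- move=> x y Fx Fy Qxy; apply: contrapT => /not_orP[nx ny].
  pose J := [set z | exists a b, [/\ integers F a, Q b & z = b + x * a]].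
  have PJ : proper_ideal J.
    split.
    - by move=> _ [a [b [Fa Qb ->]]]; apply: integersD; [exact: S|exact: integersM].
    - move=> _ _ [a [b [Fa Qb ->]]] [a' [b' [Fa' Qb' ->]]].
      by exists (a + a'), (b + b'); split; [exact: integersD|exact: D|ring].
    - move=> c _ Fc [a [b [Fa Qb ->]]].
      by exists (c * a), (c * b); split; [exact: integersM|exact: M|ring].
    - case=> a [b [Fa Qb E]]; apply: ny.
      have -> : y = y * b + a * (x * y) by rewrite -[LHS]mulr1 E; ring.
      by apply: D; apply: M.
  have QJ : Q `<=` J by move=> z Qz; exists 0, z; split; rewrite ?mulr0 ?addr0 //; exact: integers0.
  have H := Hmax (exist _ J (conj PJ (QJ _ Qp))) (asboolT QJ).
  apply: nx; have <- : J = Q by exact: (congr1 sval H).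
  by exists 1, 0; split => //; [exact: integers1|rewrite mulr1 add0r].
Qed.

End PrimeExists.

(** * Existence of Frobenius elements *)

Section Frobenius.
Variables (F : fieldType) (Q : set F) (p : nat).
Hypotheses (PQ : prime_ideal F Q) (pp : prime p) (Qp : Q p%:R).

Lemma polyP_frobD A B : polyI A -> polyI B ->
  polyP_ Q ((A + B) ^+ p - (A ^+ p + B ^+ p)).
Proof.
move=> HA HB; case: p pp Qp => // p' pp' Qp'.
rewrite exprDn big_ord_recl big_ord_recr /= subn0 subnn expr0 !mulr1 mul1r bin0 binn !mulr1n.
have -> x y z : x + (y + z) - (x + z) = y :> {poly F} by ring.
apply: big_ind => [||n _]; [exact: polyP0|exact: polyPD|].
rewrite -mulr_natr; apply: polyPMl => //.
  by apply: polyIM; apply: polyIX.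
have /dvdnP[m ->] : (p'.+1 %| 'C(p'.+1, bump 0 n))%N.
  by apply: prime_dvd_bin => //; rewrite /bump /= add1n ltnS ltn_ord.
move=> t; rewrite -polyC_natr coefC; case: eqP => _; last exact: prime0.
by rewrite natrM; apply: primeMl => //; apply: integers_nat.
Qed.

Lemma polyP_frob_sum (I : Type) (r : seq I) (f : I -> {poly F}) :
  (forall n, polyI (f n)) ->
  polyP_ Q ((\sum_(n <- r) f n) ^+ p - \sum_(n <- r) f n ^+ p).
Proof.
move=> Hf; elim: r => [|a r IH].
  by rewrite !big_nil expr0n -[p]prednK ?prime_gt0 // subrr; exact: polyP0.
rewrite !big_cons.
have E x y z t : x - (y + z) = (x - (y + t)) + (t - z) :> {poly F} by ring.
rewrite (E _ _ _ ((\sum_(j <- r) f j) ^+ p)).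
apply: polyPD => //; first apply: polyP_frobD => //.
by apply: big_ind => //; [move=> n; rewrite coef0; exact: integers0|exact: polyID].
Qed.

Lemma polyP_frob A : polyI A ->
  polyP_ Q (A ^+ p - ((\poly_(n < size A) A`_n ^+ p) \Po 'X^p)).
Proof.
move=> HA; rewrite -{1}(coefK A) !poly_def linear_sum /=.
have Hf n : polyI (A`_n *: 'X^n).
  by move=> m; rewrite coefZ coefXn; apply: integersM => //; apply: integers_nat.
have := @polyP_frob_sum _ (index_enum 'I_(size A)) (fun n => A`_n *: 'X^n) (fun n => Hf n).
congr (polyP_ Q (_ - _)); apply: eq_bigr => n _.
by rewrite comp_polyZ comp_Xn_poly exprZn -exprM mulnC exprM.
Qed.

Lemma polyP_congX A B n : polyI A -> polyI B ->
  polyP_ Q (A - B) -> polyP_ Q (A ^+ n - B ^+ n).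
Proof.
move=> HA HB H; elim: n => [|n IH]; first by rewrite subrr; exact: polyP0.
rewrite !exprS; have -> x y z t : x * y - z * t = x * (y - t) + (x - z) * t :> {poly F} by ring.
by apply: polyPD => //; [exact: polyPMl|apply: polyPMr => //; exact: polyIX].
Qed.

Lemma polyP_congM A B C D : polyI A -> polyI D ->
  polyP_ Q (A - B) -> polyP_ Q (C - D) -> polyP_ Q (A * C - B * D).
Proof.
move=> HA HD H1 H2.
have -> x y z t : x * y - z * t = x * (y - t) + (x - z) * t :> {poly F} by ring.
by apply: polyPD => //; [exact: polyPMl|exact: polyPMr].
Qed.

End Frobenius.

Lemma polyI_comp (F : fieldType) (A : {poly F}) p : polyI A -> polyI (A \Po 'X^p).
Proof.
move=> HA; rewrite comp_polyE; apply: big_ind => [||n _].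
- by move=> m; rewrite coef0; exact: integers0.
- exact: polyID.
- by move=> m; rewrite coefZ -exprM coefXn; apply: integersM => //; apply: integers_nat.
Qed.

Lemma coef_comp_Xn (F : fieldType) (A : {poly F}) p n : (0 < p)%N ->
  (A \Po 'X^p)`_(n * p) = A`_n.
Proof.
move=> p0; rewrite comp_polyE coef_sum.
have [lt|le] := ltnP n (size A).
  rewrite (bigD1 (Ordinal lt)) //= coefZ -exprM coefXn mulnC eqxx mulr1 big1 ?addr0 //.
  move=> m /eqP ne; rewrite coefZ -exprM coefXn eqn_pmul2l // eq_sym.
  by case: eqP => [E|]; rewrite ?mulr0 //; case: ne; apply: val_inj.
rewrite nth_default // big1 // => m _; rewrite coefZ -exprM coefXn [(p * m)%N]mulnC eqn_pmul2r //.
by rewrite gtn_eqF ?mulr0 // (leq_trans (ltn_ord m)).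
Qed.

Section FrobeniusExists.
Variables (W : algClosure rat) (Q : set W) (p : nat).
Hypotheses (PQ : prime_ideal W Q) (pp : prime p) (Qp : Q p%:R).
Local Notation em := (algClosure_emb W).

(** [Y] has the list as coefficients, [Y'] has their p-th powers, and G is the product of T - Z over
    the conjugates Z of [Y]. The coefficients of G lie in Z[X], so raising G(Y) = 0 to the p-th
    power shows that G(Y') vanishes modulo Q after X is replaced by X^p, hence before. Gauss' lemma
    then yields a conjugate Z congruent to [Y']. *)
Lemma frobenius_finite (r : seq W) : exists s : absGal W,
  forall z, z \in r -> integers W z -> Q (s z - z ^+ p).
Proof.
pose y n : W := if `[< integers W r`_n >] then r`_n else 0.
have yI n : integers W (y n) by rewrite /y; case: asboolP => // _; exact: integers0.
pose Y := \poly_(n < size r) y n; pose Y' := \poly_(n < size r) (y n ^+ p).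
have YI : polyI Y by move=> n; rewrite coef_poly; case: ifP => // _; exact: integers0.
have YI' : polyI Y'.
  by move=> n; rewrite coef_poly; case: ifP => // _; [exact: integersX|exact: integers0].
have [Ob [uO YO HO [c Hc]]] := poly_orbit char0_rat Y.
have OI Z : Z \in Ob -> polyI Z.
  by move=> /HO[s ->] n; rewrite coef_map; apply/integers_fmorph.
pose G := \prod_(Z <- Ob) ('X - Z%:P) : {poly {poly W}}.
have GI n : polyI G`_n.
  rewrite /G; elim: Ob n OI {uO YO HO c Hc G} => [|Z Ob IH] n OI.
    by rewrite big_nil coef1; case: eqP => _ m; rewrite ?mulr1n ?mulr0n ?coef1 ?coef0; [exact: integers_nat | exact: integers0].
  have IH' m : polyI (\prod_(Z <- Ob) ('X - Z%:P) : {poly {poly W}})`_m.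
    by apply: IH => Z' Z'O; apply: OI; rewrite inE Z'O orbT.
  rewrite big_cons mulrBl coefB coefXM coefCM => t; rewrite coefB.
  apply: integersB; first by case: eqP => _; rewrite ?coef0; [exact: integers0|apply: IH'].
  by apply: polyIM => //; apply: OI; rewrite inE eqxx.
have GE (A : {poly W}) : G.[A] = \prod_(Z <- Ob) (A - Z).
  by rewrite horner_prod; apply: eq_bigr => Z _; rewrite hornerXsubC.
have frobC n : polyP_ Q (G`_n ^+ p - (G`_n \Po 'X^p)).
  pose G' := \poly_(m < size G`_n) (G`_n)`_m ^+ p.
  have : polyP_ Q ((G`_n ^+ p - (G' \Po 'X^p)) + ((G' - G`_n) \Po 'X^p)); last first.
    by rewrite comp_polyB addrA subrK.
  apply: polyPD => //; first exact: polyP_frob.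
  move=> m; rewrite comp_polyE coef_sum; apply: prime_sum => // t.
  rewrite coefZ; apply: primeMr => //; first by rewrite -exprM coefXn; apply: integers_nat.
  rewrite coefB coef_poly; case: ltnP => [_|le]; last by rewrite nth_default // subrr; exact: prime0.
  move: (nat_of_ord t) => {}t; have := GI n t; rewrite Hc coef_map => /integers_fmorph/intr_surj_rat[a ->].
  rewrite -[Q _]/(Q (em a%:~R ^+ p - em a%:~R)).
  have -> : em a%:~R = a%:~R by rewrite rmorph_int.
  have -> : (a%:~R : W) ^+ p - a%:~R = (a ^+ p - a)%:~R by rewrite intrB rmorphXn.
  apply/(prime_intP PQ pp Qp).
  have : (a ^+ p - a)%:~R == 0 :> 'F_p.
    rewrite intrB subr_eq0 -[X in X%:~R]/(a ^+ p) rmorphXn /=.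
    by apply/eqP; have := expf_card (a%:~R : 'F_p); rewrite card_Fp.
  by rewrite -(dvdz_pcharf (pchar_Fp pp)) dvdzE.
have Q0 : polyP_ Q (G.[Y'] \Po 'X^p).
  have G0 : G.[Y] = 0.
    by rewrite GE (bigD1_seq Y) //= subrr mul0r.
  have : polyP_ Q ((\sum_(n < size G) G`_n * Y ^+ n) ^+ p - \sum_(n < size G) (G`_n * Y ^+ n) ^+ p).
    by apply: polyP_frob_sum => // n; apply: polyIM => //; apply: polyIX.
  rewrite -horner_coef G0 expr0n -[p in (p == 0%N)]prednK ?prime_gt0 // sub0r => /(polyPN PQ).
  rewrite opprK => H.
  rewrite horner_coef rmorph_sum /=.
  rewrite -(subKr (\sum_(n < size G) (G`_n * Y ^+ n) ^+ p) (\sum_(n < _) _)).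
  apply: polyPD => //; apply: polyPN => //; rewrite -sumrB.
  apply: big_ind => [||n _]; [exact: polyP0|exact: polyPD|].
  rewrite exprMn comp_polyM rmorphXn /= -exprM mulnC exprM.
  apply: polyP_congM => //.
  - exact: polyIX.
  - by apply/polyIX/polyI_comp.
  - apply: polyP_congX; [exact: PQ|exact: polyIX|exact: polyI_comp|].
    have := polyP_frob PQ pp Qp YI.
    congr (polyP_ Q (_ - (_ \Po _))); apply/polyP => m; rewrite !coef_poly.
    case: ltnP => [lt|le].
      by rewrite (leq_trans lt (size_poly _ _)).
    by have := nth_default 0 le; rewrite coef_poly; case: ifP => // _ ->; rewrite expr0n -[p]prednK ?prime_gt0.
have : polyP_ Q G.[Y'].
  by move=> n; rewrite -(coef_comp_Xn _ _ (prime_gt0 pp)).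
rewrite GE => /(polyP_prod PQ)[Z ZO|Z ZO QZ].
  by move=> n; rewrite coefB; apply: integersB => //; apply: OI.
have [s Es] := HO _ ZO; exists s => z /(nthP 0)[n ns <-] Fz.
apply: (primeBC PQ); have := QZ n.
by rewrite Es coefB coef_map !coef_poly ns /y asboolT.
Qed.

Lemma frobenius_exists : exists s : absGal W,
  forall z, integers W z -> Q (s z - z ^+ p).
Proof.
have [|w [wi wP]] := @hom_compactness _ _ em (@algClosureP _ W) W em
    (fun a z => integers W a -> Q (z - a ^+ p)).
  by move=> r; have [s Hs] := frobenius_finite r; exists s; split => // x; apply: absGal_fix.
by have [s Hs] := absGal_of wi; exists s => z; rewrite Hs; apply: wP.
Qed.

End FrobeniusExists.

Lemma scale_integral (F : fieldType) (i : {rmorphism rat -> F}) (z : F) :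
  algebraicOver i z -> exists2 m : nat, (0 < m)%N & integers F (m%:R * z).
Proof.
move=> /integral_algebraic[q mq qz].
pose d := (size q).-1.
have sq : size q = d.+1 by rewrite prednK // size_poly_gt0 monic_neq0.
have qd : q`_d = 1 by rewrite -(monicP mq) lead_coefE sq.
pose m := (\prod_(n < d.+1) `|denq q`_n|)%N.
have m0 : (0 < m)%N by rewrite prodn_gt0 // => n; rewrite absz_gt0 denq_neq0.
exists m => //.
(* This is m^d q(X/m), whose coefficients are integral since m clears every denominator of the monic
   q. *)
pose q' := \poly_(n < d.+1) (i q`_n * m%:R ^+ (d - n)).
have sq' : (size q' = d.+1)%N.
  by rewrite size_poly_eq // subnn expr0 mulr1 qd rmorph1 oner_eq0.
apply: (@integers_root _ _ q').
- rewrite monicE lead_coefE sq' coef_poly ltnSn subnn expr0 mulr1.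
  by rewrite qd rmorph1.
- apply/rootP; rewrite horner_coef sq'.
  transitivity (m%:R ^+ d * (map_poly i q).[z]); last by rewrite (rootP qz) mulr0.
  rewrite horner_coef size_map_poly sq mulr_sumr; apply: eq_bigr => n _.
  rewrite coef_poly ltn_ord coef_map /= exprMn.
  have -> : m%:R ^+ d = m%:R ^+ (d - n) * m%:R ^+ n :> F by rewrite -exprD subnK // -ltnS.
  by ring.
- move=> n; rewrite coef_poly; case: ltnP => [lt|_]; last exact: integers0.
  have [E|ne] := eqVneq n d.
    by rewrite E subnn expr0 mulr1 qd rmorph1; exact: integers1.
  have -> : (d - n = (d - n).-1.+1)%N by rewrite prednK // subn_gt0 ltn_neqAle ne -ltnS.
  rewrite exprS mulrA; apply: integersM; last by apply: integersX; apply: integers_nat.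
  have -> : i q`_n * m%:R = i (q`_n * m%:R) by rewrite rmorphM rmorph_nat.
  apply/integers_fmorph; rewrite /m (bigD1 (Ordinal lt)) //= natrM mulrA.
  apply: integersM; last exact: integers_nat.
  have -> : q`_n * (`|denq q`_n|%N)%:R = (numq q`_n)%:~R.
    have -> : (`|denq q`_n|%N)%:R = (denq q`_n)%:~R :> rat.
      by rewrite natr_absz ger0_norm // denq_ge0.
    by rewrite -{1}(divq_num_den q`_n) mulfVK // intr_eq0 denq_neq0.
  exact: integers_int.
Qed.

(** * Norms of prime ideals *)

Section Norm.
Variables (F : fieldType) (P : set F).
Hypothesis PP : prime_ideal F P.

Let cs (x : F) := [set y | integers F y /\ P (y - x)].
Let A := [set cs x | x in integers F].

Lemma coset_eq x y : integers F x -> integers F y -> cs x = cs y <-> P (x - y).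
Proof.
move=> Fx Fy; split=> [E|H].
  have : cs x x by split => //; rewrite subrr; exact: prime0.
  by rewrite E => -[].
apply/seteqP; split=> z [Fz H']; split => //.
  exact: prime_trans H' H.
exact: prime_trans H' (primeBC PP H).
Qed.

Variable p : nat.
Hypotheses (pp : prime p) (Pp : P p%:R).

Lemma nat_cosets : ([set cs n%:R | n in `I_p] #= `I_p)%card.
Proof.
apply: inj_card_eq => n m; rewrite !inE /= => np mp /(coset_eq (integers_nat _ _) (integers_nat _ _)).
wlog le : n m np mp / (m <= n)%N.
  move=> H Pnm; have [le|/ltnW le] := leqP m n; first exact: H.
  by apply/esym/H => //; apply: primeBC.
rewrite -natrB // => /(prime_natP PP pp Pp) dv.
have [|gt] := posnP (n - m); first by lia.
have := dvdn_leq gt dv; lia.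
Qed.

Lemma ideal_norm_degree1 : (forall x, integers F x -> exists n : nat, P (x - n%:R)) ->
  ideal_norm P = p.
Proof.
move=> H; apply: card_fset_set; rewrite -/A -/cs.
suff -> : A = [set cs n%:R | n in `I_p] by exact: nat_cosets.
apply/seteqP; split=> _ [x Fx <-]; last by exists x%:R => //; apply: integers_nat.
have [n Pn] := H _ Fx; exists (n %% p)%N; first by rewrite /= ltn_mod prime_gt0.
apply/coset_eq => //; first exact: integers_nat.
apply: prime_trans (primeBC PP Pn) => //.
have -> : (n %% p)%:R - n%:R = - ((n %/ p)%:R * p%:R) :> F.
  by rewrite {2}(divn_eq n p) natrD natrM; ring.
by apply: primeN => //; apply: primeMl => //; apply: integers_nat.
Qed.

Lemma ideal_norm_finite : (0 < ideal_norm P)%N -> finite_set A.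
Proof.
move=> H; apply: contrapT => inf; move: H; rewrite /ideal_norm -/A.
by rewrite /fset_set; case: pselect => // _; rewrite cardfs0.
Qed.

(** The value 0 stands for an infinite quotient; it is harmless in prime zeta sums, where 0 to the
    power -s is 0. *)
Lemma ideal_norm_ge : ideal_norm P = 0%N \/ (p <= ideal_norm P)%N.
Proof.
have [->|H] := posnP (ideal_norm P); [by left|right].
apply: leq_card_fset_set; first exact: ideal_norm_finite.
have := nat_cosets; rewrite card_eq_le => /andP[_ H1].
apply: card_le_trans H1 _; apply: subset_card_le => _ [n _ <-].
by exists n%:R => //; apply: integers_nat.
Qed.

End Norm.

Section NormPrime.
Variables (F : fieldType) (P : set F).
Hypothesis PP : prime_ideal F P.
Let cs (x : F) := [set y | integers F y /\ P (y - x)].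
Let A := [set cs x | x in integers F].

(* Summing representatives of all cosets before and after the translation by 1
   shows that the number of cosets lies in P. *)
Lemma ideal_norm_mem : (0 < ideal_norm P)%N -> P (ideal_norm P)%:R.
Proof.
move=> /ideal_norm_finite finA; rewrite -/A in finA.
pose f := fset_set A.
have inf c : (c \in f) = `[< A c >] by rewrite in_fset_set // inE.
have /choice[r Hr] (c : set F) : exists x : F, A c -> integers F x /\ cs x = c.
  have [[x Fx E]|no] := pselect (A c); first by exists x.
  by exists 0 => /no.
pose sg c := cs (r c + 1).
have csE x y : integers F x -> integers F y -> cs x = cs y <-> P (x - y).
  exact: coset_eq.
have Fr c : A c -> integers F (r c + 1).
  by move=> /Hr[? _]; apply: integersD => //; exact: integers1.
have pe : perm_eq (map sg f) f.
  have us : uniq (map sg f).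
    rewrite map_inj_in_uniq ?fset_uniq // => c c'; rewrite !inf => /asboolP Ac /asboolP Ac'.
    move/(csE _ _ (Fr _ Ac) (Fr _ Ac')); have -> : r c + 1 - (r c' + 1) = r c - r c' by ring.
    move=> H.
    have [F1 <-] := Hr _ Ac; have [F2 <-] := Hr _ Ac'; exact/csE.
  have S : {subset map sg f <= f}.
    move=> z /mapP[c cf Ez]; rewrite inf Ez; apply/asboolP; move: cf.
    by rewrite inf => /asboolP Ac; exists (r c + 1) => //; apply: Fr.
  apply: uniq_perm; rewrite ?fset_uniq //.
  by have [|_ H] := uniq_min_size us S; [rewrite size_map|exact: H].
have E : \sum_(c <- f) r (sg c) = \sum_(c <- f) r c.
  by rewrite -[RHS](perm_big _ pe) big_map.
have : P (\sum_(c <- f) (r (sg c) - (r c + 1))).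
  rewrite big_seq; apply: big_ind => [||c]; [exact: prime0|exact: primeD|].
  rewrite inf => /asboolP Ac; have Asg : A (sg c) by exists (r c + 1) => //; apply: Fr.
  have [Fs Es] := Hr _ Asg; apply/csE => //; exact: Fr.
rewrite sumrB big_split /= E opprD addrA subrr sub0r => /(primeN PP); rewrite opprK.
by rewrite big_const_seq count_predT iter_addr_0.
Qed.

(** The norm itself lies in P. The cosets of 0, ..., p - 1 are then distinct and exhaust the
    quotient. *)
Lemma ideal_norm_prime p : prime p -> ideal_norm P = p ->
  P p%:R /\ forall x, integers F x -> exists n : nat, P (x - n%:R).
Proof.
move=> pp En; have n0 : (0 < ideal_norm P)%N by rewrite En prime_gt0.
have Pp : P p%:R by rewrite -En; exact: ideal_norm_mem.
split=> // x Fx; have finA := ideal_norm_finite n0; rewrite -/A in finA.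
pose B := [set cs n%:R | n in `I_p].
have BA : B `<=` A by move=> _ [n _ <-]; exists n%:R => //; apply: integers_nat.
have finB : finite_set B by apply: sub_finite_set finA.
have cB : #|` fset_set B| = p by apply: card_fset_set; exact: nat_cosets.
have : fset_set B == fset_set A.
  rewrite eqEfcard cB -[#|` fset_set A|]/(ideal_norm P) En leqnn andbT.
  by apply/fsubsetP => c; rewrite !in_fset_set // => /set_mem/BA/mem_set.
move=> /eqP/(congr1 (fun X : {fset set F} => [set` X])).
rewrite !fset_setK // => EBA.
have : A (cs x) by exists x.
rewrite -EBA => -[n _ /(coset_eq PP (integers_nat _ _) Fx) H].
by exists n; apply: primeBC.
Qed.

End NormPrime.

(** * Separation of conjugates modulo large primes *)

Section GoodPrimes.
Variables (k : fieldType) (Kb : algClosure k).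
Hypothesis char0 : [pchar k] =i pred0.

(** n is a common multiple of the differences of distinct conjugates, in the role of a discriminant:
    a prime not containing n contains none of them. *)
Lemma conj_separated (r : seq Kb) : (forall z, z \in r -> integers Kb z) ->
  exists2 n : nat, (0 < n)%N & forall Q : set Kb, prime_ideal Kb Q -> ~ Q n%:R ->
    forall (s t : absGal Kb) z, z \in r -> Q (s z - t z) -> s z = t z.
Proof.
elim: r => [|z r IH] Hr; first by exists 1%N.
have [|n n0 Hn] := IH; first by move=> y yr; apply: Hr; rewrite inE yr orbT.
have Fz : integers Kb z by apply: Hr; rewrite inE eqxx.
have [|C [_ HC]] := absGal_orbit char0 (f := fun s : absGal Kb => s z) (r := [:: z]).
  by move=> s t H; apply: H; rewrite inE.
have FC y : y \in C -> integers Kb y by move=> /HC[s ->]; apply/integers_fmorph.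
have [m m0 Hm] : exists2 m : nat, (0 < m)%N & forall Q, prime_ideal Kb Q -> ~ Q m%:R ->
    forall u v, u \in C -> v \in C -> Q (u - v) -> u = v.
  have key (D : seq (Kb * Kb)) : (forall d, d \in D -> d.1 \in C /\ d.2 \in C) ->
      exists2 m : nat, (0 < m)%N & forall Q, prime_ideal Kb Q -> ~ Q m%:R ->
      forall d, d \in D -> Q (d.1 - d.2) -> d.1 = d.2.
    elim: D => [|d D IHD] HD; first by exists 1%N.
    have [|m m0 Hm] := IHD; first by move=> y yr; apply: HD; rewrite inE yr orbT.
    have [E|ne] := eqVneq d.1 d.2.
      exists m => // Q PQ nQ e; rewrite inE => /orP[/eqP->|] //; exact: Hm.
    have [|/FC F1 /FC F2] := HD d; first by rewrite inE eqxx.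
    have [|t t0 [y Fy Et]] := integers_dvd_nat (integersB F1 F2); first by rewrite subr_eq0.
    exists (t * m)%N; first by rewrite muln_gt0 t0.
    move=> Q PQ nQ e; rewrite inE => /orP[/eqP->|eD] Qe.
      case: nQ; rewrite natrM; apply: primeMr => //; first exact: integers_nat.
      by rewrite Et; apply: primeMr.
    apply: (Hm Q) => // Qm; case: nQ; rewrite natrM; apply: primeMl => //; exact: integers_nat.
  have [|m m0 Hm] := key [seq (u, v) | u <- C, v <- C].
    by move=> d /allpairsP[[u v] [/= uC vC ->]].
  exists m => // Q PQ nQ u v uC vC; apply: (Hm Q PQ nQ (u, v)).
  by apply/allpairsP; exists (u, v).
exists (n * m)%N; first by rewrite muln_gt0 n0.
move=> Q PQ nQ s t y; rewrite inE => /orP[/eqP->|yr].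
  apply: (Hm Q) => //; last by apply/HC; exists t.
    by move=> Qm; case: nQ; rewrite natrM; apply: primeMl => //; exact: integers_nat.
  by apply/HC; exists s.
apply: (Hn Q) => // Qm; case: nQ; rewrite natrM; apply: primeMr => //; exact: integers_nat.
Qed.

End GoodPrimes.

(** * Characters of order l *)

Definition frob_at (F : fieldType) (Q : set F) (n : nat) (t : F -> F) : Prop :=
  forall z, integers F z -> Q (t z - z ^+ n).

Section Characters.
Variables (R : realType) (k : fieldType) (Kb : algClosure k) (l : nat).
Hypothesis l_prime : prime l.
Implicit Types (chi : absGal Kb -> R[i]) (s t : absGal Kb).
Local Notation em := (algClosure_emb Kb).

(** Dirichlet characters of order dividing l in algebraic form: continuity becomes triviality on the
    stabilizer of a finite list. *)
Definition ell_char chi : Prop :=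
  [/\ forall s t, chi (absGal_mul s t) = chi s * chi t,
      forall s, chi s ^+ l = 1 &
      exists r : seq Kb, forall t, (forall z, z \in r -> t z = z) -> chi t = 1].

Lemma expr_l_neq0 (x : R[i]) : x ^+ l = 1 -> x != 0.
Proof.
by apply: contra_eq_neq => ->; rewrite expr0n -[l]prednK ?prime_gt0 // eq_sym oner_eq0.
Qed.

Lemma ell_char_dirichlet chi : ell_char chi -> dirichlet_character chi.
Proof.
move=> [M Xl [r Hr]]; split=> // [s|s]; first exact: expr_l_neq0.
move=> B nB; exists r => // t /= H; rewrite -[chi t]/(chi t).
have -> : t = absGal_mul s (absGal_mul (absGalV s) t).
  by apply: absGal_eqP => z /=; rewrite absGalKV.
have E : chi (absGal_mul (absGalV s) t) = 1.
  by apply: Hr => z zr /=; rewrite H // absGalVK.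
by rewrite M E mulr1; exact: (@nbhs_singleton R[i]^o _ _ nB).
Qed.

(** The values lie in the finite set of l-th roots of unity, so the complement of the nontrivial
    ones is a neighbourhood of 1, and continuity at the identity gives an open kernel. *)
Lemma dirichlet_ell_char chi : dirichlet_character chi ->
  (forall s, chi s ^+ l = 1) -> ell_char chi.
Proof.
move=> [nz M cont] Xl; split=> //.
pose B := [set z : R[i]^o | z ^+ l = 1 /\ z <> 1].
have finB : finite_set B.
  have p0 : 'X^l - 1%:P != 0 :> {poly R[i]} by exact: monic_neq0 (monicXnsubC _ (prime_gt0 l_prime)).
  have [C HC] := closed_root_list p0.
  apply: (sub_finite_set (B := [set` C])) (finite_seq C) => z [zl _] /=.
  by apply: HC; rewrite rootE !hornerE zl subrr.
have clB : closed B.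
  have acc : accessible_space (R[i]^o : topologicalType).
    exact: hausdorff_accessible (@norm_hausdorff _ R[i]^o).
  exact: (accessible_finite_set_closed.1 acc B finB).
have chi1 : chi (absGal1 Kb) = 1.
  have := M (absGal1 Kb) (absGal1 Kb).
  have -> : absGal_mul (absGal1 Kb) (absGal1 Kb) = absGal1 Kb.
    by apply: absGal_eqP => z /=; rewrite absGal1E.
  by move/eqP; rewrite -{1}[chi _]mulr1 => /eqP/(mulfI (nz _))/esym.
have nB : nbhs (chi (absGal1 Kb) : R[i]^o) (~` B).
  by apply: open_nbhs_nbhs; split; [exact: closed_openC|rewrite chi1 => -[]].
have [r _ Hr] := cont (absGal1 Kb) _ nB.
exists r => t Ht; have : (~` B) (chi t).
  by apply: Hr => z zr; rewrite absGal1E; apply: Ht.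
by move=> /not_andP[] // /contrapT.
Qed.

Lemma ell_char1 : ell_char (fun=> 1).
Proof. by split=> [s t|s|]; rewrite ?mulr1 ?expr1n //; exists [::]. Qed.

Lemma ell_charM chi eta : ell_char chi -> ell_char eta -> ell_char (fun s => chi s * eta s).
Proof.
move=> [M X [r Hr]] [M' X' [r' Hr']]; split=> [s t|s|].
- by rewrite M M'; ring.
- by rewrite exprMn X X' mulr1.
- exists (r ++ r') => t H; rewrite Hr ?Hr' ?mulr1 // => z zr; apply: H;
  by rewrite mem_cat zr ?orbT.
Qed.

Lemma ell_charV chi : ell_char chi -> ell_char (fun s => (chi s)^-1).
Proof.
move=> [M X [r Hr]]; split=> [s t|s|].
- by rewrite M invfM.
- by rewrite exprVn X invr1.
- by exists r => t H; rewrite Hr ?invr1.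
Qed.

Lemma gen_ell_char chi : characters_gen Kb R l chi -> ell_char chi.
Proof.
apply: smallest_sub => [|eta [d _ Xl _]]; last exact: dirichlet_ell_char.
split; [exact: ell_char_dirichlet|exact: ell_char1|exact: ell_charM|exact: ell_charV].
Qed.

(** l is prime, so a nontrivial character killed by l has order exactly l. *)
Lemma ell_char_gen chi : ell_char chi -> (exists s, chi s != 1) ->
  characters_gen Kb R l chi.
Proof.
move=> E [s s1]; apply: sub_gen_smallest; split.
- exact: ell_char_dirichlet.
- exact: prime_gt0.
- by case: E.
- move=> m /andP[m0 ml]; exists s; apply: contraNneq s1 => sm.
  have cop : coprime m l by rewrite coprime_sym prime_coprime // gtnNdvd.
  case: (egcdnP l m0) => a b Eab _.
  have := congr1 (fun n => chi s ^+ n) Eab.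
  case: E => _ Xl _.
  by rewrite mulnC exprM sm expr1n (eqP cop) exprD mulnC exprM Xl expr1n mul1r expr1 => <-.
Qed.

Section Values.
Variable chi : absGal Kb -> R[i].
Hypothesis Echi : ell_char chi.

Lemma charM s t : chi (absGal_mul s t) = chi s * chi t. Proof. by case: Echi. Qed.
Lemma char_neq0 s : chi s != 0. Proof. by case: Echi => _ X _; apply: expr_l_neq0. Qed.
Lemma char1 s : (forall z, s z = z) -> chi s = 1.
Proof. by case: Echi => _ _ [r Hr] H; apply: Hr. Qed.
Lemma charV s : chi (absGalV s) = (chi s)^-1.
Proof.
apply: (mulfI (char_neq0 s)); rewrite -charM char1 ?mulfV ?char_neq0 // => z /=.
by rewrite absGalKV.
Qed.
Lemma charX s n : chi (absGalX s n) = chi s ^+ n.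
Proof.
elim: n => [|n IH] /=; first by rewrite expr0 char1 // => z; rewrite absGal1E.
by rewrite charM IH exprS.
Qed.

Hypothesis char0 : [pchar k] =i pred0.
Variable P : set k.

(** Some g carries Q to Q'. Then g s g^-1 t^-1 lies in the inertia group of Q', where chi is
    trivial. *)
Lemma char_conj_frob (Q Q' : set Kb) s t n : unramified chi P ->
  prime_ideal Kb Q -> prime_ideal Kb Q' -> em @^-1` Q = P -> em @^-1` Q' = P ->
  frob_at Q n s -> frob_at Q' n t -> chi s = chi t.
Proof.
move=> U PQ PQ' EQ EQ' Fs Ft.
have [|w [wi wQ]] := @cover _ _ em Kb char0 (@algClosureP _ Kb) Q Q' PQ PQ'.
  by move=> a; rewrite -[Q _]/((em @^-1` Q) a) EQ -EQ'.
have [g Hg] := absGal_of wi.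
have QQ z : Q' (g z) <-> Q z by rewrite -wQ /= Hg.
pose u := absGal_mul (absGal_mul g (absGal_mul s (absGalV g))) (absGalV t).
have Iu z : integers Kb z -> Q' (u z - z).
  move=> Fz; pose y := absGalV t z.
  have Fy : integers Kb y by apply/integers_fmorph.
  rewrite -{2}(absGalKV t z) -/y /u /= -/y.
  apply: (prime_trans PQ' (y := y ^+ n)); last exact/(primeBC PQ')/Ft.
  rewrite -{2}(absGalKV g y) -rmorphXn -rmorphB; apply/QQ/Fs.
  exact/integers_fmorph.
have chiu : chi u = 1.
  apply: (U Q') => //; split=> //; apply/seteqP; split=> [_ [z Qz <-]|z Qz].
    exact: (prime_cong PQ' (Iu _ (prime_sub PQ' Qz)) Qz).
  have Fz := prime_sub PQ' Qz.
  exists (absGalV u z); last exact: absGalKV.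
  apply: (prime_cong PQ' _ Qz); apply: (primeBC PQ').
  rewrite -{1}(absGalKV u z); apply: Iu; exact/integers_fmorph.
move: chiu; rewrite !charM !charV; move: (char_neq0 g) (char_neq0 t) => g0 t0.
rewrite [chi s * _]mulrC mulrA mulfV // mul1r => /(congr1 (fun x => x * chi t)).
by rewrite mulfVK // mul1r.
Qed.

Lemma char_at_frob (Q : set Kb) s : unramified chi P -> (0 < ideal_norm P)%N ->
  prime_ideal Kb Q -> em @^-1` Q = P -> frob_at Q (ideal_norm P) s ->
  char_at chi P = chi s.
Proof.
move=> U n0 PQ EQ Fs; rewrite /char_at asboolT //.
case: xgetP => [_ -> [t [Q' [PQ' EQ' _ Ft]] <-]|/(_ (chi s))].
  exact: (@char_conj_frob Q' Q _ _ (ideal_norm P)).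
(* [s] preserves Q, as an integer lies in Q as soon as its norm-th power does; so [s] belongs to
   [frobenius P], and the choice in [char_at] is not the default. *)
case; exists s => //; exists Q; split => //.
apply/seteqP; split=> [_ [z Qz <-]|z Qz].
  have Fz := prime_sub PQ Qz.
  apply: (prime_cong PQ (Fs _ Fz)).
  by rewrite -(prednK n0) exprS; apply: primeMr => //; apply: integersX.
have Fz := prime_sub PQ Qz.
exists (absGalV s z); last exact: absGalKV.
have Fy : integers Kb (absGalV s z) by apply/integers_fmorph.
apply: (primeX PQ (n := ideal_norm P)) => //.
by apply: (prime_cong PQ _ Qz); apply: (primeBC PQ); rewrite -{1}(absGalKV s z); apply: Fs.
Qed.

(** Serves to transfer unramifiedness from chi at p to its image under psi at phi(p), where only the
    equality of values is given. *)
Lemma char_at_neq0 : char_at chi P != 0 -> unramified chi P.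
Proof. by rewrite /char_at; case: asboolP => // _; rewrite eqxx. Qed.

End Values.
End Characters.

(** * Transport of automorphisms along an embedding into W *)

Section Transport.
Variables (k : fieldType) (Kb : algClosure k) (W : algClosure rat).
Hypothesis char0 : [pchar k] =i pred0.
Variables (ik : {rmorphism rat -> k}) (x : {rmorphism k -> W}).
Local Notation em := (algClosure_emb Kb).
Local Notation eW := (algClosure_emb W).

Lemma lift_ex : exists th : {rmorphism Kb -> W},
  (forall a, th (em a) = x a) /\ bijective th.
Proof.
have [th tha] := hom_extension char0 (@algClosureP _ Kb) x.
exists th; split=> //; apply: fmorph_bijective => v.
apply: (@alg_in_closed_image rat _ _ (em \o ik)).
have [q q0 qv] := algClosureP v; exists q => //.
rewrite (_ : map_poly (th \o (em \o ik)) q = map_poly eW q) //.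
apply: eq_map_poly => a /=.
exact: (@rat_rmorphism_eq W (th \o (em \o ik)) eW).
Qed.
Definition lift := projT1 (cid lift_ex).
Lemma liftE a : lift (em a) = x a.
Proof. by rewrite /lift; case: cid => ? []. Qed.
Lemma lift_bij : bijective lift.
Proof. by rewrite /lift; case: cid => ? []. Qed.

Definition fixes_emb (s : absGal W) := forall a, s (x a) = x a.

(** The conjugate of s by the lift of x fixes K only if s fixes x(K); elsewhere an arbitrary value
    keeps [pull] total. *)
Lemma pull_ex s : exists t : absGal Kb,
  fixes_emb s -> forall z, lift (t z) = s (lift z).
Proof.
have [fs|no] := pselect (fixes_emb s); last by exists (absGal1 Kb).
have [g [lg gl]] := fmorph_inverse lift_bij.
have [w Hw] : exists w : {rmorphism Kb -> Kb}, forall z, w z = g (s (lift z)).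
  by exists (g \o ((s : {rmorphism W -> W}) \o lift)).
have [|t Ht] := @absGal_of _ Kb w; first by move=> a; rewrite Hw liftE fs -liftE lg.
by exists t => _ z; rewrite Ht Hw gl.
Qed.
Definition pull s := projT1 (cid (pull_ex s)).
Lemma pullE s : fixes_emb s -> forall z, lift (pull s z) = s (lift z).
Proof. by rewrite /pull; case: cid. Qed.

Lemma pullM s t : fixes_emb s -> fixes_emb t ->
  pull (absGal_mul s t) = absGal_mul (pull s) (pull t).
Proof.
move=> fs ft; apply: absGal_eqP => z; apply: (fmorph_inj lift).
by rewrite pullE /= ?pullE // => a /=; rewrite ft fs.
Qed.

Lemma lift_preim_prime (Q : set W) : prime_ideal W Q -> prime_ideal Kb (lift @^-1` Q).
Proof. exact: preimage_prime_ideal (char0_emb em char0). Qed.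

Lemma pull_frob (Q : set W) n s : fixes_emb s -> frob_at Q n s ->
  frob_at (lift @^-1` Q) n (pull s).
Proof.
move=> fs Fs z Fz; rewrite /= rmorphB rmorphXn pullE //; apply: Fs.
exact/integers_fmorph.
Qed.

Lemma lift_contract (Q : set W) : em @^-1` (lift @^-1` Q) = x @^-1` Q.
Proof. by apply/seteqP; split=> a /=; rewrite liftE. Qed.

End Transport.

(** * Kummer characters *)

Section EllPowers.
Variable l : nat.
Hypothesis ll : prime l.

Lemma eq_natr_Fl n m : n%:R = m%:R :> 'F_l -> (n %% l = m %% l)%N.
Proof. by move/(congr1 val) => /=; rewrite !val_Fp_nat. Qed.

Lemma expr_Fl (A : pzRingType) (y : A) n m :
  y ^+ l = 1 -> n%:R = m%:R :> 'F_l -> y ^+ n = y ^+ m.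
Proof. by move=> yl /eq_natr_Fl E; rewrite -(expr_mod n yl) E expr_mod. Qed.

Lemma prime_primitive (A : fieldType) (z : A) : z ^+ l = 1 -> z != 1 -> l.-primitive_root z.
Proof.
move=> zl z1; have [m mz /(primeP ll).2] := prim_order_exists (prime_gt0 ll) zl.
case/orP => /eqP E; last by rewrite E in mz.
by case/eqP: z1; rewrite -[z]expr1 -E; apply: prim_expr_order.
Qed.

Lemma coprime_expr1 (A : fieldType) (h : A) n : h ^+ l = 1 -> ~~ (l %| n)%N ->
  h ^+ n = 1 -> h = 1.
Proof.
move=> hl ln hn; apply/eqP/negPn/negP => h1.
by have := prim_order_dvd (prime_primitive hl h1) n; rewrite hn eqxx (negPf ln).
Qed.

(** The l-th cyclotomic polynomial. *)
Definition Phi (A : nzRingType) : {poly A} := \sum_(i < l) 'X^i.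

Lemma Phi_factor (A : fieldType) (z : A) : l.-primitive_root z ->
  Phi A = \prod_(1 <= i < l) ('X - (z ^+ i)%:P).
Proof.
move=> pz; have := factor_Xn_sub_1 pz.
rewrite big_ltn ?prime_gt0 // expr0 subrX1 => /(mulfI _) -> //.
by rewrite polyXsubC_eq0.
Qed.

Lemma Phi_coprime (A : fieldType) (z : A) (B : {poly A}) : l.-primitive_root z ->
  (forall j, (0 < j < l)%N -> ~~ root B (z ^+ j)) -> coprimep B (Phi A).
Proof.
move=> pz H; rewrite (Phi_factor pz) big_seq.
apply: (big_ind (fun q => coprimep B q)) => [|x y Hx Hy|j].
- by rewrite coprimep1.
- by rewrite coprimepMr Hx.
by rewrite mem_index_iota => /H; rewrite coprimep_XsubC.
Qed.

(* The value of the Kummer character of u0 at a Frobenius element is read off the residue of HX u0 at a root of unity. *)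
Definition HX (u0 : {poly int}) : {poly int} :=
  \prod_(a : 'F_l | a != 0) (u0 \Po 'X^a) ^+ (a^-1 : 'F_l).

End EllPowers.

Lemma poly_lift_Fp p (G : {poly 'F_p}) : exists u : {poly int}, map_poly intr u = G.
Proof.
exists (\poly_(n < size G) Posz (nat_of_ord (G`_n)%R)); apply/polyP => n.
rewrite coef_map coef_poly; case: ltnP => [_|le]; last by rewrite raddf0 nth_default.
by rewrite /= -[RHS]natr_Zp pmulrn.
Qed.

(** * A residue that is not an l-th power *)

Section FiniteField.
Variables (p l : nat).
Hypotheses (pp : prime p) (ll : prime l) (pl : p != l).
Variable L : fieldExtType 'F_p.
Local Notation ia := (in_alg L).

Let chL : p \in [pchar L].
Proof. by rewrite (pchar_lalg L) pchar_Fp. Qed.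

Lemma horner_frob (G : {poly 'F_p}) (y : L) n :
  (map_poly ia G).[y] ^+ (p ^ n) = (map_poly ia G).[y ^+ (p ^ n)].
Proof.
elim: n y => [|n IH] y; first by rewrite expn0 !expr1.
rewrite expnSr !exprM IH -[LHS](pFrobenius_autE chL) -horner_map /=.
rewrite pFrobenius_autE; congr (_.[_]); rewrite -map_poly_comp.
apply: eq_map_poly => c /=; rewrite pFrobenius_autE -[_ ^+ p](rmorphXn ia).
by have := expf_card c; rewrite card_Fp // => ->.
Qed.

Lemma frob_fixed (x : L) : x ^+ p = x -> exists c, x = ia c.
Proof.
move=> xp; have := congr1 (fun q => (map_poly ia q).[x]) (finField_genPoly 'F_p).
rewrite card_Fp // rmorphB /= map_polyXn map_polyX !hornerE xp subrr rmorph_prod horner_prod.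
move/esym/eqP; rewrite prodf_seq_eq0 => /hasP[c _] /=.
rewrite rmorphB /= map_polyX map_polyC hornerXsubC subr_eq0 => /eqP ->.
by exists c.
Qed.

Variable z : L.
Hypothesis pz : l.-primitive_root z.

Let zl : z ^+ l = 1. Proof. exact: prim_expr_order. Qed.

Let pF0 : p%:R != 0 :> 'F_l.
Proof.
apply/eqP => /(congr1 val) /=; rewrite val_Fp_nat // => /eqP.
rewrite -[_ == _]/(l %| p)%N dvdn_prime2 // eq_sym => /eqP E.
by move: pl; rewrite E eqxx.
Qed.

Let zc_eq (c d : 'F_l) : z ^+ c = z ^+ d -> c = d.
Proof.
move/eqP; rewrite (eq_prim_root_expr pz) => /eqP E; apply: val_inj => /=.
by move: E; rewrite !modn_small // -{2}(Fp_cast ll) ltn_ord.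
Qed.

(** The exponents c for which z^c is a conjugate of z over F_p. *)
Let pC (c : 'F_l) := `[< exists i : nat, c = p%:R ^+ i >].

Let pF1 : p%:R ^+ l.-1 = 1 :> 'F_l.
Proof.
apply: (mulfI pF0); rewrite -exprS prednK ?prime_gt0 // mulr1.
by have := expf_card (p%:R : 'F_l); rewrite card_Fp.
Qed.

Let pCM c : pC (p%:R * c) = pC c.
Proof.
apply/asboolP/asboolP => -[i Hi]; last by exists i.+1; rewrite exprS Hi.
exists (l - 2 + i)%N; apply: (mulfI pF0); rewrite Hi -exprS -addSn.
rewrite (_ : (l - 2).+1 = l.-1)%N; last by have := prime_gt1 ll; lia.
by rewrite exprD pF1 mul1r.
Qed.

(** Multiplication by p permutes the exponents that are not powers of p, so Frobenius fixes the
    coefficients of the product. *)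
Let m2_ex : exists m2 : {poly 'F_p},
  map_poly ia m2 = \prod_(c : 'F_l | ~~ pC c) ('X - (z ^+ c)%:P).
Proof.
set M := \prod_(c | _) _.
have zp (c : 'F_l) : (z ^+ c) ^+ p = z ^+ ((p%:R * c)%R : 'F_l).
  by rewrite -exprM; apply: (expr_Fl ll zl); rewrite natrM !natr_Zp mulrC.
have HM : map_poly (pFrobenius_aut chL) M = M.
  rewrite /M rmorph_prod [in RHS](reindex_inj (mulfI pF0)).
  under [in RHS]eq_bigl do rewrite pCM.
  apply: eq_bigr => c _; rewrite -zp rmorphB /= map_polyX map_polyC /=.
  by rewrite pFrobenius_autE.
have /choice[m Hm] n : exists c, M`_n = ia c.
  by apply: frob_fixed; rewrite -{2}HM coef_map /= pFrobenius_autE.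
exists (\poly_(n < size M) m n); apply/polyP => n; rewrite coef_map coef_poly.
by case: ltnP => [_|le]; [rewrite Hm | rewrite raddf0 nth_default].
Qed.

(** The class of u0(z) must be nontrivial without cancelling in the weighted product [HX]. So u0
    takes the value 1 at z^c unless c is a power of p modulo l, while its value g at z is a unit
    with g^e <> 1, that is, not an l-th power in a field with p^o elements. In the e-th power of
    [HX] at z^j all powers of p then contribute the same factor g^(ej), and their number is less
    than l. *)
Lemma unit_poly_aux : exists o e (u0 : {poly int}), [/\ (0 < o)%N,
  (p ^ o = 1 + l * e)%N,
  coprimep (map_poly intr (HX l u0)) (Phi l 'F_p) &
  coprimep (map_poly intr (HX l u0 ^+ e - 1)) (Phi l 'F_p)].
Proof.
have ex : exists o, (0 < o)%N && (p ^ o %% l == 1)%N.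
  exists l.-1; have l1 := prime_gt1 ll; apply/andP; split; first by lia.
  rewrite (eq_natr_Fl (m := 1) ll); first by rewrite modn_small.
  by rewrite natrX pF1.
case: (ex_minnP ex) => o /andP[ o0 /eqP po] omin.
pose e := ((p ^ o) %/ l)%N.
have Eq : (p ^ o = 1 + l * e)%N by rewrite addnC mulnC {1}(divn_eq (p ^ o) l) po.
have e0 : (0 < e)%N.
  have : (1 < p ^ o)%N by rewrite -(expn0 p) ltn_exp2l // prime_gt1.
  by rewrite Eq; case: (e) => //; rewrite muln0.
have [m2 Em2] := m2_ex.
have rootm2 c : ~~ pC c -> (map_poly ia m2).[z ^+ (c : 'F_l)] = 0.
  move=> nc; rewrite Em2 horner_prod (bigD1 c) //= hornerXsubC subrr mul0r //.
have m2z : (map_poly ia m2).[z] != 0.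
  rewrite Em2 horner_prod; apply/prodf_neq0 => c nc; rewrite hornerXsubC subr_eq0.
  apply: contraNneq nc => E; apply/asboolP; exists 0%N; rewrite expr0.
  apply: zc_eq; rewrite -E -[LHS]expr1; apply: (expr_Fl ll zl).
  by rewrite natr_Zp.
have zpinj i j : (i < o)%N -> (j < o)%N -> z ^+ (p ^ i) = z ^+ (p ^ j) -> i = j.
  wlog le : i j / (i <= j)%N.
    by move=> H io jo E; have [le|/ltnW le] := leqP i j; [|apply/esym]; apply: H.
  move=> io jo /eqP; rewrite (eq_prim_root_expr pz) => E.
  apply/eqP; rewrite eqn_leq le /= leqNgt; apply/negP => lt.
  have : (0 < j - i)%N && (p ^ (j - i) %% l == 1)%N.
    rewrite subn_gt0 lt /=.
    have EF : (p%:R : 'F_l) ^+ i * 1 = p%:R ^+ i * p%:R ^+ (j - i).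
      rewrite mulr1 -exprD subnKC // -!natrX -[LHS](Fp_nat_mod ll) (eqP E).
      by rewrite (Fp_nat_mod ll).
    rewrite (eq_natr_Fl (m := 1) ll); first by rewrite modn_small // prime_gt1.
    by rewrite natrX -(mulfI _ EF) // expf_neq0.
  by move/omin; rewrite leqNgt (leq_ltn_trans (leq_subr _ _) jo).
(* A zero at z entails zeros at its o conjugates, which are distinct by minimality of o. *)
have Ginj (G : {poly 'F_p}) : (size G <= o)%N -> (map_poly ia G).[z] = 0 -> G = 0.
  move=> sG Gz; apply/eqP/negPn/negP => G0.
  have G0' : map_poly ia G != 0 by rewrite map_poly_eq0.
  have := @max_poly_roots _ _ [seq z ^+ (p ^ i) | i <- iota 0 o] G0'.
  rewrite size_map size_iota size_map_poly ltnNge sG /= => H; apply: notF; apply: H.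
    apply/allP => _ /mapP[i _ ->]; rewrite rootE -horner_frob Gz expr0n expn_eq0.
    by rewrite eqn0Ngt prime_gt0.
  rewrite map_inj_in_uniq ?iota_uniq // => i j; rewrite !mem_iota !add0n /=.
  exact: zpinj.
(* The p^o = 1 + l e polynomials G of size at most o give distinct values of 1 + m2 G at z, whereas
   X (X^e - 1) has at most e + 1 roots. *)
have [G [gnz gne]] : exists G : {poly 'F_p},
    let g := (map_poly ia (1 + m2 * G)).[z] in g != 0 /\ g ^+ e != 1.
  apply: contrapT => no.
  pose gv (v : 'rV['F_p]_o) := (map_poly ia (1 + m2 * rVpoly v)).[z].
  have gvE v : gv v = 1 + (map_poly ia m2).[z] * (map_poly ia (rVpoly v)).[z].
    by rewrite /gv rmorphD rmorphM rmorph1 hornerD hornerM hornerC.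
  pose q : {poly L} := 'X * ('X^e - 1%:P).
  have sq : size q = e.+2.
    by rewrite size_Mmonic ?polyX_eq0 ?monicXnsubC // size_polyX size_XnsubC.
  have q0 : q != 0 by rewrite -size_poly_gt0 sq.
  have := @max_poly_roots _ _ [seq gv v | v <- enum 'rV['F_p]_o] q0.
  rewrite size_map -cardE card_mx card_Fp // mul1n sq Eq => H.
  have : (1 + l * e < e.+2)%N.
    apply: H.
      apply/allP => _ /mapP[v _ ->]; rewrite rootE !hornerE /= mulf_eq0 subr_eq0.
      by apply/negPn; rewrite negb_or; apply/negP => /andP[g1 g2]; apply: no; exists (rVpoly v).
    rewrite map_inj_uniq ?enum_uniq // => v v'; rewrite !gvE => /addrI/(mulfI m2z) E.
    apply: (can_inj rVpolyK); apply/eqP; rewrite -subr_eq0; apply/eqP/Ginj.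
      rewrite (leq_trans (size_polyD _ _)) // geq_max size_polyN !size_poly //.
    by rewrite rmorphB hornerD hornerN E subrr.
  by rewrite add1n !ltnS leqNgt -{1}(mul1n e) ltn_pmul2r // prime_gt1.
pose ub := 1 + m2 * G; have [u0 Eu] := poly_lift_Fp ub.
pose U (y : L) := (map_poly ia ub).[y]; pose g := U z.
have gq : g ^+ (l * e) = 1.
  apply: (mulfI gnz); rewrite -exprS mulr1 -[(l * e).+1]add1n -Eq.
  by rewrite /g /U horner_frob Eq exprD expr1 exprM zl expr1n mulr1.
have hl : (g ^+ e) ^+ l = 1 by rewrite -exprM mulnC.
have UC c : c != 0 -> ~~ pC c -> U (z ^+ c) = 1.
  by move=> c0 nc; rewrite /U rmorphD rmorphM rmorph1 hornerD hornerM hornerC rootm2 // mul0r addr0.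
have UCp i (c : 'F_l) : c = p%:R ^+ i -> U (z ^+ c) = g ^+ (p ^ i).
  move=> E; rewrite /g /U horner_frob; congr (_.[_]); apply: (expr_Fl ll zl).
  by rewrite natr_Zp natrX.
have Heval j : (0 < j < l)%N -> (map_poly ia (map_poly intr (HX l u0))).[z ^+ j] =
    \prod_(c : 'F_l | c != 0) U (z ^+ c) ^+ ((j%:R / c)%R : 'F_l).
  move=> /andP[j0 jl]; have jF : j%:R != 0 :> 'F_l.
    apply/eqP => /(congr1 val) /=; rewrite val_Fp_nat // modn_small // => E.
    by move: j0; rewrite E.
  have jz (a : 'F_l) : z ^+ ((j%:R * a)%R : 'F_l) = (z ^+ j) ^+ a.
    by rewrite -exprM; apply: (expr_Fl ll zl); rewrite natrM !natr_Zp.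
  have ja (a : 'F_l) : a != 0 -> j%:R / (j%:R * a) = a^-1.
    by move=> a0; rewrite invfM mulrA mulfV // mul1r.
  transitivity (\prod_(a : 'F_l | a != 0) U ((z ^+ j) ^+ a) ^+ (a^-1 : 'F_l)).
    rewrite /HX !rmorph_prod horner_prod; apply: eq_bigr => a a0.
    rewrite !rmorphXn horner_exp; congr (_ ^+ _).
    by rewrite /= !map_comp_poly Eu horner_comp !map_polyXn hornerXn.
  rewrite [RHS](reindex_inj (mulfI jF)); apply: eq_big => [a|a a0].
    by rewrite mulf_eq0 (negPf jF).
  by rewrite jz ja.
have jnd j : (0 < j < l)%N -> ~~ (l %| j)%N by move=> /andP[j0 jl]; rewrite gtnNdvd.
have EPhi : map_poly ia (Phi l 'F_p) = Phi l L.
  by rewrite rmorph_sum /=; apply: eq_bigr => i _; rewrite map_polyXn.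
exists o, e, u0; split=> //; rewrite -(coprimep_map ia).
  rewrite EPhi; apply: (Phi_coprime ll pz) => j Hj; rewrite rootE Heval //.
  apply/prodf_neq0 => c c0; apply: expf_neq0.
  have [/asboolP[i Ei]|nc] := boolP (pC c); last by rewrite UC ?oner_eq0.
  by rewrite (UCp i) // expf_neq0.
rewrite EPhi; apply: (Phi_coprime ll pz) => j Hj; rewrite rootE rmorphB rmorph1 rmorphXn rmorphB rmorph1 rmorphXn /=.
rewrite hornerD hornerN hornerC horner_exp Heval // subr_eq0 -prodrXl.
rewrite (bigID pC) /= [X in _ * X]big1 ?mulr1; last first.
  by move=> c /andP[c0 nc]; rewrite UC // !expr1n.
rewrite (eq_bigr (fun=> (g ^+ e) ^+ j)); last first.
  move=> c /andP[c0 /asboolP[i Ei]]; rewrite (UCp i) // -!exprM.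
  rewrite (_ : (p ^ i * _ * e = e * (p ^ i * ((j%:R / c)%R : 'F_l)))%N); last by rewrite mulnC.
  rewrite exprM [RHS]exprM; apply: (expr_Fl ll hl).
  by rewrite natrM natr_Zp natrX -Ei mulrC mulfVK.
(* The exponent is j times the number of nonzero powers of p in F_l. The latter is at least 1, as 1
   is one of them, and at most l - 1. *)
rewrite prodr_const -exprM; apply/eqP => /(coprime_expr1 ll hl) H.
have : g ^+ e = 1.
  apply: H; rewrite Euclid_dvdM // negb_or jnd //=.
  rewrite gtnNdvd //.
    by apply/card_gt0P; exists 1; rewrite unfold_in; apply/andP; split; [exact: oner_neq0|apply/asboolP; exists 0%N].
  have := card_Fp ll; rewrite (cardD1 0) inE /= add1n => E.
  apply: (@leq_trans #|[predD1 'F_l & 0]|.+1); last by rewrite E.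
  rewrite ltnS; apply: subset_leq_card; apply/fintype.subsetP => c.
  by rewrite unfold_in => /andP[c0 _]; rewrite !inE c0.
by move/eqP; rewrite (negPf gne).
Qed.

End FiniteField.

Lemma unit_poly (p l : nat) : prime p -> prime l -> p != l ->
  exists o e (u0 : {poly int}), [/\ (0 < o)%N, (p ^ o = 1 + l * e)%N,
  coprimep (map_poly intr (HX l u0)) (Phi l 'F_p) &
  coprimep (map_poly intr (HX l u0 ^+ e - 1)) (Phi l 'F_p)].
Proof.
move=> pp ll pl.
have q0 : 'X^l - 1 != 0 :> {poly 'F_p}.
  exact: monic_neq0 (monicXnsubC _ (prime_gt0 ll)).
have [L [rs Ers _]] := FinSplittingFieldFor q0.
have lL : l%:R != 0 :> L.
  have : p \in [pchar L] by rewrite (pchar_lalg L) pchar_Fp.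
  by move/dvdn_pcharf <-; rewrite dvdn_prime2.
rewrite rmorphB rmorph1 /= map_polyXn in Ers.
have ur : uniq rs.
  rewrite -separable_prod_XsubC -(eqp_separable Ers); exact: separable_Xn_sub_1.
have sr : size rs = l.
  have := eqp_size Ers; rewrite size_prod_XsubC -polyC1 size_XnsubC ?prime_gt0 //.
  by case.
have rt y : y \in rs -> y ^+ l = 1.
  rewrite -root_prod_XsubC -(eqp_root Ers) rootE !hornerE subr_eq0 => /eqP //.
have [y yr y1] : exists2 y, y \in rs & y != 1.
  case: rs ur sr rt {Ers} => [|a [|b rs]] ur sr rt.
  - by have := prime_gt0 ll; rewrite -sr.
  - by have := prime_gt1 ll; rewrite -sr.
  have [a1|a1] := eqVneq a 1; last by exists a; rewrite ?inE ?eqxx.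
  exists b; rewrite ?inE ?eqxx ?orbT //; move: ur; rewrite /= inE a1.
  by rewrite eq_sym => /andP[/norP[]].
exact: unit_poly_aux pp ll pl L y (prime_primitive ll (rt _ yr) y1).
Qed.

Lemma closed_prim_root (A : closedFieldType) l : prime l -> l%:R != 0 :> A ->
  exists z : A, l.-primitive_root z.
Proof.
move=> ll lA; have [rs Ers] := closed_field_poly_normal ('X^l - 1 : {poly A}).
have m1 : 'X^l - 1 \is @monic A by rewrite -polyC1 monicXnsubC // prime_gt0.
rewrite (monicP m1) scale1r in Ers.
have ur : uniq rs by rewrite -separable_prod_XsubC -Ers; exact: separable_Xn_sub_1.
have sr : size rs = l.
  have := congr1 (fun q : {poly A} => size q) Ers.
  by rewrite size_prod_XsubC -polyC1 size_XnsubC ?prime_gt0 // => -[].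
have rt y : y \in rs -> y ^+ l = 1.
  by rewrite -root_prod_XsubC -Ers rootE !hornerE subr_eq0 => /eqP.
have [y yr y1] : exists2 y, y \in rs & y != 1.
  case: rs ur sr rt {Ers} => [|a [|b rs]] ur sr rt.
  - by have := prime_gt0 ll; rewrite -sr.
  - by have := prime_gt1 ll; rewrite -sr.
  have [a1|a1] := eqVneq a 1; last by exists a; rewrite ?inE ?eqxx.
  exists b; rewrite ?inE ?eqxx ?orbT //; move: ur; rewrite /= inE a1.
  by rewrite eq_sym => /andP[/norP[]].
by exists y; apply: prime_primitive => //; apply: rt.
Qed.

Lemma frob_at_iter (k : fieldType) (Kb : algClosure k) (Q : set Kb) n t j :
  prime_ideal Kb Q -> frob_at Q n (t : absGal Kb) -> frob_at Q (n ^ j) (absGalX t j).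
Proof.
move=> PQ Ft z Fz; rewrite absGalXE; elim: j => [|j IH] /=.
  by rewrite expn0 expr1 subrr; exact: prime0.
have Fi : integers Kb (iter j t z).
  by elim: (j) => //= m Fm; apply/integers_fmorph.
apply: (prime_trans PQ (Ft _ Fi)); rewrite expnSr exprM.
by apply: prime_congX => //; apply: integersX.
Qed.

(** * Kummer characters *)

Section Kummer.
Variables (R : realType) (K : fieldType) (Kb : algClosure K) (l : nat).
Hypothesis ll : prime l.
Local Notation em := (algClosure_emb Kb).
Variables (z : Kb) (xi : R[i]).
Hypotheses (pz : l.-primitive_root z) (pxi : l.-primitive_root xi).
Variable u : {poly K}.
Implicit Types s t : absGal Kb.

Let zl : z ^+ l = 1. Proof. exact: prim_expr_order. Qed.

Definition zpw (A : fieldType) (y : A) (c : 'F_l) : A := y ^+ c.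
Arguments zpw : simpl never.

Lemma zpow_inj (A : fieldType) (y : A) : l.-primitive_root y -> injective (zpw y).
Proof.
move=> py c d /eqP; rewrite (eq_prim_root_expr py) => /eqP E; apply: val_inj => /=.
by move: E; rewrite !modn_small // -{2}(Fp_cast ll) ltn_ord.
Qed.

Lemma zpowD (A : fieldType) (y : A) : l.-primitive_root y ->
  forall c d : 'F_l, zpw y (c + d) = zpw y c * zpw y d.
Proof.
move=> py c d; rewrite /zpw -exprD; apply: (expr_Fl ll (prim_expr_order py)).
by rewrite natrD !natr_Zp.
Qed.

Lemma zpowM (A : fieldType) (y : A) : l.-primitive_root y ->
  forall c d : 'F_l, zpw y (c * d) = zpw y c ^+ d.
Proof.
move=> py c d; rewrite /zpw -exprM; apply: (expr_Fl ll (prim_expr_order py)).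
by rewrite natrM !natr_Zp.
Qed.

Lemma zpow0 (A : fieldType) (y : A) : zpw y 0 = 1.
Proof. exact: expr0. Qed.

Lemma zpow1 (A : fieldType) (y : A) : l.-primitive_root y -> zpw y 1 = y.
Proof.
move=> py; rewrite -[RHS]expr1; apply: (expr_Fl ll (prim_expr_order py)).
by rewrite natr_Zp.
Qed.

Lemma zpow_ex (y : Kb) : y ^+ l = 1 -> exists a : 'F_l, y = zpw z a.
Proof.
move=> yl; have [i ->] := prim_rootP pz yl; exists (i%:R).
by apply: (expr_Fl ll zl); rewrite natr_Zp.
Qed.

(** The family contains the conjugates over K of the single element u(z), so the Galois group acts
    on it by multiplying the index. *)
Definition kb (a : 'F_l) : Kb := (map_poly em u).[zpw z a].
Hypothesis kb0 : forall a, a != 0 -> kb a != 0.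

Lemma kbeta_ex : exists beta : 'F_l -> Kb, forall a, beta a ^+ l = kb a.
Proof.
have H a : exists y : Kb, y ^+ l = kb a; last by have [f Hf] := choice H; exists f.
have [|y] := closed_rootP ('X^l - (kb a)%:P) _.
  by rewrite size_XnsubC ?prime_gt0 // eqSS -lt0n prime_gt0.
by rewrite rootE !hornerE subr_eq0 => /eqP; exists y.
Qed.
Definition kbeta := projT1 (cid kbeta_ex).
Lemma kbetaE a : kbeta a ^+ l = kb a. Proof. by rewrite /kbeta; case: cid. Qed.
Lemma kbeta0 a : a != 0 -> kbeta a != 0.
Proof.
move=> /kb0; rewrite -kbetaE; apply: contraNneq => ->.
by rewrite expr0n -[l]prednK ?prime_gt0.
Qed.

Lemma kd_ex s : exists a : 'F_l, s z = zpw z a.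
Proof. by apply: zpow_ex; rewrite -rmorphXn zl rmorph1. Qed.
(** The cyclotomic character modulo l. *)
Definition kd s := projT1 (cid (kd_ex s)).
Lemma kdE s : s z = zpw z (kd s). Proof. by rewrite /kd; case: cid. Qed.

Lemma kd0 s : kd s != 0.
Proof.
apply/eqP => E; have := kdE s; rewrite E zpow0 -(rmorph1 s) => /fmorph_inj z1.
by have := prim_order_dvd pz 1; rewrite expr1 z1 eqxx dvdn1 => /eqP E1; move: (prime_gt1 ll); rewrite E1.
Qed.

Lemma kdM s t : kd (absGal_mul s t) = kd s * kd t.
Proof. by apply: (zpow_inj pz); rewrite -kdE /= kdE /zpw rmorphXn -/(zpw _ _) kdE zpowM. Qed.

Lemma gal_zpw s c : s (zpw z c) = zpw z (kd s * c).
Proof. by rewrite zpowM // /zpw rmorphXn kdE. Qed.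

Lemma kb_gal s a : s (kb a) = kb (a * kd s).
Proof.
rewrite /kb -horner_map /= -map_poly_comp /= /zpw rmorphXn kdE -zpowM // mulrC.
by congr (_.[_]); apply: eq_map_poly => c /=; rewrite absGal_fix.
Qed.

Lemma kk_ex s : exists k : 'F_l -> 'F_l, forall a, a != 0 ->
  s (kbeta a) = zpw z (k a) * kbeta (a * kd s).
Proof.
have H a : exists c : 'F_l, a != 0 -> s (kbeta a) = zpw z c * kbeta (a * kd s).
  have [->|a0] := eqVneq a 0; first by exists 0.
  have b0 : kbeta (a * kd s) != 0 by apply: kbeta0; rewrite mulf_neq0 // kd0.
  have [|c Hc] := @zpow_ex (s (kbeta a) / kbeta (a * kd s)).
    by rewrite exprMn exprVn kbetaE -rmorphXn kbetaE kb_gal mulfV // -kbetaE expf_neq0.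
  by exists c => _; rewrite -Hc mulfVK.
by have [f Hf] := choice H; exists f.
Qed.
(** The Kummer cocycle of the l-th roots [kbeta]. *)
Definition kk s := projT1 (cid (kk_ex s)).
Lemma kkE s a : a != 0 -> s (kbeta a) = zpw z (kk s a) * kbeta (a * kd s).
Proof. by rewrite /kk; case: cid => f /= H; apply: H. Qed.

Lemma kkM s t a : a != 0 -> kk (absGal_mul s t) a = kd s * kk t a + kk s (a * kd t).
Proof.
move=> a0; have at0 : a * kd t != 0 by rewrite mulf_neq0 // kd0.
have b0 : kbeta (a * kd t * kd s) != 0 by apply: kbeta0; rewrite mulf_neq0 // kd0.
apply: (zpow_inj pz); apply: (mulIf b0).
have := kkE (absGal_mul s t) a0; rewrite kdM [kd s * kd t]mulrC mulrA => <- /=.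
by rewrite kkE // rmorphM gal_zpw kkE // zpowD // mulrA.
Qed.

(* K need not contain z; the weights (a d)^-1, where s z = z^d, turn the cocycle kk into a homomorphism. *)
Definition kappa s : 'F_l := \sum_(a : 'F_l | a != 0) (a * kd s)^-1 * kk s a.
Definition kchi s : R[i] := zpw xi (kappa s).

Lemma kappaM s t : kappa (absGal_mul s t) = kappa s + kappa t.
Proof.
rewrite /kappa kdM addrC.
rewrite [X in _ + X](reindex_inj (mulIf (kd0 t))) /=.
under [X in _ + X]eq_bigl do rewrite mulf_eq0 (negPf (kd0 t)) orbF.
rewrite -big_split; apply: eq_bigr => a a0 /=; rewrite kkM // mulrDr.
have s0 := kd0 s; have t0 := kd0 t; congr (_ + _); last by congr (_^-1 * _); ring.
by field; rewrite a0 s0 t0.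
Qed.

Lemma kd1 s : s z = z -> kd s = 1.
Proof.
by move=> E; apply: (zpow_inj pz); rewrite -kdE E zpow1.
Qed.

Lemma kchi_ell : ell_char l kchi.
Proof.
split=> [s t|s|].
- by rewrite /kchi kappaM zpowD.
- by rewrite /kchi /zpw exprAC (prim_expr_order pxi) expr1n.
- exists (z :: [seq kbeta a | a : 'F_l]) => t H.
  have d1 : kd t = 1 by apply: kd1; apply: H; rewrite inE eqxx.
  rewrite /kchi /kappa big1 ?zpow0 // => a a0.
  suff -> : kk t a = 0 by rewrite mulr0.
  apply: (zpow_inj pz); apply: (mulIf (kbeta0 a0)).
  have := kkE t a0; rewrite d1 mulr1 => <-; rewrite H ?zpow0 ?mul1r //.
  by rewrite inE map_f ?orbT // mem_enum.
Qed.

Section ModQ.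
Variable Q : set Kb.
Hypotheses (PQ : prime_ideal Kb Q) (lQ : ~ Q l%:R).
Hypothesis uI : forall n, integers K u`_n.

Let zI : integers Kb z.
Proof. by exists ('X^l - 1%:P); rewrite ?monicXnsubC ?prime_gt0 // rmorphB /= map_polyXn map_polyC rootE !hornerE zl subrr. Qed.

Let kbI a : integers Kb (kb a).
Proof.
apply: integers_horner => [n|]; last exact: integersX.
by rewrite coef_map; apply/integers_fmorph.
Qed.

Let kbetaI a : integers Kb (kbeta a).
Proof.
apply: (@integers_root _ _ ('X^l - (kb a)%:P)).
- by rewrite monicXnsubC // prime_gt0.
- by rewrite rootE !hornerE kbetaE subrr.
- move=> n; rewrite coefB coefXn coefC; apply: integersB; first exact: integers_nat.
  by case: eqP => _; [exact: kbI|exact: integers0].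
Qed.

(** The product of the 1 - z^i for 0 < i < l is l, which is not in Q; so no factor is in Q. *)
Lemma zpow_modQ (a c : 'F_l) : Q (zpw z a - zpw z c) -> a = c.
Proof.
have key (j : nat) : (0 < j < l)%N -> ~ Q (1 - z ^+ j).
  move=> Hj Qj; apply: lQ.
  have -> : l%:R = \prod_(1 <= i < l) (1 - z ^+ i).
    have := congr1 (horner^~ 1) (Phi_factor ll pz).
    rewrite horner_prod; under eq_bigr do rewrite hornerXsubC.
    move=> <-; rewrite /Phi horner_sum.
    under eq_bigr do rewrite hornerXn expr1n.
    by rewrite sumr_const card_ord.
  rewrite (bigD1_seq j) ?iota_uniq ?mem_index_iota //=; apply: primeMr => //.
  apply: big_ind => [||i _]; [exact: integers1|exact: integersM|].
  by apply: integersB; [exact: integers1|exact: integersX].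
have le (c' : 'F_l) : (c' < l)%N by rewrite -{2}(Fp_cast ll) ltn_ord.
wlog ac : a c / (a <= c)%N.
  move=> H Qac; have [ac|/ltnW ac] := leqP a c; first exact: H.
  by apply/esym/H => //; apply: primeBC.
have [E _|ne Qac] := eqVneq a c; first by [].
have lt : (a < c)%N by rewrite ltn_neqAle ac andbT; apply: contraNneq ne => E; apply/eqP/val_inj.
case: (key (c - a)%N); first by rewrite subn_gt0 lt /= (leq_ltn_trans (leq_subr _ _)).
have zV : z ^+ (l - a) * z ^+ a = 1 by rewrite -exprD subnK ?zl // ltnW.
rewrite /zpw -(subnKC ac) in Qac; rewrite -zV.
have -> : z ^+ (l - a) * z ^+ a - z ^+ (c - a) = z ^+ (l - a) * (z ^+ a - z ^+ (a + (c - a))).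
  by rewrite mulrBr exprD mulrA zV mul1r.
by apply: primeMl => //; apply: integersX.
Qed.

Hypothesis kbQ : forall a, a != 0 -> ~ Q (kb a).

Let kbetaQ a : a != 0 -> ~ Q (kbeta a).
Proof.
move=> a0 Qb; apply: (kbQ a0); rewrite -kbetaE -[l]prednK ?prime_gt0 // exprS.
by apply: primeMr => //; apply: integersX.
Qed.

(** Inertia fixes z and the [kbeta] modulo Q. As the [kbeta] are units there and roots of unity stay
    distinct, all exponents vanish. *)
Lemma kchi_inertia s : (forall y, integers Kb y -> Q (s y - y)) -> kchi s = 1.
Proof.
move=> H; have d1 : kd s = 1.
  by apply: zpow_modQ; rewrite -kdE zpow1 //; apply: H.
rewrite /kchi /kappa big1 ?zpow0 // => a a0.
suff -> : kk s a = 0 by rewrite mulr0.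
apply: zpow_modQ; rewrite zpow0.
have := H _ (kbetaI a); rewrite kkE // d1 mulr1.
rewrite -[X in _ - X]mul1r -mulrBl => /(primeM PQ)[] //.
- apply: integersB; [exact: integersX|exact: integers1].
- by move/(kbetaQ a0).
Qed.

Variables (t : absGal Kb) (n e : nat).
Hypotheses (Ft : frob_at Q n t) (En : n = (1 + l * e)%N).

Let tz : kd t = 1.
Proof.
apply: zpow_modQ; rewrite -kdE zpow1 //.
by have := Ft zI; rewrite {1}En exprD exprM zl expr1n mulr1 expr1.
Qed.

(** Euler's criterion: with n = 1 + l e, Frobenius multiplies an l-th root of [kb a] by [kb a ^+ e]
    modulo Q. *)
Let kk_frob a : a != 0 -> Q (zpw z (kk t a) - kb a ^+ e).
Proof.
move=> a0; have := Ft (kbetaI a); rewrite kkE // tz mulr1 En exprD expr1 exprM kbetaE.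
rewrite [kbeta a * _]mulrC -mulrBl => /(primeM PQ)[] //.
- by apply: integersB; apply: integersX.
- by move/(kbetaQ a0).
Qed.

Lemma kchi_frob_trivial : (forall a, a != 0 -> Q (kb a - 1)) -> kchi t = 1.
Proof.
move=> H; rewrite /kchi /kappa big1 ?zpow0 // => a a0.
suff -> : kk t a = 0 by rewrite mulr0.
apply: zpow_modQ; rewrite zpow0; apply: (prime_trans PQ (kk_frob a0)).
by rewrite -[1](expr1n _ e); apply: prime_congX => //; [exact: integers1|exact: H].
Qed.

(** By Euler's criterion for each factor, z to the power [kappa t] is congruent to the e-th power of
    the weighted product. *)
Lemma kchi_frob_nontrivial :
  ~ Q ((\prod_(a : 'F_l | a != 0) kb a ^+ (a^-1 : 'F_l)) ^+ e - 1) -> kchi t != 1.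
Proof.
move=> H; apply/eqP => E; apply: H.
have k0 : kappa t = 0.
  by apply: (zpow_inj pxi); rewrite zpow0.
have E1 : 1 = \prod_(a : 'F_l | a != 0) zpw z (kk t a) ^+ (a^-1 : 'F_l).
  transitivity (zpw z (kappa t)); first by rewrite k0 zpow0.
  rewrite /kappa (big_morph (zpw z) (zpowD pz) (zpow0 z)).
  by apply: eq_bigr => a a0; rewrite tz mulr1 mulrC zpowM.
rewrite [X in _ - X]E1 -prodrXl.
have : forall r : seq 'F_l, Q (\prod_(a <- r | a != 0) (kb a ^+ (a^-1 : 'F_l)) ^+ e -
    \prod_(a <- r | a != 0) zpw z (kk t a) ^+ (a^-1 : 'F_l)); last exact.
elim=> [|a r IH]; first by rewrite !big_nil subrr; exact: prime0.
rewrite !big_cons; case: ifP => // a0; apply: prime_congM => //.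
- by do 2 apply: integersX.
- by apply: integers_prod => c; do 2 apply: integersX.
- rewrite exprAC; apply: prime_congX; [exact: PQ|exact: integersX|exact: integersX|].
  exact/(primeBC PQ)/kk_frob.
Qed.

End ModQ.
End Kummer.

(** A Bezout relation modulo p, lifted to Z[X] and evaluated at z, where the cyclotomic polynomial
    vanishes, makes A(z) invertible modulo Q. *)
Lemma coprime_Phi_notin (F : fieldType) (Q : set F) (p l : nat) (z : F) (A : {poly int}) :
  prime_ideal F Q -> prime p -> Q p%:R -> prime l -> l.-primitive_root z ->
  coprimep (map_poly intr A) (Phi l 'F_p) -> ~ Q (map_poly intr A).[z].
Proof.
move=> PQ pp Qp ll pz cop QA.
have zI : integers F z.
  exists ('X^l - 1%:P); first by rewrite monicXnsubC ?prime_gt0.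
  by rewrite rmorphB /= map_polyXn map_polyC rootE !hornerE (prim_expr_order pz) subrr.
have evI (B : {poly int}) : integers F (map_poly intr B).[z].
  by apply: integers_horner => // n; rewrite coef_map; apply: integers_int.
have /Bezout_eq1_coprimepP[[U V] /= E] := cop.
have [U' EU] := poly_lift_Fp U; have [V' EV] := poly_lift_Fp V.
pose D := U' * A + V' * Phi l int - 1.
have QD : Q (map_poly intr D).[z].
  rewrite horner_coef; apply: prime_sum => // n; apply: primeMr; [exact: PQ|exact: integersX|].
  rewrite coef_map /=; apply/(prime_intP PQ pp Qp).
  suff : (p %| D`_n)%Z by rewrite dvdzE.
  rewrite (dvdz_pcharf (pchar_Fp pp)).
  have -> : (D`_n)%:~R = (map_poly intr D : {poly 'F_p})`_n by rewrite coef_map.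
  have -> : map_poly intr D = 0 :> {poly 'F_p}.
    rewrite rmorphB rmorphD !rmorphM rmorph1 /= EU EV.
    have -> : map_poly intr (Phi l int) = Phi l 'F_p.
      by rewrite /Phi rmorph_sum /=; apply: eq_bigr => i _; rewrite map_polyXn.
    by rewrite E subrr.
  by rewrite coef0.
apply: (prime_ne1 PQ).
have Phi0 : (map_poly intr (Phi l int)).[z] = 0 :> F.
  have -> : map_poly intr (Phi l int) = Phi l F.
    by rewrite /Phi rmorph_sum /=; apply: eq_bigr => i _; rewrite map_polyXn.
  rewrite (Phi_factor ll pz) horner_prod big_ltn ?prime_gt1 //.
  by rewrite hornerXsubC expr1 subrr mul0r.
have -> : 1 = (map_poly intr U').[z] * (map_poly intr A).[z] - (map_poly intr D).[z].
  rewrite /D rmorphB rmorphD !rmorphM rmorph1 /= hornerD hornerN hornerD !hornerM Phi0 hornerC.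
  by rewrite mulr0 addr0 opprB addrC subrK.
by apply: primeB => //; apply: primeMl.
Qed.

(** * Characters with prescribed behaviour at finitely many primes *)

Definition char_value (R : realType) (K : fieldType) (Kb : algClosure K)
    (chi : absGal Kb -> R[i]) (P : set K) (C : R[i] -> Prop) : Prop :=
  unramified chi P /\ forall (Q : set Kb) (t : absGal Kb), prime_ideal Kb Q ->
    algClosure_emb Kb @^-1` Q = P -> frob_at Q (ideal_norm P) t -> C (chi t).

(** By the Chinese remainder theorem some integer c of K is 1 modulo P and 0 modulo every [B i].
    Then u = 1 + c (u0 - 1) is congruent to u0 modulo P, where [unit_poly] makes the Kummer class
    nontrivial, and to 1 modulo each [B i], where it is trivial. *)
Lemma kummer_char (R : realType) (K : fieldType) (Kb : algClosure K) (l p : nat)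
    (P : set K) (n : nat) (B : 'I_n -> set K) (q : 'I_n -> nat) :
  [pchar K] =i pred0 -> prime l -> prime_ideal K P -> prime p -> p != l ->
  ideal_norm P = p ->
  (forall i, prime_ideal K (B i) /\ B i <> P) ->
  (forall i, [/\ prime (q i), q i != l & ideal_norm (B i) = q i]) ->
  exists chi : absGal Kb -> R[i], [/\ ell_char l chi, char_value chi P (fun v => v <> 1) &
    forall i, char_value chi (B i) (fun v => v = 1)].
Proof.
move=> ch ll PP pp pl Pn HB Hq.
(* If no prime of Kb lies above P, the conditions at P are vacuous and the trivial character
   serves. *)
have [|noQ] := pselect (exists2 Q : set Kb, prime_ideal Kb Q & algClosure_emb Kb @^-1` Q = P);
  last first.
  exists (fun=> 1); split; first exact: ell_char1.
    by split=> [Q PQ EQ|Q t PQ EQ]; case: noQ; exists Q.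
  by move=> i; split.
case=> Q1 PQ1 EQ1.
have [z pz] : exists z : Kb, l.-primitive_root z.
  apply: closed_prim_root => //; apply: natr_neq0_char0 => //.
  exact: char0_emb (algClosure_emb Kb) ch.
have [xi pxi] : exists xi : R[i], l.-primitive_root xi.
  by apply: closed_prim_root => //; rewrite pnatr_eq0 -lt0n prime_gt0.
have [Pp _] := ideal_norm_prime PP pp Pn.
have [c [Fc Pc Bc]] : exists c, [/\ integers K c, P (c - 1) & forall i, B i c].
  have /choice[c Hc] i : exists x, B i x /\ ~ P x.
    have [PB nB] := HB i; apply: contrapT => no; apply: nB.
    apply: (prime_max_sub PB PP) => x Bx; apply: contrapT => nPx.
    by apply: no; exists x.
  have Fci i : integers K (c i) by have [PB _] := HB i; have [Bi _] := Hc i; apply: prime_sub Bi.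
  have nP : ~ P (\prod_i c i).
    by move/(prime_prod PP)=> [i _|i _ Pi]; [exact: Fci|case: (Hc i)].
  have Fp : integers K (\prod_i c i) by apply: integers_prod.
  have [y Fy Py] := prime_maximal PP pp Pp Fp nP.
  exists (\prod_i c i * y); split=> //; first exact: integersM.
  move=> i; have [PB _] := HB i; rewrite (bigD1 i) //= -mulrA; apply: primeMr => //.
    by apply: integersM => //; apply: big_ind => //; [exact: integers1|exact: integersM].
  by case: (Hc i).
have [ od [e [u0 [ _ Eo cop1 cop2]]]] := unit_poly pp ll pl.
pose u : {poly K} := 1 + c%:P * (map_poly intr u0 - 1).
have uI m : integers K u`_m.
  rewrite /u coefD coef1 coefCM coefB coef1 coef_map; apply: integersD; first exact: integers_nat.
  by apply: integersM => //; apply: integersB; [exact: integers_int|exact: integers_nat].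
have zI : integers Kb z.
  exists ('X^l - 1%:P); first by rewrite monicXnsubC ?prime_gt0.
  by rewrite rmorphB /= map_polyXn map_polyC rootE !hornerE (prim_expr_order pz) subrr.
pose v (a : 'F_l) : Kb := (map_poly intr u0).[zpw z a].
have vI a : integers Kb (v a).
  by apply: integers_horner => [m|]; [rewrite coef_map; apply: integers_int|apply: integersX].
have kbv a : kb z u a = 1 + algClosure_emb Kb c * (v a - 1).
  rewrite /kb /u rmorphD rmorphM rmorphB rmorph1 /= map_polyC hornerD hornerM !hornerC.
  rewrite hornerD hornerN hornerC /v -map_poly_comp; congr (_ + _ * (_.[_] - _)).
  by apply: eq_map_poly => x /=; rewrite rmorph_int.
have HXE : (map_poly intr (HX l u0)).[z] = \prod_(a : 'F_l | a != 0) v a ^+ (a^-1 : 'F_l).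
  rewrite /HX rmorph_prod horner_prod; apply: eq_bigr => a _.
  by rewrite rmorphXn /= horner_exp map_comp_poly horner_comp map_polyXn hornerXn.
have atP Q : prime_ideal Kb Q -> algClosure_emb Kb @^-1` Q = P ->
    [/\ Q p%:R, forall a : 'F_l, a != 0 -> ~ Q (kb z u a) & forall a : 'F_l, Q (kb z u a - v a)].
  move=> PQ EQ; have Qp : Q p%:R.
    by rewrite -(rmorph_nat (algClosure_emb Kb)) -[Q _]/((algClosure_emb Kb @^-1` Q) _) EQ.
  have Qv a : Q (kb z u a - v a).
    rewrite kbv (_ : 1 + _ - _ = algClosure_emb Kb (c - 1) * (v a - 1)).
      apply: primeMr => //; first by apply: integersB => //; exact: integers1.
      by have : (algClosure_emb Kb @^-1` Q) (c - 1) by rewrite EQ.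
    by rewrite rmorphB rmorph1; ring.
  split=> // a a0 Qb; have : ~ Q (map_poly intr (HX l u0)).[z].
    exact: (coprime_Phi_notin PQ pp Qp ll pz cop1).
  apply; rewrite HXE (bigD1 a) //=; apply: primeMr => //.
    by apply: big_ind => [||d _]; [exact: integers1|exact: integersM|exact: integersX].
  have av : (0 < (a^-1 : 'F_l))%N.
    by rewrite lt0n; apply: contraNneq a0 => E; rewrite -invr_eq0; apply/eqP/val_inj.
  rewrite -(prednK av) exprS; apply: primeMr => //; first exact: integersX.
  by apply: (prime_cong PQ) Qb; apply: (primeBC PQ).
have kb0 (a : 'F_l) : a != 0 -> kb z u a != 0.
  move=> a0; have [_ H _] := atP _ PQ1 EQ1; apply/eqP => E; apply: (H a a0).
  by rewrite E; exact: prime0.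
have lQ m Q : prime_ideal Kb Q -> prime m -> m != l -> Q m%:R -> ~ Q l%:R.
  by move=> PQ pm ml Qm /(prime_natP PQ pm Qm); rewrite dvdn_prime2 // (negPf ml).
exists (kchi ll xi pz kb0); split.
- exact: kchi_ell.
- split=> [Q PQ EQ s [_ Hs]|Q t PQ EQ Ft].
    have [Qp Qb _] := atP _ PQ EQ.
    exact: (kchi_inertia ll xi pz kb0 PQ (lQ _ _ PQ pp pl Qp) uI Qb Hs).
  have [Qp Qb Qv] := atP _ PQ EQ; have Ql := lQ _ _ PQ pp pl Qp.
  (* Euler's criterion asks for a norm that is 1 modulo l, hence the power [od] of Frobenius; if chi
     is nontrivial on the power, it is so on t. *)
  rewrite Pn in Ft; have Ft' := frob_at_iter od PQ Ft.
  suff : kchi ll xi pz kb0 (absGalX t od) != 1.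
    move=> H E; case/eqP: H; have CE := kchi_ell ll pz pxi kb0.
    by rewrite (charX CE) E expr1n.
  apply: (kchi_frob_nontrivial ll pz pxi kb0 PQ Ql uI Qb Ft' Eo) => QH.
  apply: (coprime_Phi_notin PQ pp Qp ll pz cop2).
  rewrite rmorphB rmorphXn rmorph1 /= hornerD hornerN hornerC horner_exp HXE.
  apply: (prime_trans PQ _ QH).
  have : Q (\prod_(a : 'F_l | a != 0) v a ^+ (a^-1 : 'F_l) -
            \prod_(a : 'F_l | a != 0) kb z u a ^+ (a^-1 : 'F_l)).
    have : forall r : seq 'F_l, Q (\prod_(a <- r | a != 0) v a ^+ (a^-1 : 'F_l) -
            \prod_(a <- r | a != 0) kb z u a ^+ (a^-1 : 'F_l)); last exact.
    have kbI (a : 'F_l) : integers Kb (kb z u a).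
      by rewrite kbv; apply: integersD; [exact: integers1|apply: integersM; [exact/integers_fmorph|apply: integersB => //; exact: integers1]].
    elim=> [|a r IH]; first by rewrite !big_nil subrr; exact: prime0.
    rewrite !big_cons; case: ifP => // a0; apply: prime_congM => //.
    + exact: integersX.
    + by apply: integers_prod => d; apply: integersX.
    + by apply: prime_congX => //; exact: (primeBC PQ).
  move=> H; apply: prime_congX => //.
    by apply: big_ind => [||d _]; [exact: integers1|exact: integersM|exact: integersX].
  apply: big_ind => [||d _]; [exact: integers1|exact: integersM|apply: integersX].
  by rewrite kbv; apply: integersD; [exact: integers1|apply: integersM; [exact/integers_fmorph|apply: integersB => //; exact: integers1]].
- move=> i; have [pq ql Nq] := Hq i; have [PB _] := HB i.
  have [Bq _] := ideal_norm_prime PB pq Nq.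
  have atB Q : prime_ideal Kb Q -> algClosure_emb Kb @^-1` Q = B i ->
      [/\ ~ Q l%:R, forall a : 'F_l, a != 0 -> ~ Q (kb z u a) & forall a : 'F_l, a != 0 -> Q (kb z u a - 1)].
    move=> PQ EQ; have Qq : Q (q i)%:R.
      by rewrite -(rmorph_nat (algClosure_emb Kb)) -[Q _]/((algClosure_emb Kb @^-1` Q) _) EQ.
    have Qb1 (a : 'F_l) : a != 0 -> Q (kb z u a - 1).
      move=> a0; rewrite kbv addrC addKr; apply: primeMr => //.
        by apply: integersB => //; exact: integers1.
      by have : (algClosure_emb Kb @^-1` Q) c by rewrite EQ.
    split=> //; first exact: lQ Qq.
    move=> a a0 Qb; apply: (prime_ne1 PQ); apply: (prime_cong PQ) Qb.
    exact/(primeBC PQ)/Qb1.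
  split=> [Q PQ EQ s [_ Hs]|Q t PQ EQ Ft].
    by have [Ql Qb _] := atB _ PQ EQ; exact: (kchi_inertia ll xi pz kb0 PQ Ql uI Qb Hs).
  have [Ql Qb Qv] := atB _ PQ EQ.
  (* Here the exponent l - 1, given by Fermat's little theorem, is prime to l, so triviality of chi
     on the power passes to t. *)
  rewrite Nq in Ft; have Ft' := frob_at_iter l.-1 PQ Ft.
  have [e' Ee'] : exists e', (q i ^ l.-1 = 1 + l * e')%N.
    have E : (q i ^ l.-1 %% l = 1)%N.
      rewrite (eq_natr_Fl (m := 1) ll); first by rewrite modn_small // prime_gt1.
      have qF0 : (q i)%:R != 0 :> 'F_l.
        apply/eqP => /(congr1 val) /=; rewrite val_Fp_nat // => /eqP.
        by rewrite -[_ == _]/(l %| q i)%N dvdn_prime2 // eq_sym (negPf ql).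
      apply: (mulfI qF0); rewrite natrX -exprS prednK ?prime_gt0 // mulr1.
      by have := expf_card ((q i)%:R : 'F_l); rewrite card_Fp.
    exists ((q i ^ l.-1) %/ l)%N.
    by rewrite addnC mulnC {1}(divn_eq (q i ^ l.-1) l) E.
  have := kchi_frob_trivial ll xi pz kb0 PQ Ql uI Qb Ft' Ee' Qv.
  have CE := kchi_ell ll pz pxi kb0; rewrite (charX CE).
  move/(coprime_expr1 ll) => H; apply: H; first by case: CE.
  by rewrite gtnNdvd //; have := prime_gt1 ll; lia.
Qed.

(** * Roots modulo m and norms *)

Import Pdiv.CommonRing Pdiv.RingMonic.

Lemma unitmx_int_absdet n (L : 'M[int]_n) : L \in unitmx -> absz (\det L) = 1%N.
Proof.
move=> uL; have := congr1 (fun B => absz (\det B)) (mulmxV uL).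
rewrite det_mulmx det1 abszM /= => /eqP; rewrite muln_eq1 => /andP[/eqP -> _] //.
Qed.

Lemma smith_absdet n (A : 'M[int]_n) : exists (L R : 'M[int]_n) (dg : 'I_n -> int),
  [/\ L \in unitmx, R \in unitmx, A = L *m diag_mx (\row_i dg i) *m R,
      absz (\det A) = (\prod_i absz (dg i))%N &
      forall i j : 'I_n, (i <= j)%N -> (dg i %| dg j)%Z].
Proof.
have [L uL [R uR [ds sds EA]]] := int_Smith_normal_form A.
exists L, R, (fun i => ds`_i).
have ED : \matrix_(i, j) (ds`_i *+ (i == j :> nat)) = diag_mx (\row_i ds`_i) :> 'M[int]_n.
  by apply/matrixP => i j; rewrite !mxE.
rewrite ED in EA; split=> //.
  rewrite EA !det_mulmx !abszM (unitmx_int_absdet uL) (unitmx_int_absdet uR) mul1n muln1.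
  by rewrite det_diag (big_morph absz abszM (erefl _)); apply: eq_bigr => i _; rewrite mxE.
move=> i j le; have [lt|ge] := ltnP j (size ds); last by rewrite (nth_default _ ge) dvdz0.
have tr : transitive (fun x y : int => (x %| y)%Z) by move=> x y z; apply: dvdz_trans.
have rf : reflexive (fun x y : int => (x %| y)%Z) by move=> x; apply: dvdzz.
have := sorted_leq_nth tr rf 0 sds; apply; rewrite ?inE //.
exact: leq_ltn_trans lt.
Qed.

(** In Smith coordinates a residue e with m | d_i e is determined by the quotient d_i e / m, which
    is less than |d_i|. The product of the |d_i| is the absolute determinant. *)
Lemma kernel_count n (A : 'M[int]_n) (m : nat) (T : finType) (x : T -> 'cV[int]_n) :
  (0 < m)%N -> \det A != 0 ->
  (forall t i, (m %| (A *m x t) i ord0)%Z) ->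
  (forall t t', (forall i, (m %| (x t - x t') i ord0)%Z) -> t = t') ->
  (#|T| <= absz (\det A))%N.
Proof.
move=> m0 dA Hx Hinj; have [L [R [dg [uL uR EA Edet _]]]] := smith_absdet A.
have dg0 i : (0 < absz (dg i))%N.
  rewrite lt0n; apply: contraNneq dA => E.
  by rewrite -absz_eq0 Edet (bigD1 i) //= E mul0n.
pose w t := R *m x t.
have Hw t i : (m %| dg i * w t i ord0)%Z.
  have -> : dg i * w t i ord0 = (invmx L *m (A *m x t)) i ord0.
    rewrite EA -!mulmxA mulKmx // -/(w t) mul_diag_mx mxE mxE.
    by congr (_ * _); rewrite mxE.
  by rewrite mxE; apply: rpred_sum => j _; rewrite dvdz_mull.
have m0' : m%:Z != 0 by rewrite -lt0n.
pose e t i := absz (w t i ord0 %% m)%Z.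
have eE t i : (e t i)%:Z = (w t i ord0 %% m)%Z by rewrite gez0_abs // modz_ge0.
have elt t i : (e t i < m)%N by rewrite -ltz_nat eE ltz_pmod.
have dv t i : (m %| absz (dg i) * e t i)%N.
  have : (m %| dg i * (e t i)%:Z)%Z.
    rewrite eE -(subrK (dg i * w t i ord0) (_ * _)) rpredD // -mulrBr dvdz_mull //.
    by rewrite -opprB rpredN -eqz_mod_dvd modz_mod.
  by rewrite dvdzE abszM.
have ylt t i : ((absz (dg i) * e t i) %/ m < absz (dg i))%N.
  by rewrite ltn_divLR // ltn_pmul2l.
pose y t : {dffun forall i : 'I_n, 'I_(absz (dg i))} := [ffun i => Ordinal (ylt t i)].
have yinj : injective y.
  move=> t t' E; apply: Hinj => i.
  have Ew j : (m %| w t j ord0 - w t' j ord0)%Z.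
    rewrite -eqz_mod_dvd -!eE; apply/eqP; congr Posz.
    have := congr1 (fun h : {dffun forall i : 'I_n, 'I_(absz (dg i))} => val (h j)) E.
    rewrite !ffunE /= => /(congr1 (muln^~ m)); rewrite !divnK // => /eqP.
    by rewrite eqn_pmul2l // => /eqP.
  have -> : x t - x t' = invmx R *m (w t - w t') by rewrite /w -mulmxBr mulKmx.
  rewrite mxE; apply: rpred_sum => j _; rewrite dvdz_mull //.
  by have -> : (w t - w t') j ord0 = w t j ord0 - w t' j ord0 by rewrite [LHS]mxE; congr (_ + _); rewrite [LHS]mxE.
have := leq_card _ yinj; rewrite card_dep_ffun Edet => /leq_trans; apply.
rewrite foldrE big_map big_enum /= leq_eqVlt; apply/orP; left; apply/eqP.
by apply: eq_bigr => i _; rewrite card_ord.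
Qed.

(** * Norms in Z[X]/(f), a domain by [dom] *)

Section NormForm.
Variable f : {poly int}.
Hypotheses (mf : f \is monic) (sf : (1 < size f)%N).
Let d := (size f).-1.
Hypothesis dom : forall h g : {poly int}, (size h <= d)%N -> (size g <= d)%N ->
  rmodp (h * g) f = 0 -> h = 0 \/ g = 0.

Let d0 : (0 < d)%N. Proof. by rewrite /d; case: (size f) sf => [|[]]. Qed.
Let sfd : size f = d.+1. Proof. by rewrite prednK // ltnW. Qed.

(* Multiplication by g on Z[X]/(f); its determinant is the norm of g. *)
Definition mulM (g : {poly int}) : 'M[int]_d := \matrix_(i < d) poly_rV (rmodp ('X^i * g) f).

Lemma size_rem (q : {poly int}) : (size (rmodp q f) <= d)%N.
Proof. by rewrite -ltnS -sfd ltn_rmodp monic_neq0. Qed.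

Lemma rVpolyE (v : 'rV[int]_d) : rVpoly v = \sum_(i < d) v 0 i *: 'X^i.
Proof. by rewrite /rVpoly poly_def; apply: eq_bigr => i _; rewrite valK. Qed.

Lemma mulM_row (v : 'rV[int]_d) g : v *m mulM g = poly_rV (rmodp (rVpoly v * g) f).
Proof.
rewrite rVpolyE mulr_suml rmodp_sum // linear_sum mulmx_sum_row.
by apply: eq_bigr => i _; rewrite rowK -scalerAl rmodpZ // linearZ.
Qed.

Lemma mulM_mul g h : mulM g *m mulM h = mulM (g * h).
Proof.
apply/row_matrixP => i; rewrite row_mul !rowK mulM_row poly_rV_K ?size_rem //.
by rewrite rmodp_mulml // mulrA.
Qed.

(** The powers of a root r of f modulo m form an eigenvector of multiplication by g, with eigenvalue
    g(r). *)
Lemma mulM_eval g (r : int) (m : int) : (m %| f.[r])%Z ->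
  forall i : 'I_d, (m %| (mulM g *m \col_(j < d) r ^+ j) i ord0 - r ^+ i * g.[r])%Z.
Proof.
move=> mfr i; rewrite !mxE.
have -> : \sum_j mulM g i j * (\col_(j < d) r ^+ j) j ord0 = (rmodp ('X^i * g) f).[r].
  rewrite (horner_coef_wide _ (size_rem _)); apply: eq_bigr => j _.
  by rewrite !mxE.
have -> : r ^+ i * g.[r] = ('X^i * g).[r] by rewrite hornerM hornerXn.
rewrite {2}(rdivp_eq mf ('X^i * g)) hornerD hornerM opprD addrCA subrr addr0.
by rewrite rpredN dvdz_mull.
Qed.

Lemma det_mulM_neq0 (g : {poly int}) : (size g <= d)%N -> g != 0 -> \det (mulM g) != 0.
Proof.
move=> sg g0; apply/det0P => -[v v0 vM].
have : rmodp (rVpoly v * g) f = 0.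
  by rewrite -(poly_rV_K (size_rem _)) -mulM_row vM linear0.
case/dom => //; first exact: size_poly.
  by move=> E; case/eqP: v0; rewrite -(rVpolyK v) E linear0.
by move=> E; rewrite E eqxx in g0.
Qed.

Lemma mulM_entry_bound : exists c : nat, forall (g : {poly int}) (t : nat),
  (size g <= d)%N -> (forall k, `|g`_k| <= t%:Z) ->
  forall i j, `|mulM g i j| <= (c * t)%N%:Z.
Proof.
pose c := (\sum_(i < d) \sum_(j < d) \sum_(k < d) absz ((rmodp ('X^i * 'X^k) f)`_j)%R)%N.
exists c => g t sg gt i j; rewrite !mxE.
have -> : g = \sum_(k < d) g`_k *: 'X^k.
  rewrite -poly_def; apply/polyP => k; rewrite coef_poly; case: ltnP => // le.
  by rewrite nth_default // (leq_trans sg).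
rewrite mulr_sumr rmodp_sum // coef_sum.
apply: (le_trans (ler_norm_sum _ _ _)).
apply: (@le_trans _ _ (\sum_(k < d) t%:Z * (absz (rmodp ('X^i * 'X^k) f)`_j)%:Z)).
  apply: ler_sum => k _; rewrite -scalerAr rmodpZ // coefZ normrM.
  by apply: ler_pM => //; rewrite ?abszE.
rewrite -mulr_sumr PoszM mulrC ler_wpM2r // -(big_morph _ PoszD (erefl (Posz 0))) lez_nat /c.
by rewrite [X in (_ <= X)%N](bigD1 i) //= [X in (_ <= X + _)%N](bigD1 j) //= -addnA leq_addr.
Qed.

Lemma det_bound (n : nat) (A : 'M[int]_n) (b : nat) :
  (forall i j, `|A i j| <= b%:Z) -> `|\det A| <= (n`! * b ^ n)%N%:Z.
Proof.
move=> H; apply: (le_trans (ler_norm_sum _ _ _)).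
apply: (@le_trans _ _ (\sum_(s : 'S_n) (b ^ n)%N%:Z)).
  apply: ler_sum => s _; rewrite normrM normr_sign mul1r normr_prod.
  apply: (@le_trans _ _ (\prod_(i < n) b%:Z)); first by apply: ler_prod => i _; rewrite normr_ge0 H.
  by rewrite prodr_const card_ord -[in X in _ <= X]natz natrX natz.
by rewrite sumr_const card_Sn -mulr_natl natz PoszM.
Qed.

Lemma det_mulM_bound : exists2 C0 : nat, (0 < C0)%N & forall (g : {poly int}) (t : nat),
  (size g <= d)%N -> (forall k, `|g`_k| <= t%:Z) -> (absz (\det (mulM g)) <= C0 * t ^ d)%N.
Proof.
have [c Hc] := mulM_entry_bound.
exists (d`! * c.+1 ^ d)%N; first by rewrite muln_gt0 fact_gt0 expn_gt0.
move=> g t sg gt; have := det_bound (Hc g t sg gt); rewrite -abszE lez_nat => /leq_trans; apply.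
by rewrite expnMn mulnA leq_mul2r leq_mul2l leq_exp2r // leqnSn !orbT.
Qed.

(** Thue's argument: two of the more than m polynomials with coefficients in 0, ..., t agree at r
    modulo m, and g is their difference. *)
Lemma short_vector (m t : nat) (r : int) : (0 < m)%N -> (m < t.+1 ^ d)%N ->
  exists g : {poly int}, [/\ g != 0, (size g <= d)%N, forall k, `|g`_k| <= t%:Z &
     (m %| g.[r])%Z].
Proof.
move=> m0 mt.
pose ev (a : {ffun 'I_d -> 'I_t.+1}) : 'I_m :=
  Ordinal (ltn_pmod (absz ((\sum_(i < d) (a i)%:Z * r ^+ i) %% m)%Z) m0).
have [a [b [ab E]]] : exists a b, a != b /\ ev a = ev b.
  apply: contrapT => no; have inj : injective ev.
    move=> a b E; apply/eqP/negPn/negP => ab; apply: no; exists a, b; by split.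
  have := leq_card _ inj; rewrite card_ffun !card_ord => /(leq_trans mt).
  by rewrite ltnn.
exists (\poly_(i < d) (if insub i is Some i' then (a i')%:Z - (b i')%:Z else 0)).
have coefE (i : 'I_d) : (\poly_(i < d) (if insub i is Some i' then (a i')%:Z - (b i')%:Z else 0))`_i
   = (a i)%:Z - (b i)%:Z by rewrite coef_poly ltn_ord valK.
split.
- apply: contraNneq ab => E0; apply/eqP/ffunP => i; apply: val_inj.
  by have := coefE i; rewrite E0 coef0 => /esym/eqP; rewrite subr_eq0 => /eqP[].
- exact: size_poly.
- move=> k; rewrite coef_poly; case: ltnP => [lt|_] //.
  rewrite insubT /=; set u := a _; set v := b _.
  have := ltn_ord u; have := ltn_ord v; lia.
- rewrite (horner_coef_wide _ (size_poly _ _)).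
  under eq_bigr do rewrite coefE mulrBl.
  rewrite sumrB -eqz_mod_dvd; apply/eqP.
  move/(congr1 val): E => /=.
  have m0' : (m%:Z != 0) by rewrite -lt0n.
  have nn (x : int) : (absz (x %% m)%Z %% m = absz (x %% m)%Z)%N.
    rewrite modn_small // -ltz_nat gez0_abs ?modz_ge0 // ltz_pmod //.
  rewrite !nn => /(congr1 Posz); rewrite !gez0_abs ?modz_ge0 //.
Qed.

(** The adjugate turns the kernel vector of the powers of r, whose first coordinate is 1, into the
    determinant. *)
Lemma dvd_det_root g (r m : int) : (m %| f.[r])%Z -> (m %| g.[r])%Z -> (m %| \det (mulM g))%Z.
Proof.
move=> mfr mgr; pose v : 'cV[int]_d := \col_(j < d) r ^+ j.
have H i : (m %| (mulM g *m v) i ord0)%Z.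
  have := mulM_eval g mfr i; rewrite -/v => H.
  by rewrite -(subrK (r ^+ i * g.[r]) (_ i ord0)) rpredD // dvdz_mull.
have E : (\adj (mulM g) *m (mulM g *m v)) (Ordinal d0) ord0 = \det (mulM g).
  rewrite mulmxA mul_adj_mx mul_scalar_mx !mxE expr0 mulr1 //.
by rewrite -E mxE; apply: rpred_sum => j _; rewrite dvdz_mull.
Qed.


Definition rho (m : nat) : nat := #|[pred r : 'I_m | (m %| f.[(r : nat)%:Z])%Z]|.

(** Write v(r) for the vector of powers of r and fix a common root r0. The vectors v(r) + (c - 1)
    v(r0), with r a common root and c a residue, lie in the kernel of multiplication by g modulo m.
    They are distinct: the first coordinate is c, and then the second determines r. So
    [kernel_count] applies. *)
Lemma common_root_count (g : {poly int}) (m : nat) : (0 < m)%N -> (size g <= d)%N -> g != 0 ->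
  (#|[pred r : 'I_m | (m %| f.[(r : nat)%:Z])%Z && (m %| g.[(r : nat)%:Z])%Z]| * m
    <= absz (\det (mulM g)))%N.
Proof.
move=> m0 sg g0; set P := [pred r : 'I_m | _].
have [P0|] := posnP #|P|; first by rewrite P0.
move=> /card_gt0P[r0 Pr0].
pose v (r : int) : 'cV[int]_d := \col_(j < d) r ^+ j.
have Hv (r : 'I_m) i : r \in P -> (m %| (mulM g *m v (r : nat)%:Z) i ord0)%Z.
  rewrite inE => /andP[H1 H2]; have := mulM_eval g H1 i => H.
  by rewrite -(subrK ((r : nat)%:Z ^+ i * g.[(r : nat)%:Z]) (_ i ord0)) rpredD // dvdz_mull.
pose T := ({r : 'I_m | r \in P} * 'I_m)%type.
pose x (t : T) : 'cV[int]_d := v (val t.1 : nat)%:Z + ((t.2 : nat)%:Z - 1) *: v (r0 : nat)%:Z.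
have small (a b : 'I_m) : (m %| (a : nat)%:Z - (b : nat)%:Z)%Z -> a = b.
  rewrite -eqz_mod_dvd !modz_small ?ltn_ord //; last 2 first.
    by rewrite /= ltz_nat ltn_ord.
  by rewrite /= ltz_nat ltn_ord.
  by move=> /eqP[] /val_inj.
have := @kernel_count d (mulM g) m T x m0 (det_mulM_neq0 sg g0).
rewrite card_prod card_ord card_sig; apply.
  move=> t i; rewrite mulmxDr -scalemxAr mxE rpredD ?Hv ?(valP t.1) //.
  by rewrite mxE dvdz_mull // Hv.
move=> [[r rP] c] [[r' r'P] c'] H.
have Ec : c = c'.
  apply: small; have := H (Ordinal d0); rewrite !mxE /= !expr0 !mulr1.
  by congr (_ %| _)%Z; ring.
move: H; rewrite Ec => H; congr (_, _); apply: val_inj => /=; apply: small.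
have [d1|d1] := ltnP 1 d.
  have := H (Ordinal d1); rewrite !mxE /= !expr1.
  by congr (_ %| _)%Z; ring.
(* There is no second coordinate here, but f is linear and has a single root modulo m. *)
have Ed : d = 1%N by apply/eqP; rewrite eqn_leq d1 d0.
have fE (a : int) : f.[a] = a + f`_0.
  rewrite horner_coef sfd Ed !big_ord_recl big_ord0 /= expr0 expr1 mulr1 addr0 addrC.
  by move: (monicP mf); rewrite lead_coefE sfd Ed /= => ->; rewrite mul1r.
have /andP[H1 _] := rP; have /andP[H2 _] := r'P.
have -> : (r : nat)%:Z - (r' : nat)%:Z = f.[(r : nat)%:Z] - f.[(r' : nat)%:Z].
  by rewrite !fE; ring.
exact: rpredB.
Qed.

(* By pigeonhole a root r of f modulo m is also a root modulo m of some g with coefficients of size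
   m^(1/d). Such a g has norm O(m), hence serves boundedly many r. *)
Lemma count_upper : exists C1 : nat, forall x : nat,
  (\sum_(1 <= m < x.+1) rho m <= C1 * x)%N.
Proof.
have [C0 C00 HC0] := det_mulM_bound.
(* With t^d <= x, at most (2t + 1)^d <= 3^d x polynomials g occur. Each serves at most C0 moduli,
   since m is determined by the quotient of the norm of g by m, which is at most C0; and each
   modulus uses it for at most C0 roots. *)
exists (C0 * C0 * 3 ^ d)%N => x.
have [->|x0] := posnP x; first by rewrite big_geq.
have rootd (n : nat) : (0 < n)%N -> exists t, (0 < t)%N && (t ^ d <= n < t.+1 ^ d)%N.
  move=> n0; have ex : exists t, (t ^ d <= n)%N by exists 0%N; rewrite exp0n.
  have ub t : (t ^ d <= n)%N -> (t <= n)%N.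
    by apply: leq_trans; rewrite -{1}(expn1 t); case: t => // t; rewrite leq_pexp2l.
  case: (ex_maxnP ex ub) => t tn tmax; exists t.
  have -> : (0 < t)%N by apply: tmax; rewrite exp1n.
  by rewrite tn /= ltnNge; apply/negP => /tmax; rewrite ltnn.
have [t /andP[t0 /andP[tx xt]]] := rootd _ x0.
pose A := {ffun 'I_d -> 'I_(2 * t).+1}.
pose dec (a : A) : {poly int} :=
  \poly_(i < d) (if insub i is Some i' then (a i')%:Z - t%:Z else 0).
have /choice[ac Hac] (mr : nat * nat) : exists a : A, (0 < mr.1 <= x)%N ->
    [/\ dec a != 0, (absz (\det (mulM (dec a))) <= C0 * mr.1)%N & (mr.1 %| (dec a).[mr.2%:Z])%Z].
  case: mr => m r /=; have [/andP[m0 mx]|] := boolP (0 < m <= x)%N; last by exists [ffun=> ord0].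
  have [tm /andP[_ /andP[tm1 tm2]]] := rootd _ m0.
  have [g [g0 sg gt mg]] := @short_vector m tm r%:Z m0 tm2.
  have tmt : (tm <= t)%N.
    rewrite leqNgt; apply/negP => lt; have := leq_trans xt (_ : t.+1 ^ d <= tm ^ d)%N.
    by rewrite leq_exp2r // => /(_ lt); rewrite ltnNge (leq_trans tm1 mx).
  pose a : A := [ffun i : 'I_d => inord (absz (g`_i + t%:Z)%R)].
  have Eg : dec a = g.
    apply/polyP => k; rewrite coef_poly; case: ltnP => [lt|le]; last first.
      by rewrite nth_default // (leq_trans sg).
    have := gt k; rewrite ler_norml => /andP[h1 h2].
    rewrite insubT ffunE /=; move: (g`_k)%R h1 h2 => z h1 h2.
    have zt : (absz (z + t%:Z)%R < (2 * t).+1)%N by move: h1 h2 tmt; clear; lia.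
    by rewrite inordK //; move: h1 h2 tmt; clear; lia.
  exists a => _; rewrite Eg; split=> //.
  by apply: (leq_trans (HC0 g tm sg gt)); rewrite leq_mul2l tm1 orbT.
pose n (a : A) m := #|[pred r : 'I_m | (m %| f.[(r : nat)%:Z])%Z && (ac (m, nat_of_ord r) == a)]|.
have Erho m : rho m = (\sum_a n a m)%N.
  rewrite /rho -sum1_card (partition_big (fun r : 'I_m => ac (m, nat_of_ord r)) predT) //=.
  by apply: eq_bigr => a _; rewrite /n -sum1_card; apply: eq_bigl => r; rewrite !inE.
under eq_bigr do rewrite Erho.
rewrite exchange_big /=.
apply: (@leq_trans (\sum_(a : A) C0 * C0)%N); last first.
  rewrite sum_nat_const card_ffun !card_ord mulnC -[leqRHS]mulnA; apply: leq_mul => //.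
  apply: (@leq_trans ((3 * t) ^ d)%N); first by rewrite leq_exp2r //; lia.
  by rewrite expnMn leq_mul2l tx orbT.
apply: leq_sum => a _.
pose D := absz (\det (mulM (dec a))).
have sdec : (size (dec a) <= d)%N by exact: size_poly.
have nb m : (0 < m <= x)%N ->
    (n a m <= if [&& 0 < D, m %| D & D <= C0 * m] then C0 else 0)%N.
  move=> Hm; have m0 : (0 < m)%N by case/andP: Hm.
  have [->|] := posnP (n a m); first by [].
  move=> /card_gt0P[r]; rewrite inE => /andP[fr /eqP Ea].
  have := Hac (m, nat_of_ord r) Hm; rewrite Ea /= => -[g0 Db gr].
  have Dm : (m %| D)%N by have := dvd_det_root fr gr; rewrite dvdzE.
  have D0 : (0 < D)%N by rewrite lt0n absz_eq0 det_mulM_neq0.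
  rewrite -/D in Db; rewrite D0 Dm Db /=.
  have : (n a m * m <= D)%N.
    apply: leq_trans (common_root_count m0 sdec g0); rewrite leq_mul2r; apply/orP; right.
    apply: subset_leq_card; apply/fintype.subsetP => r'; rewrite !inE => /andP[-> /eqP Ea'] /=.
    by have := Hac (m, nat_of_ord r') Hm; rewrite Ea' /= => -[].
  by move/leq_trans => /(_ _ Db); rewrite leq_pmul2r.
apply: (@leq_trans (\sum_(1 <= m < x.+1) if [&& 0 < D, m %| D & D <= C0 * m] then C0 else 0)%N).
  rewrite big_seq [leqRHS]big_seq; apply: leq_sum => m; rewrite mem_index_iota ltnS.
  exact: nb.
rewrite -big_mkcond /= big_const_seq iter_addn addn0 leq_mul2l; apply/orP; right.
rewrite -size_filter; set q := seq.filter _ _.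
have qP m : m \in q -> [&& 0 < m, 0 < D, m %| D & D <= C0 * m]%N.
  by rewrite mem_filter mem_index_iota => /andP[-> /andP[->]].
rewrite -(size_map (fun m => D %/ m)%N) -[leqRHS](size_iota 1).
apply: uniq_leq_size.
  rewrite map_inj_in_uniq ?filter_uniq ?iota_uniq // => m m' /qP /and4P[m0 D0 mD _] /qP /and4P[m0' _ mD' _] E.
  have : (D %/ m * m = D %/ m * m')%N by rewrite {2}E !divnK.
  by move/eqP; rewrite eqn_pmul2l ?divn_gt0 ?(dvdn_leq D0) // => /eqP.
move=> _ /mapP[m /qP /and4P[m0 D0 mD Dm] ->].
by rewrite mem_iota divn_gt0 // (dvdn_leq D0) //= add1n ltnS leq_divLR // mulnC.
Qed.

End NormForm.

Lemma dvdz_Fp p (z : int) : prime p -> (p %| z)%Z = (z%:~R == 0 :> 'F_p).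
Proof. by move=> pp; apply: dvdz_pcharf; apply: pchar_Fp. Qed.

Lemma lift_rV_Fp p n (v : 'rV['F_p]_n) : exists u : 'rV[int]_n, v = map_mx intr u.
Proof.
exists (\row_i (v 0 i : nat)%:Z); apply/rowP => i; rewrite !mxE.
by rewrite -pmulrn natr_Zp.
Qed.

Lemma unitmx_map_int (F : fieldType) n (A : 'M[int]_n) :
  A \in unitmx -> map_mx (intr : int -> F) A \in unitmx.
Proof. by rewrite !unitmxE det_map_mx; apply: rmorph_unit. Qed.

Lemma leq_card_pred (T T' : finType) (f : T -> T') (A : pred T) :
  {in A &, injective f} -> (#|A| <= #|T'|)%N.
Proof. by move=> inj; rewrite -(card_in_imset inj) max_card. Qed.

Lemma leq_card_preds (T T' : finType) (f : T -> T') (A : pred T) (B : pred T') :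
  {in A &, injective f} -> (forall x, A x -> B (f x)) -> (#|A| <= #|B|)%N.
Proof.
move=> inj AB; rewrite -(card_in_imset inj); apply: subset_leq_card.
by apply/fintype.subsetP => _ /imsetP[x Ax ->]; apply: AB.
Qed.

Lemma col_mulmx (F : comNzRingType) m n p (A : 'M[F]_(m, n)) (B : 'M[F]_(n, p)) j :
  col j (A *m B) = A *m col j B.
Proof. by rewrite !colE mulmxA. Qed.

(** * Elements with cyclic quotient *)

Section GoodElements.
Variable f : {poly int}.
Hypotheses (mf : f \is monic) (sf : (1 < size f)%N).
Let d := (size f).-1.
Hypothesis dom : forall h g : {poly int}, (size h <= d)%N -> (size g <= d)%N ->
  rmodp (h * g) f = 0 -> h = 0 \/ g = 0.

Let d0 : (0 < d)%N. Proof. by rewrite /d; case: (size f) sf => [|[]]. Qed.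
Let sfd : size f = d.+1. Proof. by rewrite prednK // ltnW. Qed.

(** D is the norm of f', the discriminant up to sign; the cofactor of f' is read off the first row
    of the adjugate of multiplication by f'. *)
Lemma bezout_deriv : exists (u v : {poly int}) (D : int),
  D != 0 /\ u * f + v * f^`() = D%:P.
Proof.
have sf' : (size f^`() <= d)%N.
  rewrite -ltnS -sfd; apply: lt_size_deriv; exact: monic_neq0.
have f'0 : f^`() != 0.
  apply/eqP => /polyP /(_ d.-1); rewrite coef_deriv coef0 prednK //.
  move: (monicP mf); rewrite lead_coefE -/d => -> /eqP.
  by rewrite pmulrn intz => /eqP[] /eqP; rewrite gtn_eqF.
have D0 := det_mulM_neq0 mf sf dom sf' f'0.
pose v := row (Ordinal d0) (\adj (mulM f f^`())).
have Ev : v *m mulM f f^`() = poly_rV ((\det (mulM f f^`()))%:P).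
  rewrite /v -row_mul mul_adj_mx; apply/rowP => j; rewrite !mxE coefC eq_sym.
  by case: eqP => [->//|ne]; case: eqP => // E; case: ne; apply: val_inj.
have : rmodp (rVpoly v * f^`()) f = (\det (mulM f f^`()))%:P.
  rewrite -(poly_rV_K (size_rem mf sf _)) -(mulM_row mf) Ev poly_rV_K //.
  by rewrite (leq_trans (size_polyC_leq1 _)).
have := rdivp_eq mf (rVpoly v * f^`()) => E1 E2.
exists (- rdivp (rVpoly v * f^`()) f), (rVpoly v), (\det (mulM f f^`())); split=> //.
by rewrite -E2 {2}E1 mulNr addKr.
Qed.

Section ModP.
Variable p : nat.
Hypothesis pp : prime p.
Local Notation F := 'F_p.
Local Notation mp := (map_poly (intr : int -> F)).

Lemma mp_monic : mp f \is monic. Proof. exact: monic_map. Qed.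

Lemma size_mp : size (mp f) = d.+1.
Proof. by rewrite size_map_poly_id0 // (monicP mf) rmorph1 oner_neq0. Qed.

Lemma mulM_kernel (v : 'rV[F]_d) (g : {poly int}) :
  (v *m map_mx intr (mulM f g) == 0) = (mp f %| rVpoly v * mp g)%R.
Proof.
have [u ->] := lift_rV_Fp v.
rewrite -map_mxM (mulM_row mf).
have -> : rVpoly (map_mx intr u) = mp (rVpoly u) by rewrite map_rVpoly.
rewrite -rmorphM /=.
rewrite {2}(rdivp_eq mf (rVpoly u * g)) rmorphD rmorphM /= dvdp_addr ?dvdp_mull //.
rewrite map_poly_rV; set q := mp (rmodp _ _).
have sq : (size q <= d)%N by rewrite (leq_trans (size_poly _ _)) // (size_rem mf sf).
apply/eqP/idP => [E|H].
  by have := poly_rV_K sq; rewrite E linear0 => <-; rewrite dvdp0.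
have [->|q0] := eqVneq q 0; first by rewrite linear0.
by have := dvdp_leq q0 H; rewrite size_mp leqNgt ltnS sq.
Qed.

(** Modulo p the kernel of multiplication by g consists of the multiples of f/h, with h the gcd, and
    has dimension deg h. Two invariant factors divisible by p give two independent vectors in it. *)
Lemma two_dvd_size_gcd (g : {poly int}) (L R : 'M[int]_d) (dg : 'I_d -> int) (i j : 'I_d) :
  L \in unitmx -> mulM f g = L *m diag_mx (\row_i dg i) *m R -> i != j ->
  (p %| dg i)%Z -> (p %| dg j)%Z -> (2 < size (gcdp (mp f) (mp g)))%N.
Proof.
move=> uL EA ij; rewrite !dvdz_Fp // => /eqP pi /eqP pj.
rewrite ltnNge; apply/negP => sg.
pose Lp := map_mx (intr : int -> F) L.
have uLp : Lp \in unitmx by exact: unitmx_map_int.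
pose v (k : 'I_d) : 'rV[F]_d := row k (invmx Lp).
have Hv k : (dg k)%:~R = 0 :> F -> (mp f %| rVpoly (v k) * mp g)%R.
  move=> Ek; rewrite -mulM_kernel EA !map_mxM -/Lp !mulmxA -row_mul mulVmx // map_diag_mx.
  suff -> : row k 1%:M *m diag_mx (map_mx intr (\row_i dg i)) = 0 :> 'rV[F]_d by rewrite mul0mx.
  rewrite mul_mx_diag; apply/rowP => t; rewrite !mxE.
  by have [<-|_] := eqVneq k t; rewrite ?Ek ?mulr0 ?mul0r.
set h := gcdp _ _ in sg.
have h0 : h != 0 by rewrite gcdp_eq0 negb_and monic_neq0 // mp_monic.
pose q := (mp f %/ h)%R.
have Ef : mp f = q * h by rewrite divpK // dvdp_gcdl.
have q0 : q != 0 by apply: contraTneq mp_monic => E; rewrite Ef E mul0r; apply/negP => /monicP/eqP; rewrite lead_coef0 eq_sym oner_eq0.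
have cop : coprimep q (mp g %/ h)%R.
  by rewrite coprimep_div_gcd // monic_neq0 // mp_monic.
have Hc k : (dg k)%:~R = 0 :> F -> exists c : F, rVpoly (v k) = c *: q.
  move=> /Hv; rewrite Ef -(divpK (dvdp_gcdr (mp f) (mp g))) -/h mulrA dvdp_mul2r // Gauss_dvdpl // => dv.
  have [w Ew] : exists w, rVpoly (v k) = w * q by exists (rVpoly (v k) %/ q)%R; rewrite divpK.
  have sw : (size w <= 1)%N.
    have [->|w0] := eqVneq w 0; first by rewrite size_poly0.
    have : (size (rVpoly (v k)) < (size (mp f)))%N by rewrite size_mp ltnS size_poly.
    rewrite Ew Ef !size_mul //; move: sg.
    have : (0 < size q)%N by rewrite size_poly_gt0.
    have : (0 < size h)%N by rewrite size_poly_gt0.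
    have : (0 < size w)%N by rewrite size_poly_gt0.
    move: (size w) (size q) (size h) => n1 n2 n3; clear; lia.
  by exists w`_0; rewrite Ew (size1_polyC sw) mul_polyC coefC.
have [ci Ei] := Hc i pi; have [cj Ej] := Hc j pj.
have E : cj *: v i = ci *: v j.
  by apply: (can_inj rVpolyK); rewrite !linearZ /= Ei Ej !scalerA mulrC.
have /rowP E2 : cj *: row i 1%:M = ci *: row j 1%:M :> 'rV[F]_d.
  by rewrite -(mulVmx uLp) !row_mul -!/(v _) !scalemxAl E.
have := E2 i; have := E2 j; rewrite !mxE !eqxx (negbTE ij) (eq_sym j) (negbTE ij) !mulr0 !mulr1.
move=> ci0 cj0; have vj0 : v j = 0 by apply: (can_inj rVpolyK); rewrite Ej cj0 scale0r linear0.
have /rowP/(_ j) : row j (1%:M : 'M[F]_d) = 0 by rewrite -(mulVmx uLp) row_mul -/(v j) vj0 mul0mx.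
by rewrite !mxE eqxx => /eqP; rewrite oner_eq0.
Qed.

(** The kernel modulo p contains the independent vectors f/h and X f/h, so at least two invariant
    factors are divisible by p. *)
Lemma gcd_dvd_det (g : {poly int}) (h : {poly F}) :
  (h %| mp f)%R -> (h %| mp g)%R -> (2 < size h)%N -> (p ^ 2 %| absz (\det (mulM f g)))%N.
Proof.
move=> hf hg sh; have [L [R [dg [uL uR EA Edet _]]]] := smith_absdet (mulM f g).
pose q := (mp f %/ h)%R.
have Ef : mp f = q * h by rewrite divpK.
have q0 : q != 0 by apply: contraTneq mp_monic => E; rewrite Ef E mul0r; apply/negP => /monicP/eqP; rewrite lead_coef0 eq_sym oner_eq0.
have h0 : h != 0 by rewrite -size_poly_gt0 (leq_trans _ sh).
pose Lp := map_mx (intr : int -> F) L.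
have uLp : Lp \in unitmx by exact: unitmx_map_int.
have sq : (size q + size h = d.+2)%N.
  have := size_mul q0 h0; rewrite -Ef size_mp.
  move: sh; move: (size q) (size h) => n1 n2 H1 H2; move: H1 H2; clear; lia.
pose v (e : bool) : 'rV[F]_d := poly_rV ('X^e * q).
have vK e : rVpoly (v e) = 'X^e * q.
  rewrite poly_rV_K //; apply: (leq_trans (size_polyMleq _ _)); rewrite size_polyXn.
  move: sq sh; move: (size q) (size h) => n1 n2; clear; case: e => /=; lia.
have vD e : (v e *m Lp) *m diag_mx (map_mx intr (\row_i dg i)) = 0.
  have : v e *m map_mx intr (mulM f g) == 0.
    by rewrite mulM_kernel vK Ef -mulrA dvdp_mull // dvdp_mul2l // .
  rewrite EA !map_mxM map_diag_mx !mulmxA -/Lp => /eqP E.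
  have uR' : map_mx (intr : int -> F) R \in unitmx by exact: unitmx_map_int.
  by rewrite -[LHS](mulmxK uR') E mul0mx.
have Z e i : (v e *m Lp) 0 i != 0 -> (p %| absz (dg i))%N.
  move=> nz; have /rowP/(_ i) := vD e; rewrite mul_mx_diag !mxE => /eqP.
  rewrite mulf_eq0 -dvdz_Fp // dvdzE => /orP[/eqP E|//]; case/eqP: nz.
  by rewrite -[RHS]E mxE.
have vnz e : v e != 0.
  apply: contraNneq q0 => E; have := vK e; rewrite E linear0 => /esym/eqP.
  by rewrite mulf_eq0 expf_eq0 polyX_eq0 andbF.
have exi e : exists i, (v e *m Lp) 0 i != 0.
  apply: contrapT => no; case/eqP: (vnz e); rewrite -[LHS](mulmxK uLp).
  suff -> : v e *m Lp = 0 by rewrite mul0mx.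
  apply/rowP => i; rewrite [RHS]mxE; apply/eqP/negPn/negP => H; apply: no; by exists i.
have [i Hi] := exi false; have [j [ji Hj]] : exists j, j != i /\ (p %| absz (dg j))%N.
  apply: contrapT => no.
  have supp e k : k != i -> (v e *m Lp) 0 k = 0.
    move=> ki; apply/eqP/negPn/negP => /Z H; apply: no; by exists k.
  pose a := (v false *m Lp) 0 i; pose b := (v true *m Lp) 0 i.
  have E : b *: v false = a *: v true.
    apply: (can_inj (mulmxK uLp)); rewrite -!scalemxAl; apply/rowP => k; rewrite [LHS]mxE [RHS]mxE.
    have [->|ki] := eqVneq k i; first by rewrite -/a -/b mulrC.
    by rewrite !supp // !mulr0.
  have : b%:P * q = a%:P * 'X * q.
    have := congr1 rVpoly E; rewrite !linearZ /= !vK expr0 expr1 mul1r -!mul_polyC mulrA //.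
  move/(mulIf q0) => /polyP /(_ 1%N); rewrite coefC coefMX coefC /= => /esym/eqP.
  exact/negP.
rewrite Edet (bigD1 i) //= (bigD1 j) //= mulnA dvdn_mulr // -mulnn dvdn_mul //.
exact: Z Hi.
Qed.

End ModP.


(** All invariant factors but the last are 1 by [two_dvd_size_gcd], so the quotient by g is cyclic
    of order m: it is Z/m, with X acting as some r, and a polynomial of degree less than d lies in
    the ideal of g when it vanishes at r modulo m. *)
Lemma good_root (g : {poly int}) (m := absz (\det (mulM f g))) :
  (size g <= d)%N -> g != 0 ->
  (forall p, prime p ->
    (size (gcdp (map_poly (intr : int -> 'F_p) f) (map_poly intr g)) <= 2)%N) ->
  exists r : nat, [/\ (r < m)%N, (m %| f.[r%:Z])%Z, (m %| g.[r%:Z])%Z &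
    forall h : {poly int}, (size h <= d)%N -> (m %| h.[r%:Z])%Z ->
      exists z : 'rV[int]_d, poly_rV h = z *m mulM f g].
Proof.
move=> sg g0 good; have D0 := det_mulM_neq0 mf sf dom sg g0.
have [L [R [dg [uL uR EA Edet dgdv]]]] := smith_absdet (mulM f g).
have dg0 i : (0 < absz (dg i))%N.
  rewrite lt0n; apply: contraNneq D0 => E.
  by rewrite -absz_eq0 Edet (bigD1 i) //= E mul0n.
have ltl : (d.-1 < d)%N by rewrite prednK.
pose la : 'I_d := Ordinal ltl.
have dg1 i : i != la -> absz (dg i) = 1%N.
  move=> il; apply/eqP/negPn/negP => n1.
  have gt1 : (1 < absz (dg i))%N by rewrite ltn_neqAle eq_sym n1 dg0.
  have pp := pdiv_prime gt1.
  have di : (pdiv (absz (dg i)) %| dg i)%Z by rewrite dvdzE pdiv_dvd.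
  have le : (i <= la)%N by rewrite -ltnS prednK.
  have := two_dvd_size_gcd pp uL EA il di (dvdz_trans di (dgdv _ _ le)).
  by rewrite ltnNge good.
have Em : m = absz (dg la).
  by rewrite /m Edet (bigD1 la) //= big1 ?muln1 // => i /dg1.
have m0 : (0 < m)%N by rewrite Em.
have m0' : m%:Z != 0 by rewrite -lt0n.
have dgm i : i != la -> forall y : int, (dg i %| y)%Z by move=> il y; rewrite dvdzE dg1 // dvd1n.
have dgla y : (dg la %| y)%Z = (m %| y)%Z by rewrite !dvdzE -Em.
(* Pairing with [w] modulo m is the quotient map by the ideal of g ([span]), and [w] spans the
   kernel of multiplication by g modulo m ([ker]). *)
pose w : 'cV[int]_d := col la (invmx R).
have span (b : 'rV[int]_d) : (m %| (b *m w) ord0 ord0)%Z -> exists z, b = z *m mulM f g.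
  move=> mb; pose c := b *m invmx R.
  have Hc i : (dg i %| c ord0 i)%Z.
    have [->|il] := eqVneq i la; last exact: dgm.
    by rewrite dgla; move: mb; rewrite /w -col_mulmx mxE.
  exists ((\row_i (c ord0 i %/ dg i)%Z) *m invmx L).
  rewrite EA !mulmxA mulmxKV //.
  have -> : (\row_i (c ord0 i %/ dg i)%Z) *m diag_mx (\row_i dg i) = c.
    rewrite mul_mx_diag; apply/rowP => i; rewrite mxE [X in X * _]mxE [X in _ * X]mxE; exact: divzK.
  by rewrite mulmxKV.
have ker (x : 'cV[int]_d) : (forall i, (m %| (mulM f g *m x) i ord0)%Z) ->
    exists c : int, forall i, (m %| x i ord0 - c * w i ord0)%Z.
  move=> Hx; pose y := R *m x.
  have Hy i : (m %| dg i * y i ord0)%Z.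
    have -> : dg i * y i ord0 = (invmx L *m (mulM f g *m x)) i ord0.
      rewrite EA -!mulmxA mulKmx // -/y mul_diag_mx mxE mxE.
      by congr (_ * _); rewrite mxE.
    by rewrite mxE; apply: rpred_sum => j _; rewrite dvdz_mull.
  have Hy' i : i != la -> (m %| y i ord0)%Z.
    by move=> /dg1 E; have := Hy i; rewrite !dvdzE abszM E mul1n.
  exists (y la ord0) => i.
  have -> : x i ord0 = \sum_j invmx R i j * y j ord0 by rewrite -(mulKmx uR x) -/y mxE.
  rewrite (bigD1 la) //= addrAC [y la _ * _]mulrC.
  have -> : w i ord0 = invmx R i la by rewrite mxE.
  rewrite subrr add0r.
  by apply: rpred_sum => j jl; rewrite dvdz_mull // Hy'.
have Aw i : (m %| (mulM f g *m w) i ord0)%Z.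
  rewrite EA /w -!mulmxA -col_mulmx mulmxV // mxE; apply: rpred_sum => j _.
  rewrite dvdz_mull // mul_diag_mx !mxE.
  have [->|_] := eqVneq j la; last by rewrite mulr0 dvdz0.
  by rewrite mulr1 -dgla dvdzz.
(* Multiplication by X commutes with g, so it acts on the kernel spanned by [w] as a scalar, which
   is the root r. *)
pose C := mulM f 'X.
have Cw i : (m %| (mulM f g *m (C *m w)) i ord0)%Z.
  rewrite mulmxA (mulM_mul mf sf) mulrC -(mulM_mul mf sf) -mulmxA mxE.
  by apply: rpred_sum => j _; rewrite dvdz_mull.
have [c Hc] := ker _ Cw.
pose r := absz (c %% m)%Z.
have rE : r%:Z = (c %% m)%Z by rewrite gez0_abs // modz_ge0.
have rm : (r < m)%N by rewrite -ltz_nat rE ltz_pmod.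
have Hr i : (m %| (C *m w) i ord0 - r%:Z * w i ord0)%Z.
  have -> : (C *m w) i ord0 - r%:Z * w i ord0 = ((C *m w) i ord0 - c * w i ord0) + (c - r%:Z) * w i ord0 by ring.
  apply: rpredD; first exact: Hc.
  by rewrite dvdz_mulr // rE -eqz_mod_dvd modz_mod.
(* The quotient map agrees modulo m with evaluation at r times [l1]; the element [h1], at which it
   takes the value 1, shows that [l1] is a unit. *)
pose lam q : int := (poly_rV (rmodp q f) *m w) ord0 ord0.
pose l1 : int := lam 1.
have lamD q q' : lam (q + q') = lam q + lam q'.
  by rewrite /lam rmodpD // linearD mulmxDl mxE.
have lamC a : lam a%:P = a * l1.
  by rewrite /l1 /lam -(mulr1 a%:P) mul_polyC rmodpZ // linearZ -scalemxAl mxE.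
have lamX q : (m %| lam (q * 'X) - r%:Z * lam q)%Z.
  have -> : lam (q * 'X) = (poly_rV (rmodp q f) *m (C *m w)) ord0 ord0.
    by rewrite mulmxA (mulM_row mf) poly_rV_K ?size_rem // rmodp_mulml.
  rewrite /lam mxE [X in _ - _ * X]mxE mulr_sumr -sumrB; apply: rpred_sum => i _.
  by rewrite mulrCA -mulrBr dvdz_mull.
have lamE q : (m %| lam q - q.[r%:Z] * l1)%Z.
  elim/poly_ind: q => [|q a IH]; first by rewrite /lam rmod0p linear0 mul0mx mxE horner0 mul0r subrr dvdz0.
  rewrite lamD lamC hornerMXaddC.
  have -> : lam (q * 'X) + a * l1 - (q.[r%:Z] * r%:Z + a) * l1
     = (lam (q * 'X) - r%:Z * lam q) + r%:Z * (lam q - q.[r%:Z] * l1) by ring.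
  by rewrite rpredD // dvdz_mull.
pose h1 := rVpoly (row la R).
have lamh1 : lam h1 = 1.
  rewrite /lam rmodp_small ?rVpolyK; last by rewrite sfd ltnS size_poly.
  by rewrite /w -row_mul -col_mulmx mulmxV // !mxE eqxx.
have u1 : (m %| 1 - h1.[r%:Z] * l1)%Z by rewrite -{1}lamh1.
have inv q : (m %| q.[r%:Z] * l1)%Z -> (m %| q.[r%:Z])%Z.
  move=> H; have -> : q.[r%:Z] = q.[r%:Z] * (1 - h1.[r%:Z] * l1) + h1.[r%:Z] * (q.[r%:Z] * l1) by ring.
  by rewrite rpredD // dvdz_mull.
have inv2 q : (m %| lam q)%Z -> (m %| q.[r%:Z])%Z.
  move=> H; apply: inv; have -> : q.[r%:Z] * l1 = lam q - (lam q - q.[r%:Z] * l1) by ring.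
  exact: rpredB.
exists r; split=> //.
- by apply: inv2; rewrite /lam rmodpp // linear0 mul0mx mxE dvdz0.
- apply: inv2; have -> : lam g = (row (Ordinal d0) (mulM f g *m w)) ord0 ord0.
    by rewrite row_mul rowK expr0 mul1r.
  by rewrite mxE; apply: Aw.
- move=> h sh mh; apply: span.
  have -> : (poly_rV h *m w) ord0 ord0 = lam h by rewrite /lam rmodp_small // sfd ltnS.
  have -> : lam h = (lam h - h.[r%:Z] * l1) + h.[r%:Z] * l1 by ring.
  by rewrite rpredD // dvdz_mulr.
Qed.

Definition pbox Y (a : {ffun 'I_d -> 'I_Y}) : {poly int} := rVpoly (\row_i (a i : nat)%:Z).
(** With c = 1 mod B the norm is prime to B, and with c large compared to B Y multiplication by the
    element is close to the scalar c. *)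
Definition gbox (c B : int) Y (a : {ffun 'I_d -> 'I_Y}) : {poly int} := c%:P + B *: pbox a.

Lemma pbox_coef Y (a : {ffun 'I_d -> 'I_Y}) (i : 'I_d) : (pbox a)`_i = (a i : nat)%:Z.
Proof. by rewrite coef_rVpoly_ord mxE. Qed.

Lemma size_pbox Y (a : {ffun 'I_d -> 'I_Y}) : (size (pbox a) <= d)%N.
Proof. exact: size_poly. Qed.

Lemma size_gbox c B Y (a : {ffun 'I_d -> 'I_Y}) : (size (gbox c B a) <= d)%N.
Proof.
apply: (leq_trans (size_polyD _ _)); rewrite geq_max.
rewrite (leq_trans (size_polyC_leq1 _)) //= (leq_trans (size_scale_leq _ _)) //.
exact: size_pbox.
Qed.

Lemma pbox_bound Y (a : {ffun 'I_d -> 'I_Y}) k : `|(pbox a)`_k| <= Y%:Z.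
Proof.
have [lt|le] := ltnP k d; last by rewrite nth_default ?normr0 // (leq_trans (size_pbox a)).
by rewrite (pbox_coef a (Ordinal lt)) ger0_norm // lez_nat ltnW.
Qed.

Lemma mulM_gbox c B Y (a : {ffun 'I_d -> 'I_Y}) :
  mulM f (gbox c B a) = c%:M + B *: mulM f (pbox a).
Proof.
apply/row_matrixP => i; rewrite linearD linearZ /= !rowK mulrDr rmodpD // linearD /=; congr (_ + _).
  rewrite mulrC mul_polyC rmodpZ // linearZ /= rmodp_small; last by rewrite size_polyXn [ltnRHS]sfd ltnS; apply: ltn_ord.
  by apply/rowP => j; rewrite !mxE coefXn -val_eqE /= eq_sym mulr_natr.
by rewrite /gbox -scalerAr rmodpZ // linearZ.
Qed.

Lemma gbox_inj (c B : int) Y : B != 0 -> injective (@gbox c B Y).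
Proof.
move=> B0 a b /addrI/eqP; rewrite -subr_eq0 -scalerBr -mul_polyC mulf_eq0 polyC_eq0 (negbTE B0) /= subr_eq0 => /eqP E.
by apply/ffunP => i; apply: val_inj; have := pbox_coef a i; rewrite E pbox_coef => -[].
Qed.

(** At the largest entry of z the scalar part exceeds the perturbation by at least c - B d e times
    that entry. In [good_fibres] this bounds the cofactor relating two box elements with the same m
    and r. *)
Lemma diag_dominant (A : 'M[int]_d) (c B e bb K : nat) (E : 'M[int]_d) (z b : 'rV[int]_d) :
  A = c%:Z%:M + B%:Z *: E -> (forall i j, `|E i j| <= e%:Z) ->
  z *m A = b -> (forall j, `|b 0 j| <= bb%:Z) -> (bb < (c - B * d * e) * K.+1)%N ->
  forall j, `|z 0 j| <= K%:Z.
Proof.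
move=> EA He Ez Hb Hbb j0.
have [k _ kmax] := @arg_maxnP _ j0 predT (fun j => absz (z 0 j)) isT.
suff : (absz (z 0 k)%R <= K)%N by move=> H; rewrite -abszE lez_nat; apply: leq_trans H; apply: kmax.
rewrite leqNgt; apply/negP => lt.
have Ek : c%:Z * z 0 k = b 0 k - B%:Z * \sum_i z 0 i * E i k.
  rewrite -Ez EA mulmxDr mul_mx_scalar -scalemxAr !mxE.
  by rewrite addrK.
have : `|c%:Z * z 0 k| <= bb%:Z + B%:Z * (d * (absz (z 0 k)%R * e))%N%:Z.
  rewrite Ek (le_trans (ler_normB _ _)) // lerD // normrM ler_wpM2l //.
  apply: (le_trans (ler_norm_sum _ _ _)).
  apply: (@le_trans _ _ (\sum_(i < d) (absz (z 0 k)%R * e)%N%:Z)).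
    apply: ler_sum => i _; rewrite normrM PoszM ler_pM // -abszE lez_nat; exact: kmax.
  by rewrite sumr_const card_ord -mulr_natl natz PoszM.
rewrite normrM -!abszE -!PoszM -PoszD lez_nat absz_nat => H.
move: Hbb H lt; move: (absz (z 0 k)%R) => zk; clear; nia.
Qed.


Lemma mask_nth (T : Type) (m m' : bitseq) (r : seq T) :
  (forall i, (i < size r)%N -> nth false m i = nth false m' i) -> mask m r = mask m' r.
Proof.
elim: r m m' => [|x r IH] m m' H; first by rewrite !mask0.
have E0 := H 0%N (ltn0Sn _).
have Er : mask (behead m) r = mask (behead m') r.
  by apply: IH => i ir; rewrite !nth_behead; apply: H.
have E (q : seq T) : mask [::] q = [::] by case: q.
case: m m' {H} E0 Er => [|b m] [|b' m'] //=.
- by rewrite E => <- <-.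
- by rewrite E => -> ->.
- by move=> -> ->.
Qed.

(** Over a splitting field the gcd is one of 2^d subproducts of the linear factors of f. Two
    elements with the same gcd differ by B times an element whose norm is divisible by p^2, hence
    have coordinates that differ by more than [delta], so a cube of side [delta.+1] contains at most
    one of them. *)
Lemma bad_count C0 c B Y p (Bad := fun a : {ffun 'I_d -> 'I_Y} =>
    (2 < size (gcdp (map_poly (intr : int -> 'F_p) f) (map_poly intr (gbox c B a))))%N) :
  (forall (g : {poly int}) (t : nat), (size g <= d)%N -> (forall k, `|g`_k| <= t%:Z) ->
     (absz (\det (mulM f g)) <= C0 * t ^ d)%N) ->
  prime p -> ~~ (p %| B)%Z ->
  (#|[pred a | Bad a]| * p ^ 2 <= 2 ^ d * (2 ^ d * C0 * Y ^ d + p ^ 2))%N.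
Proof.
move=> HC0 pp pB; pose mpf := map_poly (intr : int -> 'F_p) f.
have mf0 : mpf != 0 by rewrite monic_neq0 // mp_monic.
have [L [rs Ers _]] := FinSplittingFieldFor mf0.
pose ia := in_alg L.
have srs : size rs = d.
  have := eqp_size Ers; rewrite size_map_poly size_mp // size_prod_XsubC => -[] //.
have /choice[code Hcode] (a : {ffun 'I_d -> 'I_Y}) : exists m : bitseq,
   map_poly ia (gcdp mpf (map_poly intr (gbox c B a))) %= \prod_(z <- mask m rs) ('X - z%:P).
  have : map_poly ia (gcdp mpf (map_poly intr (gbox c B a))) %| \prod_(z <- rs) ('X - z%:P).
    by rewrite -(eqp_dvdr _ Ers) dvdp_map dvdp_gcdl.
  by move=> /dvdp_prod_XsubC[m]; exists m.
have p2 : (0 < p ^ 2)%N by rewrite expn_gt0 prime_gt0.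
(* [delta] is the largest coefficient bound for which the norm still stays below p^2. *)
have [delta dlt dge] : exists2 delta, (C0 * delta ^ d < p ^ 2)%N & (p ^ 2 <= C0 * delta.+1 ^ d)%N.
  have C00 : (0 < C0)%N.
    have := HC0 1 1%N; rewrite size_poly1 d0 exp1n muln1 => /(_ isT) H.
    apply: leq_trans (H _); last by move=> k; rewrite coef1; case: (k == 0%N).
    by rewrite lt0n absz_eq0 det_mulM_neq0 ?size_poly1 ?oner_neq0.
  have ex : exists t, (C0 * t ^ d < p ^ 2)%N by exists 0%N; rewrite exp0n // muln0.
  have ub t : (C0 * t ^ d < p ^ 2)%N -> (t <= p ^ 2)%N.
    move=> /ltnW; apply: leq_trans; case: t => // t.
    apply: (@leq_trans (t.+1 ^ d)); last exact: leq_pmull.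
    by rewrite -{1}(expn1 t.+1) leq_pexp2l.
  case: (ex_maxnP ex ub) => t tn tmax; exists t => //.
  by rewrite leqNgt; apply/negP => /tmax; rewrite ltnn.
pose N := (Y %/ delta.+1).+1.
have qlt (a : 'I_Y) : (a %/ delta.+1 < N)%N by rewrite ltnS leq_div2r // ltnW.
pose cd a : {ffun 'I_d -> bool} * {ffun 'I_d -> 'I_N} :=
  ([ffun i : 'I_d => nth false (code a) i], [ffun i : 'I_d => Ordinal (qlt (a i))]).
have inj : {in [pred a | Bad a] &, injective cd}.
  move=> a a' Ba _ [/ffunP E1 /ffunP E2]; apply/eqP/negPn/negP => ne.
  have Em : mask (code a) rs = mask (code a') rs.
    apply: mask_nth => i; rewrite srs => lt.
    by have := E1 (Ordinal lt); rewrite !ffunE.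
  have Eg : gcdp mpf (map_poly intr (gbox c B a)) %= gcdp mpf (map_poly intr (gbox c B a')).
    rewrite -(eqp_map ia); apply: (eqp_trans (Hcode a)); rewrite Em eqp_sym; exact: Hcode.
  set h := gcdp mpf (map_poly intr (gbox c B a)) in Eg.
  pose g := pbox a - pbox a'.
  have hg : (h %| map_poly intr g)%R.
    have h1 : (h %| map_poly intr (gbox c B a))%R by exact: dvdp_gcdr.
    have h2 : (h %| map_poly intr (gbox c B a'))%R by rewrite (eqp_dvdl _ Eg) dvdp_gcdr.
    have := dvdp_sub h1 h2; rewrite -rmorphB /=.
    have -> : gbox c B a - gbox c B a' = B *: g by rewrite /gbox scalerBr; ring.
    rewrite map_polyZ /= dvdpZr //.
    by apply: contra pB; rewrite -dvdz_Fp.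
  have sg : (size g <= d)%N by rewrite (leq_trans (size_polyD _ _)) // size_polyN geq_max !size_pbox.
  have g0 : g != 0.
    rewrite subr_eq0; apply: contraNneq ne => E; apply/eqP/ffunP => i; apply: val_inj.
    by have := pbox_coef a i; rewrite E pbox_coef => -[].
  have gd k : `|g`_k| <= delta%:Z.
    have [lt|le] := ltnP k d; last by rewrite nth_default ?normr0 // (leq_trans sg).
    rewrite coefB -[k]/(nat_of_ord (Ordinal lt)) !pbox_coef.
    have := E2 (Ordinal lt); rewrite !ffunE => /(congr1 val) /=.
    move: (a _) (a' _) => u u'; have := divn_eq u delta.+1; have := divn_eq u' delta.+1.
    have := @ltn_pmod u delta.+1 isT; have := @ltn_pmod u' delta.+1 isT.
    move: (u %/ delta.+1)%N (u' %/ delta.+1)%N (u %% delta.+1)%N (u' %% delta.+1)%N (nat_of_ord u) (nat_of_ord u').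
    by clear => q q' r r' v v' h1 h2 h3 h4 h5; subst; lia.
  have := gcd_dvd_det pp (dvdp_gcdl _ _) hg Ba.
  move/dvdn_leq; rewrite lt0n absz_eq0 det_mulM_neq0 // => /(_ isT) H.
  by have := leq_ltn_trans (leq_trans H (HC0 _ _ sg gd)) dlt; rewrite ltnn.
have := leq_card_pred inj; rewrite card_prod !card_ffun card_bool !card_ord => /leq_trans le.
apply: (@leq_trans (2 ^ d * N ^ d * p ^ 2)); first by rewrite leq_mul2r; apply/orP; right; apply: le.
rewrite -mulnA leq_mul2l; apply/orP; right.
have [lt|ge] := ltnP Y delta.+1; first by rewrite /N divn_small // exp1n mul1n leq_addl.
apply: leq_trans (leq_addr _ _); rewrite mulnC.
apply: (@leq_trans (C0 * delta.+1 ^ d * N ^ d)); first by rewrite leq_mul2r dge orbT.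
rewrite -mulnA -expnMn [leqRHS]mulnAC [leqRHS]mulnC -expnMn leq_mul2l; apply/orP; right.
rewrite leq_exp2r // /N mulnS mulnC mul2n -addnn addnC leq_add //.
exact: leq_divM.
Qed.

End GoodElements.

(** The bound M / n^2 + e on b n is summed over P < n <= q; telescoping bounds the tail of 1 / n^2
    by 1 / P. *)
Lemma sparse_sum (b : nat -> nat) (M e P q N : nat) : (0 < P)%N ->
  (forall n, (b n * n ^ 2 <= M + e * n ^ 2)%N) ->
  (forall n, (n <= P)%N \/ (q < n)%N -> b n = 0%N) ->
  ((\sum_(n < N) b n) * P <= M + e * q * P)%N.
Proof.
move=> P0 Hb Hz; case: N => [|N]; first by rewrite big_ord0.
have [NP|PN] := ltnP N P.
  by rewrite big1 ?mul0n // => n _; apply: Hz; left; apply: leq_trans NP; exact: ltnW (ltn_ord n).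
suff main k : (P <= k)%N ->
    (\sum_(n < k.+1) b n)%:R <= M%:R * (P%:R^-1 - k%:R^-1) + (e * minn k q)%:R :> rat.
  have := main N PN; rewrite -(ler_pM2r (_ : 0 < P%:R :> rat)) ?ltr0n //.
  rewrite mulrDl -mulrA mulrBl mulVf ?pnatr_eq0 -?lt0n // -!natrM => H.
  rewrite -(ler_nat rat) natrD (le_trans H) // lerD //.
    by rewrite mulrBr mulr1 lerBlDr lerDl !mulr_ge0 ?invr_ge0 ?ler0n.
  by rewrite ler_nat leq_mul2r leq_mul2l geq_minr !orbT.
elim: k => [|k IH] Pk; first by move: P0; rewrite ltnNge Pk.
have [E|lt] := eqVneq P k.+1.
  rewrite E subrr mulr0 add0r big1 ?ler0n // => n _; apply: Hz; left.
  by rewrite E -ltnS; apply: ltn_ord.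
have {}lt : (P <= k)%N by rewrite -ltnS ltn_neqAle lt.
have k0 : (0 < k)%N by apply: leq_trans lt.
rewrite big_ord_recr /= natrD.
have kp : 0 < k%:R :> rat by rewrite ltr0n.
have kp1 : 0 < k.+1%:R :> rat by rewrite ltr0n.
have kk : (k.+1%:R ^+ 2)^-1 <= k%:R^-1 - k.+1%:R^-1 :> rat.
  have -> : k%:R^-1 - k.+1%:R^-1 = (k%:R * k.+1%:R)^-1 :> rat.
    rewrite -natr1; field; rewrite natr1.
    by rewrite !gt_eqF.
  rewrite lef_pV2 ?posrE ?exprn_gt0 ?mulr_gt0 //.
  by rewrite expr2 ler_pM2r // ler_nat.
have k20 : 0 <= (k.+1%:R ^+ 2)^-1 :> rat by rewrite invr_ge0 exprn_ge0 ?ler0n.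
have {}IH := IH lt.
have [kq|qk] := ltnP k q; last first.
  rewrite Hz; last by right.
  have -> : minn k.+1 q = minn k q by rewrite !(minn_idPr _) // ltnW.
  rewrite addr0 (le_trans IH) // lerD2r ler_wpM2l ?ler0n //.
  by rewrite lerD2l lerN2 lef_pV2 ?posrE // ler_nat.
have bk : (b k.+1)%:R <= M%:R * (k.+1%:R ^+ 2)^-1 + e%:R :> rat.
  rewrite -(ler_pM2r (_ : 0 < k.+1%:R ^+ 2 :> rat)) ?exprn_gt0 //.
  rewrite mulrDl mulfVK ?expf_neq0 ?pnatr_eq0 // -natrX -!natrM -natrD ler_nat; exact: Hb.
apply: (le_trans (lerD IH bk)).
rewrite !(minn_idPl _) ?(ltnW kq) // mulnS natrD.
have := ler_wpM2l (ler0n rat M) kk; rewrite !mulrBr.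
move: (M%:R / P%:R) (M%:R / k%:R) (M%:R / k.+1%:R) (M%:R * (k.+1%:R ^+ 2)^-1) (e * k)%:R e%:R => a1 a2 a3 a4 a5 a6.
by clear; lra.
Qed.

Lemma taylor2 (f : {poly int}) (x h : int) :
  exists w, f.[x + h] = f.[x] + h * (f^`().[x] + h * w).
Proof.
elim/poly_ind: f => [|q a [w IH]]; first by exists 0; rewrite deriv0 !horner0; ring.
exists (q^`().[x] + w * (x + h)); rewrite !hornerMXaddC IH derivD derivC addr0 derivM derivX.
by rewrite hornerD !hornerM !hornerX hornerC; ring.
Qed.

Lemma horner_cong (f : {poly int}) (a x y : int) : (a %| x - y)%Z -> (a %| f.[x] - f.[y])%Z.
Proof.
move=> H; have [w] := taylor2 f y (x - y); rewrite addrC subrK => ->.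
by rewrite addrC addKr dvdz_mulr.
Qed.

Lemma ord_congr m (r r' : 'I_m) : (m %| (r : nat)%:Z - (r' : nat)%:Z)%Z -> r = r'.
Proof.
rewrite -eqz_mod_dvd !modz_small ?ltz_nat ?ltn_ord //.
by move=> /eqP[] /val_inj.
Qed.

Lemma rho_mul f a b : (0 < a)%N -> (0 < b)%N -> coprime a b -> rho f (a * b) = (rho f a * rho f b)%N.
Proof.
move=> a0 b0 ab; have ab0 : (0 < a * b)%N by rewrite muln_gt0 a0.
have fm n x y : (n > 0)%N -> x = y %[mod n] -> (n %| f.[x%:Z])%Z = (n %| f.[y%:Z])%Z.
  move=> n0 E; have H : (n %| x%:Z - y%:Z)%Z.
    by rewrite -eqz_mod_dvd !modz_nat E.
  have := horner_cong f H => H2; apply/idP/idP => H3.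
    by rewrite -(subKr f.[x%:Z] f.[y%:Z]) rpredB.
  by rewrite -(subrK f.[y%:Z] f.[x%:Z]) rpredD.
have dv x : ((a * b)%N %| f.[x%:Z])%Z = (a %| f.[x%:Z])%Z && (b %| f.[x%:Z])%Z.
  by rewrite !dvdzE Gauss_dvd.
rewrite /rho; set A := [pred r : 'I_a | _]; set B := [pred r : 'I_b | _]; rewrite -cardX.
apply/eqP; rewrite eqn_leq; apply/andP; split.
  pose h (r : 'I_(a * b)) : 'I_a * 'I_b := (Ordinal (ltn_pmod r a0), Ordinal (ltn_pmod r b0)).
  apply: (@leq_card_preds _ _ h) => [r r' _ _ [E1 E2]|r].
    apply: val_inj => /=; have : r = r' %[mod a * b] by apply/eqP; rewrite chinese_remainder // E1 E2 !eqxx.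
    by rewrite !modn_small.
  rewrite /= !inE /= dv => /andP[H1 H2].
  by rewrite (fm a _ r) ?modn_mod // H1 (fm b _ r) ?modn_mod.
pose h (k : 'I_a * 'I_b) : 'I_(a * b) := Ordinal (ltn_pmod (chinese a b k.1 k.2) ab0).
have h1 k : h k = k.1 %[mod a] by rewrite /= modn_dvdm ?dvdn_mulr // chinese_modl.
have h2 k : h k = k.2 %[mod b] by rewrite /= modn_dvdm ?dvdn_mull // chinese_modr.
apply: (@leq_card_preds _ _ h) => [[r s] [r' s'] _ _ E|[r s]].
  have := h1 (r, s); have := h2 (r, s); rewrite E h1 h2 /= !modn_small // => E1 E2.
  by congr (_, _); apply: val_inj.
rewrite /= !inE /= => /andP[H1 H2].
have := h1 (r, s); have := h2 (r, s) => E2 E1.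
by rewrite dv (fm a _ r) // ?H1 ?(fm b _ s).
Qed.

(** * Lower bound for the number of roots *)

Section CountLower.
Variable f : {poly int}.
Hypotheses (mf : f \is monic) (sf : (1 < size f)%N).
Let d := (size f).-1.
Hypothesis dom : forall h g : {poly int}, (size h <= d)%N -> (size g <= d)%N ->
  rmodp (h * g) f = 0 -> h = 0 \/ g = 0.

Let d0 : (0 < d)%N. Proof. by rewrite /d; case: (size f) sf => [|[]]. Qed.
Let sfd : size f = d.+1. Proof. by rewrite prednK // ltnW. Qed.

(** A good a is sent to (m, r), the norm of g a and its common root with f. If a and a0 have the
    same image, [good_root] at a0 puts g a in the ideal of g a0, and [diag_dominant] bounds the
    coefficients of the cofactor, leaving boundedly many a in each fibre. *)
Lemma good_fibres (cE B Y : nat) (kp := (d * cE).+1) (c := (1 + B * kp * Y)%N) (x : nat)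
    (g := fun a : {ffun 'I_d -> 'I_Y} => gbox c B a)
    (mm := fun a : {ffun 'I_d -> 'I_Y} => absz (\det (mulM f (g a))))
    (G : pred {ffun 'I_d -> 'I_Y}) :
  (0 < B)%N -> (0 < Y)%N ->
  (forall (h : {poly int}) (t : nat), (size h <= d)%N -> (forall k, `|h`_k| <= t%:Z) ->
     forall i j, `|mulM f h i j| <= (cE * t)%N%:Z) ->
  (forall a, (0 < mm a <= x)%N && coprime (mm a) B) ->
  (forall a p, G a -> prime p ->
    (size (gcdp (map_poly (intr : int -> 'F_p) f) (map_poly intr (g a))) <= 2)%N) ->
  (#|G| <= (2 * kp.+1).+1 ^ d * \sum_(1 <= m < x.+1 | coprime m B) rho f m)%N.
Proof.
move=> B0 Y0 HcE Hm HG.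
have sg a : (size (g a) <= d)%N by exact: size_gbox.
have g0 a : g a != 0.
  have /andP[/andP[m0 _] _] := Hm a; apply: contraTneq m0 => E.
  rewrite /mm E -leqNgt leqn0 absz_eq0; apply/det0P; exists (delta_mx ord0 (Ordinal d0)).
    by apply/eqP => /rowP /(_ (Ordinal d0)); rewrite !mxE !eqxx.
  by rewrite -rowE rowK mulr0 rmod0p linear0.
have /choice[rt Hrt] (a : {ffun 'I_d -> 'I_Y}) : exists r : nat, G a -> [/\ (r < mm a)%N, (mm a %| f.[r%:Z])%Z, (mm a %| (g a).[r%:Z])%Z &
    forall h : {poly int}, (size h <= d)%N -> (mm a %| h.[r%:Z])%Z ->
      exists z : 'rV[int]_d, poly_rV h = z *m mulM f (g a)].
  have [Ga|] := boolP (G a); last by exists 0%N.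
  have [r Hr] := good_root mf sf dom (sg a) (g0 a) (fun p => HG a p Ga).
  by exists r.
pose key a : 'I_x.+1 * 'I_x.+1 := (inord (mm a), inord (rt a)).
pose valid (k : 'I_x.+1 * 'I_x.+1) := [&& (0 < k.1)%N, coprime k.1 B, (k.2 < k.1)%N & ((k.1 : nat) %| f.[(k.2 : nat)%:Z])%Z].
have k1E a : (key a).1 = mm a :> nat by rewrite /= inordK // ltnS; case/andP: (Hm a) => /andP[].
have k2E a : G a -> (key a).2 = rt a :> nat.
  move=> Ga; rewrite /= inordK //; have [lt _ _ _] := Hrt a Ga.
  by apply: ltn_trans lt _; rewrite ltnS; case/andP: (Hm a) => /andP[].
have val a : G a -> valid (key a).
  move=> Ga; rewrite /valid k1E k2E //; have [-> -> _ _] := Hrt a Ga.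
  by have /andP[/andP[-> _] ->] := Hm a.
pose NK := (2 * kp.+1).+1.
have fib k : (#|[pred a | G a && (key a == k)]| <= NK ^ d)%N.
  have [->//|/card_gt0P[a0]] := posnP #|[pred a | G a && (key a == k)]|.
  rewrite inE => /andP[Ga0 /eqP Ek].
  have /choice[zc Hz] (a : {ffun 'I_d -> 'I_Y}) : exists z : 'rV[int]_d, G a && (key a == k) ->
     poly_rV (g a) = z *m mulM f (g a0) /\ forall j, `|z 0 j| <= kp.+1%:Z.
    have [/andP[Ga /eqP Eka]|] := boolP (G a && (key a == k)); last by exists 0.
    have Em : mm a = mm a0 by rewrite -!k1E Eka Ek.
    have Er : rt a = rt a0 by rewrite -!k2E // Eka Ek.
    have [_ _ H _] := Hrt a Ga; have [_ _ _ H0] := Hrt a0 Ga0.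
    have [|z Ez] := H0 (g a) (sg a); first by rewrite -Em -Er.
    exists z => _; split=> //.
    have EA : mulM f (g a0) = c%:Z%:M + B%:Z *: mulM f (pbox a0) by exact: mulM_gbox.
    have He i j : `|mulM f (pbox a0) i j| <= (cE * Y)%N%:Z.
      by apply: HcE; [exact: size_pbox | move=> k'; apply: pbox_bound].
    apply: (diag_dominant EA He (esym Ez) (bb := (c + B * Y)%N)).
      move=> j; rewrite mxE /g /gbox coefD coefC coefZ.
      rewrite (le_trans (ler_normD _ _)) // PoszD lerD //; first by case: (_ == _).
      by rewrite normrM PoszM ler_wpM2l // pbox_bound.
    (* [kp] exceeds d cE by 1 precisely so that c outweighs the off-diagonal part by 1 + B Y. *)
    have -> : (c - B * (size f).-1 * (cE * Y) = 1 + B * Y)%N.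
      have -> : (c = 1 + B * Y + B * (size f).-1 * (cE * Y))%N by rewrite /c /kp /d; ring.
      by rewrite addnK.
    rewrite /c; move: (kp) => n; clear; nia.
  pose cd a : {ffun 'I_d -> 'I_NK} := [ffun j : 'I_d => inord (absz (zc a 0 j + kp.+1%:Z)%R)].
  have inj : {in [pred a | G a && (key a == k)] &, injective cd}.
    move=> a a' /Hz[E1 b1] /Hz[E2 b2] /ffunP E.
    suff Ez : zc a = zc a'.
      have : poly_rV (g a) = poly_rV (g a') :> 'rV[int]_d by rewrite E1 E2 Ez.
      move/(congr1 rVpoly); rewrite !poly_rV_K //; apply: gbox_inj => //.
      by rewrite -lt0n.
    apply/rowP => j; have := E j; rewrite !ffunE => /(congr1 (@nat_of_ord _)).
    move: (b1 j) (b2 j); move: (zc a 0 j) (zc a' 0 j) => y1 y2 h1 h2.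
    rewrite !inordK /NK; first by move: h1 h2; clear; lia.
      by move: h2; clear; lia.
    by move: h1; clear; lia.
  by have := leq_card_pred inj; rewrite card_ffun !card_ord.
have -> : (\sum_(1 <= m < x.+1 | coprime m B) rho f m = #|valid|)%N.
  rewrite -sum1_card (big_nat_widenl _ 0) // big_mkord.
  rewrite (eq_bigr (fun m : 'I_x.+1 => \sum_(r < x.+1 | ((m : nat) %| f.[(r : nat)%:Z])%Z && (r < m)%N) 1%N)); last first.
    move=> m _; rewrite /rho -sum1_card.
    rewrite -(big_ord_widen_cond _ (fun r : nat => ((m : nat) %| f.[r%:Z])%Z) (fun=> 1%N)) //.
    by rewrite ltnW.
  rewrite pair_big_dep; apply: eq_bigl => -[m r] /=; rewrite unfold_in /valid /=.
  by rewrite -!andbA; do !bool_congr.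
rewrite -[leqLHS]sum1_card (partition_big key valid) //=.
rewrite mulnC -sum_nat_const; apply: leq_sum => k _.
by rewrite (_ : (\sum_(i in G | key i == k) 1)%N = #|[pred a | G a && (key a == k)]|) ?fib // -sum1_card.
Qed.

(** Roots modulo p are simple when p does not divide D. As in Hensel's lemma, a root modulo a power
    of p is then determined by its residue modulo p. *)
Lemma rho_pow_bound (u v : {poly int}) (D : int) p e :
  u * f + v * f^`() = D%:P -> prime p -> ~~ (p %| D)%Z -> (rho f (p ^ e.+1) <= d)%N.
Proof.
move=> Euv pp pD; set q := (p ^ e.+1)%N.
pose mpf := map_poly (intr : int -> 'F_p) f.
have pq : (p %| q)%N by rewrite /q expnS dvdn_mulr.
pose A := [pred r : 'I_q | (q %| f.[(r : nat)%:Z])%Z].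
pose rs := map (fun r : 'I_q => ((r : nat)%:Z)%:~R : 'F_p) (enum A).
rewrite /rho -/A cardE -(size_map (fun r : 'I_q => ((r : nat)%:Z)%:~R : 'F_p)) -/rs -ltnS -(size_mp mf sf p).
apply: max_poly_roots; first by rewrite monic_neq0 // mp_monic.
  apply/allP => y /mapP[r]; rewrite mem_enum inE => Hr ->{y}.
  rewrite /root horner_map /= -dvdz_Fp //; apply: dvdz_trans Hr; by rewrite dvdzE.
rewrite map_inj_in_uniq ?enum_uniq // => r r'; rewrite !mem_enum !inE => Hr Hr' E.
apply: ord_congr; set h := (r : nat)%:Z - _.
have ph : (p %| h)%Z by rewrite dvdz_Fp // rmorphB /= E subrr.
have [w Ew] := taylor2 f (r' : nat)%:Z h.
have : (q %| h * (f^`().[(r' : nat)%:Z] + h * w))%Z.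
  have -> : h * (f^`().[(r' : nat)%:Z] + h * w) = f.[(r : nat)%:Z] - f.[(r' : nat)%:Z].
    move: Ew; rewrite (_ : (r' : nat)%:Z + h = (r : nat)%:Z); last by rewrite /h addrC subrK.
    by move=> ->; ring.
  by rewrite rpredB.
rewrite Gauss_dvdzl // coprimezE absz_nat coprime_pexpl // prime_coprime //.
apply/negP => H0; have H : (p %| f^`().[(r' : nat)%:Z] + h * w)%Z by rewrite dvdzE.
have pf' : (p %| f^`().[(r' : nat)%:Z])%Z by rewrite -(addrK (h * w) f^`().[_]) rpredB // dvdz_mulr.
have := congr1 (fun g => g.[(r' : nat)%:Z]) Euv; rewrite hornerC hornerD !hornerM => ED.
case/negP: pD; rewrite -ED rpredD // dvdz_mull //.
by apply: dvdz_trans Hr'; rewrite dvdzE.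
Qed.

(* An element g of a box of side Y whose kernel modulo each prime is at most one-dimensional
   has a single common root r with f modulo its norm m, and (m, r) determines g up to boundedly many. *)
Lemma count_lower : exists B c x0 : nat,
  [/\ (0 < B)%N, forall p e, prime p -> ~~ (p %| B)%N -> (rho f (p ^ e.+1) <= d)%N &
      forall x, (x0 <= x)%N -> (x <= c * \sum_(1 <= m < x.+1 | coprime m B) rho f m)%N].
Proof.
have [cE HcE] := mulM_entry_bound mf; have [C0 C00 HC0] := det_mulM_bound mf sf.
have [u [v [D [D0 Euv]]]] := bezout_deriv mf sf dom.
(* [B] absorbs the discriminant and all primes up to [P0]. The main terms of [bad_count] over the
   remaining primes add up to at most a quarter of the box. [C2] bounds the norms by C2 Y^d. *)
pose P0 := (4 * (4 ^ d * C0))%N; pose B := (absz D * P0`!)%N; pose kp := (d * cE).+1.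
pose C2 := (C0 * (1 + B * kp.+1) ^ d)%N; pose NK := ((2 * kp.+1).+1 ^ d)%N.
have B0 : (0 < B)%N by rewrite muln_gt0 lt0n absz_eq0 D0 fact_gt0.
have C20 : (0 < C2)%N by rewrite muln_gt0 C00 expn_gt0.
have P00 : (0 < P0)%N by rewrite !muln_gt0 expn_gt0 C00.
have BD p : ~~ (p %| B)%N -> ~~ (p %| D)%Z by apply: contra; rewrite dvdzE => H; rewrite dvdn_mulr.
(* The size of Y makes the other term of [bad_count], summed over p up to the square root of x, at
   most another quarter of the box; so half of the elements are good. *)
have main Y : (0 < Y)%N -> (16 * 4 ^ d * C2 <= Y)%N ->
   (Y ^ d <= 2 * NK * \sum_(1 <= m < (C2 * Y ^ d).+1 | coprime m B) rho f m)%N.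
  move=> Y0 YC; set x := (C2 * Y ^ d)%N.
  pose c := (1 + B * kp * Y)%N.
  pose g (a : {ffun 'I_d -> 'I_Y}) := gbox c B a.
  pose mm a := absz (\det (mulM f (g a))).
  have sg a : (size (g a) <= d)%N by exact: size_gbox.
  have gb a k : `|(g a)`_k| <= ((1 + B * kp.+1) * Y)%N%:Z.
    rewrite /g /gbox coefD coefC coefZ.
    apply: (@le_trans _ _ (c + B * Y)%N%:Z).
      rewrite (le_trans (ler_normD _ _)) // PoszD lerD //; first by case: (_ == _).
      by rewrite normrM PoszM ler_wpM2l // pbox_bound.
    by rewrite lez_nat /c; move: Y0; clear; nia.
  have g0 a : g a != 0.
    apply/eqP => /polyP /(_ 0%N); rewrite coefD coefC coefZ coef0 /= -[0%N]/(nat_of_ord (Ordinal d0)).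
    by rewrite pbox_coef; move: (nat_of_ord _) => y; clear; rewrite /c; lia.
  have mm0 a : (0 < mm a)%N by rewrite lt0n absz_eq0; apply: (det_mulM_neq0 mf sf dom (sg a) (g0 a)).
  have mmx a : (mm a <= x)%N.
    by apply: (leq_trans (HC0 _ _ (sg a) (gb a))); rewrite expnMn mulnA.
  have BFp p : prime p -> (p %| B)%N -> (B%:Z)%:~R = 0 :> 'F_p.
    by move=> pp pB; apply/eqP; rewrite -dvdz_Fp // dvdzE.
  have cFp p : prime p -> (p %| B)%N -> (c%:Z)%:~R = 1 :> 'F_p.
    by move=> pp pB; rewrite /c -mulnA PoszD PoszM rmorphD rmorphM /= BFp // mul0r addr0.
  (* Modulo a prime dividing B the matrix of g a is the identity. *)
  have cop a : coprime (mm a) B.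
    rewrite /coprime; apply/negPn/negP => ne.
    have gt1 : (1 < gcdn (mm a) B)%N by rewrite ltn_neqAle eq_sym ne gcdn_gt0 B0 orbT.
    have pp := pdiv_prime gt1; have := pdiv_dvd (gcdn (mm a) B).
    move: (pdiv _) pp => p pp; rewrite dvdn_gcd => /andP[pm pB].
    have : (p %| \det (mulM f (g a)))%Z by rewrite dvdzE.
    rewrite dvdz_Fp // -det_map_mx mulM_gbox //.
    rewrite raddfD /= map_scalar_mx map_mxZ /= BFp // cFp // scale0r addr0 det1.
    by rewrite oner_eq0.
  pose Bad p a := (2 < size (gcdp (map_poly (intr : int -> 'F_p) f) (map_poly intr (g a))))%N.
  have BadB p a : prime p -> Bad p a -> ~~ (p %| B)%N.
    move=> pp; apply: contraTN => pB; rewrite /Bad /g /gbox rmorphD /= map_polyC map_polyZ /= BFp // cFp //.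
    by rewrite scale0r addr0 (eqp_size (gcdp1 _)) size_poly1.
  have Bad2 p a : prime p -> Bad p a -> (p ^ 2 <= x)%N.
    move=> pp H; apply: leq_trans (mmx a); apply: dvdn_leq => //.
    exact: (gcd_dvd_det mf sf pp (dvdp_gcdl _ _) (dvdp_gcdr _ _) H).
  pose G (a : {ffun 'I_d -> 'I_Y}) := [forall p : 'I_x.+1, prime p ==> ~~ Bad p a].
  have GP a p : G a -> prime p -> (size (gcdp (map_poly (intr : int -> 'F_p) f) (map_poly intr (g a))) <= 2)%N.
    move=> /forallP Ga pp; rewrite leqNgt; apply/negP => H.
    have px : (p < x.+1)%N.
      by rewrite ltnS; apply: leq_trans (Bad2 _ _ pp H); rewrite -mulnn leq_pmull ?prime_gt0.
    by have := Ga (Ordinal px); rewrite /= pp /= /Bad H.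
  have cG := good_fibres B0 Y0 HcE (x := x) (fun a => introT andP (conj (introT andP (conj (mm0 a) (mmx a))) (cop a))) GP.
  pose b n := if prime n && ~~ (n %| B)%N then #|[pred a | Bad n a]| else 0%N.
  have bad : (#|[predC G]| <= \sum_(n < x.+1) b n)%N.
    rewrite -sum1_card big_mkcond /=.
    rewrite (_ : \sum_(n < x.+1) b n = \sum_a \sum_(n < x.+1) ((prime n && ~~ (n %| B)%N) && Bad n a : nat))%N; last first.
      rewrite exchange_big /=; apply: eq_bigr => n _; rewrite /b; case: ifP => _ /=; last by rewrite big1.
      by rewrite -sum1_card big_mkcond /=; apply: eq_bigr => a _; rewrite inE; case: (Bad n a).
    apply: leq_sum => a _; rewrite inE; case: ifP => // /forallPn[n].
    rewrite negb_imply negbK => /andP[pn Bn].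
    by rewrite (bigD1 n) //= pn Bn (BadB _ _ pn Bn).
  have exq : exists q, (q ^ 2 <= x)%N by exists 0%N.
  have ubq q : (q ^ 2 <= x)%N -> (q <= x)%N by case: q => // q; apply: leq_trans; rewrite -mulnn leq_pmulr.
  case: (ex_maxnP exq ubq) => q qx qmax.
  have Hs : ((\sum_(n < x.+1) b n) * P0 <= 2 ^ d * (2 ^ d * C0 * Y ^ d) + 2 ^ d * q * P0)%N.
    apply: (@sparse_sum b _ _ P0 q x.+1 P00).
  - move=> n; rewrite /b; case: ifP => // /andP[pn nB].
    by rewrite -mulnDr; apply: (bad_count mf sf dom) => //; rewrite dvdzE.
  - move=> n Hn; rewrite /b; case: ifP => // /andP[pn nB]; case: Hn => [nP|qn].
      case/negP: nB; rewrite dvdn_mull // dvdn_fact // prime_gt0 //.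
    apply: eq_card0 => a; rewrite !inE; apply/negP => /(Bad2 _ _ pn) /qmax.
    by rewrite leqNgt qn.
  have q4 : (2 ^ d * 4 * q <= Y ^ d)%N.
    rewrite -(leq_exp2r _ _ (isT : (0 < 2)%N)) expnMn.
    apply: (@leq_trans ((2 ^ d * 4) ^ 2 * x)); first by rewrite leq_mul2l qx orbT.
    rewrite expnMn -expnM mulnC [(2 ^ _)%N](_ : _ = 4 ^ d)%N; last by rewrite mulnC expnM.
    rewrite /x -[((Y ^ d) ^ 2)%N]mulnn mulnAC leq_mul2r; apply/orP; right.
    apply: (@leq_trans Y); last by rewrite -{1}(expn1 Y) leq_pexp2l.
    by apply: leq_trans YC; rewrite mulnC [(4 ^ d * _)%N]mulnC.
  have tot : (#|G| + #|[predC G]| = Y ^ d)%N.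
    by rewrite cardC card_ffun !card_ord.
  have bad4 : (4 * \sum_(n < x.+1) b n <= Y ^ d + 2 ^ d * 4 * q)%N.
    rewrite -(leq_pmul2l (_ : 0 < 4 ^ d * C0)%N); last by rewrite muln_gt0 expn_gt0.
    move: Hs; rewrite /P0 (_ : 4 ^ d = 2 ^ d * 2 ^ d)%N; last by rewrite -expnMn.
    move: (\sum_(n < _) b n)%N (2 ^ d)%N (Y ^ d)%N; clear => s t y H; apply: (leq_trans _ (leq_trans H _)).
      by rewrite leq_eqVlt; apply/orP; left; apply/eqP; ring.
    by rewrite leq_eqVlt; apply/orP; left; apply/eqP; ring.
  have G2 : (Y ^ d <= 2 * #|G|)%N.
    move: bad bad4 q4 tot; move: (\sum_(n < _) b n)%N #|G| #|[predC G]| (2 ^ d * 4 * q)%N (Y ^ d)%N.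
    by clear; lia.
  by apply: (leq_trans G2); rewrite -mulnA leq_mul2l; apply/orP; right.
pose Y0 := (16 * 4 ^ d * C2)%N.
have Y00 : (0 < Y0)%N by rewrite muln_gt0 C20 muln_gt0 expn_gt0.
exists B, (C2 * 2 ^ d * (2 * NK))%N, (C2 * Y0 ^ d)%N; split=> //.
  by move=> p e pp pB; apply: rho_pow_bound Euv pp (BD _ pB).
move=> x x0.
have ex : exists Y, (C2 * Y ^ d <= x)%N by exists Y0.
have ub Y : (C2 * Y ^ d <= x)%N -> (Y <= x)%N.
  apply: leq_trans; case: Y => // Y.
  apply: (@leq_trans (Y.+1 ^ d)); last exact: leq_pmull.
  by rewrite -{1}(expn1 Y.+1) leq_pexp2l.
case: (ex_maxnP ex ub) => Y Yx Ymax.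
have Y0Y : (Y0 <= Y)%N by apply: Ymax.
have YY : (0 < Y)%N by apply: leq_trans Y0Y.
have xY : (x <= C2 * Y.+1 ^ d)%N.
  by rewrite leqNgt; apply/negP => /ltnW /Ymax; rewrite ltnn.
apply: (leq_trans xY); rewrite -[leqRHS]mulnA -[leqRHS]mulnA leq_mul2l; apply/orP; right.
apply: (@leq_trans ((2 * Y) ^ d)); first by rewrite leq_exp2r // mul2n -addnn -addn1 leq_add2l.
rewrite expnMn leq_mul2l; apply/orP; right.
apply: (leq_trans (main Y YY Y0Y)); rewrite leq_mul2l; apply/orP; right.
rewrite [leqRHS](@big_cat_nat _ _ _ (C2 * Y ^ d).+1) //= ?leq_addr //.
Qed.

End CountLower.

(** Isolates the input of the Dirichlet series argument, so that it also covers the constant 1, that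
    is, the Riemann zeta function. The lower bound runs over m prime to B because values at prime
    powers are controlled only away from B. *)
Definition prime_weight (r : nat -> nat) : Prop := exists D B C c x0 : nat,
  [/\ r 1 = 1%N,
      forall a b, (0 < a)%N -> (0 < b)%N -> coprime a b -> r (a * b) = (r a * r b)%N,
      forall x, (\sum_(1 <= m < x.+1) r m <= C * x)%N,
      (forall p, prime p -> (r p <= D)%N) /\
      (forall p e, prime p -> ~~ (p %| B)%N -> (r (p ^ e.+1) <= D)%N) &
      forall x, (x0 <= x)%N -> (x <= c * \sum_(1 <= m < x.+1 | coprime m B) r m)%N].

Lemma rho_weight (f : {poly int}) : f \is monic -> (1 < size f)%N ->
  (forall h g : {poly int}, (size h <= (size f).-1)%N -> (size g <= (size f).-1)%N ->
    rmodp (h * g) f = 0 -> h = 0 \/ g = 0) -> prime_weight (rho f).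
Proof.
move=> mf sf dom; have [C HC] := count_upper mf sf dom.
have [B [c [x0 [B0 Hp Hx]]]] := count_lower mf sf dom.
exists ((size f).-1 + B)%N, B, C, c, x0; split=> //.
- by rewrite /rho (eq_card (_ : _ =i predT)) ?card_ord // => i; rewrite inE dvd1z.
- exact: rho_mul.
- split=> p; last by move=> e pp pB; rewrite (leq_trans (Hp p e pp pB)) // leq_addr.
  move=> pp; have [pB|pB] := boolP (p %| B)%N; last first.
    by have := Hp p 0%N pp pB; rewrite expn1 => /leq_trans; apply; rewrite leq_addr.
  apply: (@leq_trans p); last by rewrite (leq_trans (dvdn_leq B0 pB)) // leq_addl.
  by rewrite /rho -[leqRHS]card_ord max_card.
Qed.

(** * Dirichlet series *)

Section NatPowers.
Variable R : realType.
Implicit Types (s t : R) (m n : nat).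

(* n ^ -s *)
Definition nps s n : R := expR (- (s * ln n%:R)).

Lemma nps_gt0 s n : 0 < nps s n. Proof. exact: expR_gt0. Qed.

Lemma nps_ge0 s n : 0 <= nps s n. Proof. exact: expR_ge0. Qed.

Lemma nps1 s : nps s 1 = 1. Proof. by rewrite /nps ln1 mulr0 oppr0 expR0. Qed.

Lemma npsM s m n : (0 < m)%N -> (0 < n)%N -> nps s (m * n) = nps s m * nps s n.
Proof.
move=> m0 n0; rewrite /nps natrM lnM ?posrE ?ltr0n // -expRD.
by congr expR; ring.
Qed.

Lemma npsX s m k : (0 < m)%N -> nps s (m ^ k) = nps s m ^+ k.
Proof.
move=> m0; elim: k => [|k IH]; first by rewrite expn0 nps1 expr0.
by rewrite expnS npsM ?expn_gt0 ?m0 // IH exprS.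
Qed.

Lemma nps_le s m n : 0 <= s -> (0 < m)%N -> (m <= n)%N -> nps s n <= nps s m.
Proof.
move=> s0 m0 mn; rewrite ler_expR lerN2 ler_wpM2l // ler_ln ?posrE ?ltr0n ?ler_nat //.
exact: leq_trans mn.
Qed.

Lemma nps_inv s n : 1 <= s -> (0 < n)%N -> nps s n <= n%:R^-1.
Proof.
move=> s1 n0; have np : 0 < n%:R :> R by rewrite ltr0n.
rewrite -[X in X^-1](lnK (_ : n%:R \is Num.pos)) ?posrE // -expRN ler_expR lerN2.
by rewrite ler_peMl // ln_ge0 // ler1n.
Qed.

Lemma nps_powR s n : (0 < n)%N -> n%:R `^ (- s) = nps s n.
Proof. by move=> n0; rewrite /powR pnatr_eq0 gtn_eqF // mulNr. Qed.

Lemma npsS s n : (0 < n)%N -> nps (s + 1) n = nps s n / n%:R.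
Proof.
move=> n0; have np : 0 < n%:R :> R by rewrite ltr0n.
rewrite -[X in _ / X](lnK (_ : n%:R \is Num.pos)) ?posrE // -expRN /nps -expRD.
by congr expR; ring.
Qed.

(** This and the next lemma replace the comparison of the sum with the integral of x^(-t-1); they
    come from 1 + u <= exp u and ln(1 + u) <= u. *)
Lemma nps_telescope_up t n : 0 < t -> (0 < n)%N ->
  t * nps (t + 1) n.+1 <= nps t n - nps t n.+1.
Proof.
move=> t0 n0; have np : 0 < n%:R :> R by rewrite ltr0n.
have np1 : 0 < n.+1%:R :> R by rewrite ltr0n.
have H : ln n%:R <= ln n.+1%:R - n.+1%:R^-1 :> R.
  have -> : n%:R = n.+1%:R * (1 + (- n.+1%:R^-1)) :> R.
    by rewrite mulrDr mulr1 mulrN divff ?gt_eqF // -natr1 addrK.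
  have lt1 : n.+1%:R^-1 < 1 :> R by rewrite invf_lt1 // ltr1n ltnS.
  rewrite lnM ?posrE ?subr_gt0 // lerD2l; apply: le_ln1Dx.
  by rewrite ltrN2.
rewrite npsS // lerBrDr.
have -> : nps t n = nps t n.+1 * expR (t * (ln n.+1%:R - ln n%:R)).
  by rewrite /nps -expRD; congr expR; ring.
apply: (@le_trans _ _ (nps t n.+1 * (1 + t * (ln n.+1%:R - ln n%:R)))); last first.
  by rewrite ler_pM2l ?nps_gt0 // expR_ge1Dx.
have := ler_wpM2l (mulr_ge0 (ltW t0) (nps_ge0 t n.+1)) H.
rewrite mulrBr; move: (nps t n.+1) (ln n%:R) (ln n.+1%:R) (n.+1%:R^-1) => a b c e.
by clear; lra.
Qed.

Lemma nps_telescope_down t n : 0 < t -> (0 < n)%N ->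
  nps t n - nps t n.+1 <= t * nps (t + 1) n.
Proof.
move=> t0 n0; have np : 0 < n%:R :> R by rewrite ltr0n.
have np1 : 0 < n.+1%:R :> R by rewrite ltr0n.
have H : ln n.+1%:R - ln n%:R <= n%:R^-1 :> R.
  have -> : n.+1%:R = n%:R * (1 + n%:R^-1) :> R.
    by rewrite mulrDr mulr1 divff ?gt_eqF // natr1.
  have ip : 0 < n%:R^-1 :> R by rewrite invr_gt0.
  rewrite lnM ?posrE ?addr_gt0 // addrC addKr; apply: le_ln1Dx.
  by apply: lt_trans ip; rewrite ltrN10.
rewrite npsS // lerBlDr -lerBlDl.
have -> : nps t n.+1 = nps t n * expR (- (t * (ln n.+1%:R - ln n%:R))).
  by rewrite /nps -expRD; congr expR; ring.
apply: (@le_trans _ _ (nps t n * (1 - t * (ln n.+1%:R - ln n%:R)))); last first.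
  by rewrite ler_pM2l ?nps_gt0 // expR_ge1Dx.
have := ler_wpM2l (mulr_ge0 (ltW t0) (nps_ge0 t n)) H.
move: (nps t n) (ln n%:R) (ln n.+1%:R) (n%:R^-1) => a b c e.
by clear; lra.
Qed.

Lemma zeta_upper t N : 0 < t -> \sum_(1 <= n < N.+1) nps (t + 1) n <= 1 + t^-1.
Proof.
move=> t0; case: N => [|N]; first by rewrite big_geq // addr_ge0 // invr_ge0 ltW.
suff : \sum_(1 <= n < N.+2) nps (t + 1) n <= 1 + t^-1 * (1 - nps t N.+1).
  move/le_trans; apply; rewrite lerD2l ler_piMr ?invr_ge0 ?(ltW t0) //.
  by rewrite lerBlDr lerDl nps_ge0.
elim: N => [|N IH]; first by rewrite big_nat1 !nps1 subrr mulr0 addr0.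
rewrite big_nat_recr //=; have := nps_telescope_up t0 (ltn0Sn N).
rewrite mulrC -ler_pdivlMr // mulrC => H; have := lerD IH H => /le_trans; apply.
by rewrite !mulrBr; lra.
Qed.

Lemma zeta_lower t : 0 < t -> exists N : nat, forall M, (N <= M)%N ->
  (2 * t)^-1 <= \sum_(1 <= n < M.+1) nps (t + 1) n.
Proof.
(* Beyond this N the power n^-t is at most 1/2, which leaves half of 1/t. *)
move=> t0; pose N := (Num.truncn (expR (t^-1 * ln 2))).+1; exists N => M NM.
have : t^-1 * (1 - nps t M.+1) <= \sum_(1 <= n < M.+1) nps (t + 1) n.
  elim: M {NM} => [|M IH]; first by rewrite nps1 subrr mulr0 big_geq.
  rewrite big_nat_recr //=; have := nps_telescope_down t0 (ltn0Sn M).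
  rewrite mulrC -ler_pdivrMr // mulrC => H; have := lerD IH H; apply: le_trans.
  by rewrite !mulrBr; lra.
apply: le_trans; rewrite invfM mulrC ler_pM2l ?invr_gt0 //.
suff : nps t M.+1 <= 2^-1 by lra.
rewrite -[X in X^-1](lnK (_ : 2 \is Num.pos)) ?posrE ?ltr0n // -expRN ler_expR lerN2.
rewrite mulrC -ler_pdivrMr // mulrC.
have e0 := expR_gt0 (t^-1 * ln (2 : R)).
rewrite -[leLHS]expRK ler_ln ?posrE ?ltr0n //.
apply: (@le_trans _ _ N%:R); last by rewrite ler_nat ltnW.
by apply: ltW; rewrite /N; case/andP: (truncn_itv (ltW e0)).
Qed.

(** Summation by parts; the induction carries the boundary term, which is nonnegative. *)
Lemma abel_le (a b u : nat -> R) N :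
  (forall n, 0 <= u n) -> (forall n, (0 < n)%N -> u n.+1 <= u n) ->
  (forall n, \sum_(1 <= m < n.+1) a m <= \sum_(1 <= m < n.+1) b m) ->
  \sum_(1 <= m < N.+1) a m * u m <= \sum_(1 <= m < N.+1) b m * u m.
Proof.
move=> u0 ud H; case: N => [|N]; first by rewrite !big_geq.
suff : (\sum_(1 <= m < N.+2) b m - \sum_(1 <= m < N.+2) a m) * u N.+1
   <= \sum_(1 <= m < N.+2) b m * u m - \sum_(1 <= m < N.+2) a m * u m.
  move=> le; rewrite -subr_ge0 (le_trans _ le) // mulr_ge0 // subr_ge0; exact: H.
elim: N => [|N IH]; first by rewrite !big_nat1 mulrBl.
have rec (h : nat -> R) : \sum_(1 <= m < N.+3) h m = \sum_(1 <= m < N.+2) h m + h N.+2.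
  by rewrite big_nat_recr.
rewrite !rec.
have := ler_wpM2l (_ : 0 <= \sum_(1 <= m < N.+2) b m - \sum_(1 <= m < N.+2) a m) (ud N.+1 isT).
rewrite subr_ge0 => /(_ (H N.+1)) H1; have := le_trans H1 IH.
move: (\sum_(1 <= m < N.+2) b m) (\sum_(1 <= m < N.+2) a m) (\sum_(1 <= m < N.+2) b m * u m) (\sum_(1 <= m < N.+2) a m * u m) => x1 x2 x3 x4.
by clear; lra.
Qed.

Lemma square_sum N : \sum_(1 <= n < N.+1) (n%:R ^+ 2)^-1 <= 2 :> R.
Proof.
have := zeta_upper N (@ltr01 R); rewrite invr1; apply: le_trans.
rewrite big_nat [leRHS]big_nat; apply: ler_sum => n /andP[n0 _].
rewrite !npsS // /nps; have np : 0 < n%:R :> R by rewrite ltr0n.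
by rewrite mul1r expRN lnK ?posrE // expr2 invfM.
Qed.

End NatPowers.

(** * Partial Euler products *)

Section Euler.
Variables (R : realType) (r : nat -> nat).
Hypothesis rM : forall a b, (0 < a)%N -> (0 < b)%N -> coprime a b -> r (a * b) = (r a * r b)%N.
Hypothesis r1 : r 1 = 1%N.
Variable s : R.
Let F n : R := (r n)%:R * nps s n.

Let F0 n : 0 <= F n. Proof. by rewrite mulr_ge0 ?ler0n ?nps_ge0. Qed.
Let FM a b : (0 < a)%N -> (0 < b)%N -> coprime a b -> F (a * b) = F a * F b.
Proof. by move=> a0 b0 ab; rewrite /F rM // npsM // natrM; ring. Qed.
Let F1 : F 1 = 1. Proof. by rewrite /F r1 nps1 mulr1. Qed.

(** Expanding the product gives the terms at distinct squarefree numbers. *)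
Lemma euler_upper y : exists N, \prod_(p < y | prime p) (1 + F p) <= \sum_(1 <= m < N.+1) F m.
Proof.
suff [L [uL HL le]] : exists L : seq nat, [/\ uniq L,
    forall m, m \in L -> (0 < m)%N && all (fun p => p < y)%N (primes m) &
    \prod_(p < y | prime p) (1 + F p) <= \sum_(m <- L) F m].
  pose N := (\max_(m <- L) m)%N; exists N; apply: (le_trans le).
  rewrite [leRHS](bigID (mem L)) /= -[leLHS]addr0 lerD ?sumr_ge0 //.
  rewrite -[leRHS]big_filter le_eqVlt; apply/orP; left; apply/eqP/perm_big.
  apply: uniq_perm => //; first by rewrite filter_uniq // iota_uniq.
  move=> m; rewrite mem_filter mem_index_iota; case mL : (m \in L) => //=.
  by have /andP[-> _] := HL m mL; rewrite ltnS /N (big_rem m) //= leq_maxl.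
elim: y => [|y [L [uL HL le]]].
  exists [:: 1%N]; split=> //; first by move=> m; rewrite inE => /eqP ->.
  by rewrite big_ord0 big_seq1 F1.
rewrite big_mkcond big_ord_recr -big_mkcond /=; case: ifP => py; last first.
  exists L; rewrite mulr1; split=> // m mL; have /andP[-> H] := HL m mL.
  by apply/allP => p /(allP H) /ltnW.
have yL m : m \in L -> coprime y m.
  move=> mL; have /andP[m0 /allP H] := HL m mL; rewrite prime_coprime //; apply/negP => ym.
  by have := H y; rewrite mem_primes py m0 ym ltnn => /(_ isT).
exists (L ++ map (muln y) L); split.
- rewrite cat_uniq uL map_inj_uniq ?uL ?andbT; last first.
    by move=> m m' /eqP; rewrite eqn_pmul2l ?prime_gt0 // => /eqP.
  apply/hasPn => _ /mapP[m mL ->]; apply/negP => /yL.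
  by rewrite coprimeMr /coprime gcdnn => /andP[/eqP E _]; rewrite E in py.
- move=> m; rewrite mem_cat => /orP[mL|/mapP[m' mL ->]].
    have /andP[-> H] := HL m mL; by apply/allP => p /(allP H) /ltnW.
  have /andP[m0 /allP H] := HL m' mL; rewrite muln_gt0 prime_gt0 // m0 /=.
  apply/allP => p; rewrite primesM ?m0 ?(prime_gt0 py) // => /orP[|/H /ltnW //].
  by rewrite primes_prime // inE => /eqP ->.
rewrite big_cat big_map /= mulrDr mulr1; apply: lerD => //.
rewrite (eq_big_seq (fun m => F m * F y)).
  by rewrite -mulr_suml ler_wpM2r.
by move=> m mL; have /andP[m0 _] := HL m mL; rewrite FM ?(prime_gt0 py) ?yL //; apply: mulrC.
Qed.

(** Induction on y splits m into its y-part and the rest; exponents up to M are enough because y^e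
    <= m <= M. *)
Lemma euler_lower (P : pred nat) M y :
  \sum_(1 <= m < M.+1 | all (fun p => P p && (p < y)%N) (primes m)) F m
  <= \prod_(p < y | prime p && P p) (1 + \sum_(1 <= e < M.+1) F (p ^ e)).
Proof.
elim: y => [|y IH].
  rewrite big_ord0; case: M => [|M]; first by rewrite big_geq.
  rewrite big_ltn_cond //= big1_seq ?addr0 ?F1 // => m /andP[H]; rewrite mem_index_iota => /andP[m2 _].
  have := pi_pdiv m; rewrite m2 /= => H2; have := allP H (pdiv m) H2.
  by rewrite ltn0 andbF.
rewrite [leRHS]big_mkcond big_ord_recr -big_mkcond /=; case: ifP => [/andP[py Py]|npy]; last first.
  rewrite mulr1 (le_trans _ IH) // big_nat_cond [leRHS]big_nat_cond.
  rewrite le_eqVlt; apply/orP; left; apply/eqP; apply: eq_bigl => m.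
  case: (_ <= _ < _)%N => //=; apply: eq_in_all => p; rewrite mem_primes => /and3P[pp _ _].
  rewrite ltnS leq_eqVlt; case: (eqVneq p y) => [E|//]; subst p.
  by rewrite ltnn orbF /= ; move: npy; rewrite pp /= => ->.
set Q := \prod_(p < y | _) _ in IH *.
pose A := [seq m <- index_iota 1 M.+1 | all (fun p => P p && (p < y)%N) (primes m)].
pose A' := [seq m <- index_iota 1 M.+1 | all (fun p => P p && (p < y.+1)%N) (primes m)].
have Aprop m : m \in A' -> [/\ (0 < m <= M)%N, (logn y m <= M)%N, (m`_y^')%N \in A & m = (y ^ logn y m * m`_y^')%N].
  rewrite mem_filter mem_index_iota ltnS => /andP[/allP H /andP[m0 mM]].
  have E : m = (y ^ logn y m * m`_y^')%N by rewrite -p_part partnC.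
  have mp0 : (0 < m`_y^')%N by rewrite part_gt0.
  split=> //; first by rewrite m0.
    apply: leq_trans mM; rewrite ltnW // (leq_trans (ltn_expl _ (prime_gt1 py))) //.
    by rewrite dvdn_leq // pfactor_dvdnn.
  rewrite mem_filter mem_index_iota ltnS mp0 (leq_trans _ mM) ?andbT; last by rewrite dvdn_leq // dvdn_part.
  apply/allP => p; rewrite primes_part mem_filter !inE => /andP[py' pm].
  by have /andP[-> /=] := H p pm; rewrite ltnS leq_eqVlt (negbTE py').
have copy m : m \in A -> coprime y m.
  rewrite mem_filter mem_index_iota => /andP[/allP H /andP[m0 _]].
  rewrite prime_coprime //; apply/negP => ym.
  by have := H y; rewrite mem_primes py m0 ym ltnn andbF => /(_ isT).
have Apos m : m \in A -> (0 < m)%N by rewrite mem_filter mem_index_iota => /and3P[].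
apply: (@le_trans _ _ (\sum_(m <- A) \sum_(0 <= e < M.+1) F (y ^ e) * F m)); last first.
  rewrite (eq_bigr (fun m => (\sum_(0 <= e < M.+1) F (y ^ e)) * F m)); last by move=> m _; rewrite mulr_suml.
  have -> : \sum_(0 <= e < M.+1) F (y ^ e) = 1 + \sum_(1 <= e < M.+1) F (y ^ e).
    by rewrite big_ltn // expn0 F1.
  rewrite -mulr_sumr mulrC ler_wpM2r //.
    by rewrite addr_ge0 // sumr_ge0.
  by rewrite big_filter.
rewrite -big_filter -/A'.
pose h m := (m`_y^', logn y m)%N.
have hinj : {in A' &, injective h}.
  by move=> m m' /Aprop[_ _ _ E] /Aprop[_ _ _ E'] [E1 E2]; rewrite E E' E1 E2.
rewrite (eq_big_seq (fun m => F (y ^ (h m).2) * F (h m).1)); last first.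
  move=> m /Aprop[_ _ mA E]; rewrite {1}E FM ?expn_gt0 ?(prime_gt0 py) ?(Apos _ mA) //.
  by rewrite coprimeXl ?copy.
rewrite -(big_map h predT (fun k => F (y ^ k.2) * F k.1)).
rewrite (_ : \sum_(m <- A) _ = \sum_(k <- [seq (m, e) | m <- A, e <- index_iota 0 M.+1]) F (y ^ k.2) * F k.1); last first.
  by rewrite big_allpairs.
set B := [seq (m, e) | m <- A, e <- _].
have uB : uniq B.
  apply: allpairs_uniq; rewrite ?iota_uniq ?filter_uniq ?iota_uniq //.
  by move=> [a b] [a' b'] _ _ /= [-> ->].
rewrite [leRHS](bigID (mem (map h A'))) /= -[leLHS]addr0 lerD ?sumr_ge0 //; last first.
  by move=> k _; rewrite mulr_ge0.
rewrite -[leRHS]big_filter le_eqVlt; apply/orP; left; apply/eqP/perm_big.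
apply: uniq_perm; rewrite ?filter_uniq ?map_inj_in_uniq ?filter_uniq ?iota_uniq //.
move=> k; rewrite mem_filter; case kh : (k \in map h A') => //=.
apply/esym; case/mapP: kh => m /Aprop[_ lM mA _] ->.
by apply/allpairsP; exists (h m); rewrite /= mA mem_index_iota /= ltnS lM.
Qed.

End Euler.

(** * Sums over primes as s tends to 1 *)

Section WeightSums.
Variable R : realType.
Implicit Types (t : R) (r : nat -> nat).

(** From exp(-v) >= 1 - v at v = x - x^2 and (1 + x)(1 - x + x^2) = 1 + x^3. *)
Lemma expR_le1D (x : R) : 0 <= x -> expR (x - x ^+ 2) <= 1 + x.
Proof.
move=> x0; have := expR_ge1Dx (- (x - x ^+ 2)).
have p1 : 0 < 1 + - (x - x ^+ 2) by have := sqr_ge0 (x - 2^-1); lra.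
rewrite expRN -[X in X <= _]invrK lef_pV2 ?posrE ?expR_gt0 ?invr_gt0 // => /le_trans; apply.
rewrite -[leLHS]mul1r ler_pdivrMr // (_ : (1 + x) * _ = 1 + x ^+ 3); last by ring.
by rewrite lerDl exprn_ge0.
Qed.

Lemma prime_sum_le (g : nat -> R) y : (forall n, 0 <= g n) ->
  \sum_(p < y | prime p) g p <= \sum_(1 <= n < y.+1) g n.
Proof.
move=> g0; rewrite -(big_mkord prime g).
case: y => [|y]; first by rewrite !big_geq.
rewrite big_ltn_cond //= [leRHS]big_nat_recr //= -[leLHS]addr0 lerD //.
by rewrite big_mkcond; apply: ler_sum => n _; case: ifP.
Qed.

Lemma expR_bigsum (I : finType) (P : pred I) (g : I -> R) :
  expR (\sum_(i | P i) g i) = \prod_(i | P i) expR (g i).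
Proof. by apply: (big_morph _ (@expRD R) (expR0 _)). Qed.

(** Linear growth makes the Dirichlet series, hence the Euler product, O(1/t). Taking logarithms
    costs only the sum of squares, at most 2 D^2 uniformly in t. *)
Lemma weight_upper r : prime_weight r -> exists A : R, forall t, 0 < t <= 1 ->
  forall y, \sum_(p < y | prime p) (r p)%:R * nps (t + 1) p <= A - ln t.
Proof.
move=> [D [B [C [c [x0 [r1 rM HC [rD _] _]]]]]].
exists (ln (C.+1%:R * 2) + D%:R ^+ 2 * 2) => t /andP[t0 t1] y.
have s1 : 1 <= t + 1 by lra.
have [N HN] := euler_upper rM r1 (t + 1) y.
pose F p : R := (r p)%:R * nps (t + 1) p.
have F0 p : 0 <= F p by rewrite mulr_ge0 ?ler0n ?nps_ge0.
have up : \prod_(p < y | prime p) (1 + F p) <= C.+1%:R * 2 / t.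
  apply: (le_trans HN).
  apply: (@le_trans _ _ (\sum_(1 <= m < N.+1) C.+1%:R * nps (t + 1) m)).
    apply: (@abel_le R (fun m => (r m)%:R) (fun=> C.+1%:R) (nps (t + 1))).
    - exact: nps_ge0.
    - by move=> n n0; apply: nps_le => //; lra.
    move=> n; rewrite -natr_sum sumr_const_nat subn1 /= -mulrnA ler_nat.
    by rewrite (leq_trans (HC n)) // leq_mul2r leqnSn orbT.
  rewrite -mulr_sumr -mulrA ler_wpM2l ?ler0n //; apply: (le_trans (zeta_upper _ t0)).
  by rewrite ler_pdivlMr // mulrDl mulVf ?gt_eqF // mul1r; lra.
have lowr : expR (\sum_(p < y | prime p) (F p - F p ^+ 2)) <= \prod_(p < y | prime p) (1 + F p).
  rewrite expR_bigsum; apply: ler_prod => p _; rewrite expR_ge0 /=; exact: expR_le1D.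
have sq : \sum_(p < y | prime p) F p ^+ 2 <= D%:R ^+ 2 * 2.
  apply: (@le_trans _ _ (\sum_(p < y | prime p) D%:R ^+ 2 * (p%:R ^+ 2)^-1)).
    apply: ler_sum => p pp; rewrite -exprVn -exprMn ler_sqr ?nnegrE ?mulr_ge0 ?ler0n ?invr_ge0 ?nps_ge0 //.
    by rewrite ler_pM ?ler0n ?nps_ge0 ?ler_nat ?rD // nps_inv // prime_gt0.
  rewrite -mulr_sumr ler_wpM2l ?sqr_ge0 //.
  apply: (le_trans _ (square_sum R y)); apply: (@prime_sum_le (fun n => (n%:R ^+ 2)^-1)) => n.
  by rewrite invr_ge0 sqr_ge0.
have Cp : 0 < C.+1%:R * 2 :> R by rewrite mulr_gt0 ?ltr0n.
have := le_trans lowr up; rewrite -[leRHS]lnK ?posrE ?divr_gt0 // ler_expR ln_div ?posrE //.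
rewrite sumrB; move: sq; rewrite -/F; move: (\sum_(p < y | prime p) F p) (\sum_(p < y | prime p) F p ^+ 2).
move: (ln (C.+1%:R * 2)) (ln t) (D%:R ^+ 2) => a b e x z; clear; lra.
Qed.

Lemma geometric_tail (q : R) K : 0 <= q -> q <= 2^-1 -> \sum_(2 <= e < K) q ^+ e <= 2 * q ^+ 2.
Proof.
move=> q0 q1; have [K2|K2] := leqP K 2; first by rewrite big_geq // mulr_ge0 ?sqr_ge0.
rewrite -(subnKC K2); move: (K - 3)%N => k; rewrite [X in \sum_(2 <= _ < X) _](_ : _ = k.+3) ?addSn ?addn0 //.
suff : \sum_(2 <= e < k.+3) q ^+ e <= 2 * q ^+ 2 - 2 * q ^+ k.+3.
  by move/le_trans; apply; rewrite lerBlDr lerDl mulr_ge0 ?exprn_ge0.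
have step n : q ^+ n <= 2 * q ^+ n - 2 * q ^+ n.+1.
  rewrite exprS; have := ler_wpM2r (exprn_ge0 n q0) q1; move: (q ^+ n) => z; lra.
elim: k => [|k IH]; first by rewrite big_nat1 step.
by rewrite big_nat_recr //=; have H := lerD IH (step k.+3); apply: (le_trans H); lra.
Qed.

(** Exponents at least 2 add at most 2 D / p^2 to the Euler factor at p, hence a bounded factor
    overall, while the series over m prime to B is at least of order 1/t. *)
Lemma weight_lower r : prime_weight r -> exists A : R, forall t, 0 < t <= 1 ->
  exists y, - ln t - A <= \sum_(p < y | prime p) (r p)%:R * nps (t + 1) p.
Proof.
move=> [D [B [C [c [x0 [r1 rM _ [rD rDp] Hx]]]]]].
pose A0 : R := 2 * (c + x0).+1%:R.
exists (ln A0 + D%:R * 4) => t /andP[t0 t1].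
have s1 : 1 <= t + 1 by lra.
have [M HM] := zeta_lower t0; exists M.+1.
pose F p : R := (r p)%:R * nps (t + 1) p.
have F0 p : 0 <= F p by rewrite mulr_ge0 ?ler0n ?nps_ge0.
pose Sg := \sum_(m < M.+1 | prime m) F m.
pose E := expR (Sg + D%:R * 4).
have eul : \sum_(1 <= m < M.+1 | coprime m B) F m <= E.
  apply: (@le_trans _ _ (\sum_(1 <= m < M.+1 | all (fun p => ~~ (p %| B)%N && (p < M.+1)%N) (primes m)) F m)).
    rewrite big_nat_cond [leRHS]big_nat_cond big_mkcond [leRHS]big_mkcond; apply: ler_sum => m _.
    case: ifP => [/andP[/andP[m1 mM] cm]|_]; last by case: ifP.
    rewrite m1 mM /= ifT //; apply/allP => p; rewrite mem_primes => /and3P[pp m0 pm].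
    rewrite (leq_ltn_trans (dvdn_leq m0 pm) mM) andbT; apply/negP => pB.
    have := dvdn_gcd p m B; rewrite pm pB (eqP cm) dvdn1 => /eqP Ep.
    by rewrite Ep in pp.
  apply: (le_trans (euler_lower rM r1 (t + 1) (fun p => ~~ (p %| B)%N) M M.+1)).
  apply: (@le_trans _ _ (expR (\sum_(p < M.+1 | prime p && ~~ (p %| B)%N) (F p + D%:R * (2 * (p%:R ^+ 2)^-1))))).
    rewrite expR_bigsum; apply: ler_prod => p /andP[pp pB].
    have p0 := prime_gt0 pp; have pp0 : 0 < p%:R :> R by rewrite ltr0n.
    rewrite addr_ge0 ?sumr_ge0 //=; last by move=> e _; exact: F0.
    apply: le_trans (expR_ge1Dx _); rewrite lerD2l.
    case: M {HM Sg E} => [|M] in p pp pB p0 pp0 *.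
      by rewrite big_geq // addr_ge0 // !mulr_ge0 ?ler0n ?invr_ge0 ?sqr_ge0.
    rewrite big_ltn // expn1 lerD2l.
    apply: (@le_trans _ _ (\sum_(2 <= e < M.+2) D%:R * p%:R^-1 ^+ e)).
      rewrite big_nat_cond [leRHS]big_nat_cond; apply: ler_sum => e /andP[/andP[e2 _] _].
      rewrite npsX // ler_pM ?ler0n ?exprn_ge0 ?nps_ge0 //.
        by rewrite ler_nat; case: e e2 => // e _; apply: rDp.
      by rewrite ler_pXn2r ?nnegrE ?nps_ge0 ?invr_ge0 ?ler0n ?nps_inv //; apply: ltnW.
    rewrite -mulr_sumr ler_wpM2l ?ler0n // -exprVn geometric_tail ?invr_ge0 ?ler0n //.
    by rewrite lef_pV2 ?posrE ?ltr0n // ler_nat prime_gt1.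
  rewrite ler_expR big_split /=; apply: lerD.
    by rewrite big_mkcond [leRHS]big_mkcond; apply: ler_sum => p _; case: prime; case: (_ %| _)%N.
  rewrite -!mulr_sumr ler_wpM2l ?ler0n //.
  rewrite (_ : 4 = 2 * 2 :> R); last by ring.
  rewrite ler_wpM2l //; apply: le_trans (square_sum R M.+1).
  apply: le_trans (@prime_sum_le (fun n => (n%:R ^+ 2)^-1) M.+1 _); last by move=> n; rewrite invr_ge0 sqr_ge0.
  rewrite big_mkcond [leRHS]big_mkcond; apply: ler_sum => p _.
  by case: prime; case: (_ %| _)%N => //=; rewrite invr_ge0 sqr_ge0.
have E1 : 1 <= E.
  by rewrite -expR0 ler_expR addr_ge0 ?sumr_ge0 // mulr_ge0 ?ler0n.
have main : (2 * t)^-1 <= (c + x0).+1%:R * E.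
  apply: (le_trans (HM M (leqnn _))).
  (* The extra mass x0 at m = 1 makes the comparison of partial sums valid below the threshold x0 as
     well. *)
  pose b m : R := c%:R * (if coprime m B then r m else 0%N)%:R + (if m == 1%N then x0 else 0%N)%:R.
  have Hb n : \sum_(1 <= m < n.+1) b m = (c * (\sum_(1 <= m < n.+1 | coprime m B) r m) + (if (0 < n)%N then x0 else 0))%N%:R.
    rewrite big_split /= -mulr_sumr -natr_sum -big_mkcond natrD natrM; congr (_ + _).
    rewrite -natr_sum; congr _%:R; case: n => [|n]; first by rewrite big_geq.
    rewrite big_ltn //= big_nat_cond big1 ?addn0 // => m /andP[/andP[m2 _] _].
    by rewrite gtn_eqF.
  apply: (@le_trans _ _ (\sum_(1 <= m < M.+1) b m * nps (t + 1) m)).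
    rewrite (eq_bigr (fun m => 1 * nps (t + 1) m)); last by move=> m _; rewrite mul1r.
    apply: abel_le; [exact: nps_ge0 | by move=> n n0; apply: nps_le => //; lra |].
    move=> n; rewrite Hb sumr_const_nat subn1 /= ler_nat.
    have [xn|nx] := leqP x0 n; first by rewrite (leq_trans (Hx _ xn)) // leq_addr.
    by case: n nx => // n nx; rewrite (leq_trans (ltnW nx)) // leq_addl.
  have -> : \sum_(1 <= m < M.+1) b m * nps (t + 1) m =
     c%:R * \sum_(1 <= m < M.+1 | coprime m B) F m + \sum_(1 <= m < M.+1) (if m == 1%N then x0 else 0%N)%:R * nps (t + 1) m.
    rewrite [in RHS]big_mkcond mulr_sumr -big_split /=; apply: eq_bigr => m _.
    by rewrite /b /F mulrDl; congr (_ + _); case: ifP => _; rewrite ?mulr0 ?mul0r ?mulrA.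
  have x0b : \sum_(1 <= m < M.+1) (if m == 1%N then x0 else 0%N)%:R * nps (t + 1) m <= x0%:R.
    case: (M) => [|M']; first by rewrite big_geq // ler0n.
    rewrite big_ltn //= nps1 mulr1 big_nat_cond big1 ?addr0 // => m /andP[/andP[m2 _] _].
    by rewrite gtn_eqF // mul0r.
  apply: (le_trans (lerD (ler_wpM2l (ler0n R c) eul) x0b)).
  rewrite -natr1 natrD; have := ler_wpM2l (ler0n R x0) E1; move: E1.
  by move: (E) (c%:R : R) (x0%:R : R) => z a1 a2; clear; lra.
have A00 : 0 < A0 by rewrite mulr_gt0 ?ltr0n.
have : t^-1 <= A0 * E.
  by have := ler_wpM2l (_ : 0 <= 2 :> R) main; rewrite invfM mulrA divff ?mul1r ?mulrA ?gt_eqF //; apply.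
have ti : 0 < t^-1 by rewrite invr_gt0.
rewrite -ler_ln ?posrE ?mulr_gt0 ?expR_gt0 // lnM ?posrE ?expR_gt0 // lnV ?posrE // /E expRK.
by rewrite -/Sg; move: (ln A0) (ln t) (D%:R) => a b e; clear; lra.
Qed.

(** Dirichlet density zero for a set of rational primes, the sum over all primes being - ln t +
    O(1); stated on finite sums, uniformly in y. *)
Definition thin (T : pred nat) : Prop := forall e : R, 0 < e -> exists2 dl : R, 0 < dl &
  forall t, 0 < t < dl -> forall y, \sum_(p < y | prime p && T p) nps (t + 1) p <= e * (- ln t).

(* Both sides are compared as t tends to 0, where a weight contributes - ln t + O(1). *)
Lemma weight_compare r r' (T : pred nat) l N : prime_weight r -> prime_weight r' -> thin T ->
  (1 < l)%N -> exists p, [/\ prime p, (N < p)%N, ~~ T p & (r' p < l * r p)%N].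
Proof.
move=> wr wr' thT l1; apply: contrapT => no.
have dom p : prime p -> (N < p)%N -> ~~ T p -> (l * r p <= r' p)%N.
  by move=> pp Np Tp; rewrite leqNgt; apply/negP => lt; apply: no; exists p.
have [A1 H1] := weight_upper wr'; have [A2 H2] := weight_lower wr.
have [D [_ [_ [_ [_ [_ _ _ [rD _] _]]]]]] := wr.
(* With L = - ln t, this e lets the primes of T contribute at most L/2, and K below keeps all
   constants under L/2; this contradicts l L >= 2 L. *)
pose e : R := (2 * (l * D.+1)%:R)^-1.
have lD : 0 < (l * D.+1)%:R :> R by rewrite ltr0n muln_gt0 ltnW.
have e0 : 0 < e by rewrite invr_gt0 mulr_gt0.
have [dl dl0 Hdl] := thT e e0.
pose K : R := `|l%:R * A2 + A1 + (l * D * N.+1)%:R| + 1.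
pose t := Num.min (Num.min (dl / 2) 1) (expR (- (2 * K))).
have t0 : 0 < t by rewrite !lt_min divr_gt0 ?ltr01 ?expR_gt0 // ltr0n.
have t1 : t <= 1 by rewrite !ge_min lexx orbT.
have tdl : t < dl.
  by apply: (@le_lt_trans _ _ (dl / 2)); [rewrite !ge_min lexx | rewrite ltr_pdivrMr // ltr_pMr // ltr1n].
have lt : 2 * K <= - ln t.
  rewrite lerNr -[leRHS](expRK (- (2 * K))) ler_ln ?posrE ?expR_gt0 //.
  by rewrite !ge_min lexx !orbT.
have [y Hy] := H2 t (introT andP (conj t0 t1)).
have Hu := H1 t (introT andP (conj t0 t1)) y.
have HT := Hdl t (introT andP (conj t0 tdl)) y.
have s0 : 0 <= t + 1 by lra.
have split : l%:R * \sum_(p < y | prime p) (r p)%:R * nps (t + 1) p <=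
   (l * D * N.+1)%:R + (l * D)%:R * \sum_(p < y | prime p && T p) nps (t + 1) p
   + \sum_(p < y | prime p) (r' p)%:R * nps (t + 1) p.
  apply: (@le_trans _ _ (\sum_(p < y | prime p) ((if (p <= N)%N then (l * D)%:R else 0)
     + (if T p then (l * D)%:R * nps (t + 1) p else 0) + (r' p)%:R * nps (t + 1) p))).
    rewrite mulr_sumr; apply: ler_sum => p pp; rewrite mulrA -natrM.
    have n0 := nps_ge0 (t + 1) p; have r0 : 0 <= (r' p)%:R * nps (t + 1) p by rewrite mulr_ge0 ?ler0n.
    have lDn : (l * r p)%:R * nps (t + 1) p <= (l * D)%:R * nps (t + 1) p.
      by rewrite ler_wpM2r // ler_nat leq_mul2l rD // orbT.
    have [pN|Np] := leqP p N.
      have nn : (l * D)%:R * nps (t + 1) p <= (l * D)%:R.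
        rewrite ler_piMr ?ler0n //.
        by have := nps_le s0 (isT : (0 < 1)%N) (prime_gt0 pp); rewrite nps1.
      rewrite (le_trans lDn) // (le_trans nn) // -addrA lerDl addr_ge0 //.
      by case: ifP => // _; rewrite mulr_ge0 ?ler0n.
    rewrite add0r; case: ifP => Tp; first by rewrite (le_trans lDn) // lerDl.
    by rewrite add0r ler_wpM2r // ler_nat dom // Tp.
  rewrite !big_split /= lerD2r lerD //; last first.
    by rewrite mulr_sumr -big_mkcondr.
  apply: (le_trans (@prime_sum_le (fun p => if (p <= N)%N then (l * D)%:R else 0) y _)).
    by move=> p; case: ifP => // _; rewrite ler0n.
  apply: (@le_trans _ _ ((l * D)%:R * (minn y N)%:R)); last first.
    by rewrite -natrM ler_nat leq_mul2l (leq_trans (geq_minr _ _)) ?orbT.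
  elim: (y) => [|n IH]; first by rewrite big_geq // min0n mulr0.
  rewrite big_nat_recr //=; have [nN|Nn] := ltnP n N.
    rewrite (minn_idPl nN) -natr1 mulrDr mulr1 lerD2r.
    by move: IH; rewrite (minn_idPl (ltnW nN)).
  by rewrite addr0 (minn_idPr (leq_trans Nn (leqnSn _))); move: IH; rewrite (minn_idPr Nn).
set S := \sum_(p < y | prime p) _ in Hy split; set U := \sum_(p < y | prime p) _ in Hu split.
set Tt := \sum_(p < y | _) _ in HT split; set L := - ln t in Hy HT lt.
have L0 : 0 <= L by apply: le_trans lt; rewrite mulr_ge0 // addr_ge0.
have h1 : 2 * L <= l%:R * L by rewrite ler_wpM2r // ler_nat.
have h2 : (l * D)%:R * Tt <= 2^-1 * L.
  apply: (le_trans (ler_wpM2l (ler0n R (l * D)) HT)); rewrite mulrA ler_wpM2r //.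
  rewrite /e invfM mulrCA ler_piMr ?invr_ge0 // ler_pdivrMr // mul1r ler_nat leq_mul2l leqnSn orbT //.
have h3 := ler_wpM2l (ler0n R l) Hy.
have h4 := ler_norm (l%:R * A2 + A1 + (l * D * N.+1)%:R); rewrite mulrBr in h3.
have h5 : U <= A1 + L by rewrite /L.
move: split h1 h2 h3 h4 h5 lt; rewrite /K.
by move: (S) (U) (Tt) (L) => a1 a2 a3 a4; clear; lra.
Qed.

End WeightSums.

(** * Density of Frobenius elements *)

Section GaloisGroup.
Variable W : algClosure rat.
Local Notation G := (absGal W).
Implicit Types (s t g h : G) (N H : set G).

Lemma galP s t : (forall z, s z = t z) -> s = t. Proof. by move=> H; apply/absGal_eqP. Qed.

Lemma gmulA s t g : absGal_mul s (absGal_mul t g) = absGal_mul (absGal_mul s t) g.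
Proof. exact: galP. Qed.

Lemma g1mul s : absGal_mul (absGal1 W) s = s.
Proof. by apply: galP => z /=; rewrite absGal1E. Qed.

Lemma gVmul s : absGal_mul (absGalV s) s = absGal1 W.
Proof. by apply: galP => z /=; rewrite absGal1E absGalVK. Qed.

Lemma gmulV s : absGal_mul s (absGalV s) = absGal1 W.
Proof. by apply: galP => z /=; rewrite absGal1E absGalKV. Qed.

Lemma gX s n z : absGalX s n z = iter n s z. Proof. exact: absGalXE. Qed.

Lemma gXD s m n : absGalX s (m + n) = absGal_mul (absGalX s m) (absGalX s n).
Proof. by apply: galP => z /=; rewrite !gX iterD. Qed.

Definition gconj g s : G := absGal_mul g (absGal_mul s (absGalV g)).

Record open_subgroup H : Prop := OpenSubgroup {
  osg1 : H (absGal1 W);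
  osgM : forall s t, H s -> H t -> H (absGal_mul s t);
  osgV : forall s, H s -> H (absGalV s);
  osgO : exists r : seq W, forall s, (forall z, z \in r -> s z = z) -> H s }.

Definition normal_in N := forall g s, N s -> N (gconj g s).

Lemma osgX H s n : open_subgroup H -> H s -> H (absGalX s n).
Proof. by move=> oH Hs; elim: n => [|n IH] /=; [apply: osg1 | apply: osgM]. Qed.

Lemma osg_mull H s t : open_subgroup H -> H s -> H (absGal_mul s t) -> H t.
Proof.
move=> oH Hs Hst; have := osgM oH (osgV oH Hs) Hst.
by rewrite gmulA gVmul g1mul.
Qed.

Lemma alg_integral (z : W) : exists2 m : nat, (0 < m)%N & integers W (m%:R * z).
Proof. exact: scale_integral (algClosureP z). Qed.

Lemma W_char0 : [pchar W] =i pred0. Proof. exact: char0_emb (algClosure_emb W) char0_rat. Qed.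

Lemma W_nat_neq0 n : (0 < n)%N -> n%:R != 0 :> W.
Proof. by move=> n0; have /pcharf0P -> := W_char0; rewrite -lt0n. Qed.

Lemma W_nat_inj : injective (fun n : nat => n%:R : W).
Proof.
move=> a b /eqP; rewrite -!(rmorph_nat (algClosure_emb W)) => /eqP/fmorph_inj/eqP.
by rewrite eqr_nat => /eqP.
Qed.

Lemma W_int_inj : injective (intr : int -> W).
Proof.
move=> a b /eqP; rewrite -!(rmorph_int (algClosure_emb W)) => /eqP/fmorph_inj.
exact: intr_inj.
Qed.

Lemma gal_natM s n z : s (n%:R * z) = n%:R * s z.
Proof. by rewrite rmorphM rmorph_nat. Qed.

Lemma gal_integral s z : integers W (s z) <-> integers W z.
Proof. exact: integers_fmorph. Qed.

Lemma orbit_list (e : W) : exists O : seq W, uniq O /\ forall y, y \in O <-> exists s : G, y = s e.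
Proof.
apply: (absGal_orbit char0_rat (f := fun s : G => s e) (r := [:: e])) => s t; apply.
by rewrite inE.
Qed.

(* A generic specialization of the orbit polynomial of a primitive element. *)
Lemma subgroup_generator H : open_subgroup H ->
  exists2 e, integers W e & forall s, s e = e <-> H s.
Proof.
move=> oH; have [r Hr] := osgO oH.
have [e1 He1] := primitive_list char0_rat (@algClosureP _ W) r.
have [m m0 me] := alg_integral e1; pose e0 := m%:R * e1.
have stab0 s : s e0 = e0 -> H s.
  rewrite gal_natM => /(mulfI (W_nat_neq0 m0)) E; apply: Hr => z zr.
  have [P <-] := He1 z zr.
  rewrite -horner_map E -map_poly_comp; congr (_.[_]).
  by apply: eq_map_poly => a /=; rewrite absGal_fix.
have [ O [uO HO]] := orbit_list e0.
pose OH := [seq z <- O | `[< exists2 s, H s & z = s e0 >]].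
have OHP z : z \in OH <-> exists2 s, H s & z = s e0.
  rewrite mem_filter; split=> [/andP[/asboolP //]|Hz]; apply/andP; split; first exact/asboolP.
  by apply/HO; case: Hz => s _ ->; exists s.
pose P := \prod_(z <- OH) ('X - z%:P).
have mapP_ s : map_poly s P = \prod_(z <- OH) ('X - (s z)%:P).
  by rewrite rmorph_prod; apply: eq_bigr => z _; rewrite rmorphB /= map_polyX map_polyC.
have stabP s : map_poly s P = P <-> H s.
  split=> [E|Hs].
    have : root P (s e0).
      rewrite -E mapP_ -(big_map s predT (fun z => 'X - z%:P)) root_prod_XsubC map_f //.
      by apply/OHP; exists (absGal1 W); [exact: osg1 | rewrite absGal1E].
    rewrite root_prod_XsubC => /OHP[t Ht Et].
    have Hts : H (absGal_mul (absGalV t) s) by apply: stab0 => /=; rewrite Et absGalVK.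
    by have := osgM oH Ht Hts; rewrite gmulA gmulV g1mul.
  rewrite mapP_ -(big_map s predT (fun z => 'X - z%:P)); apply: perm_big.
  apply: uniq_perm; rewrite ?(map_inj_uniq (fmorph_inj s)) ?filter_uniq // => z.
  apply/idP/idP => [/mapP[y /OHP[t Ht ->] ->]|/OHP[t Ht ->]].
    by apply/OHP; exists (absGal_mul s t) => //; apply: osgM.
  apply/mapP; exists (absGalV s (t e0)); last by rewrite absGalKV.
  by apply/OHP; exists (absGal_mul (absGalV s) t) => //; apply: osgM => //; apply: osgV.
have [|OP [uOP HOP]] := @absGal_orbit _ W char0_rat _ (fun s => map_poly s P) P.
  by move=> s t st; apply/polyP => n; rewrite !coef_map; have [lt|le] := ltnP n (size P);
    [apply: st; apply: mem_nth | rewrite nth_default // !raddf0].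
(* The roots of D are the points at which some other conjugate of P takes the same value as P. *)
pose D := \prod_(Z <- OP | Z != P) (Z - P).
have D0 : D != 0.
  by rewrite prodf_seq_neq0; apply/allP => Z _; apply/implyP; rewrite subr_eq0.
have [c Hc] : exists c : nat, ~~ root D c%:R.
  apply: contrapT => no.
  have := @max_poly_roots _ D [seq n%:R | n <- iota 0 (size D)] D0.
  rewrite size_map size_iota ltnn => H1; suff : false by [].
  apply: H1.
    by apply/allP => _ /mapP[n _ ->]; apply/negPn/negP => H2; apply: no; exists n.
  by rewrite map_inj_uniq ?iota_uniq //; apply: W_nat_inj.
exists P.[c%:R].
  rewrite /P horner_prod big_seq; apply: (big_ind (@integers W)).
  - exact: integers1.
  - exact: integersM.
  move=> z /OHP[s _ ->]; rewrite hornerXsubC; apply: integersB; first exact: integers_nat.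
  exact/gal_integral.
move=> s; split=> [E|/stabP EP].
  apply/stabP; apply/eqP/negPn/negP => ne; case/negP: Hc; rewrite /root /D horner_prod.
  rewrite prodf_seq_eq0; apply/hasP; exists (map_poly s P); first by apply/HOP; exists s.
  by rewrite ne hornerD hornerN subr_eq0 /= -{1}(rmorph_nat s) horner_map E.
by rewrite -horner_map rmorph_nat EP.
Qed.

(** The product over the conjugates is Galois invariant and integral, so it comes from Z[X]. A
    polynomial of smaller degree that vanishes at e vanishes at every conjugate; hence Z[X]/(f) is a
    domain and [rho_weight] applies. *)
Lemma int_min_poly (e : W) : integers W e -> exists (f : {poly int}) (O : seq W),
  [/\ uniq O, forall y, y \in O <-> exists s : G, y = s e, f \is monic,
      map_poly intr f = \prod_(z <- O) ('X - z%:P) & prime_weight (rho f)].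
Proof.
move=> Ie; have [ O [uO HO]] := orbit_list e.
pose Z := \prod_(z <- O) ('X - z%:P).
have eO : e \in O by apply/HO; exists (absGal1 W); rewrite absGal1E.
have [c Ec] : exists c : {poly rat}, Z = map_poly (algClosure_emb W) c.
  apply: (fixed_poly char0_rat) => s.
  rewrite rmorph_prod (eq_bigr (fun z => 'X - (s z)%:P)); last first.
    by move=> z _; rewrite rmorphB /= map_polyX map_polyC.
  rewrite -(big_map s predT (fun z => 'X - z%:P)); apply: perm_big.
  apply: uniq_perm; rewrite ?(map_inj_uniq (fmorph_inj s)) // => z.
  apply/idP/idP => [/mapP[y /HO[t ->] ->]|/HO[t ->]].
    by apply/HO; exists (absGal_mul s t).
  apply/mapP; exists (absGalV s (t e)); last by rewrite absGalKV.
  by apply/HO; exists (absGal_mul (absGalV s) t).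
have ZI : polyI Z.
  rewrite /Z big_seq; apply: (big_ind (@polyI W)); [exact: polyI1 | exact: polyIM |].
  move=> z /HO[s ->] n; rewrite coefB coefX coefC; apply: integersB; first exact: integers_nat.
  by case: eqP => _; [apply/gal_integral | exact: integers0].
have /choice[fc Hfc] n : exists a : int, c`_n = a%:~R.
  apply: intr_surj_rat; apply/(integers_fmorph (algClosure_emb W)).
  by have := ZI n; rewrite Ec coef_map.
pose f : {poly int} := \poly_(n < size c) fc n.
have Ef : map_poly intr f = Z.
  apply/polyP => n; rewrite Ec !coef_map coef_poly; case: ltnP => [_|le].
    by rewrite Hfc; apply/esym; apply: (rmorph_int (algClosure_emb W)).
  by rewrite nth_default // !raddf0.
have mapi0 : (0 : int)%:~R = 0 :> W by [].
have szf : size f = (size O).+1 by rewrite -(size_map_inj_poly W_int_inj mapi0) Ef size_prod_XsubC.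
have mf : f \is monic.
  apply/monicP; apply: W_int_inj; rewrite -(lead_coef_map_inj W_int_inj mapi0) Ef.
  by apply/monicP; apply: monic_prod_XsubC.
exists f, O; split=> //; apply: rho_weight => //.
  by rewrite szf ltnS; case: (O) eO.
have van (q : {poly int}) : (size q <= (size f).-1)%N -> (map_poly intr q).[e] = 0 :> W -> q = 0.
  rewrite szf /= => sq qe; apply/eqP/negPn/negP => q0.
  have q0' : map_poly (intr : int -> W) q != 0.
    by rewrite -size_poly_gt0 (size_map_inj_poly W_int_inj mapi0) size_poly_gt0.
  have := max_poly_roots q0' _ uO; rewrite (size_map_inj_poly W_int_inj mapi0) ltnNge sq => H.
  suff : false by []; apply: H; apply/allP => z /HO[s ->]; rewrite /root.
  have -> : map_poly (intr : int -> W) q = map_poly s (map_poly intr q).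
    by rewrite -map_poly_comp; apply: eq_map_poly => a /=; rewrite rmorph_int.
  by rewrite horner_map qe rmorph0.
move=> h g sh sg E.
have : (map_poly (intr : int -> W) h).[e] * (map_poly intr g).[e] = 0.
  rewrite -hornerM -rmorphM /= (rdivp_eq mf (h * g)) E addr0 rmorphM /= Ef hornerM.
  have /eqP -> : (\prod_(z <- O) ('X - z%:P)).[e] == 0 by rewrite -/(root _ _) root_prod_XsubC.
  by rewrite mulr0.
by move/eqP; rewrite mulf_eq0 => /orP[/eqP /van|/eqP /van]; [left|right]; auto.
Qed.

End GaloisGroup.

Lemma prod_Fp p : prime p -> forall c,
  (p %| (('X^p - 'X - \prod_(n < p) ('X - n%:R%:P) : {poly int})`_c)%R)%Z.
Proof.
move=> pp c; rewrite dvdz_Fp // -coef_map /= .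
suff -> : map_poly (intr : int -> 'F_p) ('X^p - 'X - \prod_(n < p) ('X - n%:R%:P)) = 0 by rewrite coef0.
rewrite !rmorphB /= map_polyXn map_polyX rmorph_prod /=.
have := finField_genPoly 'F_p; rewrite card_Fp // => ->; apply/eqP; rewrite subr_eq0; apply/eqP.
rewrite (eq_bigr (fun n : 'I_p => 'X - (n%:R : 'F_p)%:P)); last first.
  by move=> n _; rewrite rmorphB /= map_polyX map_polyC /= rmorph_nat.
rewrite -(big_map (fun n : 'I_p => n%:R : 'F_p) predT (fun x => 'X - x%:P)).
rewrite -[LHS]big_filter /=; apply: perm_big; apply: uniq_perm.
- by rewrite filter_uniq // index_enum_uniq.
- rewrite map_inj_uniq ?index_enum_uniq // => a b E; apply: val_inj.
  by have := congr1 (@nat_of_ord _) E; rewrite !val_Fp_nat // !modn_small.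
move=> x; rewrite mem_filter mem_index_enum /=; apply/esym/mapP.
have lt : (x < p)%N by rewrite -{2}(Fp_cast pp) ltn_ord.
by exists (Ordinal lt); rewrite ?mem_index_enum //= natr_Zp.
Qed.

Lemma rho_prime_le (f : {poly int}) p : f \is monic -> (1 < size f)%N -> prime p ->
  (rho f p <= (size f).-1)%N.
Proof.
move=> mf sf pp; pose A := [pred r : 'I_p | (p %| f.[(r : nat)%:Z])%Z].
pose rs := map (fun r : 'I_p => ((r : nat)%:Z)%:~R : 'F_p) (enum A).
rewrite /rho -/A cardE -(size_map (fun r : 'I_p => ((r : nat)%:Z)%:~R : 'F_p)) -/rs -ltnS -(size_mp mf sf p).
apply: max_poly_roots; first by rewrite monic_neq0 // mp_monic.
  apply/allP => y /mapP[r]; rewrite mem_enum inE => Hr ->{y}.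
  by rewrite /root horner_map /= -dvdz_Fp.
rewrite map_inj_in_uniq ?enum_uniq // => r r' _ _ E.
by apply: ord_congr; rewrite dvdz_Fp // rmorphB /= E subrr.
Qed.

(** * Frobenius elements prescribed up to a generator *)

Section FrobeniusDensity.
Variable W : algClosure rat.
Local Notation G := (absGal W).
Implicit Types (s t g h : G) (N H : set G).

Section AtPrime.
Variables (Q : set W) (p : nat).
Hypotheses (PQ : prime_ideal W Q) (pp : prime p) (Qp : Q p%:R).

Lemma prime_not_nat n : (0 < n < p)%N -> ~ Q n%:R.
Proof.
move=> /andP[n0 np] /(prime_natP PQ pp Qp) /dvdn_leq => /(_ n0).
by rewrite leqNgt np.
Qed.

Lemma frob_fixed_nat z : integers W z -> Q (z ^+ p - z) -> exists2 n : nat, (n < p)%N & Q (z - n%:R).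
Proof.
move=> Iz Hz.
pose q : {poly int} := 'X^p - 'X - \prod_(n < p) ('X - n%:R%:P).
have Qq : Q (map_poly intr q).[z].
  rewrite horner_coef; apply: (prime_sum PQ) => c.
  apply: (primeMr PQ); first exact: integersX.
  rewrite coef_map /=; apply/(prime_intP PQ pp Qp).
  by have := prod_Fp pp c; rewrite dvdzE.
have Qprod : Q (\prod_(n < p) (z - n%:R)).
  have -> : \prod_(n < p) (z - n%:R) = (z ^+ p - z) - (map_poly intr q).[z].
    rewrite /q !rmorphB /= map_polyXn map_polyX rmorph_prod /= !hornerE horner_prod.
    rewrite [X in _ - (_ - X)](eq_bigr (fun n : 'I_p => z - n%:R)); first by rewrite subKr.
    by move=> n _; rewrite rmorphB /= map_polyX map_polyC /= hornerXsubC rmorph_nat.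
  exact: primeB.
have [|n _ Hn] := prime_prod PQ (r := index_enum 'I_p) (f := fun n : 'I_p => z - n%:R) _ Qprod.
  by move=> n _; apply: integersB => //; apply: integers_nat.
by exists n.
Qed.

Lemma int_poly_root (f : {poly int}) (O : seq W) (n : nat) :
  map_poly intr f = \prod_(z <- O) ('X - z%:P) -> (forall z, z \in O -> integers W z) ->
  (p %| f.[n%:Z])%Z <-> exists2 z, z \in O & Q (z - n%:R).
Proof.
move=> Ef IO.
have Ev : (f.[n%:Z])%:~R = \prod_(z <- O) (n%:R - z) :> W.
  rewrite -(horner_map (intr : int -> W)) /= Ef horner_prod.
  by apply: eq_bigr => z _; rewrite hornerXsubC.
have -> : (p %| f.[n%:Z])%Z <-> Q (f.[n%:Z])%:~R by rewrite dvdzE; apply: iff_sym; apply: prime_intP.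
rewrite Ev; split=> [H|[z zO Qz]].
  have [|z zO /(primeBC PQ) Hz] := prime_prod PQ _ H; last by exists z.
  by move=> z zO; apply: integersB; [exact: integers_nat | apply: IO].
rewrite (big_rem z) //=; apply: primeMr => //; last exact: primeBC.
rewrite big_seq; apply: (big_ind (@integers W)); [exact: integers1 | exact: integersM |].
by move=> y /mem_rem yO; apply: integersB; [exact: integers_nat | apply: IO].
Qed.

End AtPrime.

Section Generator.
Variables (H : set G) (e : W) (f : {poly int}) (O : seq W) (n1 p : nat).
Hypotheses (Ie : integers W e) (eH : forall s, s e = e <-> H s).
Hypotheses (uO : uniq O) (HO : forall y, y \in O <-> exists s : G, y = s e).
Hypothesis Ef : map_poly intr f = \prod_(z <- O) ('X - z%:P).
Hypothesis n10 : (0 < n1)%N.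
Hypothesis sep : forall Q : set W, prime_ideal W Q -> ~ Q n1%:R ->
  forall s t, Q (s e - t e) -> s e = t e.
Hypotheses (pp : prime p) (n1p : (n1 < p)%N).

Let IO z : z \in O -> integers W z. Proof. by move=> /HO[s ->]; apply/gal_integral. Qed.

(** A root modulo p is congruent to some conjugate of e; moving the prime by the inverse conjugation
    makes it congruent to e itself. Frobenius then fixes e modulo Q, hence exactly by [sep]. *)
Lemma root_frobenius : (0 < rho f p)%N ->
  exists Q t, [/\ prime_ideal W Q, Q p%:R, frob_at Q p t & H t].
Proof.
move=> /card_gt0P[r]; rewrite inE => fr.
have [Q0 PQ0 Q0p] := prime_ideal_exists (@W_char0 W) (algClosure_emb W) pp.
have /(int_poly_root PQ0 pp Q0p _ Ef IO)[z /HO[g ->] Qz] := fr.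
pose Q := g @^-1` Q0; have PQ : prime_ideal W Q by apply: preimage_prime_ideal => //; exact: W_char0.
have Qp : Q p%:R by rewrite /Q /= rmorph_nat.
have Qe : Q (e - (r : nat)%:R) by rewrite /Q /= rmorphB /= rmorph_nat.
have [t Ht] := frobenius_exists PQ pp Qp.
exists Q, t; split=> //; apply/eH.
have Ir : integers W (r : nat)%:R by exact: integers_nat.
have Qrr : Q ((r : nat)%:R - (r : nat)%:R ^+ p) by have := Ht _ Ir; rewrite rmorph_nat.
have : Q (t e - absGal1 W e).
  rewrite absGal1E; apply: (prime_trans PQ (Ht e Ie)).
  apply: (prime_trans PQ (prime_congX PQ p Ie Ir Qe)).
  apply: (prime_trans PQ (primeBC PQ Qrr)); exact: primeBC.
by move/sep => ->; rewrite ?absGal1E //; apply: (prime_not_nat PQ pp Qp); rewrite n10.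
Qed.

(** By normality t fixes all conjugates of e, so each is congruent to a natural number; these are
    distinct roots of f modulo p by [sep]. *)
Lemma split_count (Q : set W) t : normal_in H -> prime_ideal W Q -> Q p%:R -> frob_at Q p t -> H t ->
  (forall s, H s -> H (absGalV s)) -> (size O <= rho f p)%N.
Proof.
move=> nH PQ Qp Ft Ht HV.
have fixO z : z \in O -> t z = z.
  move=> /HO[g ->]; have /eH := nH (absGalV g) _ Ht.
  rewrite /gconj /= => /(congr1 g); rewrite absGalKV.
  suff -> : absGalV (absGalV g) e = g e by [].
  by apply: (fmorph_inj (absGalV g)); rewrite absGalKV absGalVK.
have /choice[nz Hnz] z : exists n : nat, z \in O -> (n < p)%N /\ Q (z - n%:R).
  have [zO|] := boolP (z \in O); last by exists 0%N.
  have [|n np Qn] := frob_fixed_nat PQ pp Qp (IO zO); last by exists n.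
  by have := primeBC PQ (Ft z (IO zO)); rewrite fixO.
have p0 := prime_gt0 pp.
pose F z : 'I_p := insubd (Ordinal p0) (nz z).
have FE z : z \in O -> F z = nz z :> nat by move=> zO; rewrite val_insubd (Hnz z zO).1.
have uF : uniq (map F O).
  rewrite map_inj_in_uniq // => z z' zO zO' E.
  have Enz : nz z = nz z' by rewrite -!FE // E.
  have [_ h1] := Hnz z zO; have [_ h2] := Hnz z' zO'.
  have : Q (z - z') by apply: (prime_trans PQ h1); rewrite Enz; apply: primeBC.
  move: zO zO' => /HO[s ->] /HO[s' ->]; apply: sep => //.
  by apply: (prime_not_nat PQ pp Qp); rewrite n10.
rewrite -(size_map F) -(card_uniqP uF) /rho; apply: subset_leq_card.
apply/fintype.subsetP => r /mapP[z zO ->]; rewrite inE.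
by apply/(int_poly_root PQ pp Qp _ Ef IO); exists z => //; rewrite FE //; case: (Hnz z zO).
Qed.

End Generator.

Variables (R : realType) (T : pred nat) (l : nat).
Hypotheses (thT : thin R T) (ll : prime l).

Lemma coprime_pow_in N s a : open_subgroup N -> N (absGalX s l) -> ~~ (l %| a)%N -> N (absGalX s a) -> N s.
Proof.
move=> oN Nl la Na; have a0 : (0 < a)%N by rewrite lt0n; apply: contraNneq la => ->; rewrite dvdn0.
have : coprime a l by rewrite coprime_sym prime_coprime.
case/(coprimeP _ a0) => -[u v] /= E.
have XM c b : absGalX s (c * b) = absGalX (absGalX s b) c.
  elim: c => [|c IH]; first by [].
  by rewrite mulSn gXD IH.
have N1 : N (absGalX s (u * a)) by rewrite XM; apply: osgX.
have N2 : N (absGalX s (v * l)) by rewrite XM; apply: osgX.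
move: N1; rewrite (_ : u * a = v * l + 1)%N; last by lia.
rewrite gXD => /(osg_mull oN N2); congr N; apply: galP => z; exact: gX.
Qed.

(* A substitute for the Chebotarev density theorem. *)
Lemma frobenius_density N s n0 : open_subgroup N -> normal_in N -> N (absGalX s l) ->
  exists p Q t c, [/\ prime p, (n0 < p)%N, ~~ T p & prime_ideal W Q] /\
   [/\ Q p%:R, frob_at Q p t, ~~ (l %| c)%N & N (absGal_mul (absGalX s c) t)].
Proof.
move=> oN nN Nl; have l1 := prime_gt1 ll.
have nl1 : ~~ (l %| 1)%N by rewrite gtnNdvd.
have [eE IE HE] := subgroup_generator oN.
have [fE [OE [uOE HOE mfE EfE wE]]] := int_min_poly IE.
have sE : size fE = (size OE).+1.
  by rewrite -(size_map_inj_poly (@W_int_inj W)) // EfE size_prod_XsubC.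
have XM c b : absGalX s (c * b) = absGalX (absGalX s b) c.
  elim: c => [|c IH]; first by [].
  by rewrite mulSn gXD IH.
(* The subgroup generated by s and N. Below, [eE] generates the fixed field of N and [eA] that of
   H. *)
pose H g := exists c, N (absGal_mul (absGalX s c) g).
have oH : open_subgroup H.
  split.
  - by exists 0%N; rewrite /= g1mul; apply: osg1.
  - move=> g h [c Nc] [c' Nc']; exists (c' + c)%N.
    have -> : absGal_mul (absGalX s (c' + c)) (absGal_mul g h) =
       absGal_mul (gconj (absGalX s c') (absGal_mul (absGalX s c) g)) (absGal_mul (absGalX s c') h).
      by apply: galP => z; rewrite /gconj gXD /= absGalVK.
    by apply: osgM => //; apply: nN.
  - move=> g [c Nc]; exists (c * l.-1)%N.
    have Ncl : N (absGalX s (c * l)) by rewrite XM; apply: osgX.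
    have -> : absGal_mul (absGalX s (c * l.-1)) (absGalV g) =
       absGal_mul (absGalX s (c * l)) (gconj g (absGalV (absGal_mul (absGalX s c) g))).
      apply: galP => z; rewrite /gconj /=.
      have EV y : absGalV (absGal_mul (absGalX s c) g) y = absGalV g (absGalV (absGalX s c) y).
        by apply: (fmorph_inj (absGal_mul (absGalX s c) g)); rewrite absGalKV /= !absGalKV.
      rewrite EV absGalKV.
      have -> y : absGalX s (c * l) y = absGalX s (c * l.-1) (absGalX s c y).
        rewrite -[RHS]/(absGal_mul _ _ y) -gXD; congr (absGalX s _ y).
        by rewrite -{1}(prednK (prime_gt0 ll)) mulnS addnC.
      by rewrite absGalKV.
    exact: (osgM oN Ncl (nN _ _ (osgV oN Nc))).
  - have [r Hr] := osgO oN; exists r => g Hg; exists 0%N; rewrite /= g1mul; exact: Hr.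
have [eA IA HA] := subgroup_generator oH.
have [fA [OA [uOA HOA mfA EfA wA]]] := int_min_poly IA.
have sA : size fA = (size OA).+1.
  by rewrite -(size_map_inj_poly (@W_int_inj W)) // EfA size_prod_XsubC.
have OA0 : (0 < size OA)%N.
  by case: (OA) HOA => // HO0; have /HO0 : exists s : G, eA = s eA; [exists (absGal1 W); rewrite absGal1E|].
have [|n1 n10 sep] := @conj_separated _ W char0_rat [:: eA; eE].
  by move=> z; rewrite !inE => /orP[/eqP ->|/eqP ->].
have sepA Q (PQ : prime_ideal W Q) (nQ : ~ Q n1%:R) s1 t1 : Q (s1 eA - t1 eA) -> s1 eA = t1 eA.
  by apply: sep => //; rewrite !inE eqxx.
have sepE Q (PQ : prime_ideal W Q) (nQ : ~ Q n1%:R) s1 t1 : Q (s1 eE - t1 eE) -> s1 eE = t1 eE.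
  by apply: sep => //; rewrite !inE eqxx orbT.
(* If s is in N, c = 1 works for any Frobenius element in N; comparing [fE] with itself yields a
   prime where it has a root. *)
have [Ns|nNs] := pselect (N s).
  have [p [pp np Tp lt]] := weight_compare (maxn n0 n1) wE wE thT l1.
  have {np} /andP[n0p n1p] : (n0 < p)%N && (n1 < p)%N by rewrite -gtn_max.
  have rp : (0 < rho fE p)%N by case: (rho fE p) lt => //; rewrite muln0.
  have [Q [t [PQ Qp Ft Nt]]] := root_frobenius IE HE HOE EfE n10 sepE pp n1p rp.
  exists p, Q, t, 1%N; split; split=> //; apply: osgM => //.
  by have -> : absGalX s 1 = s by apply: galP => z; rewrite gX.
have [p [pp np Tp lt]] := weight_compare (maxn n0 n1) wA wE thT l1.
have {np} /andP[n0p n1p] : (n0 < p)%N && (n1 < p)%N by rewrite -gtn_max.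
have rp : (0 < rho fA p)%N by case: (rho fA p) lt => //; rewrite muln0.
have [Q [t [PQ Qp Ft [c Nc]]]] := root_frobenius IA HA HOA EfA n10 sepA pp n1p rp.
(* If l divided c, t would be in N and [fE] would have as many roots modulo p as its degree, at
   least l times the degree of [fA], against the choice of p. *)
exists p, Q, t, c; split; split=> //; apply/negP => /dvdnP[k Ek].
have Nt : N t.
  by apply: (osg_mull oN _ Nc); rewrite Ek XM; apply: osgX.
have sz1 := split_count IE HE uOE HOE EfE n10 sepE pp n1p nN PQ Qp Ft Nt (osgV oN).
have sz2 : (rho fA p <= size OA)%N by have := rho_prime_le mfA _ pp; rewrite sA; apply.
suff : (l * size OA <= size OE)%N.
  move=> sz3; have := leq_trans sz3 sz1; rewrite leqNgt => /negP; apply.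
  by apply: (leq_trans lt); rewrite leq_mul2l sz2 orbT.
have NH g : N g -> H g by move=> Ng; exists 0%N; rewrite /= g1mul.
have Hs k1 : H (absGalX s k1).
  apply: osgX => //; exists l.-1; rewrite (_ : absGal_mul _ s = absGalX s l) //.
  rewrite -{2}(prednK (prime_gt0 ll)) -addn1 gXD; congr absGal_mul; apply: galP => z; by rewrite gX.
have /choice[ga Hga] a : exists g : G, a \in OA -> a = g eA.
  by have [/HOA[g Eg]|] := boolP (a \in OA); [exists g | exists (absGal1 W)].
(* Powers of s below l are distinct modulo N, so these l |OA| conjugates of [eE] are distinct. *)
pose B := [seq ga a (absGalX s i eE) | a <- OA, i <- iota 0 l].
have -> : (l * size OA)%N = size B by rewrite size_allpairs size_iota mulnC.
apply: uniq_leq_size; last first.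
  move=> _ /allpairsP[[a i] /= [_ _ ->]]; apply/HOE; by exists (absGal_mul (ga a) (absGalX s i)).
have step a b i j : a \in OA -> b \in OA -> ga a (absGalX s i eE) = ga b (absGalX s j eE) ->
   a = b /\ N (absGal_mul (absGalV (absGalX s j)) (absGalX s i)).
  move=> aO bO E.
  have Nu : N (absGal_mul (absGalV (absGalX s j)) (absGal_mul (absGalV (ga b)) (absGal_mul (ga a) (absGalX s i)))).
    by apply/HE; rewrite /= E !absGalVK.
  have Hu : H (absGal_mul (absGalV (ga b)) (ga a)).
    have := osgM oH (osgM oH (Hs j) (NH _ Nu)) (osgV oH (Hs i)).
    by congr H; apply: galP => z /=; rewrite !absGalKV.
  have Eab : a = b.
    by rewrite (Hga a aO) (Hga b bO); move/HA: Hu => /= /(congr1 (ga b)); rewrite absGalKV.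
  split=> //; move: Nu; rewrite Eab; congr N; apply: galP => z /=; by rewrite absGalVK.
apply: allpairs_uniq => //; first exact: iota_uniq.
move=> [a i] [b j] /allpairsP[[a1 i1] /= [aO il [-> ->]]] /allpairsP[[b1 j1] /= [bO jl [-> ->]]] /= E.
have [Eab Nij] := step _ _ _ _ aO bO E; have [_ Nji] := step _ _ _ _ bO aO (esym E).
move: il jl; rewrite !mem_iota /= !add0n => il jl.
congr (_, _) => //.
have key i0 j0 : (i0 <= j0)%N -> (j0 < l)%N -> N (absGal_mul (absGalV (absGalX s i0)) (absGalX s j0)) -> i0 = j0.
  move=> le jl0 Nd; apply/eqP; rewrite eqn_leq le /= leqNgt; apply/negP => lt0.
  case: nNs; apply: (@coprime_pow_in N s (j0 - i0)) => //.
    by rewrite gtnNdvd ?subn_gt0 // (leq_ltn_trans (leq_subr _ _)).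
  move: Nd; congr N; rewrite -{1}(subnKC le) gXD gmulA gVmul g1mul //.
by have [le|/ltnW le] := leqP i1 j1; [apply: key | apply/esym; apply: key].
Qed.

End FrobeniusDensity.

(** * Split primes *)

Section Embeddings.
Variable W : algClosure rat.
Local Notation G := (absGal W).
Local Notation eW := (algClosure_emb W).

(** Integral elements that determine an embedding, used in place of an integral basis. *)
Definition int_gens (E : fieldType) (b : seq E) : Prop :=
  (forall z, z \in b -> integers E z) /\
  forall w w' : {rmorphism E -> W}, {in b, w =1 w'} -> w =1 w'.

Lemma int_gens_rat : int_gens ([::] : seq rat).
Proof. by split=> // w w' _; apply: rat_rmorphism_eq. Qed.

Lemma int_gens_ext (F : fieldType) (E : fieldExtType F) (x : {rmorphism F -> W}) (b : seq F) :
  [pchar F] =i pred0 -> int_gens b -> exists b' : seq E, int_gens b'.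
Proof.
move=> ch [Ib Hb].
have [w0 Hw0] := hom_extension ch (@fieldExt_algebraic F E) x.
have /choice[m Hm] (z : E) : exists m : nat, (0 < m)%N /\ integers E (m%:R * z).
  have [m m0 Im] := alg_integral (w0 z); exists m; split=> //.
  by apply/(integers_fmorph w0); rewrite rmorphM rmorph_nat.
exists (map (in_alg E) b ++ [seq (m z)%:R * z | z <- vbasis {:E}]); split.
  move=> z; rewrite mem_cat => /orP[/mapP[y yb ->]|/mapP[y yb ->]]; last by case: (Hm y).
  by apply/(integers_fmorph (in_alg E)); apply: Ib.
move=> w w' Hw.
have onF : (w \o in_alg E : {rmorphism F -> W}) =1 (w' \o in_alg E : {rmorphism F -> W}).
  apply: Hb => y yb; apply: Hw; rewrite mem_cat; apply/orP; left; exact: map_f.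
have onB z : z \in vbasis {:E} -> w z = w' z.
  move=> zb; have [m0 _] := Hm z.
  have := Hw ((m z)%:R * z); rewrite mem_cat (map_f (fun z => (m z)%:R * z)) ?orbT // => /(_ isT).
  by rewrite !rmorphM !rmorph_nat => /(mulfI (W_nat_neq0 W m0)).
move=> a; rewrite (coord_vbasis (memvf a)) !rmorph_sum; apply: eq_bigr => i _.
rewrite -mulr_algl !rmorphM; congr (_ * _); first exact: onF.
by apply: onB; apply: mem_nth; rewrite size_tuple.
Qed.

Section OneField.
Variables (E : fieldType) (iE : {rmorphism rat -> E}).

Lemma alg_over_emb (w : {rmorphism E -> W}) z : algebraicOver w z.
Proof.
have [q q0 qz] := algClosureP z; exists (map_poly iE q); first by rewrite map_poly_eq0.
rewrite -map_poly_comp (eq_map_poly (_ : _ =1 eW)) // => a /=.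
exact: (rat_rmorphism_eq (w \o iE) eW).
Qed.

Lemma E_char0 : [pchar E] =i pred0. Proof. exact: char0_emb iE char0_rat. Qed.

Lemma gal_of (u : {rmorphism W -> W}) : exists s : G, forall z, s z = u z.
Proof. by apply: absGal_of => a; apply: (rat_rmorphism_eq (u \o eW) eW). Qed.

Lemma emb_trans (w w' : {rmorphism E -> W}) : exists s : G, forall a, s (w a) = w' a.
Proof.
have [u Hu] := hom_extension E_char0 (alg_over_emb w) w'.
by have [s Hs] := gal_of u; exists s => a; rewrite Hs.
Qed.

(** The Galois group of W over the Galois closure of E; quantifying over all embeddings is what
    makes it normal. *)
Definition fixes_all (s : G) : Prop := forall (w : {rmorphism E -> W}) a, s (w a) = w a.

Lemma fixes_all_normal : normal_in fixes_all.
Proof.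
move=> g s Hs w a; rewrite /gconj /=.
by have := Hs (absGalV g \o w : {rmorphism E -> W}) a => /= ->; rewrite absGalKV.
Qed.

Variables (b : seq E) (w0 : {rmorphism E -> W}).
Hypothesis gb : int_gens b.

Lemma fixes_all_open : open_subgroup fixes_all.
Proof.
split.
- by move=> w a; rewrite absGal1E.
- by move=> s t Hs Ht w a /=; rewrite Ht Hs.
- by move=> s Hs w a; rewrite -{1}(Hs w a) absGalVK.
have /choice[Ob HOb] (e : W) : exists Ob : seq W, forall y, y \in Ob <-> exists s : G, y = s e.
  by have [ Ob [_ HO]] := orbit_list e; exists Ob.
exists (flatten [seq Ob (w0 z) | z <- b]) => s Hs w.
apply: (gb.2 (s \o w : {rmorphism E -> W}) w) => z zb /=; apply: Hs.
apply/flattenP; exists (Ob (w0 z)); first exact: (map_f (fun z => Ob (w0 z))).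
by apply/HOb; have [g Hg] := emb_trans w0 w; exists g; rewrite Hg.
Qed.

(** If t fixes w(E), an integer z of E is congruent to a natural number modulo the prime below Q. As
    w' sees the same prime, w z and w' z are congruent conjugates, hence equal for large p. *)
Lemma split_separated : exists2 n : nat, (0 < n)%N & forall (Q : set W) p (t : G) (w w' : {rmorphism E -> W}),
  prime_ideal W Q -> prime p -> Q p%:R -> frob_at Q p t -> (n < p)%N ->
  (forall a, t (w a) = w a) -> w @^-1` Q = w' @^-1` Q -> w =1 w'.
Proof.
have [|n n0 Hn] := @conj_separated _ W char0_rat (map w0 b).
  by move=> _ /mapP[z zb ->]; apply/(integers_fmorph w0); apply: gb.1.
exists n => // Q p t w w' PQ pp Qp Ft np tw E1; apply: gb.2 => z zb.
have [g Hg] := emb_trans w0 w; have [g' Hg'] := emb_trans w0 w'.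
have Iz : integers W (w z) by apply/(integers_fmorph w); apply: gb.1.
have [|m _ Hm] := frob_fixed_nat PQ pp Qp Iz.
  by have := primeBC PQ (Ft _ Iz); rewrite tw.
have Q1 : (w @^-1` Q) (z - m%:R) by rewrite /= rmorphB rmorph_nat.
have Q2 : Q (w' z - m%:R) by move: Q1; rewrite E1 /= rmorphB rmorph_nat.
rewrite -Hg -Hg'; apply: (Hn Q PQ) => //; last 2 first.
- exact: map_f.
- by rewrite Hg Hg'; apply: (prime_trans PQ Hm); apply: primeBC.
by apply: (prime_not_nat PQ pp Qp); rewrite n0.
Qed.

End OneField.

Section Split.
Variables (E : fieldType) (iE : {rmorphism rat -> E}).
Variables (Q : set W) (p : nat) (t : G) (w : {rmorphism E -> W}).
Hypotheses (PQ : prime_ideal W Q) (pp : prime p) (Qp : Q p%:R) (Ft : frob_at Q p t).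

Lemma below_prime : prime_ideal E (w @^-1` Q).
Proof. apply: preimage_prime_ideal => //; exact: E_char0 iE. Qed.

Lemma split_norm : (forall a, t (w a) = w a) -> ideal_norm (w @^-1` Q) = p.
Proof.
move=> tw; apply: (ideal_norm_degree1 below_prime pp); first by rewrite /= rmorph_nat.
move=> a Ia; have Iw : integers W (w a) by apply/(integers_fmorph w).
have [|n _ Hn] := frob_fixed_nat PQ pp Qp Iw; first by have := primeBC PQ (Ft Iw); rewrite tw.
by exists n; rewrite /= rmorphB rmorph_nat.
Qed.

End Split.

Lemma primes_below (E : fieldExtType rat) (P : set E) (Q : set W) (p : nat) :
  prime_ideal E P -> prime_ideal W Q -> prime p -> P p%:R -> Q p%:R ->
  exists w : {rmorphism E -> W}, w @^-1` Q = P.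
Proof.
move=> PP PQ pp Pp Qp.
have [|w [_ Hw]] := @cover rat E (in_alg E) W char0_rat (@fieldExt_algebraic rat E) P Q PP PQ.
  move=> a Pa.
  have Ia : integers rat a by apply/(integers_fmorph (in_alg E)); exact: (prime_sub PP Pa).
  have [n En] := intr_surj_rat Ia; move: Pa; rewrite En rmorph_int.
  move/(prime_intP PP pp Pp) => dv; rewrite rmorph_int; exact/(prime_intP PQ pp Qp).
by exists w.
Qed.

(** The [L : K] embeddings of L above x give distinct primes by [split_separated], and [cover] shows
    that there are no others. *)
Lemma split_Spl (K : fieldExtType rat) (L : fieldExtType K) (bL : seq L) (w0 : {rmorphism L -> W}) :
  int_gens bL -> exists2 n : nat, (0 < n)%N & forall (Q : set W) p (t : G) (x : {rmorphism K -> W}),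
  prime_ideal W Q -> prime p -> Q p%:R -> frob_at Q p t -> (n < p)%N ->
  fixes_all L t -> Spl L (x @^-1` Q).
Proof.
move=> gL; pose iL : {rmorphism rat -> L} := in_alg L \o in_alg K.
have [n n0 sep] := split_separated iL w0 gL.
exists n => // Q p t x PQ pp Qp Ft np Ht.
have chK := E_char0 (in_alg K).
split; first exact: (below_prime (in_alg K) x PQ).
have [w [wx winj wex]] := embeddings L x chK.
have dim0 : (0 < \dim {:L})%N by exact: adim_gt0.
pose i0 : 'I_(\dim {:L}) := Ordinal dim0.
pose f k := w (insubd i0 k) @^-1` Q.
have fE (k : 'I_(\dim {:L})) : f k = w k @^-1` Q by rewrite /f valKd.
have -> : [set P | prime_ideal L P /\ lies_over (in_alg L) (x @^-1` Q) P] = f @` `I_(\dim {:L}).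
  apply/seteqP; split=> [P [PP lo]|_ [k /= kn <-]]; last first.
    rewrite -[k]/(nat_of_ord (Ordinal kn)) fE; split; first exact: (below_prime iL).
    by apply/funext => a /=; rewrite /preimage /= wx.
  (* W is an algebraic closure of K through x, so that [cover] applies over the base K. *)
  pose Wx : algClosure K := AlgClosure (alg_over_emb (in_alg K) x).
  have [|u [ux uQ]] := @cover K L (in_alg L) Wx chK (@fieldExt_algebraic K L) P Q PP PQ.
    have lo' : in_alg L @^-1` P = x @^-1` Q := lo.
    by move=> a Pa; rewrite -[Q _]/((x @^-1` Q) a) -lo'.
  have [k Hk] := wex u ux; exists k; first exact: ltn_ord.
  by rewrite fE -uQ; apply/funext => a; rewrite /preimage /= Hk.
apply: inj_card_eq => k k'; rewrite !inE /= => kn kn'.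
rewrite -[k]/(nat_of_ord (Ordinal kn)) -[k']/(nat_of_ord (Ordinal kn')) !fE => /(sep Q p t) E1.
by congr nat_of_ord; apply: winj; apply: E1.
Qed.

End Embeddings.

(** * From density zero in K to thin sets of rational primes *)

Section Thin.
Variables (R : realType) (W : algClosure rat) (K : fieldExtType rat).

Lemma ler_sum_sub (I : eqType) (s1 s2 : seq I) (f : I -> R) : (forall i, 0 <= f i) ->
  uniq s1 -> {subset s1 <= s2} -> uniq s2 -> \sum_(i <- s1) f i <= \sum_(i <- s2) f i.
Proof.
move=> f0 u1 sub u2; rewrite [leRHS](bigID (mem s1)) /= -[leLHS]addr0 lerD ?sumr_ge0 //.
rewrite -[leRHS]big_filter le_eqVlt; apply/orP; left; apply/eqP/perm_big.
apply: uniq_perm; rewrite ?filter_uniq // => i; rewrite mem_filter.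
by case i1 : (i \in s1) => //=; rewrite sub.
Qed.

Lemma one_weight : prime_weight (fun=> 1%N).
Proof.
exists 1%N, 1%N, 1%N, 1%N, 0%N; split=> //.
  by move=> x; rewrite sum_nat_const_nat subn1 muln1 mul1n.
move=> x _; rewrite mul1n (eq_bigl predT); last by move=> m; rewrite coprimen1.
by rewrite sum_nat_const_nat subn1 muln1.
Qed.

Let F (s : R) (P : set K) : R := (ideal_norm P)%:R `^ (- s).

(** Once a prime of W above p is fixed, each prime of K above p comes from one of the [K : Q]
    embeddings; a nonzero norm is at least p. *)
Lemma zeta_K_bound : exists A : R, forall t, 0 < t <= 1 -> forall s : seq (set K), uniq s ->
  (forall P, P \in s -> prime_ideal K P) -> \sum_(P <- s) F (t + 1) P <= (\dim {:K})%:R * (A - ln t).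
Proof.
have [A HA] := weight_upper R one_weight; exists A => t t01 s us Hs.
have /andP[t0 t1] := t01.
have [w [_ _ wex]] := embeddings K (algClosure_emb W) char0_rat.
have /choice[Qp HQ] (p : nat) : exists Q : set W, prime p -> prime_ideal W Q /\ Q p%:R.
  have [pp|] := boolP (prime p); last by exists set0.
  by have [Q PQ Qp] := prime_ideal_exists (@W_char0 W) (algClosure_emb W) pp; exists Q.
have /choice[h Hh] (P : set K) : exists k : nat * 'I_(\dim {:K}), prime_ideal K P ->
    [/\ prime k.1, w k.2 @^-1` Qp k.1 = P & F (t + 1) P <= nps (t + 1) k.1].
  have [PP|] := pselect (prime_ideal K P); last by exists (0%N, Ordinal (adim_gt0 _)).
  have [p pp Pp] := prime_above PP; have [PQ Qpp] := HQ p pp.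
  have [v Hv] := primes_below PP PQ pp Pp Qpp.
  have [|k Hk] := wex v; first by move=> a; apply: (rat_rmorphism_eq (v \o in_alg K) (algClosure_emb W)).
  exists (p, k) => _; split=> //=.
    by rewrite -Hv; apply/funext => a; rewrite /preimage /= Hk.
  rewrite /F; have [->|le] := ideal_norm_ge PP pp Pp.
    by rewrite powR0 ?nps_ge0 // oppr_eq0 gt_eqF //; lra.
  rewrite nps_powR ?(leq_trans (prime_gt0 pp) le) //; apply: nps_le => //; first by lra.
  exact: prime_gt0.
pose y := (\max_(P <- s) (h P).1).+1.
apply: (@le_trans _ _ (\sum_(k <- map h s) nps (t + 1) k.1)).
  rewrite big_map big_seq [leRHS]big_seq; apply: ler_sum => P /Hs /Hh[] //.
apply: (@le_trans _ _ (\sum_(k <- [seq (p, i) | p <- [seq p <- index_iota 0 y | prime p], i <- enum 'I_(\dim {:K})]) nps (t + 1) k.1)).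
  apply: ler_sum_sub.
  - by move=> k; apply: nps_ge0.
  - rewrite map_inj_in_uniq // => P P' /Hs /Hh[_ E1 _] /Hs /Hh[_ E2 _] E.
    by rewrite -E1 -E2 E.
  - move=> _ /mapP[P Ps ->]; have [pr _ _] := Hh P (Hs P Ps).
    apply/allpairsP; exists (h P); split; last by case: (h P).
      by rewrite mem_filter pr mem_index_iota /= ltnS /y (big_rem P) //= leq_maxl.
    by rewrite mem_enum.
  apply: allpairs_uniq; [by rewrite filter_uniq ?iota_uniq | exact: enum_uniq |].
  by move=> [a b] [a' b'] _ _ /= [-> ->].
rewrite big_allpairs big_filter /=.
rewrite (eq_bigr (fun p => (\dim {:K})%:R * nps (t + 1) p)); last first.
  by move=> p _; rewrite big_enum /= sumr_const card_ord mulr_natl.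
rewrite -mulr_sumr ler_wpM2l ?ler0n // big_mkord.
have := HA t t01 y; apply: le_trans; rewrite le_eqVlt; apply/orP; left; apply/eqP.
by apply: eq_bigr => p _; rewrite mul1r.
Qed.

(** The sum over A is a small multiple of the prime zeta function of K, which is O(- ln t). One
    prime of A is chosen for each prime norm that occurs. *)
Lemma density_thin (A : set (set K)) : A `<=` prime_ideal K ->
  has_dirichlet_density A (0 : R) -> thin R (fun p => `[< exists2 P, A P & ideal_norm P = p >]).
Proof.
move=> Asub dens e e0; have [B HB] := zeta_K_bound.
pose d := \dim {:K}; have d0 : (0 < d)%N by exact: adim_gt0.
have d0R : 0 < d%:R :> R by rewrite ltr0n.
pose e1 := e / (2 * d%:R).
have e10 : 0 < e1 by rewrite divr_gt0 // mulr_gt0.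
have /cvgrPdist_le/(_ e1 e10) := dens.
rewrite near_withinE => /nbhs_ballP[dl /= dl0 Hdl].
(* The last bound gives - ln t >= |B|, so that B - ln t is at most twice - ln t; this is the 2 in
   [e1]. *)
exists (Num.min (Num.min dl 1) (expR (- `|B|))).
  by rewrite !lt_min dl0 ltr01 expR_gt0.
move=> t; rewrite !lt_min => /andP[t0 /andP[/andP[tdl t1] tB]] y.
have t01 : 0 < t <= 1 by rewrite t0 ltW.
have fin (A' : set (set K)) : A' `<=` prime_ideal K ->
   (0 <= prime_zeta A' (t + 1) <= (d%:R * (B - ln t))%:E)%E.
  move=> sub; apply/andP; split; first by apply: esum_ge0 => P _; rewrite lee_fin powR_ge0.
  apply: ge_ereal_sup => _ [X [finX XA] <-].
  rewrite fsbig_finite //= sumEFin lee_fin; apply: HB => //; first exact: fset_uniq.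
  by move=> P; rewrite in_fset_set // inE => /XA /sub.
have finn (A' : set (set K)) : A' `<=` prime_ideal K -> prime_zeta A' (t + 1) \is a fin_num.
  move=> /fin/andP[a b]; rewrite fin_numElt (lt_le_trans _ a) ?ltNyr // (le_lt_trans b) ?ltry //.
have zK := fin _ (@subset_refl _ (prime_ideal K)).
have fzK : fine (prime_zeta (prime_ideal K) (t + 1)) <= d%:R * (B - ln t).
  by case/andP: zK => _; rewrite -[in X in X -> _](fineK (finn _ (@subset_refl _ _))) lee_fin.
have zK0 : 0 <= fine (prime_zeta (prime_ideal K) (t + 1)) by apply: fine_ge0; case/andP: zK.
have AK : fine (prime_zeta A (t + 1)) <= fine (prime_zeta (prime_ideal K) (t + 1)).
  apply: fine_le; [exact: finn | exact: finn |].
  apply: ge_ereal_sup => _ [X [finX XA] <-]; apply: ereal_sup_ubound; exists X => //.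
  by split=> // P /XA /Asub.
have A0 : 0 <= fine (prime_zeta A (t + 1)) by apply: fine_ge0; case/andP: (fin _ Asub).
have ratio : fine (prime_zeta A (t + 1)) <= e1 * fine (prime_zeta (prime_ideal K) (t + 1)).
  have := Hdl (t + 1); rewrite /ball /= opprD addrCA subrr addr0 normrN gtr0_norm // => /(_ tdl).
  rewrite ltrDr => /(_ t0); rewrite sub0r normrN.
  move: zK0; rewrite le_eqVlt => /orP[/eqP E|pos]; first by move: AK; rewrite -E mulr0.
  by rewrite normrM normfV !ger0_norm ?(ltW pos) // ler_pdivrMr.
have Tsum : \sum_(p < y | prime p && `[< exists2 P, A P & ideal_norm P = p >]) nps (t + 1) p
   <= fine (prime_zeta A (t + 1)).
  have /choice[Pp HPp] (p : nat) : exists P, (exists2 P, A P & ideal_norm P = p) -> A P /\ ideal_norm P = p.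
    by have [[P AP nP]|] := pselect (exists2 P, A P & ideal_norm P = p); [exists P | exists set0].
  pose ps := [seq p <- index_iota 0 y | prime p && `[< exists2 P, A P & ideal_norm P = p >]].
  have psP p : p \in ps -> [/\ prime p, A (Pp p) & ideal_norm (Pp p) = p].
    by rewrite mem_filter => /andP[/andP[pp /asboolP /HPp[]]].
  have uP : uniq (map Pp ps).
    rewrite map_inj_in_uniq ?filter_uniq ?iota_uniq // => p q /psP[_ _ E1] /psP[_ _ E2] E.
    by rewrite -E1 -E2 E.
  rewrite -lee_fin fineK; last exact: finn.
  apply: esum_ge; exists [set` map Pp ps].
    by split=> [|_ /= /mapP[p /psP[_ Ap _] ->]]; [exact: finite_seq | ].
  rewrite -fsbig_seq // sumEFin lee_fin big_map -(big_mkord (fun p => prime p && `[< exists2 P, A P & ideal_norm P = p >]) (nps (t + 1))) -big_filter -/ps.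
  rewrite big_seq [leRHS]big_seq; apply: ler_sum => p /psP[pp _ ->].
  by rewrite nps_powR // prime_gt0.
apply: (le_trans Tsum); apply: (le_trans ratio).
apply: (le_trans (ler_wpM2l (ltW e10) fzK)).
have Bt : B <= - ln t.
  apply: (le_trans (ler_norm B)); rewrite lerNr -[leRHS](expRK (- `|B|)) ler_ln ?posrE ?expR_gt0 //.
  exact: ltW.
have -> : e * - ln t = e1 * (d%:R * (2 * - ln t)).
  by rewrite /e1; field; rewrite gt_eqF.
by rewrite ler_pM2l // ler_pM2l //; lra.
Qed.

End Thin.

(** * Matching embeddings *)

Section CharTransport.
Variables (R : realType) (W : algClosure rat) (l : nat).
Variables (K : fieldExtType rat) (Kb : algClosure K).
Hypothesis ll : prime l.
Local Notation G := (absGal W).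
Local Notation em := (algClosure_emb Kb).
Let chK : [pchar K] =i pred0 := E_char0 (in_alg K).
Implicit Types (x : {rmorphism K -> W}) (s t g : G).

Definition chx (chi : absGal Kb -> R[i]) (x : {rmorphism K -> W}) (s : G) : R[i] :=
  chi (@pull K Kb W chK (in_alg K) x s).

Variable chi : absGal Kb -> R[i].
Hypothesis Echi : ell_char l chi.

Lemma chxM x s t : fixes_emb x s -> fixes_emb x t ->
  chx chi x (absGal_mul s t) = chx chi x s * chx chi x t.
Proof. by move=> fs ft; rewrite /chx pullM // (charM Echi). Qed.

Lemma chx_neq0 x s : chx chi x s != 0. Proof. exact: (char_neq0 ll Echi). Qed.

Lemma chx_l x s : chx chi x s ^+ l = 1. Proof. by case: Echi => _ + _; apply. Qed.

Lemma chx1 x s : (forall z, s z = z) -> chx chi x s = 1.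
Proof.
move=> Hs; have [_ _ [r Hr]] := Echi; apply: Hr => z _.
have fs : fixes_emb x s by move=> a; rewrite Hs.
by apply: (fmorph_inj (@lift K Kb W chK (in_alg K) x)); rewrite pullE // Hs.
Qed.

Lemma fixes_embX x s n : fixes_emb x s -> fixes_emb x (absGalX s n).
Proof. by move=> fs a; elim: n => [|n IH] /=; rewrite ?absGal1E // IH fs. Qed.

Lemma chxX x s n : fixes_emb x s -> chx chi x (absGalX s n) = chx chi x s ^+ n.
Proof.
move=> fs; elim: n => [|n IH] /=; first by apply: chx1 => z; rewrite absGal1E.
by rewrite chxM // ?IH ?exprS //; apply: fixes_embX.
Qed.

Lemma chxV x s : fixes_emb x s -> chx chi x (absGalV s) = (chx chi x s)^-1.
Proof.
move=> fs; have fV : fixes_emb x (absGalV s) by move=> a; rewrite -{1}(fs a) absGalVK.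
apply: (mulfI (chx_neq0 x s)); rewrite divff ?chx_neq0 // -chxM //.
by apply: chx1 => z /=; rewrite absGalKV.
Qed.

(** The lift of x' and g composed with the lift of x differ by an element tau of Gal(Kb/K). The two
    pulls are conjugate under tau, and chi is a class function. *)
Lemma chx_conj x (x' : {rmorphism K -> W}) g s : (forall a, x' a = g (x a)) -> fixes_emb x s ->
  chx chi x' (gconj g s) = chx chi x s.
Proof.
move=> Ex fs; pose lx := @lift K Kb W chK (in_alg K) x; pose lx' := @lift K Kb W chK (in_alg K) x'.
have [h [hK Kh]] := fmorph_inverse (lift_bij Kb chK (in_alg K) x' : bijective lx').
have [|tau Htau] := @absGal_of _ Kb (h \o (g \o lx : {rmorphism Kb -> W}) : {rmorphism Kb -> Kb}).
  move=> a /=; rewrite liftE -Ex -(liftE Kb chK (in_alg K) x'); exact: hK.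
have lt y : lx' (tau y) = g (lx y) by rewrite Htau /= Kh.
have fs' : fixes_emb x' (gconj g s) by move=> a; rewrite Ex /gconj /= absGalVK fs.
have -> : chx chi x' (gconj g s) = chi (absGal_mul tau (absGal_mul (@pull K Kb W chK (in_alg K) x s) (absGalV tau))).
  rewrite /chx; congr chi; apply: absGal_eqP => z; apply: (fmorph_inj lx').
  rewrite pullE // /gconj /= lt pullE // -/lx; congr (g (s _)).
  by apply: (fmorph_inj g); rewrite absGalKV -lt absGalKV.
by rewrite !(charM Echi) (charV ll Echi) mulrCA mulfV ?mulr1 // (char_neq0 ll Echi).
Qed.

Lemma chx_open x : exists r : seq W, forall s, fixes_emb x s -> (forall z, z \in r -> s z = z) ->
  chx chi x s = 1.
Proof.
have [_ _ [r Hr]] := Echi; exists (map (@lift K Kb W chK (in_alg K) x) r) => s fs Hs.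
apply: Hr => z zr; apply: (fmorph_inj (@lift K Kb W chK (in_alg K) x)); rewrite pullE //.
by apply: Hs; apply: map_f.
Qed.

Section Frob.
Variables (x : {rmorphism K -> W}) (Q : set W) (p : nat) (t : G).
Hypotheses (PQ : prime_ideal W Q) (Ft : frob_at Q p t) (ft : fixes_emb x t).
Hypotheses (nP : ideal_norm (x @^-1` Q) = p) (p0 : (0 < p)%N).

Lemma chx_frob : unramified chi (x @^-1` Q) -> char_at chi (x @^-1` Q) = chx chi x t.
Proof.
move=> un; apply: (char_at_frob ll Echi chK un (Q := @lift K Kb W chK (in_alg K) x @^-1` Q)).
- by rewrite nP.
- exact: lift_preim_prime.
- exact: lift_contract.
- by rewrite nP; apply: pull_frob.
Qed.

Lemma chx_value C : char_value chi (x @^-1` Q) C -> C (chx chi x t).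
Proof.
case=> _ H; apply: (H (@lift K Kb W chK (in_alg K) x @^-1` Q)).
- exact: lift_preim_prime.
- exact: lift_contract.
- by rewrite nP; apply: pull_frob.
Qed.

End Frob.

(** chi is trivial on the stabilizer of finitely many elements, scaled to be integral. Inertia sends
    each to a congruent conjugate, hence to itself when p is large. *)
Lemma unramified_large (x : {rmorphism K -> W}) : exists n : nat, forall P p, prime_ideal K P -> prime p ->
  P p%:R -> (n < p)%N -> unramified chi P.
Proof.
have [_ _ [r Hr]] := Echi.
pose lx := @lift K Kb W chK (in_alg K) x.
have /choice[m Hm] (z : Kb) : exists m : nat, (0 < m)%N /\ integers Kb (m%:R * z).
  have [m m0 Im] := alg_integral (lx z); exists m; split=> //.
  by apply/(integers_fmorph lx); rewrite rmorphM rmorph_nat.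
have [|n n0 sep] := @conj_separated _ Kb chK [seq (m z)%:R * z | z <- r].
  by move=> _ /mapP[z _ ->]; case: (Hm z).
exists n => P p PP pp Pp np Q PQ QP s [_ Hs].
have Qp : Q p%:R.
  have : (em @^-1` Q) p%:R by rewrite QP.
  by rewrite /= rmorph_nat.
have nQ : ~ Q n%:R.
  by move=> /(prime_natP PQ pp Qp) /dvdn_leq => /(_ n0); rewrite leqNgt np.
apply: Hr => z zr; have [mz0 Iz] := Hm z.
have : s ((m z)%:R * z) = absGal1 Kb ((m z)%:R * z).
  apply: (sep Q PQ nQ); first exact: (map_f (fun z => (m z)%:R * z)).
  by rewrite absGal1E; apply: Hs.
rewrite absGal1E rmorphM rmorph_nat; apply: mulfI.
by have /pcharf0P -> := char0_emb em chK; rewrite -lt0n.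
Qed.

End CharTransport.

(** * Matching the embeddings of K and K' *)

Section Matching.
Variables (R : realType) (l : nat) (l_prime : prime l).
Variables (K K' : fieldExtType rat) (Kbar : algClosure K) (Kbar' : algClosure K').
Hypothesis same_degree : \dim {:K} = \dim {:K'}.
Variables (S : set (set K)) (L : fieldExtType K).
Hypothesis S_Spl : has_dirichlet_density (Spl L `\` S) (0 : R).
Variable psi : (absGal Kbar -> R[i]) -> (absGal Kbar' -> R[i]).
Hypothesis psi_gen : forall chi, characters_gen Kbar R l chi -> characters_gen Kbar' R l (psi chi).
Variable phi : set K -> set K'.
Hypothesis phi_fun : set_fun S (prime_ideal K') phi.
Hypothesis phi_inj : set_inj S phi.
Hypothesis phi_norm : forall p, S p -> ideal_norm (phi p) = ideal_norm p.
Hypothesis psi_phi : forall chi p, characters_gen Kbar R l chi -> S p ->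
  char_at chi p = char_at (psi chi) (phi p).
Variable W : algClosure rat.
Local Notation G := (absGal W).
Local Notation gen := (characters_gen Kbar R l).

Variables (n : nat) (x : 'I_n -> {rmorphism K -> W}) (y : 'I_n -> {rmorphism K' -> W}).
Hypothesis xinj : forall i j, x i =1 x j -> i = j.
Hypothesis xall : forall w : {rmorphism K -> W}, exists i, w =1 x i.
Hypothesis yall : forall w : {rmorphism K' -> W}, exists i, w =1 y i.

Let T p := `[< exists2 P, (Spl L `\` S) P & ideal_norm P = p >].
Let thT : thin R T. Proof. by apply: density_thin => // P [[]]. Qed.

(** The open normal subgroup G_M. *)
Definition FA (s : G) : Prop := [/\ fixes_all K s, fixes_all K' s & fixes_all L s].

Let gK : exists b : seq K, int_gens W b.
Proof. by apply: (@int_gens_ext W rat K (algClosure_emb W) [::] char0_rat); apply: int_gens_rat. Qed.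
Let gK' : exists b : seq K', int_gens W b.
Proof. by apply: (@int_gens_ext W rat K' (algClosure_emb W) [::] char0_rat); apply: int_gens_rat. Qed.
Let gL (i : 'I_n) : exists b : seq L, int_gens W b.
Proof. by have [b Hb] := gK; apply: (int_gens_ext L (x i) (E_char0 (in_alg K)) Hb). Qed.
Let wL (i : 'I_n) : exists w : {rmorphism L -> W}, True.
Proof. by have [w _] := hom_extension (E_char0 (in_alg K)) (@fieldExt_algebraic K L) (x i); exists w. Qed.
Let iL : {rmorphism rat -> L} := in_alg L \o in_alg K.

Hypothesis i0 : 'I_n.

Lemma FA_open : open_subgroup FA.
Proof.
have [b gb] := gK; have [b' gb'] := gK'; have [c gc] := gL i0; have [w _] := wL i0.
have o1 := fixes_all_open (in_alg K) (x i0) gb.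
have o2 := fixes_all_open (in_alg K') (y i0) gb'.
have o3 := fixes_all_open iL w gc.
split.
- by split; [exact: (osg1 o1) | exact: (osg1 o2) | exact: (osg1 o3)].
- by move=> s t [a1 a2 a3] [b1 b2 b3]; split; [exact: (osgM o1) | exact: (osgM o2) | exact: (osgM o3)].
- by move=> s [a1 a2 a3]; split; [exact: (osgV o1) | exact: (osgV o2) | exact: (osgV o3)].
have [r1 H1] := osgO o1; have [r2 H2] := osgO o2; have [r3 H3] := osgO o3.
exists (r1 ++ (r2 ++ r3)) => s Hs; split; [apply: H1 | apply: H2 | apply: H3] => z zr;
  by apply: Hs; rewrite !mem_cat zr ?orbT.
Qed.

Lemma FA_normal : normal_in FA.
Proof. by move=> g s [a1 a2 a3]; split; apply: fixes_all_normal. Qed.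

Lemma gen_ell chi : gen chi -> ell_char l chi.
Proof. exact: gen_ell_char. Qed.
Lemma gen_ell' chi : gen chi -> ell_char l (psi chi).
Proof. by move=> /psi_gen; apply: gen_ell_char. Qed.

(** When Frobenius lies in [FA], the primes of K below Q have norm p and split in L, so they belong
    to S because p is not in [T]. Their images under phi have norm p as well, so each lies below Q
    along some embedding of K', and injectivity of phi makes this assignment injective. *)
Lemma at_frobenius : exists n0 : nat, forall p (Q : set W) (t : G), prime p -> (n0 < p)%N -> ~~ T p ->
  prime_ideal W Q -> Q p%:R -> frob_at Q p t -> FA t ->
  [/\ forall w : {rmorphism K -> W}, S (w @^-1` Q) /\ ideal_norm (w @^-1` Q) = p,
      forall w w' : {rmorphism K -> W}, w @^-1` Q = w' @^-1` Q -> w =1 w' &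
      exists2 pi : 'I_n -> 'I_n, injective pi &
        forall i, phi (x i @^-1` Q) = y (pi i) @^-1` Q].
Proof.
have [b gb] := gK; have [c gc] := gL i0; have [w _] := wL i0.
have [n1 n10 sepK] := split_separated (in_alg K) (x i0) gb.
have [n2 n20 splL] := @split_Spl W K L c w gc.
exists (maxn n1 n2) => p Q t pp; rewrite gtn_max => /andP[n1p n2p] Tp PQ Qp Ft [tK tK' tL].
have HS (v : {rmorphism K -> W}) : S (v @^-1` Q) /\ ideal_norm (v @^-1` Q) = p.
  have nv : ideal_norm (v @^-1` Q) = p by apply: (split_norm (in_alg K) PQ pp Qp Ft) => a; apply: tK.
  split=> //; apply: contrapT => nS; case/asboolP: Tp; exists (v @^-1` Q) => //; split=> //.
  exact: (splL Q p t v PQ pp Qp Ft n2p tL).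
have dist (v v' : {rmorphism K -> W}) : v @^-1` Q = v' @^-1` Q -> v =1 v'.
  by apply: (sepK Q p t v v' PQ pp Qp Ft n1p) => a; apply: tK.
split=> //.
have /choice[pi Hpi] i : exists j, phi (x i @^-1` Q) = y j @^-1` Q.
  have [Si ni] := HS (x i); have PP := phi_fun Si.
  have np : ideal_norm (phi (x i @^-1` Q)) = p by rewrite phi_norm.
  have [Pp _] := ideal_norm_prime PP pp np.
  have [v Hv] := primes_below PP PQ pp Pp Qp.
  by have [j Hj] := yall v; exists j; rewrite -Hv; apply/funext => a; rewrite /preimage /= Hj.
exists pi => // i j Eij; apply: xinj; apply: dist; apply: phi_inj.
- by rewrite inE; case: (HS (x i)).
- by rewrite inE; case: (HS (x j)).
- by rewrite !Hpi Eij.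
Qed.

Section Family.
Variables (I : finType) (chi : I -> absGal Kbar -> R[i]).
Hypothesis gchi : forall k, gen (chi k).

(** The common kernel of the finite family at all embeddings; it is normal because conjugation
    permutes the embeddings. *)
Definition NF (s : G) : Prop := [/\ FA s, forall k i, chx (chi k) (x i) s = 1 &
  forall k i, chx (psi (chi k)) (y i) s = 1].

Lemma FAx s i : FA s -> fixes_emb (x i) s. Proof. by case=> + _ _ a; apply. Qed.
Lemma FAy s i : FA s -> fixes_emb (y i) s. Proof. by case=> _ + _ a; apply. Qed.

Lemma NF_open : open_subgroup NF.
Proof.
have oF := FA_open.
split.
- split; first exact: osg1 oF.
    by move=> k i; apply: (chx1 (gen_ell (gchi k))) => z; rewrite absGal1E.
  by move=> k i; apply: (chx1 (gen_ell' (gchi k))) => z; rewrite absGal1E.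
- move=> s t [Fs s1 s2] [Ft t1 t2]; split; first exact: osgM oF _ _ Fs Ft.
    by move=> k i; rewrite (chxM (gen_ell (gchi k))) ?s1 ?t1 ?mulr1 //; apply: FAx.
  by move=> k i; rewrite (chxM (gen_ell' (gchi k))) ?s2 ?t2 ?mulr1 //; apply: FAy.
- move=> s [Fs s1 s2]; split; first exact: osgV oF _ Fs.
    by move=> k i; rewrite (chxV l_prime (gen_ell (gchi k))) ?s1 ?invr1 //; apply: FAx.
  by move=> k i; rewrite (chxV l_prime (gen_ell' (gchi k))) ?s2 ?invr1 //; apply: FAy.
have [r0 H0] := osgO oF.
have /choice[r1 H1] (k : I * 'I_n) := chx_open (gen_ell (gchi k.1)) (x k.2).
have /choice[r2 H2] (k : I * 'I_n) := chx_open (gen_ell' (gchi k.1)) (y k.2).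
exists (r0 ++ (flatten [seq r1 k | k <- enum {: I * 'I_n}] ++ flatten [seq r2 k | k <- enum {: I * 'I_n}])).
move=> s Hs; have Fs : FA s by apply: H0 => z zr; apply: Hs; rewrite mem_cat zr.
split=> // k i; [apply: (H1 (k, i)) | apply: (H2 (k, i))]; try exact: FAx; try exact: FAy.
  move=> z zr; apply: Hs; rewrite !mem_cat; apply/orP; right; apply/orP; left.
  by apply/flattenP; exists (r1 (k, i)) => //; apply: map_f; rewrite mem_enum.
move=> z zr; apply: Hs; rewrite !mem_cat; apply/orP; right; apply/orP; right.
by apply/flattenP; exists (r2 (k, i)) => //; apply: map_f; rewrite mem_enum.
Qed.

Lemma NF_normal : normal_in NF.
Proof.
move=> g s [Fs s1 s2]; split; first exact: FA_normal.
  move=> k i; have [j Hj] := xall (absGalV g \o x i : {rmorphism K -> W}).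
  rewrite (@chx_conj _ _ _ _ _ l_prime _ (gen_ell (gchi k)) (x j)) ?s1 //; last exact: FAx.
  by move=> a; rewrite -Hj /= absGalKV.
move=> k i; have [j Hj] := yall (absGalV g \o y i : {rmorphism K' -> W}).
rewrite (@chx_conj _ _ _ _ _ l_prime _ (gen_ell' (gchi k)) (y j)) ?s2 //; last exact: FAy.
by move=> a; rewrite -Hj /= absGalKV.
Qed.

(** A Frobenius element t with s^c t in [NF] has values inverse to the c-th powers of those at s.
    Agreement of the values at t therefore gives it for the c-th powers at s, and l does not divide
    c. *)
Lemma family_match s : FA s -> exists2 pi : 'I_n -> 'I_n, injective pi &
  forall k i, chx (chi k) (x i) s = chx (psi (chi k)) (y (pi i)) s.
Proof.
move=> Fs; have [n0 Hn0] := at_frobenius.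
have /choice[m Hm] (k : I) := unramified_large (gen_ell (gchi k)) (x i0).
have Nl : NF (absGalX s l).
  split; first exact: osgX FA_open Fs.
    by move=> k i; rewrite (chxX (gen_ell (gchi k))) ?(chx_l (gen_ell (gchi k))) //; apply: FAx.
  by move=> k i; rewrite (chxX (gen_ell' (gchi k))) ?(chx_l (gen_ell' (gchi k))) //; apply: FAy.
have [p [Q [t [c [[pp np Tp PQ] [Qp Ft lc [Fct c1 c2]]]]]]] :=
  frobenius_density thT l_prime (maxn n0 (\max_k m k)) NF_open NF_normal Nl.
move: np; rewrite gtn_max => /andP[n0p mp].
have FtA : FA t by apply: (osg_mull FA_open _ Fct); apply: osgX FA_open Fs.
have [HS _ [pi ipi Hpi]] := Hn0 p Q t pp n0p Tp PQ Qp Ft FtA.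
exists pi => // k i; set u := chx (chi k) (x i) s; set v := chx (psi (chi k)) _ s.
have [Si ni] := HS (x i).
have un : unramified (chi k) (x i @^-1` Q).
  apply: (Hm k _ p) => //; first exact: (below_prime (in_alg K)).
    by rewrite /= rmorph_nat.
  by apply: leq_ltn_trans mp; apply: leq_bigmax.
have e1 := chx_frob l_prime (gen_ell (gchi k)) PQ Ft (FAx i FtA) ni (prime_gt0 pp) un.
have ch := psi_phi (gchi k) Si.
have un' : unramified (psi (chi k)) (phi (x i @^-1` Q)).
  by apply: char_at_neq0; rewrite -ch e1; exact: (chx_neq0 l_prime (gen_ell (gchi k))).
rewrite Hpi in un' ch.
have ni' : ideal_norm (y (pi i) @^-1` Q) = p by rewrite -Hpi phi_norm.
have e2 := chx_frob l_prime (gen_ell' (gchi k)) PQ Ft (FAy (pi i) FtA) ni' (prime_gt0 pp) un'.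
have Euv : chx (chi k) (x i) t = chx (psi (chi k)) (y (pi i)) t by rewrite -e1 -e2.
have Fx := @FAx s i Fs; have Fy := @FAy s (pi i) Fs.
have h1 : u ^+ c * chx (chi k) (x i) t = 1.
  rewrite /u -(chxX (gen_ell (gchi k))) // -(chxM (gen_ell (gchi k))) ?c1 //; last exact: FAx.
  exact: fixes_embX.
have h2 : v ^+ c * chx (psi (chi k)) (y (pi i)) t = 1.
  rewrite /v -(chxX (gen_ell' (gchi k))) // -(chxM (gen_ell' (gchi k))) ?c2 //; last exact: FAy.
  exact: fixes_embX.
have v0 : v != 0 by exact: (chx_neq0 l_prime (gen_ell' (gchi k))).
have Ec : u ^+ c = v ^+ c.
  apply: (mulIf (chx_neq0 l_prime (gen_ell (gchi k)) (x i) t)).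
  by rewrite h1 Euv h2.
have : (u / v) = 1.
  apply: (coprime_expr1 l_prime _ lc).
    by rewrite exprMn exprVn (chx_l (gen_ell (gchi k))) (chx_l (gen_ell' (gchi k))) invr1 mulr1.
  by rewrite exprMn exprVn Ec mulfV // expf_neq0.
by move/divr1_eq.
Qed.

End Family.

Lemma split_frobenius N m : open_subgroup N -> normal_in N ->
  exists p (Q : set W) (t : G), [/\ prime p, (m < p)%N, ~~ T p & prime_ideal W Q] /\
    [/\ Q p%:R, frob_at Q p t & N t].
Proof.
move=> oN nN; have N1 c : N (absGalX (absGal1 W) c) by apply: osgX oN (osg1 oN).
have [p [Q [t [c [[pp np Tp PQ] [Qp Ft _ Nt]]]]]] := frobenius_density thT l_prime m oN nN (N1 l).
by exists p, Q, t; split=> //; split=> //; apply: (osg_mull oN _ Nt).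
Qed.

(** At a Frobenius element t in N the n primes below Q are distinct, so [kummer_char] can isolate
    the j-th one. *)
Lemma special_char N (j : 'I_n) : open_subgroup N -> normal_in N -> (forall s, N s -> FA s) ->
  exists chi0 t, [/\ gen chi0, N t, chx chi0 (x j) t != 1 &
    forall i, i != j -> chx chi0 (x i) t = 1].
Proof.
move=> oN nN NFA; have [n0 Hn0] := at_frobenius.
have [p [Q [t [[pp np Tp PQ] [Qp Ft Nt]]]]] := split_frobenius (maxn n0 l) oN nN.
move: np; rewrite gtn_max => /andP[n0p lp]; have Fa := NFA _ Nt.
have [HS dist _] := Hn0 p Q t pp n0p Tp PQ Qp Ft Fa.
have pl : p != l by rewrite gtn_eqF.
have PPi i : prime_ideal K (x i @^-1` Q) by apply: (below_prime (in_alg K)).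
have [] := @kummer_char R K Kbar l p (x j @^-1` Q) n.-1 (fun i => x (fintype.lift j i) @^-1` Q) (fun=> p)
  (E_char0 (in_alg K)) l_prime (PPi j) pp pl (HS (x j)).2.
- move=> i; split=> // /dist /xinj E; have := neq_lift j i.
  by rewrite E eqxx.
- by move=> i; split=> //; case: (HS (x (fintype.lift j i))).
move=> chi0 [E0 v0 vB].
have h1 : chx chi0 (x j) t != 1.
  by apply/eqP; apply: (chx_value PQ Ft (FAx j Fa) (HS (x j)).2 v0).
exists chi0, t; split=> //.
  apply: ell_char_gen => //; by exists (@pull K Kbar W (E_char0 (in_alg K)) (in_alg K) (x j) t).
move=> i; rewrite eq_sym => ij; have [i' Ei _] := unlift_some ij.
by rewrite Ei; apply: (chx_value PQ Ft (FAx _ Fa) (HS _).2 (vB i')).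
Qed.

Lemma root_power (u v : R[i]) : u ^+ l = 1 -> u != 1 -> v ^+ l = 1 -> exists c, v * u ^+ c = 1.
Proof.
move=> ul u1 vl; have pu := prime_primitive l_prime ul u1.
have v0 := expr_l_neq0 l_prime vl.
have vi : v^-1 ^+ l = 1 by rewrite exprVn vl invr1.
by have [c Ec] := prim_rootP pu vi; exists c; rewrite -Ec divff.
Qed.

Lemma inj_surj (pi : 'I_n -> 'I_n) : injective pi -> forall j, exists i, pi i = j.
Proof. by move=> /injF_bij[h hK Kh] j; exists (h j). Qed.

Lemma matched_embedding_family (I : finType) (chi : I -> absGal Kbar -> R[i]) (j : 'I_n) :
  (forall k, gen (chi k)) ->
  exists j0, forall k s, FA s -> chx (chi k) (x j) s = chx (psi (chi k)) (y j0) s.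
Proof.
move=> gchi; have oN := NF_open gchi; have nN := NF_normal gchi; have oF := FA_open.
have NFA s : NF chi s -> FA s by case.
have [chi0 [t [g0 Nt c1 c2]]] := special_char j oN nN NFA.
have E0 := gen_ell g0; have E0' := gen_ell' g0.
have /choice[g Hg] i := emb_trans (in_alg K) (x j) (x i).
(* Conjugating t moves its mark: [chi0] is nontrivial at [s_ i] for the embedding [x i] only. *)
pose s_ i := gconj (g i) t.
have Ns i : NF chi (s_ i) by apply: nN.
have Fs_ i : FA (s_ i) := NFA _ (Ns i).
have Ft := NFA _ Nt.
have v1 i : chx chi0 (x i) (s_ i) != 1.
  by rewrite (chx_conj l_prime E0 (x := x j)) //; apply: FAx.
have v2 i i' : i' != i -> chx chi0 (x i') (s_ i) = 1.
  move=> ne; have [k Hk] := xall (absGalV (g i) \o x i' : {rmorphism K -> W}).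
  have Ek a : x i' a = g i (x k a) by rewrite -Hk /= absGalKV.
  rewrite (chx_conj l_prime E0 Ek); last exact: FAx.
  apply: c2; apply: contraNneq ne => Ekj; apply/eqP; apply: xinj => a.
  by rewrite Ek Ekj Hg.
(* Powers of the [s_ k] correct [chi0] at one embedding after the other without changing the family,
   as they lie in [NF chi]. *)
have adj s : FA s -> exists2 u, NF chi u & forall i, chx chi0 (x i) (absGal_mul s u) = 1.
  move=> Fs; suff [u Nu Hu] : exists2 u, NF chi u & forall i, i \in enum 'I_n -> chx chi0 (x i) (absGal_mul s u) = 1.
    by exists u => // i; apply: Hu; rewrite mem_enum.
  elim: (enum 'I_n) => [|k r [u Nu Hu]]; first by exists (absGal1 W) => //; apply: osg1 oN.
  have Fu := NFA _ Nu; have Fsu : FA (absGal_mul s u) by apply: osgM oF _ _ Fs Fu.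
  have [c Hc] := root_power (chx_l E0 (x k) (s_ k)) (v1 k) (chx_l E0 (x k) (absGal_mul s u)).
  have Nc : NF chi (absGalX (s_ k) c) by apply: osgX oN (Ns k).
  exists (absGal_mul u (absGalX (s_ k) c)); first exact: osgM oN _ _ Nu Nc.
  move=> i; rewrite inE gmulA => ir.
  rewrite (chxM E0); [|exact: FAx|exact: (FAx _ (NFA _ Nc))].
  rewrite (chxX E0); last exact: FAx.
  have [->|ik] := eqVneq i k; first exact: Hc.
  by rewrite v2 // expr1n mulr1; apply: Hu; move: ir; rewrite (negbTE ik).
pose chi1 (k : option I) := if k is Some k' then chi k' else chi0.
have gchi1 k : gen (chi1 k) by case: k.
have [pi3 ip3 H3] := family_match gchi1 (Fs_ j).
(* The embedding of K' marked by [s_ j]: [psi chi0] is trivial at [s_ j] for all others. *)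
pose j0 := pi3 j.
have uniqJ j' : chx (psi chi0) (y j') (s_ j) != 1 -> j' = j0.
  have [i <-] := inj_surj ip3 j'; rewrite -(H3 None i) /= => H.
  by have [->//|ij] := eqVneq i j; rewrite v2 ?eqxx in H.
exists j0 => k s Fs.
have [u Nu Hu] := adj s Fs; have Fu := NFA _ Nu.
pose s1 := absGal_mul s u; have Fs1 : FA s1 by apply: osgM oF _ _ Fs Fu.
(* [s2] agrees with s on the family and with [s_ j] on [chi0]. So the bijection matched to [s2]
   sends j to j0, whatever s is. *)
pose s2 := absGal_mul s1 (s_ j); have Fs2 : FA s2 by apply: osgM oF _ _ Fs1 (Fs_ j).
have [pi1 ip1 H1] := family_match gchi1 Fs1.
have [pi2 ip2 H2] := family_match gchi1 Fs2.
have t1 j' : chx (psi chi0) (y j') s1 = 1.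
  by have [i <-] := inj_surj ip1 j'; rewrite -(H1 None i) /= Hu.
have Ej : pi2 j = j0.
  apply: uniqJ; have := H2 None j; rewrite /= (chxM E0) ?Hu ?mul1r; [|exact: FAx|exact: FAx].
  rewrite (chxM E0') ?t1 ?mul1r; [|exact: FAy|exact: FAy].
  by move=> <-.
have := H2 (Some k) j; rewrite /= Ej.
have [_ u1 u2] := Nu; have [_ w1 w2] := Ns j.
have -> : chx (chi k) (x j) s2 = chx (chi k) (x j) s.
  rewrite (chxM (gen_ell (gchi k))); [|exact: FAx|exact: FAx].
  rewrite (chxM (gen_ell (gchi k))); [|exact: FAx|exact: FAx].
  by rewrite u1 w1 !mulr1.
rewrite (chxM (gen_ell' (gchi k))); [|exact: FAy|exact: FAy].
rewrite (chxM (gen_ell' (gchi k))); [|exact: FAy|exact: FAy].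
by rewrite u2 w2 !mulr1.
Qed.

(** Otherwise every j0 has a counterexample, and these characters form a family indexed by the
    finite set of candidates. *)
Lemma matched_embedding (j : 'I_n) : exists j0, forall chi, gen chi -> forall s, FA s ->
  chx chi (x j) s = chx (psi chi) (y j0) s.
Proof.
apply: contrapT => no.
have /choice[chi Hchi] j0 : exists chi, gen chi /\ exists2 s, FA s & chx chi (x j) s <> chx (psi chi) (y j0) s.
  apply: contrapT => no2; apply: no; exists j0 => chi gchi s Fs; apply: contrapT => ne.
  by apply: no2; exists chi; split=> //; exists s.
have [j0 Hj0] := matched_embedding_family j (fun k => (Hchi k).1).
by have [_ [s Fs]] := Hchi j0; apply; apply: Hj0.
Qed.

Section Sigma.
Variables (j j0 : 'I_n).
Hypothesis Hj : forall chi, gen chi -> forall s, FA s -> chx chi (x j) s = chx (psi chi) (y j0) s.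

(** If g moved [x j] to another [x i], the character isolating j at t would have the value 1 at i.
    But g fixes [y j0], so conjugation by g leaves the value of psi(chi) at [y j0] unchanged, and by
    [Hj] the values of chi at [x i] and [x j] agree. *)
Lemma stab_incl (g : G) : (forall a, g (y j0 a) = y j0 a) -> forall a, g (x j a) = x j a.
Proof.
move=> gy; have [i Hi] := xall (g \o x j : {rmorphism K -> W}).
have [E|ne] := eqVneq i j; first by move=> a; have := Hi a; rewrite E.
have [chi0 [t [g0 Ft c1 c2]]] := special_char j FA_open FA_normal (fun s Fs => Fs).
case/eqP: c1; have E0 := gen_ell g0; have E0' := gen_ell' g0.
pose t' := gconj (absGalV g) t; have Ft' : FA t' by apply: FA_normal.
have Et : gconj g t' = t.
  apply: galP => z; rewrite /gconj /= absGalKV; congr (t _).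
  exact: absGalVK.
have e1 : chx chi0 (x i) t = chx chi0 (x j) t'.
  by rewrite -{1}Et; apply: (chx_conj l_prime E0); [move=> a; rewrite -Hi | apply: FAx].
have e2 : chx (psi chi0) (y j0) t = chx (psi chi0) (y j0) t'.
  by rewrite -{1}Et; apply: (chx_conj l_prime E0') => //; apply: FAy.
by rewrite Hj // e2 -Hj // -e1 c2.
Qed.

(** Elements of x(K) are fixed by the stabilizer of y(K'), hence lie in y(K'); equality of degrees
    makes the resulting map onto. *)
Lemma sigma_exists : exists2 sigma : {rmorphism K -> K'}, forall a, y j0 (sigma a) = x j a & bijective sigma.
Proof.
pose Wy : algClosure K' := AlgClosure (alg_over_emb (in_alg K') (y j0)).
have /choice[f Hf] a : exists b, y j0 b = x j a.
  have [|b Eb] := @absGal_fixed K' Wy (E_char0 (in_alg K')) (x j a); last by exists b.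
  move=> s; have [g Hg] := gal_of (s : {rmorphism W -> W}).
  by rewrite -[s _]Hg; apply: stab_incl => b; rewrite Hg; apply: (absGal_fix s).
have [|||sg Hsg] := @rmorphism_of K K' f.
- by move=> a b; apply: (fmorph_inj (y j0)); rewrite rmorphB !Hf rmorphB.
- by apply: (fmorph_inj (y j0)); rewrite Hf !rmorph1.
- by move=> a b; apply: (fmorph_inj (y j0)); rewrite rmorphM !Hf rmorphM.
exists sg; first by move=> a; rewrite Hsg.
apply: fmorph_bijective.
have lin : linear sg.
  move=> q a b; have Eq : sg (in_alg K q) = in_alg K' q.
    exact: (rat_rmorphism_eq (sg \o in_alg K) (in_alg K')).
  by rewrite -[q *: a]mulr_algl -[q *: sg a]mulr_algl rmorphD rmorphM -[in LHS]/(in_alg K q) Eq.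
pose sl : {linear K -> K'} := HB.pack (sg : K -> K') (GRing.isLinear.Build rat K K' *:%R sg lin).
have ker0 : (fullv :&: lker (linfun sl) = 0)%VS.
  apply/eqP; rewrite -subv0; apply/subvP => a; rewrite memv_cap memv_ker lfunE /= => /andP[_ /eqP E].
  by rewrite memv0 -(fmorph_eq0 sg) -[X in X == 0]/(sl a) E.
have full : (linfun sl @: fullv)%VS = fullv.
  by apply/eqP; rewrite eqEdim subvf /= (limg_dim_eq ker0) same_degree.
move=> v; have : v \in (linfun sl @: fullv)%VS by rewrite full memvf.
by case/memv_imgP => u _ ->; exists u; rewrite lfunE.
Qed.

End Sigma.

(** * Finiteness of the exceptions and uniqueness *)

Section Exceptions.
Hypothesis S_degree1 : S `<=` degree1_primes K.
Variables (j j0 : 'I_n) (sigma : {rmorphism K -> K'}).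
Hypothesis Hj : forall chi, gen chi -> forall s, FA s -> chx chi (x j) s = chx (psi chi) (y j0) s.
Hypotheses (ysig : forall a, y j0 (sigma a) = x j a) (bsig : bijective sigma).

(** The single basis element is invertible modulo P because 1 is an integer multiple of it; so it is
    itself congruent to an integer, and so is every residue. *)
Lemma degree1_norm (P : set K) : degree1_primes K P -> exists p, [/\ prime p, P p%:R & ideal_norm P = p].
Proof.
move=> [PP [b [Ib gen_b _]]]; have [p pp Pp] := prime_above PP.
exists p; split=> //; apply: (ideal_norm_degree1 PP pp Pp).
have Hb z : integers K z -> exists a : int, P (z - a%:~R * b ord0).
  move=> /gen_b[a [Ia Pa]]; have [m Em] := intr_surj_rat (Ia ord0); exists m.
  by move: Pa; rewrite big_ord1 Em rmorph_int.
have [m Hm] := Hb 1 (integers1 K).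
have ndv : ~~ (p %| absz m)%N.
  apply/negP => dv; apply: (prime_ne1 PP); apply: (prime_cong PP Hm); apply: primeMr => //.
  exact/(prime_intP PP pp Pp).
have [u Hu] : exists u : int, P (b ord0 - u%:~R).
  have [y0 Iy Hy] := prime_maximal PP pp Pp (integers_int K m) (fun H => negP ndv (iffLR (prime_intP PP pp Pp m) H)).
  have : coprimez m p by rewrite coprimezE /= coprime_sym prime_coprime.
  case/coprimezP => -[u v] /= E; exists u.
  have -> : b ord0 - u%:~R = - (u%:~R * (1 - m%:~R * b ord0)) + v%:~R * (p%:R * b ord0).
    have : (u * m + v * p)%:~R = 1 :> K by rewrite E.
    rewrite rmorphD !rmorphM /= => E2.
    by rewrite mulrBr mulr1 opprB mulrA addrAC mulrA -mulrDl [_ + v%:~R * _]E2 mul1r.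
  apply: primeD => //; first by apply: primeN => //; apply: primeMl => //; apply: integers_int.
  by apply: primeMl => //; [exact: integers_int | apply: primeMr].
move=> z Iz; have [a Ha] := Hb z Iz.
have Hz : P (z - (a * u)%:~R).
  apply: (prime_trans PP Ha); rewrite rmorphM /= -mulrBr; apply: primeMl => //; exact: integers_int.
exists (absz ((a * u) %% p)%Z); apply: (prime_trans PP Hz).
have p0 : (p%:Z != 0) by rewrite -lt0n prime_gt0.
rewrite -[X in _ - X]/((absz ((a * u) %% p)%Z)%:Z)%:~R gez0_abs ?modz_ge0 // -rmorphB /=.
apply/(prime_intP PP pp Pp); rewrite -[(p %| _)%N]/(p%:Z %| _)%Z.
by rewrite -eqz_mod_dvd modz_mod.
Qed.

(** The generators are congruent to natural numbers modulo P, so Frobenius fixes their images modulo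
    Q, hence exactly for large p. Only w(E) is fixed, not its conjugates. *)
Lemma degree1_frobenius (E : fieldExtType rat) (w : {rmorphism E -> W}) : exists m : nat,
  forall (P : set E) p, prime_ideal E P -> prime p -> (m < p)%N -> ideal_norm P = p ->
  exists (Q : set W) (t : G), [/\ prime_ideal W Q, Q p%:R, frob_at Q p t, w @^-1` Q = P &
    forall a, t (w a) = w a].
Proof.
have [b gb] := @int_gens_ext W rat E (algClosure_emb W) [::] char0_rat (int_gens_rat W).
have [|m m0 sep] := @conj_separated _ W char0_rat (map w b).
  by move=> _ /mapP[z zb ->]; apply/(integers_fmorph w); apply: gb.1.
exists m => P p PP pp mp nP; have [Pp Hn] := ideal_norm_prime PP pp nP.
have [Q0 PQ0 Q0p] := prime_ideal_exists (@W_char0 W) (algClosure_emb W) pp.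
have [v Hv] := primes_below PP PQ0 pp Pp Q0p.
have [g Hg] := emb_trans (in_alg E) w v.
pose Q := g @^-1` Q0; have PQ : prime_ideal W Q by apply: preimage_prime_ideal => //; exact: W_char0.
have Qp : Q p%:R by rewrite /Q /= rmorph_nat.
have QP : w @^-1` Q = P by rewrite -Hv; apply/funext => a; rewrite /Q /preimage /= Hg.
have [t Ht] := frobenius_exists PQ pp Qp.
exists Q, t; split=> //; apply: (gb.2 (t \o w : {rmorphism E -> W}) w) => z zb /=.
have Iz := gb.1 z zb; have Iw : integers W (w z) by apply/(integers_fmorph w).
have [k Hk] := Hn z Iz.
have Qk : Q (w z - k%:R).
  have : (w @^-1` Q) (z - k%:R) by rewrite QP.
  by rewrite /= rmorphB rmorph_nat.
have Ik : integers W k%:R by exact: integers_nat.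
have Qkk : Q (k%:R - k%:R ^+ p) by have := Ht _ Ik; rewrite rmorph_nat.
have : Q (t (w z) - absGal1 W (w z)).
  rewrite absGal1E; apply: (prime_trans PQ (Ht _ Iw)).
  apply: (prime_trans PQ (prime_congX PQ p Iw Ik Qk)).
  apply: (prime_trans PQ (primeBC PQ Qkk)); exact: primeBC.
move/(sep Q PQ) => H; rewrite -[RHS](absGal1E (w z)); apply: H; last exact: map_f.
by apply: (prime_not_nat PQ pp Qp); rewrite m0.
Qed.

Lemma bounded_primes_finite N : finite_set [set P | prime_ideal K P /\ exists p, [/\ prime p, (p <= N)%N & P p%:R]].
Proof.
have /choice[Qp HQ] (p : nat) : exists Q : set W, prime p -> prime_ideal W Q /\ Q p%:R.
  have [pp|] := boolP (prime p); last by exists set0.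
  by have [Q PQ Qp] := prime_ideal_exists (@W_char0 W) (algClosure_emb W) pp; exists Q.
apply: (sub_finite_set _ (finite_seq [seq x i @^-1` Qp p | p <- iota 0 N.+1, i <- enum 'I_n])).
move=> P [PP [p [pp pN Pp]]]; have [PQ Qpp] := HQ p pp.
have [v Hv] := primes_below PP PQ pp Pp Qpp; have [i Hi] := xall v.
apply/allpairsP; exists (p, i); split; [by rewrite mem_iota add0n | by rewrite mem_enum |].
by rewrite -Hv; apply/funext => a; rewrite /preimage /= Hi.
Qed.

(** An exception P carries a Frobenius element t' for P along x and another one t for phi(P) along
    y, and t is also Frobenius for sigma^-1 phi(P) <> P along x. Neither has to lie in [FA], where
    chi_x and psi(chi)_y agree, so two exceptions are used, with t1 and t2 in the same coset. A
    character nontrivial at P1 but trivial at P2 and at both sigma^-1 phi(Pi) has psi(chi)_y(t1) =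
    psi(chi)_y(t2), whereas its values at P1 and P2 differ. *)
Lemma exceptions_finite : finite_set (exceptions S phi sigma).
Proof.
have [e Ie He] := subgroup_generator FA_open.
have [ Oe [_ HOe]] := orbit_list e.
have [m1 H1] := degree1_frobenius (x j); have [m2 H2] := degree1_frobenius (y j0).
pose good P p (Q : set W) (t : G) (Q' : set W) (t' : G) := [/\ [/\ prime p, p != l, S P & sigma @^-1` (phi P) <> P],
  [/\ prime_ideal W Q, frob_at Q p t, y j0 @^-1` Q = phi P & forall a, t (y j0 a) = y j0 a],
  [/\ prime_ideal W Q', frob_at Q' p t', x j @^-1` Q' = P & forall a, t' (x j a) = x j a] &
  [/\ x j @^-1` Q = sigma @^-1` (phi P), forall a, t (x j a) = x j a, ideal_norm P = p,
      ideal_norm (phi P) = p & ideal_norm (x j @^-1` Q) = p]].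
have goodP P p : exceptions S phi sigma P -> prime p -> P p%:R -> (maxn l (maxn m1 m2) < p)%N ->
    exists Q t Q' t', good P p Q t Q' t'.
  move=> [SP exc] pp Pp; rewrite !gtn_max => /and3P[lp m1p m2p].
  have [p' [pp' Pp' nP]] := degree1_norm (S_degree1 SP).
  have PP : prime_ideal K P by case: (S_degree1 SP).
  have Epp : p' = p.
    have := (prime_natP PP pp Pp p').1 Pp'; rewrite dvdn_prime2 // => /eqP //.
  rewrite {}Epp in nP.
  have PP' := phi_fun SP; have nP' : ideal_norm (phi P) = p by rewrite phi_norm.
  have [Q [t [PQ Qp Ft QP tf]]] := H2 (phi P) p PP' pp m2p nP'.
  have [Q' [t' [PQ' Qp' Ft' QP' tf']]] := H1 P p PP pp m1p nP.
  have Eq : x j @^-1` Q = sigma @^-1` (phi P).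
    by rewrite -QP; apply/funext => a; rewrite /preimage /= ysig.
  have tx a : t (x j a) = x j a by rewrite -ysig tf.
  exists Q, t, Q', t'; split; split=> //; first by rewrite gtn_eqF.
    move=> E; apply: exc; rewrite -{1}E image_preimage //; apply/seteqP; split=> // b _.
    by case: bsig => h _ Kh; exists (h b).
  exact: (split_norm (in_alg K) PQ pp Qp Ft tx).
apply: contrapT => inf.
have big N : exists P p Q t Q' t', (N < p)%N /\ good P p Q t Q' t'.
  apply: contrapT => no; apply: inf.
  apply: sub_finite_set (bounded_primes_finite (maxn N (maxn l (maxn m1 m2)))) => P exP.
  have PP : prime_ideal K P by case: exP => /S_degree1[].
  split=> //; have [p pp Pp] := prime_above PP; exists p; split=> //.
  rewrite leqNgt; apply/negP; rewrite gtn_max => /andP[Np mp]; apply: no.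
  by have [Q [t [Q' [t' gd]]]] := goodP P p exP pp Pp mp; exists P, p, Q, t, Q', t'.
(* The coset of t modulo [FA] is recorded by [t e], which has finitely many values; one of them
   recurs for arbitrarily large p. *)
have [v Hv] : exists v, forall N, exists P p Q t Q' t', [/\ (N < p)%N, good P p Q t Q' t' & t e = v].
  apply: contrapT => no.
  have /choice[Nv HNv] v : exists N, forall P p Q t Q' t', (N < p)%N -> good P p Q t Q' t' -> t e <> v.
    apply: contrapT => no2; apply: no; exists v => N; apply: contrapT => no3; apply: no2; exists N.
    by move=> P p Q t Q' t' Np gd Ev; apply: no3; exists P, p, Q, t, Q', t'.
  have [P [p [Q [t [Q' [t' [Np gd]]]]]]] := big (\max_(v <- Oe) Nv v)%N.
  apply: (HNv (t e) P p Q t Q' t') => //; apply: leq_ltn_trans Np.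
  have tO : t e \in Oe by apply/HOe; exists t.
  by rewrite (big_rem _ tO) /= leq_maxl.
have [P1 [p1 [Q1 [t1 [Q1' [t1' [_ [[pp1 pl1 S1 ne1] [PQ1 F1 QP1 f1] [PQ1' F1' QP1' f1'] [Eq1 tx1 n1 n1' n1q]] Ev1]]]]]]] := Hv 0%N.
have [P2 [p2 [Q2 [t2 [Q2' [t2' [lt12 [[pp2 pl2 S2 ne2] [PQ2 F2 QP2 f2] [PQ2' F2' QP2' f2'] [Eq2 tx2 n2 n2' n2q]] Ev2]]]]]]] := Hv p1.
pose u := absGal_mul (absGalV t2) t1.
have Fu : FA u by apply/He; rewrite /u /= Ev1 -Ev2 absGalVK.
have Et : t1 = absGal_mul t2 u by rewrite /u gmulA gmulV g1mul.
(* The primes at which chi is to be trivial; those with norm p2 > p1 differ from P1, and the first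
   one does because P1 is an exception. *)
pose B (k : 'I_3) := nth set0 [:: x j @^-1` Q1; P2; x j @^-1` Q2] k.
pose q (k : 'I_3) := nth 0%N [:: p1; p2; p2] k.
have PK P (Q : set W) : prime_ideal W Q -> x j @^-1` Q = P -> prime_ideal K P.
  by move=> PQ <-; apply: (below_prime (in_alg K)).
have PP1 : prime_ideal K P1 by apply: (PK _ Q1').
have diff P : ideal_norm P = p2 -> P <> P1.
  by move=> nP E; move: lt12; rewrite -n1 -nP E ltnn.
have [] := @kummer_char R K Kbar l p1 P1 3 B q (E_char0 (in_alg K)) l_prime PP1 pp1 pl1 n1.
- case=> [[|[|[|//]]] k3]; rewrite /B /=; split.
  + exact: (PK _ Q1).
  + by rewrite Eq1.
  + exact: (PK _ Q2').
  + exact: diff.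
  + exact: (PK _ Q2).
  + exact: diff.
- by case=> [[|[|[|//]]] k3]; rewrite /B /q /=.
move=> chi [E0 v0 vB].
have h1 : chx chi (x j) t1' <> 1.
  rewrite -QP1' in v0 n1; exact: (chx_value PQ1' F1' f1' n1 v0).
have h2 : chx chi (x j) t1 = 1.
  by apply: (chx_value PQ1 F1 tx1 n1q (vB (@Ordinal 3 0 isT))).
have h3 : chx chi (x j) t2' = 1.
  have := vB (@Ordinal 3 1 isT); rewrite /B /= -QP2' => w0; rewrite -QP2' in n2.
  exact: (chx_value PQ2' F2' f2' n2 w0).
have h4 : chx chi (x j) t2 = 1.
  by apply: (chx_value PQ2 F2 tx2 n2q (vB (@Ordinal 3 2 isT))).
have gchi : gen chi.
  apply: ell_char_gen => //; exists (@pull K Kbar W (E_char0 (in_alg K)) (in_alg K) (x j) t1').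
  exact/eqP.
have E0' := gen_ell' gchi.
have hu : chx chi (x j) u = 1.
  by move: h2; rewrite Et (chxM E0) ?h4 ?mul1r //; apply: FAx.
have hu' : chx (psi chi) (y j0) t1 = chx (psi chi) (y j0) t2.
  rewrite {1}Et (chxM E0') //; last exact: FAy.
  by rewrite -(Hj gchi Fu) hu mulr1.
have c1 : char_at chi P1 = chx chi (x j) t1'.
  by rewrite -QP1'; apply: (chx_frob l_prime E0 PQ1' F1' f1') => //; rewrite ?QP1' ?prime_gt0 //; case: v0.
have c2 : char_at chi P2 = chx chi (x j) t2'.
  rewrite -QP2'; apply: (chx_frob l_prime E0 PQ2' F2' f2') => //; rewrite ?QP2' ?prime_gt0 //.
  by case: (vB (@Ordinal 3 1 isT)).
have c' P p Q (t t' : G) : S P -> prime p -> prime_ideal W Q -> frob_at Q p t -> y j0 @^-1` Q = phi P ->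
    (forall a, t (y j0 a) = y j0 a) -> ideal_norm (phi P) = p -> char_at chi P = chx chi (x j) t' ->
    chx (psi chi) (y j0) t = chx chi (x j) t'.
  move=> SP pp PQ Ft QP ft nP cP; have ch := psi_phi gchi SP.
  have un : unramified (psi chi) (phi P) by apply: char_at_neq0; rewrite -ch cP; exact: (chx_neq0 l_prime E0).
  rewrite -cP ch -QP; apply/esym; apply: (chx_frob l_prime E0' PQ Ft ft); rewrite ?QP ?prime_gt0 //.
apply: h1; rewrite -(c' P1 p1 Q1 t1 t1') // hu' (c' P2 p2 Q2 t2 t2') //.
Qed.

(** At a split prime beyond all exceptions sigma and tau have the same effect, so [x j] and [x j]
    composed with sigma^-1 tau define the same prime below Q. Embeddings are determined by that
    prime. *)
Lemma sigma_unique (tau : {rmorphism K -> K'}) : bijective tau ->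
  finite_set (exceptions S phi sigma) -> finite_set (exceptions S phi tau) -> tau =1 sigma.
Proof.
move=> btau fs ft; have [n0 Hn0] := at_frobenius.
have /finite_seqP[r1 E1] := fs; have /finite_seqP[r2 E2] := ft.
pose N := (\max_(P <- r1 ++ r2) ideal_norm P)%N.
have [p [Q [t [[pp np Tp PQ] [Qp Ft Ft']]]]] := split_frobenius (maxn n0 N) FA_open FA_normal.
move: np; rewrite gtn_max => /andP[n0p Np].
have [HS dist _] := Hn0 p Q t pp n0p Tp PQ Qp Ft Ft'.
have [SP nP] := HS (x j); set P := x j @^-1` Q in SP nP.
have nex (r : seq (set K)) : {subset r <= r1 ++ r2} -> P \in r -> False.
  move=> sub /sub Pr; move: Np; rewrite /N (big_rem _ Pr) /= nP gtn_max => /andP[].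
  by rewrite ltnn.
have es : sigma @` P = phi P.
  apply: contrapT => ne; apply: (nex r1); first by move=> z; rewrite mem_cat => ->.
  by have : exceptions S phi sigma P by []; rewrite E1.
have et : tau @` P = phi P.
  apply: contrapT => ne; apply: (nex r2); first by move=> z; rewrite mem_cat => ->; rewrite orbT.
  by have : exceptions S phi tau P by []; rewrite E2.
have [h [hK Kh]] := fmorph_inverse bsig.
have Ew : (x j \o (h \o tau : {rmorphism K -> K}) : {rmorphism K -> W}) @^-1` Q = P.
  apply/seteqP; split=> a /= Ha.
    have : (sigma @` P) (tau a) by exists (h (tau a)).
    by rewrite es -et => -[b Pb /fmorph_inj <-].
  have : (tau @` P) (tau a) by exists a.
  by rewrite et -es => -[b Pb Eb]; rewrite -Eb hK.
move=> a; have := dist _ _ Ew a => /= /fmorph_inj Ea.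
by rewrite -{2}Ea Kh.
Qed.

End Exceptions.
End Matching.

Lemma algC_algebraic (z : algC) : algebraicOver (ratr : rat -> algC) z.
Proof.
have [p [Ep mp] Hp] := minCpolyP z; exists p; first exact: monic_neq0.
by rewrite Hp dvdpp.
Qed.

Theorem theorem6p5 (R : realType) (l : nat) (l_prime : prime l)
    (K K' : fieldExtType rat) (Kbar : algClosure K) (Kbar' : algClosure K')
    (same_degree : \dim {:K} = \dim {:K'})
    (S : set (set K)) (S_degree1 : S `<=` degree1_primes K)
    (L : fieldExtType K)
    (S_Spl : has_dirichlet_density (Spl L `\` S) (0 : R))
    (psi : (absGal Kbar -> R[i]) -> (absGal Kbar' -> R[i]))
    (psi_iso : is_character_iso
                 (characters_gen Kbar R l) (characters_gen Kbar' R l) psi)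
    (phi : set K -> set K')
    (phi_fun : set_fun S (prime_ideal K') phi)
    (phi_inj : set_inj S phi)
    (phi_norm : forall p, S p -> ideal_norm (phi p) = ideal_norm p)
    (psi_phi : forall chi p, characters_gen Kbar R l chi -> S p ->
                 char_at chi p = char_at (psi chi) (phi p)) :
  (exists sigma : {rmorphism K -> K'}, bijective sigma) /\
  (exists sigma : {rmorphism K -> K'},
     [/\ bijective sigma,
         finite_set (exceptions S phi sigma) &
         forall tau : {rmorphism K -> K'}, bijective tau ->
           finite_set (exceptions S phi tau) -> tau =1 sigma]).
Proof.
pose W : algClosure rat := @AlgClosure rat algC (ratr : {rmorphism rat -> algC}) algC_algebraic.
have ratE (E : fieldExtType rat) (w : {rmorphism E -> W}) a : w (in_alg E a) = algClosure_emb W a.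
  exact: (rat_rmorphism_eq (w \o in_alg E) (algClosure_emb W)).
have [x [_ xinj xex]] := embeddings K (algClosure_emb W) char0_rat.
have [y' [_ _ yex]] := embeddings K' (algClosure_emb W) char0_rat.
pose y i := y' (cast_ord same_degree i).
have xall (w : {rmorphism K -> W}) : exists i, w =1 x i by apply: xex => a; apply: ratE.
have yall (w : {rmorphism K' -> W}) : exists i, w =1 y i.
  have [i Hi] := yex w (ratE K' w); exists (cast_ord (esym same_degree) i).
  by rewrite /y cast_ordKV.
have psi_gen chi : characters_gen Kbar R l chi -> characters_gen Kbar' R l (psi chi).
  by case: psi_iso => -[fn _ _] _; apply: fn.
pose i0 : 'I_(\dim {:K}) := Ordinal (adim_gt0 (aspacef K)).
have [j0 Hj] := matched_embedding l_prime S_Spl psi_gen phi_fun phi_inj phi_norm psi_phi xinj xall yall i0 i0.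
have [sigma ysig bsig] := sigma_exists l_prime same_degree S_Spl psi_gen phi_fun phi_inj phi_norm
  xinj xall yall i0 Hj.
have fin := exceptions_finite l_prime psi_gen phi_fun phi_norm psi_phi xall i0 S_degree1 Hj ysig bsig.
split; exists sigma => //; split=> // tau btau ftau.
exact: (sigma_unique l_prime S_Spl phi_fun phi_inj phi_norm xinj yall i0 i0 bsig btau fin ftau).
Qed.
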